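(* Let $0<q<p<\infty$, $0<r<1$, $\omega\in\mathcal{D}$, let $\varphi,\psi$ be holomorphic self-maps of $\mathbb{B}_n$, $u,v$ weights (Borel functions on $\mathbb{B}_n$), and $\mu$ a positive Borel measure on $\mathbb{B}_n$. If $\eta+\sigma_{\varphi,r}$ or $\eta+\sigma_{\psi,r}$ is a $q$-Carleson measure for $A^p_\omega$, then $uC_\varphi-vC_\psi:A^p_\omega\to L^q_\mu$ is compact. Here $$\eta=(|\rho u|^qd\mu)\circ\varphi^{-1}+(|\rho v|^qd\mu)\circ\psi^{-1},\ \ \sigma_{\varphi,r}=(\chi_{G_r}|u-v|^qd\mu)\circ\varphi^{-1},\ \ \sigma_{\psi,r}=(\chi_{G_r}|u-v|^qd\mu)\circ\psi^{-1},$$ with $\rho(z)=\rho(\varphi(z),\psi(z))$ and $G_r=\{z:\rho(z)<r\}$.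
   Context: $\mathbb{B}_n$ is the open unit ball of $\mathbb{C}^n$, $dV$ the normalized volume measure. A radial weight is a positive, measurable, integrable $\omega$ with $\omega(z)=\omega(|z|)$; $\hat\omega(r)=\int_r^1\omega(s)ds$. $\omega\in\hat{\mathcal D}$ if there is $C\ge1$ with $\hat\omega(r)\le C\hat\omega(\frac{1+r}{2})$ for all $r\in[0,1)$; $\omega\in\check{\mathcal D}$ if there are $C,K>1$ with $\hat\omega(r)\ge C\hat\omega(1-\frac{1-r}{K})$ for all $r\in[0,1)$; $\mathcal D=\hat{\mathcal D}\cap\check{\mathcal D}$. $A^p_\omega$ is the space of holomorphic $f$ with $\|f\|^p_{A^p_\omega}=\int|f|^p\omega\,dV<\infty$; $L^q_\mu$ the space of measurable $g$ with $\int|g|^qd\mu<\infty$. $(uC_\varphi f)(z)=u(z)f(\varphi(z))$. The pseudohyperbolic distance is $\rho(a,z)=|\varphi_a(z)|$ with $\varphi_a$ the involutive automorphism exchanging $a$ and $0$. $(\nu\circ\varphi^{-1})(E)=\nu(\varphi^{-1}(E))$. A positive Borel measure $\nu$ is a $q$-Carleson measure for $A^p_\omega$ if the identity $A^p_\omega\to L^q_\nu$ is bounded; a linear map is compact if it maps bounded sequences to sequences with a convergent subsequence. *)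

(* Defs.v *)
From HB Require Import structures.
From mathcomp Require Import all_boot all_order all_algebra.
From mathcomp Require Import all_classical all_reals all_analysis.
From mathcomp Require Import complex.
Import Order.TTheory GRing.Theory Num.Theory.
Import numFieldNormedType.Exports.

Set Implicit Arguments.
Unset Strict Implicit.
Unset Printing Implicit Defensive.

Local Open Scope classical_set_scope.
Local Open Scope ring_scope.

Section Defs.
Variable R : realType.
Local Notation C := R[i].

(* C^n as row vectors; its topology is the usual (Euclidean) one. *)
Definition cabs (z : C) : R := ComplexField.Normc.normc z.

Definition Cvec (n : nat) : normedModType C := ('rV[C]_n : normedModType C).

Definition Cn (n : nat) :=
  g_sigma_algebraType (@open ((Cvec n : normedModType C) : topologicalType)).

Definition cinner n (z w : 'rV[C]_n) : C := \sum_(j < n) z 0 j * conjc (w 0 j).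
Definition sqnorm n (z : 'rV[C]_n) : R := \sum_(j < n) (cabs (z 0 j)) ^+ 2.
Definition enorm n (z : 'rV[C]_n) : R := Num.sqrt (sqnorm z).

Definition Ball n : set 'rV[C]_n := [set z | enorm z < 1].

(* The involutive automorphism phi_a of B_n exchanging a and 0 (Rudin/Zhu):
   phi_a(z) = (a - P_a z - s_a Q_a z) / (1 - <z,a>),
   P_a z = (<z,a>/<a,a>) a  (P_0 = 0, since 0^-1 = 0 in MathComp),
   Q_a = I - P_a,  s_a = sqrt(1 - |a|^2). *)
Definition Pa n (a z : 'rV[C]_n) : 'rV[C]_n := (cinner z a / cinner a a) *: a.
Definition Qa n (a z : 'rV[C]_n) : 'rV[C]_n := z - Pa a z.
Definition ball_aut n (a z : 'rV[C]_n) : 'rV[C]_n :=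
  (1 - cinner z a)^-1 *:
    (a - Pa a z - ((Num.sqrt (1 - sqnorm a))%:C)%C *: Qa a z).

Definition pseudohyp n (a z : 'rV[C]_n) : R := enorm (ball_aut a z).

Definition holomorphic_on n (D : set 'rV[C]_n) (f : 'rV[C]_n -> C) : Prop :=
  (forall z, D z -> {for z, continuous (f : Cvec n -> C^o)}) /\
  (forall z, D z -> forall j : 'I_n, exists l : C,
      ((fun h : C^o => ((f (z + h *: delta_mx 0 j) - f z) / h : C^o))
         @ (0 : C^o)^' --> (l : C^o))).

Definition holo_selfmap n (phi : 'rV[C]_n -> 'rV[C]_n) : Prop :=
  (forall j : 'I_n, holomorphic_on (@Ball n) (fun z => phi z 0 j)) /\
  (forall z, Ball z -> Ball (phi z)).

(* Radial weights, given by their profile w on [0,1): omega(z) = w(|z|). *)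
Definition radial_weight (w : R -> R) : Prop :=
  (forall s, 0 <= s < 1 -> 0 < w s) /\
  measurable_fun (`[0%R, 1%R[ : set R) w /\
  (@lebesgue_measure R).-integrable (`[0%R, 1%R[ : set R) (fun s => (w s)%:E).

Definition what (w : R -> R) (r : R) : \bar R :=
  (\int[@lebesgue_measure R]_(s in `[r, 1%R[) (w s)%:E)%E.

Definition Dhat (w : R -> R) : Prop :=
  exists K : R, 1 <= K /\
    forall r, 0 <= r < 1 -> (what w r <= K%:E * what w ((1 + r) / 2))%E.

Definition Dcheck (w : R -> R) : Prop :=
  exists K1 K2 : R, 1 < K1 /\ 1 < K2 /\
    forall r, 0 <= r < 1 -> (K1%:E * what w (1 - (1 - r) / K2) <= what w r)%E.

Definition Dclass (w : R -> R) : Prop := Dhat w /\ Dcheck w.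

Definition box n (a b c d : 'I_n -> R) : set 'rV[C]_n :=
  [set z | forall j, (a j <= complex.Re (z 0 j) <= b j) /\
                     (c j <= complex.Im (z 0 j) <= d j)].

(* V is the normalized volume measure dV on (the Borel sets of) C^n: a
   positive constant multiple of Lebesgue measure on R^{2n} (i.e. it is
   c times the product of side lengths on boxes), with V(B_n) = 1. *)
Definition normalized_volume n (V : {measure set (Cn n) -> \bar R}) : Prop :=
  exists c : R, 0 < c /\
    (forall a b cc d : 'I_n -> R, (forall j, a j <= b j /\ cc j <= d j) ->
       V (box a b cc d) = (c * \prod_(j < n) ((b j - a j) * (d j - cc j)))%:E) /\
    V (@Ball n) = 1%E.

Definition Ap_int n (V : {measure set (Cn n) -> \bar R}) (p : R) (w : R -> R)
  (f : 'rV[C]_n -> C) : \bar R :=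
  (\int[V]_(z in (@Ball n : set (Cn n))) ((cabs (f z)) `^ p * w (enorm z))%:E)%E.

(* ||f||_{A^p_omega} (meaningful when the integral is finite) *)
Definition Ap_norm n V p w (f : 'rV[C]_n -> C) : R := (fine (@Ap_int n V p w f)) `^ p^-1.

Definition in_Ap n V p w (f : 'rV[C]_n -> C) : Prop :=
  holomorphic_on (@Ball n) f /\ (@Ap_int n V p w f < +oo)%E.

Definition Lq_int n (mu : {measure set (Cn n) -> \bar R}) (q : R)
  (g : 'rV[C]_n -> C) : \bar R :=
  (\int[mu]_(z in (@Ball n : set (Cn n))) ((cabs (g z)) `^ q)%:E)%E.

Definition cmeasurable n (g : 'rV[C]_n -> C) : Prop :=
  measurable_fun (@Ball n : set (Cn n)) (fun z : Cn n => complex.Re (g z)) /\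
  measurable_fun (@Ball n : set (Cn n)) (fun z : Cn n => complex.Im (g z)).

Definition in_Lq n mu q (g : 'rV[C]_n -> C) : Prop :=
  cmeasurable g /\ (@Lq_int n mu q g < +oo)%E.

Definition carleson n V p w q (nu : {measure set (Cn n) -> \bar R}) : Prop :=
  exists K : R, 0 <= K /\
    forall f, @in_Ap n V p w f ->
      (@Lq_int n nu q f <= ((K * Ap_norm V p w f) `^ q)%:E)%E.

Definition carleson_setfun n V p w q (m : set (Cn n) -> \bar R) : Prop :=
  exists nu : {measure set (Cn n) -> \bar R},
    (forall E, measurable E -> nu E = m E) /\ @carleson n V p w q nu.

Definition wcomp_diff n (u v : 'rV[C]_n -> C) (phi psi : 'rV[C]_n -> 'rV[C]_n)
  (f : 'rV[C]_n -> C) : 'rV[C]_n -> C :=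
  fun z => u z * f (phi z) - v z * f (psi z).

Definition compact_op n V p w (mu : {measure set (Cn n) -> \bar R}) q
  (T : ('rV[C]_n -> C) -> ('rV[C]_n -> C)) : Prop :=
  (forall f, @in_Ap n V p w f -> in_Lq mu q (T f)) /\
  (forall fs : nat -> ('rV[C]_n -> C),
     (forall k, in_Ap V p w (fs k)) ->
     (exists M : R, forall k, (Ap_int V p w (fs k) <= M%:E)%E) ->
     exists (s : nat -> nat) (g : 'rV[C]_n -> C),
       {homo s : k l / (k < l)%N >-> (k < l)%N} /\ in_Lq mu q g /\
       (fun k => Lq_int mu q (fun z => T (fs (s k)) z - g z)) @ \oo --> 0%E).

Definition rho2 n (phi psi : 'rV[C]_n -> 'rV[C]_n) (z : 'rV[C]_n) : R :=
  pseudohyp (phi z) (psi z).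

Definition Gr n (phi psi : 'rV[C]_n -> 'rV[C]_n) (r : R) : set 'rV[C]_n :=
  [set z | rho2 phi psi z < r].

Definition eta_m n (mu : {measure set (Cn n) -> \bar R}) (q : R)
  (u v : 'rV[C]_n -> C) (phi psi : 'rV[C]_n -> 'rV[C]_n) (E : set (Cn n)) : \bar R :=
  (\int[mu]_(z in (@Ball n `&` phi @^-1` E : set (Cn n)))
      ((rho2 phi psi z * cabs (u z)) `^ q)%:E +
   \int[mu]_(z in (@Ball n `&` psi @^-1` E : set (Cn n)))
      ((rho2 phi psi z * cabs (v z)) `^ q)%:E)%E.

Definition sigma_m n (mu : {measure set (Cn n) -> \bar R}) (q : R)
  (u v : 'rV[C]_n -> C) (phi psi : 'rV[C]_n -> 'rV[C]_n) (r : R)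
  (chi : 'rV[C]_n -> 'rV[C]_n) (E : set (Cn n)) : \bar R :=
  (\int[mu]_(z in (@Ball n `&` Gr phi psi r `&` chi @^-1` E : set (Cn n)))
      ((cabs (u z - v z)) `^ q)%:E)%E.

End Defs.

(* Main.v *)
(** The difference u f(phi) - v f(psi) is split as u (f(phi) - f(psi)) + (u - v) f(psi) where
    rho < r, and estimated term by term where rho >= r.  The only term that is not directly
    controlled by the Carleson hypothesis is the first one, which needs |f(a) - f(b)|^q to be at
    most C rho(a, b)^q |F(a)|^q for some F of comparable norm.  For a separated sequence (a_k) and
    x_k = 1 - |a_k|^2, the random sums F = sum_k +- c_k (x_k / (1 - <z, a_k>))^N, where c_k is the
    maximum of |f| near a_k, have this property on average over the signs.  Their norm is controlled through kernel estimates (from the doubling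
    property), a Schur test, and the fact that the weights w and what(|z|)/(1 - |z|) define the same
    norm (from the reverse doubling property and the subharmonicity of |f|^p).

    Once the operator is bounded from A^p to L^q, compactness follows from q < p alone: by
    Montel's theorem one may subtract a limit and assume that f_k tends to 0 pointwise; if T f_k
    did not tend to 0, the Brezis-Lieb lemma would give sums of N terms of the sequence whose
    p-norm is of order N^(1/p) and whose image has q-norm of order N^(1/q). *)

Require Import Defs.
From HB Require Import structures.
From mathcomp Require Import all_boot all_order all_algebra.
From mathcomp Require Import all_classical all_reals all_analysis.
From mathcomp Require Import measurable_realfun complex ring lra.
Import Order.TTheory GRing.Theory Num.Theory.
Import numFieldNormedType.Exports.
Set Implicit Arguments.
Unset Strict Implicit.
Unset Printing Implicit Defensive.
Local Open Scope classical_set_scope.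
Local Open Scope ring_scope.

(** * Complex numbers and extraction of subsequences *)

Section ComplexModulus.
Variable R : realType.
Local Notation C := R[i].
Implicit Types (z w : C).

(** A pointwise bound of |f(a) - f(b)|^q involves the maximum of |f| near a, whereas the Carleson
    hypothesis only controls integrals of |F|^q against a measure without any regularity, so that
    the maximum cannot be traded for a local mean with respect to that measure. A single kernel sum
    may vanish at a through cancellation. This is why signs are averaged: of two sums that differ in
    one sign, one is at least as large as the term concerned. Infinite kernel sums are avoided: for
    |a| <= r0 a finite separated family suffices, with constants independent of r0, and Fatou's
    lemma removes the restriction. The weight what(|z|)/(1 - |z|) enters because w itself may
    oscillate on the neighbourhoods where f is sampled. The function theory rests on Riemann sums at
    dyadic midpoints of segments and, for |f|^p, on averages over roots of unity; no integral along
    a curve is formed. The case of sigma_phi reduces to that of sigma_psi by exchanging (phi, u)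
    with (psi, v). *)

Lemma cabs_ge0 z : 0 <= cabs z.
Proof. by case: z => a b; rewrite /cabs /= sqrtr_ge0. Qed.

Lemma cabsM z w : cabs (z * w) = cabs z * cabs w.
Proof. exact: ComplexField.Normc.normcM. Qed.

Lemma cabsD z w : cabs (z + w) <= cabs z + cabs w.
Proof. exact: le_normcD. Qed.

Lemma cabsN z : cabs (- z) = cabs z.
Proof. exact: normcN. Qed.

Lemma cabsB z w : cabs (z - w) <= cabs z + cabs w.
Proof. by rewrite -(cabsN w) cabsD. Qed.

Lemma cabs_distC z w : cabs (z - w) = cabs (w - z).
Proof. by rewrite -cabsN opprB. Qed.

Lemma cabs0 : cabs (0 : C) = 0.
Proof. exact: ComplexField.Normc.normc0. Qed.

Lemma cabs1 : cabs (1 : C) = 1.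
Proof. exact: ComplexField.Normc.normc1. Qed.

Lemma cabs0_eq z : cabs z = 0 -> z = 0.
Proof. exact: ComplexField.Normc.eq0_normc. Qed.

Lemma cabs_gt0 z : (0 < cabs z) = (z != 0).
Proof.
rewrite lt_def cabs_ge0 andbT; congr (~~ _); apply/eqP/eqP => [/cabs0_eq//|->].
exact: cabs0.
Qed.

Lemma cabsV z : cabs z^-1 = (cabs z)^-1.
Proof. exact: ComplexField.Normc.normcV. Qed.

Lemma cabsX z k : cabs (z ^+ k) = cabs z ^+ k.
Proof. by elim: k => [|k IH]; rewrite ?expr0 ?cabs1// !exprS cabsM IH. Qed.

Lemma cabsR (x : R) : cabs (x%:C)%C = `|x|.
Proof. by rewrite /cabs /= expr0n /= addr0 sqrtr_sqr. Qed.

Lemma cabs_norm z : `|z| = ((cabs z)%:C)%C.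
Proof. by []. Qed.

Lemma cabs_Re z : `|complex.Re z| <= cabs z.
Proof.
case: z => a b; rewrite /cabs /= -sqrtr_sqr ler_wsqrtr// lerDl sqr_ge0//.
Qed.

Lemma cabs_Im z : `|complex.Im z| <= cabs z.
Proof.
case: z => a b; rewrite /cabs /= -sqrtr_sqr ler_wsqrtr// lerDr sqr_ge0//.
Qed.

Lemma cabs_sqr z : cabs z ^+ 2 = complex.Re z ^+ 2 + complex.Im z ^+ 2.
Proof. by case: z => a b; rewrite /cabs /= sqr_sqrtr// addr_ge0// sqr_ge0. Qed.

Lemma cabs_le_ReIm z : cabs z <= `|complex.Re z| + `|complex.Im z|.
Proof.
rewrite -(@ler_pXn2r _ 2)// ?nnegrE ?addr_ge0 ?cabs_ge0//.
rewrite cabs_sqr sqrrD !real_normK ?num_real// lerD2r lerDl.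
by rewrite mulrn_wge0// mulr_ge0.
Qed.

Lemma cabsJ z : cabs (z^*)%C = cabs z.
Proof. by case: z => a b; rewrite /cabs /= sqrrN. Qed.

Lemma cabs_sum (I : Type) (s : seq I) (P : pred I) (F : I -> C) :
  cabs (\sum_(i <- s | P i) F i) <= \sum_(i <- s | P i) cabs (F i).
Proof.
elim/big_ind2 : _ => [|x1 x2 y1 y2 h1 h2|//]; first by rewrite cabs0.
exact: (le_trans (cabsD _ _) (lerD h1 h2)).
Qed.

Lemma cabs_prod (I : Type) (s : seq I) (P : pred I) (F : I -> C) :
  cabs (\prod_(i <- s | P i) F i) = \prod_(i <- s | P i) cabs (F i).
Proof. by elim/big_ind2 : _ => [|x1 x2 y1 y2 <- <-|//]; rewrite ?cabs1 ?cabsM. Qed.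

Lemma cabs_lerB z w : cabs z - cabs w <= cabs (z - w).
Proof. by rewrite lerBlDr -{1}(subrK w z) cabsD. Qed.

Lemma cReD z w : complex.Re (z + w) = complex.Re z + complex.Re w.
Proof. by case: z; case: w. Qed.

Lemma cImD z w : complex.Im (z + w) = complex.Im z + complex.Im w.
Proof. by case: z; case: w. Qed.

Lemma cReN z : complex.Re (- z) = - complex.Re z.
Proof. by case: z. Qed.

Lemma cImN z : complex.Im (- z) = - complex.Im z.
Proof. by case: z. Qed.

Lemma cReM z w : complex.Re (z * w) =
  complex.Re z * complex.Re w - complex.Im z * complex.Im w.
Proof. by case: z; case: w. Qed.

Lemma cImM z w : complex.Im (z * w) =
  complex.Re z * complex.Im w + complex.Im z * complex.Re w.
Proof. by case: z; case: w. Qed.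

Lemma cabs_half z : cabs (z / 2) = cabs z / 2.
Proof.
rewrite cabsM cabsV; congr (_ / _).
by rewrite (_ : (2 : C) = ((2 : R)%:C)%C) ?cabsR ?ger0_norm// rmorphD.
Qed.

End ComplexModulus.

Section Subsequences.
Variable R : realType.
Local Notation C := R[i].

Definition rcvg (v : nat -> R) (L : R) :=
  forall e, 0 < e -> exists K, forall k, (K <= k)%N -> `|v k - L| < e.

Definition ccvg (v : nat -> C) (L : C) :=
  forall e, 0 < e -> exists K, forall k, (K <= k)%N -> cabs (v k - L) < e.

Definition sincr (s : nat -> nat) := forall k, (s k < s k.+1)%N.

Lemma sincr_homo s : sincr s -> {homo s : k l / (k < l)%N >-> (k < l)%N}.
Proof.
move=> hs k l; elim: l => [//|l IH]; rewrite ltnS leq_eqVlt => /orP[/eqP->|/IH]//.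
by move=> h; exact: ltn_trans h (hs l).
Qed.

Lemma sincr_ge s : sincr s -> forall k, (k <= s k)%N.
Proof. by move=> hs; elim=> [//|k IH]; exact: leq_ltn_trans IH (hs k). Qed.

(** Any two intervals [x_j - b_j, x_j + b_j] meet, since both contain x_m for m the larger index;
    the supremum of the left ends is then a common point. *)
Lemma nested_limit (x b : nat -> R) :
  (forall j k, (j <= k)%N -> `|x k - x j| <= b j) ->
  exists w, forall j, `|x j - w| <= b j.
Proof.
move=> h.
have key j k : x j - b j <= x k + b k.
  pose m := maxn j k.
  have := h j m (leq_maxl _ _); have := h k m (leq_maxr _ _).
  rewrite !ler_norml => /andP[h1 h2] /andP[h3 h4]; lra.
pose S := [set y | exists j, y = x j - b j].
have hS : has_sup S.
  split; first by exists (x 0%N - b 0%N), 0%N.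
  by exists (x 0%N + b 0%N) => y [j ->].
exists (sup S) => j.
have h1 : x j - b j <= sup S by apply: ub_le_sup; [exact: hS.2|exists j].
have h2 : sup S <= x j + b j.
  by apply: ge_sup; [exact: hS.1|move=> y [k ->]].
by rewrite ler_norml; apply/andP; split; lra.
Qed.

Lemma nested_climit (x : nat -> C) (b : nat -> R) :
  (forall j k, (j <= k)%N -> cabs (x k - x j) <= b j) ->
  exists w, forall j, cabs (x j - w) <= b j *+ 2.
Proof.
move=> h.
have [j k jk|u hu] := @nested_limit (fun k => complex.Re (x k)) b.
  by apply: le_trans (h j k jk); rewrite -cReN -cReD cabs_Re.
have [j k jk|v hv] := @nested_limit (fun k => complex.Im (x k)) b.
  by apply: le_trans (h j k jk); rewrite -cImN -cImD cabs_Im.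
exists (u +i* v)%C => j; apply: (le_trans (cabs_le_ReIm _)).
rewrite cReD cImD cReN cImN /= mulr2n; exact: lerD.
Qed.

Lemma bolzano (v : nat -> R) (B : R) : (forall k, `|v k| <= B) ->
  exists e, sincr e /\ exists L, rcvg (fun k => v (e k)) L.
Proof.
move=> hB.
(* [sup S] is the upper limit of v: the sequence reaches every level in [S] infinitely often. *)
pose S := [set x | forall N, exists2 k, (N <= k)%N & x <= v k].
have S0 : S (- B) by move=> N; exists N => //; have := hB N; rewrite ler_norml => /andP[].
have Sub : ubound S B.
  move=> x /(_ 0%N)[k _ hk]; apply: le_trans hk _.
  by have := hB k; rewrite ler_norml => /andP[].
have hS : has_sup S by split; [exists (- B)|exists B].
pose L := sup S.
have up e : 0 < e -> exists N, forall k, (N <= k)%N -> v k < L + e.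
  move=> e0; apply: contrapT => hn.
  have : S (L + e).
    move=> N; apply: contrapT => hk; apply: hn; exists N => k Nk.
    by rewrite ltNge; apply/negP => h; apply: hk; exists k.
  move=> /(ub_le_sup hS.2); rewrite -/L; lra.
have inf e N : 0 < e -> exists k, (N <= k)%N /\ `|v k - L| < e.
  move=> e0; have [N' hN'] := up e e0.
  have [x Sx hx] := @sup_adherent _ S e e0 hS.
  have [k Nk xk] := Sx (maxn N N').
  exists k; split; first exact: leq_trans (leq_maxl _ _) Nk.
  have := hN' k (leq_trans (leq_maxr _ _) Nk).
  by rewrite ltr_norml => h; apply/andP; split; rewrite -/L in hx; lra.
have [|f hf] := @choice _ _
    (fun (p : nat * nat) k => (p.1 <= k)%N /\ `|v k - L| < (p.2.+1%:R)^-1).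
  by move=> p; apply: inf; rewrite invr_gt0.
(* Starting from [(e k').+1] makes [e] increase; the second component [k] asks for an error below
   1/(k+1). *)
pose e := fix e k := if k is k'.+1 then f ((e k').+1, k) else f (0%N, 0%N).
exists e; split; first by move=> k /=; exact: (hf (_, _)).1.
exists L => d d0; exists (Num.truncn d^-1) => k hk.
have : `|v (e k) - L| < (k.+1%:R)^-1 by case: k {hk} => [|k] /=; exact: (hf (_, _)).2.
move=> /lt_trans; apply.
rewrite invf_plt ?posrE//.
apply: lt_le_trans (truncnS_gt _) _; by rewrite ler_nat.
Qed.

Lemma diagonal_extraction (u : nat -> nat -> R) (B : nat -> R) :
  (forall k j, `|u k j| <= B j) ->
  exists s, sincr s /\ exists L, forall j, rcvg (fun k => u (s k) j) (L j).
Proof.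
move=> hB.
have [|E hE] := @choice _ _ (fun (p : (nat -> nat) * nat) (e : nat -> nat) =>
    sincr e /\ exists L, rcvg (fun k => u (p.1 (e k)) p.2) L).
  by move=> p; apply: (@bolzano (fun k => u (p.1 k) p.2) (B p.2)).
(* [S j] composes j successive extractions, each refining the previous one. Beyond rank j the
   diagonal is a subsequence of [S j.+1], which [Sfac] makes explicit. *)
pose S := fix S j : nat -> nat := if j is j'.+1 then S j' \o E (S j', j') else id.
have SS j : sincr (S j).
  elim: j => [k//|j IH k] /=; apply: sincr_homo => //; exact: (hE (_, _)).1.
have Sfac j i : exists2 T, sincr T & S (j + i)%N = S j \o T.
  elim: i => [|i [T hT IH]]; first by exists id => //; rewrite addn0.
  rewrite addnS /=; exists (T \o E (S (j + i)%N, (j + i)%N)).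
    by move=> k /=; apply: sincr_homo => //; exact: (hE (_, _)).1.
  by rewrite IH.
exists (fun k => S k k); split.
  move=> k /=; apply: sincr_homo => //.
  exact: leq_trans (sincr_ge (hE (_, _)).1 _).
have [|L hL] := @choice _ _ (fun j l => rcvg (fun k => u (S j.+1 k) j) l).
  by move=> j; exact: (hE (S j, j)).2.
exists L => j e e0; have [K hK] := hL j e e0.
exists (maxn K j.+1) => k; rewrite geq_max => /andP[Kk jk].
have [T hT ST] := Sfac j.+1 (k - j.+1)%N.
rewrite subnKC// in ST; rewrite {1}ST [X in u X]/=.
apply: hK; exact: leq_trans Kk (sincr_ge hT k).
Qed.

Lemma diagonal_cextraction (u : nat -> nat -> C) (B : nat -> R) :
  (forall k j, cabs (u k j) <= B j) ->
  exists s, sincr s /\ exists L, forall j, ccvg (fun k => u (s k) j) (L j).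
Proof.
move=> hB.
(* Real and imaginary parts are interleaved as even and odd columns, so that one real extraction
   serves both. *)
pose u' k j := if odd j then complex.Im (u k j./2) else complex.Re (u k j./2).
have [k j|s [hs [L hL]]] := @diagonal_extraction u' (fun j => B j./2).
  rewrite /u'; case: ifP => _; apply: le_trans (hB k j./2); [exact: cabs_Im|exact: cabs_Re].
exists s; split=> //; exists (fun j => (L j.*2 +i* L j.*2.+1)%C) => j e e0.
have e20 : 0 < e / 2 by rewrite divr_gt0.
have [K1 h1] := hL j.*2 _ e20; have [K2 h2] := hL j.*2.+1 _ e20.
exists (maxn K1 K2) => k; rewrite geq_max => /andP[/h1 + /h2].
rewrite /u' /= odd_double /= uphalf_double doubleK => {}h1 {}h2.
apply: (le_lt_trans (cabs_le_ReIm _)); rewrite cReD cImD cReN cImN /=.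
by rewrite (splitr e) ltrD.
Qed.

End Subsequences.

(** * One-variable complex analysis *)

Section ComplexDerivative.
Variable R : realType.
Local Notation C := R[i].
Implicit Types (z w : C) (f g : C -> C).

(** The difference quotient is multiplied out, so that h = 0 is allowed and no punctured
    neighbourhood appears. *)
Definition cderiv g z l := forall e : R, 0 < e -> exists2 d : R, 0 < d &
  forall h, cabs h < d -> cabs (g (z + h) - g z - l * h) <= e * cabs h.

Definition cdiff g z := exists l, cderiv g z l.

(** Lets the tolerance e / (1 + c) absorb a factor c that may be 0. *)
Lemma shrink (e c : R) : 0 <= e -> 0 <= c -> e / (1 + c) * c <= e.
Proof.
by move=> e0 c0; rewrite mulrAC ler_pdivrMr ?ltr_pwDl// mulrDr mulr1 lerDr.
Qed.

Lemma cderiv_cst c z : cderiv (fun=> c) z 0.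
Proof.
by move=> e e0; exists 1 => // h _; rewrite subrr mul0r subr0 cabs0 mulr_ge0 ?cabs_ge0// ltW.
Qed.

Lemma cderivD f g z l m : cderiv f z l -> cderiv g z m ->
  cderiv (fun s => f s + g s) z (l + m).
Proof.
move=> hf hg e e0; have e20 : 0 < e / 2 by rewrite divr_gt0.
have [d1 d10 h1] := hf _ e20; have [d2 d20 h2] := hg _ e20.
exists (Num.min d1 d2) => [|h]; first by rewrite lt_min d10.
rewrite lt_min => /andP[/h1 {}h1 /h2 {}h2].
rewrite (_ : _ - _ - _ = (f (z + h) - f z - l * h) + (g (z + h) - g z - m * h)); last by ring.
by apply: le_trans (cabsD _ _) _; rewrite (splitr e) mulrDl lerD.
Qed.

Lemma cderiv_bounded g z l : cderiv g z l -> exists2 d : R, 0 < d &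
  forall h, cabs h < d -> cabs (g (z + h) - g z) <= (1 + cabs l) * cabs h.
Proof.
move=> /(_ 1 ltr01)[d d0 hd]; exists d => // h /hd h1.
rewrite -(subrK (l * h) (g (z + h) - g z)).
by apply: le_trans (cabsD _ _) _; rewrite mulrDl cabsM lerD2r.
Qed.

Lemma cdiff_bounded g z : cdiff g z -> exists2 M : R, 0 < M & exists2 d : R, 0 < d &
  forall h, cabs h < d -> cabs (g (z + h) - g z) <= M * cabs h.
Proof.
by move=> [l /cderiv_bounded h]; exists (1 + cabs l) => //; rewrite ltr_pwDl// cabs_ge0.
Qed.

Lemma cderivM f g z l m : cderiv f z l -> cderiv g z m ->
  cderiv (fun s => f s * g s) z (l * g z + f z * m).
Proof.
move=> hf hg e e0.
have [d0 d00 h0] := cderiv_bounded hf.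
have [d0' d00' h0'] := cderiv_bounded hg.
pose Kf := 1 + cabs l. pose Kg := 1 + cabs m.
have Kf0 : 0 < Kf by rewrite /Kf ltr_pwDl// cabs_ge0.
have Kg0 : 0 < Kg by rewrite /Kg ltr_pwDl// cabs_ge0.
have e1 : 0 < e / 3 / (1 + cabs (g z)).
  by rewrite !divr_gt0// ltr_pwDl// cabs_ge0.
have e2 : 0 < e / 3 / (1 + cabs (f z)).
  by rewrite !divr_gt0// ltr_pwDl// cabs_ge0.
have [d1 d10 h1] := hf _ e1; have [d2 d20 h2] := hg _ e2.
pose d3 := e / 3 / (Kf * Kg).
have d30 : 0 < d3 by rewrite /d3 !divr_gt0// mulr_gt0.
exists (Num.min (Num.min d0 d0') (Num.min d3 (Num.min d1 d2))) => [|h].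
  by rewrite !lt_min d00 d00' d30 d10.
rewrite !lt_min => /andP[/andP[/h0 {}h0 /h0' {}h0'] /andP[hd3 /andP[/h1 {}h1 /h2 {}h2]]].
rewrite (_ : _ - _ - _ = (f (z + h) - f z - l * h) * g z + f z * (g (z + h) - g z - m * h)
   + (f (z + h) - f z) * (g (z + h) - g z)); last by ring.
apply: le_trans (cabsD _ _) _.
have -> : e = e / 3 + e / 3 + e / 3 by lra.
rewrite [leRHS]mulrDl; apply: lerD.
  apply: le_trans (cabsD _ _) _; rewrite [leRHS]mulrDl !cabsM; apply: lerD.
    apply: le_trans (ler_wpM2r (cabs_ge0 _) h1) _.
    by rewrite mulrAC ler_wpM2r ?cabs_ge0// shrink ?cabs_ge0 ?divr_ge0 ?ltW.
  apply: le_trans (ler_wpM2l (cabs_ge0 _) h2) _.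
  by rewrite mulrA ler_wpM2r ?cabs_ge0// mulrC shrink ?cabs_ge0 ?divr_ge0 ?ltW.
rewrite cabsM; apply: le_trans (ler_pM (cabs_ge0 _) (cabs_ge0 _) h0 h0') _.
rewrite -/Kf -/Kg mulrACA mulrA ler_wpM2r ?cabs_ge0//.
by rewrite mulrC -ler_pdivlMr ?mulr_gt0// ltW.
Qed.

Lemma cderivV z : z != 0 -> cderiv (fun s => s^-1) z (- (z ^+ 2)^-1).
Proof.
move=> z0 e e0.
have az : 0 < cabs z by rewrite cabs_gt0.
pose d := Num.min (cabs z / 2) (e * cabs z ^+ 3 / 2).
exists d => [|h]; first by rewrite lt_min !divr_gt0// mulr_gt0// exprn_gt0.
rewrite lt_min => /andP[h1 h2].
have hz : cabs z / 2 <= cabs (z + h).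
  have := cabs_lerB (z + h) h; rewrite addrK => ?.
  have := cabsD (z + h) (- h); rewrite addrK cabsN; lra.
have zh0 : z + h != 0 by rewrite -cabs_gt0; apply: lt_le_trans hz; rewrite divr_gt0.
rewrite (_ : _ - _ - _ = h * h / (z ^+ 2 * (z + h))); last first.
  by field; rewrite zh0 z0.
rewrite cabsM cabsV !cabsM mulrAC ler_wpM2r ?cabs_ge0//.
rewrite ler_pdivrMr ?mulr_gt0 ?cabs_gt0//.
apply: le_trans (ltW h2) _; rewrite -mulrA ler_wpM2l ?(ltW e0)//.
by rewrite exprSr expr2 -[leLHS]mulrA ler_wpM2l// mulr_ge0// ltW.
Qed.

Lemma cderiv_comp_affine g z a b l : cderiv g (a + b * z) l ->
  cderiv (fun s => g (a + b * s)) z (b * l).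
Proof.
move=> hg e e0.
have b0 : 0 < 1 + cabs b by rewrite ltr_pwDl// cabs_ge0.
have [d d0 hd] := hg (e / (1 + cabs b)) (divr_gt0 e0 b0).
exists (d / (1 + cabs b)) => [|h]; first by rewrite divr_gt0.
rewrite ltr_pdivlMr// => h1.
have : cabs (b * h) < d.
  rewrite cabsM; apply: le_lt_trans h1; rewrite mulrC ler_wpM2l ?cabs_ge0//.
  by rewrite lerDr.
move=> /hd; rewrite mulrDr addrA [l * _]mulrCA mulrA => /le_trans; apply.
by rewrite cabsM mulrA ler_wpM2r ?cabs_ge0// shrink ?cabs_ge0// ltW.
Qed.

Lemma cdiff_cst c z : cdiff (fun=> c) z. Proof. by exists 0; exact: cderiv_cst. Qed.
Lemma cdiffD f g z : cdiff f z -> cdiff g z -> cdiff (fun s => f s + g s) z.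
Proof. by move=> [l hl] [m hm]; eexists; exact: cderivD hl hm. Qed.
Lemma cdiffM f g z : cdiff f z -> cdiff g z -> cdiff (fun s => f s * g s) z.
Proof. by move=> [l hl] [m hm]; eexists; exact: cderivM hl hm. Qed.
Lemma cdiff_affine g z a b : cdiff g (a + b * z) -> cdiff (fun s => g (a + b * s)) z.
Proof. by move=> [l hl]; eexists; exact: cderiv_comp_affine hl. Qed.
Lemma cdiffV_sub z c : z != c -> cdiff (fun s => (s - c)^-1) z.
Proof.
move=> zc.
have [|l hl] := @cdiff_affine (fun s => s^-1) z (- c) 1.
  eexists; apply: cderivV; by rewrite mul1r addrC subr_eq0.
by exists l => e /hl[d d0 hd]; exists d => // h /hd; rewrite !mul1r ![_ - c]addrC.
Qed.
Lemma cdiffX g z k : cdiff g z -> cdiff (fun s => g s ^+ k) z.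
Proof.
move=> hg; elim: k => [|k IH]; first by rewrite /=; exact: (cdiff_cst 1).
have := cdiffM hg IH; by under eq_fun do rewrite -exprS.
Qed.
End ComplexDerivative.

(* [lseg m g A B] is the midpoint Riemann sum, over 2^m equal pieces, of the
   integral of g along the segment [A, B]. *)
Section Goursat.
Variable R : realType.
Local Notation C := R[i].
Implicit Types (A B : C) (g : C -> C) (P : C -> Prop).

Fixpoint lseg m g A B : C :=
  if m is m'.+1 then lseg m' g A ((A + B) / 2) + lseg m' g ((A + B) / 2) B
  else (B - A) * g ((A + B) / 2).

(** The Riemann sums sample dyadic points of segments, so closure under midpoints is the form of
    convexity that matters. *)
Definition midconvex P := forall a b, P a -> P b -> P ((a + b) / 2).

Lemma half_subl A B : (A + B) / 2 - A = (B - A) / 2. Proof. by field. Qed.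
Lemma half_subr A B : B - (A + B) / 2 = (B - A) / 2. Proof. by field. Qed.

Lemma lseg_bound m g A B P (M : R) : midconvex P -> P A -> P B ->
  (forall s, P s -> cabs (g s) <= M) -> cabs (lseg m g A B) <= M * cabs (B - A).
Proof.
move=> hP + + hM; elim: m A B => [|m IH] A B PA PB /=.
  by rewrite cabsM mulrC ler_wpM2r ?cabs_ge0// hM//; exact: hP.
apply: le_trans (cabsD _ _) _.
apply: le_trans (lerD (IH _ _ PA (hP _ _ PA PB)) (IH _ _ (hP _ _ PA PB) PB)) _.
by rewrite half_subl half_subr !cabs_half -mulrDr -splitr.
Qed.

Lemma eq_lseg m g h A B P : midconvex P -> P A -> P B ->
  (forall s, P s -> g s = h s) -> lseg m g A B = lseg m h A B.
Proof.
move=> hP + + gh; elim: m A B => [|m IH] A B PA PB /=.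
  by rewrite gh//; exact: hP.
have Pm := hP _ _ PA PB; by rewrite (IH _ _ PA Pm) (IH _ _ Pm PB).
Qed.

Lemma lsegD m g h A B : lseg m (fun s => g s + h s) A B = lseg m g A B + lseg m h A B.
Proof. by elim: m A B => [|m IH] A B /=; [rewrite mulrDr|rewrite !IH addrACA]. Qed.

Lemma lsegZ m c g A B : lseg m (fun s => c * g s) A B = c * lseg m g A B.
Proof. by elim: m A B => [|m IH] A B /=; [rewrite mulrCA|rewrite !IH mulrDr]. Qed.

Lemma lseg0 m A B : lseg m (fun=> 0) A B = 0.
Proof. by elim: m A B => [|m IH] A B /=; rewrite ?mulr0// !IH addr0. Qed.

Lemma lseg_sum m (I : Type) (r : seq I) (F : I -> C -> C) A B :
  lseg m (fun s => \sum_(i <- r) F i s) A B = \sum_(i <- r) lseg m (F i) A B.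
Proof.
elim: r => [|i r IH].
  by rewrite big_nil -[RHS](lseg0 m A B); congr lseg; apply/funext => s; rewrite big_nil.
rewrite big_cons -IH -lsegD; congr lseg; apply/funext => s; by rewrite big_cons.
Qed.

(** The midpoint rule is exact on affine functions. The right-hand side is the increment of a
    primitive, so affine functions sum to 0 around triangles. *)
Lemma lseg_lin m a b A B :
  lseg m (fun s => a + b * s) A B = a * (B - A) + b * (B ^+ 2 - A ^+ 2) / 2.
Proof. by elim: m A B => [|m IH] A B /=; [field|rewrite !IH; field]. Qed.

Lemma lsegN m g A B : lseg m g B A = - lseg m g A B.
Proof.
elim: m A B => [|m IH] A B /=; first by rewrite [B + A]addrC -mulNr opprB.
by rewrite [B + A]addrC (IH A ((A + B) / 2)) (IH ((A + B) / 2) B) opprD addrC.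
Qed.

Lemma lseg_scale m g c A B : lseg m g (c * A) (c * B) = lseg m (fun s => c * g (c * s)) A B.
Proof.
elim: m A B => [|m IH] A B /=.
  by rewrite -mulrDr -mulrA; ring.
by rewrite -mulrDr -mulrA !IH.
Qed.

Lemma lseg_Im m g A B P (c t : R) w : midconvex P -> P A -> P B ->
  (forall s, P s -> c <= complex.Im (w * g s)) -> 0 <= t -> B - A = (t%:C)%C * w ->
  c * t <= complex.Im (lseg m g A B).
Proof.
move=> hP + + hc; elim: m A B t => [|m IH] A B t PA PB t0 hw /=.
  rewrite hw -mulrA cImM /= mul0r addr0 mulrC ler_wpM2l// hc//; exact: hP.
have Pm := hP _ _ PA PB; rewrite cImD.
have h2 : (B - A) / 2 = ((t / 2)%:C)%C * w.
  by rewrite hw mulrAC; congr (_ * _); rewrite rmorphM fmorphV rmorphD.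
rewrite (splitr t) mulrDr; apply: lerD; apply: IH => //; rewrite ?divr_ge0//.
  by rewrite half_subl.
by rewrite half_subr.
Qed.

Definition ltri m g A B D := lseg m g A B + lseg m g B D + lseg m g D A.

(** One level of [lseg] halves every side, so the subdivision into four triangles is an exact
    identity between Riemann sums of consecutive levels; the inner sides cancel by [lsegN]. *)
Lemma ltri_split m g A B D : ltri m.+1 g A B D =
  ltri m g A ((A + B) / 2) ((D + A) / 2) + ltri m g ((A + B) / 2) B ((B + D) / 2) +
  ltri m g ((D + A) / 2) ((B + D) / 2) D + ltri m g ((A + B) / 2) ((B + D) / 2) ((D + A) / 2).
Proof.
rewrite /ltri /= (lsegN m g ((D + A) / 2) ((A + B) / 2)).
rewrite (lsegN m g ((A + B) / 2) ((B + D) / 2)) (lsegN m g ((B + D) / 2) ((D + A) / 2)).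
ring.
Qed.

Lemma ltri_lin m a b A B D : ltri m (fun s => a + b * s) A B D = 0.
Proof. by rewrite /ltri !lseg_lin; field. Qed.

Lemma ltri_bound m g A B D P (M d : R) : midconvex P -> P A -> P B -> P D -> 0 <= M ->
  (forall s, P s -> cabs (g s) <= M) ->
  cabs (B - A) <= d -> cabs (D - B) <= d -> cabs (A - D) <= d ->
  cabs (ltri m g A B D) <= M * d *+ 3.
Proof.
move=> hP PA PB PD M0 hM h1 h2 h3; rewrite mulrSr mulr2n.
apply: le_trans (cabsD _ _) (lerD (le_trans (cabsD _ _) (lerD _ _)) _).
- exact: le_trans (lseg_bound m hP PA PB hM) (ler_wpM2l M0 h1).
- exact: le_trans (lseg_bound m hP PB PD hM) (ler_wpM2l M0 h2).
- exact: le_trans (lseg_bound m hP PD PA hM) (ler_wpM2l M0 h3).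
Qed.

Definition adherent_closed P := forall s, (forall e : R, 0 < e -> exists2 s', P s' & cabs (s' - s) <= e) -> P s.

Definition eventually_small (u : nat -> C) (e : R) :=
  exists m0, forall m, (m0 <= m)%N -> cabs (u m) <= e.

Definition cto0 (u : nat -> C) := forall e : R, 0 < e -> eventually_small u e.

Lemma cto0D u v : cto0 u -> cto0 v -> cto0 (fun m => u m + v m).
Proof.
move=> hu hv e e0; have e20 : 0 < e / 2 by rewrite divr_gt0.
have [m1 h1] := hu _ e20; have [m2 h2] := hv _ e20; exists (maxn m1 m2) => m.
rewrite geq_max => /andP[/h1 {}h1 /h2 {}h2].
by apply: le_trans (cabsD _ _) _; rewrite (splitr e) lerD.
Qed.

Lemma cto0Z c u : cto0 u -> cto0 (fun m => c * u m).
Proof.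
move=> hu e e0; have c0 : 0 < 1 + cabs c by rewrite ltr_pwDl// cabs_ge0.
have [m1 h1] := hu _ (divr_gt0 e0 c0); exists m1 => m /h1 h.
rewrite cabsM; apply: le_trans (ler_wpM2l (cabs_ge0 _) h) _.
by rewrite mulrC shrink ?cabs_ge0// ltW.
Qed.

Lemma eq_cto0 u v : u =1 v -> cto0 u -> cto0 v.
Proof. by move=> /funext ->. Qed.

Lemma cto0_sum (I : Type) (r : seq I) (F : I -> nat -> C) :
  (forall i, cto0 (F i)) -> cto0 (fun m => \sum_(i <- r) F i m).
Proof.
move=> h; elim: r => [|i r IH].
  by move=> e e0; exists 0%N => m _; rewrite big_nil cabs0 ltW.
by apply: eq_cto0 (cto0D (h i) IH) => m; rewrite big_cons.
Qed.

(** Goursat's subdivision, applied to the property that the Riemann sums of a triangle are not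
    eventually below eps times the square of its size d. If none of the four half-size triangles has
    it, neither has the whole. A nested sequence of bad triangles therefore shrinks to a point w of
    P, where g is affine up to o(|h|), and affine functions contribute 0. *)
Theorem goursat g P A B D : midconvex P -> adherent_closed P ->
  (forall s, P s -> cdiff g s) -> P A -> P B -> P D ->
  cto0 (fun m => ltri m g A B D).
Proof.
move=> hP cP hg PA PB PD e e0.
apply: contrapT => hbad.
pose d0 := cabs (B - A) + cabs (D - B) + cabs (A - D) + 1.
have d00 : 0 < d0 by rewrite /d0 ltr_wpDl// !addr_ge0 ?cabs_ge0.
(* Normalised so that the initial bound [eps * d0 ^+ 2] is e; halving d divides the bound by 4, the
   number of subtriangles. *)
pose eps := e / d0 ^+ 2.
have eps0 : 0 < eps by rewrite divr_gt0// exprn_gt0.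
pose tri := (C * C * C)%type.
pose bad (T : tri) (d : R) := [/\ P T.1.1, P T.1.2 & P T.2] /\
  [/\ cabs (T.1.2 - T.1.1) <= d, cabs (T.2 - T.1.2) <= d & cabs (T.1.1 - T.2) <= d] /\
  ~ eventually_small (fun m => ltri m g T.1.1 T.1.2 T.2) (eps * d ^+ 2).
(* The hypotheses sit inside the conclusion so that [choice] yields a total function, which [T]
   iterates. *)
have step (p : tri * R) : exists T' : tri, 0 < p.2 -> bad p.1 p.2 ->
    bad T' (p.2 / 2) /\ cabs (T'.1.1 - p.1.1.1) <= p.2 / 2.
  case: p => -[[X Y] Z] d /=.
  apply: contrapT => /forallNP hno.
  have [d0' /= hb] : 0 < d /\ bad (X, Y, Z) d.
    apply: contrapT => hnn; apply: (hno (X, Y, Z)) => h1 h2; by case: hnn.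
  case: hb => /= -[PX PY PZ] [[h1 h2 h3] hbd].
  have PXY := hP _ _ PX PY; have PYZ := hP _ _ PY PZ; have PZX := hP _ _ PZ PX.
  have hd2 x : cabs x <= d -> cabs (x / 2) <= d / 2 by rewrite cabs_half ler_pM2r.
  have good (X' Y' Z' : C) : P X' -> P Y' -> P Z' -> cabs (Y' - X') <= d / 2 ->
      cabs (Z' - Y') <= d / 2 -> cabs (X' - Z') <= d / 2 -> cabs (X' - X) <= d / 2 ->
      eventually_small (fun m => ltri m g X' Y' Z') (eps * (d / 2) ^+ 2).
    move=> *; apply: contrapT => hns; apply: (hno (X', Y', Z')) => _ _; split => //.
  have [||||m1 hm1] := good X ((X + Y) / 2) ((Z + X) / 2) PX PXY PZX.
  - by rewrite half_subl hd2.
  - by rewrite (_ : _ - _ = (Z - Y) / 2) ?hd2//; field.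
  - by rewrite (_ : _ - _ = (X - Z) / 2) ?hd2//; field.
  - by rewrite subrr cabs0 ltW// divr_gt0.
  have [||||m2 hm2] := good ((X + Y) / 2) Y ((Y + Z) / 2) PXY PY PYZ.
  - by rewrite half_subr hd2.
  - by rewrite half_subl hd2.
  - by rewrite (_ : _ - _ = (X - Z) / 2) ?hd2//; field.
  - by rewrite half_subl hd2.
  have [||||m3 hm3] := good ((Z + X) / 2) ((Y + Z) / 2) Z PZX PYZ PZ.
  - by rewrite (_ : _ - _ = (Y - X) / 2) ?hd2//; field.
  - by rewrite half_subr hd2.
  - by rewrite half_subl hd2.
  - by rewrite -cabsN opprB half_subr hd2.
  have [||||m4 hm4] := good ((X + Y) / 2) ((Y + Z) / 2) ((Z + X) / 2) PXY PYZ PZX.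
  - by rewrite (_ : _ - _ = - ((X - Z) / 2)) ?cabsN ?hd2//; field.
  - by rewrite (_ : _ - _ = - ((Y - X) / 2)) ?cabsN ?hd2//; field.
  - by rewrite (_ : _ - _ = - ((Z - Y) / 2)) ?cabsN ?hd2//; field.
  - by rewrite half_subl hd2.
  apply: hbd; exists (maxn (maxn m1 m2) (maxn m3 m4)).+1 => -[//|m].
  rewrite ltnS !geq_max => /andP[/andP[/hm1 {}hm1 /hm2 {}hm2] /andP[/hm3 {}hm3 /hm4 {}hm4]].
  rewrite ltri_split (_ : eps * d ^+ 2 = eps * (d / 2) ^+ 2 + eps * (d / 2) ^+ 2 +
    eps * (d / 2) ^+ 2 + eps * (d / 2) ^+ 2); last by field.
  apply: le_trans (cabsD _ _) (lerD _ hm4).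
  apply: le_trans (cabsD _ _) (lerD _ hm3).
  exact: le_trans (cabsD _ _) (lerD _ hm2).
have [F hF] := choice step.
pose dd k := d0 / 2 ^+ k.
have dd0 k : 0 < dd k by rewrite divr_gt0// exprn_gt0.
pose T := fix T k : tri := if k is k'.+1 then F (T k', dd k') else (A, B, D).
have ddS k : dd k.+1 = dd k / 2 by rewrite /dd exprSr invfM mulrA.
have badT k : bad (T k) (dd k).
  elim: k => [|k IH].
    rewrite /dd expr0 divr1 /T; split => //; split => /=.
      rewrite /d0; split; have := cabs_ge0 (B - A); have := cabs_ge0 (D - B);
      have := cabs_ge0 (A - D); lra.
    by rewrite /eps divfK// gt_eqF// exprn_gt0.
  by rewrite ddS; exact: (hF (T k, dd k) (dd0 k) IH).1.
have mov k : cabs ((T k.+1).1.1 - (T k).1.1) <= dd k - dd k.+1.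
  have /= := (hF (T k, dd k) (dd0 k) (badT k)).2.
  by move=> /le_trans; apply; rewrite ddS; lra.
have movs j i : cabs ((T (j + i)%N).1.1 - (T j).1.1) <= dd j - dd (j + i)%N.
  elim: i => [|i IH]; first by rewrite addn0 !subrr cabs0.
  rewrite addnS -(subrKA (T (j + i)%N).1.1).
  apply: le_trans (cabsD _ _) _; apply: le_trans (lerD (mov _) IH) _; lra.
have [j k jk|w hw] := @nested_climit R (fun k => (T k).1.1) dd.
  have := movs j (k - j)%N; rewrite subnKC// => /le_trans; apply.
  by rewrite gerBl ltW.
have dd_small d : 0 < d -> exists k, dd k < d.
  move=> d_gt0.
  have := @cvg_geometric R d0 2^-1; rewrite ger0_norm ?invr_ge0// invf_lt1 ?ltr1n// => /(_ isT).
  move=> /cvgrPdist_lt /(_ d d_gt0)[N _ /(_ N (leqnn _))] /=.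
  rewrite sub0r normrN exprVn => hN; exists N; apply: le_lt_trans hN.
  exact: ler_norm.
have Pw : P w.
  apply: cP => d d_gt0; have [k hk] := dd_small (d / 2) (divr_gt0 d_gt0 (ltr0n _ 2)).
  exists (T k).1.1; first by have [[]] := badT k.
  by apply: le_trans (hw k) _; rewrite mulr2n; lra.
have [l hl] := hg w Pw.
(* The sides have length at most [dd k] and the points lie within 3 [dd k] of w, so the three sides
   contribute at most 9 (eps / 12) times the square of [dd k]. *)
have [dl dl0 hdl] := hl (eps / 12) (divr_gt0 eps0 (ltr0n _ 12)).
have [k hk] := dd_small (dl / 4) (divr_gt0 dl0 (ltr0n _ 4)).
have [[PX PY PZ] [[h1 h2 h3] hns]] := badT k.
apply: hns; exists 0%N => m _.
move: PX PY PZ h1 h2 h3 (hw k).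
case: (T k) => -[X Y] Z /= PX PY PZ h1 h2 h3 hXw.
(* Subtracting the affine approximation of g at w leaves the sum unchanged, by [ltri_lin]. *)
rewrite (_ : ltri m g X Y Z = ltri m (fun s => g s - ((g w - l * w) + l * s)) X Y Z); last first.
  rewrite -[LHS]addr0 -[in LHS](ltri_lin m (- (g w - l * w)) (- l) X Y Z).
  rewrite /ltri; rewrite [lseg m _ X Y + _ + _ + _]addrACA [X in X + _]addrACA -!lsegD.
  by congr (lseg _ _ _ _ + lseg _ _ _ _ + lseg _ _ _ _); apply/funext => s; ring.
pose P' s := cabs (s - w) <= dd k *+ 3.
have ddk0 := dd0 k.
have bnd : forall s, P' s -> cabs (g s - ((g w - l * w) + l * s)) <= eps / 12 * (dd k *+ 3).
  move=> s Ps; have hs : cabs (s - w) < dl.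
    by apply: le_lt_trans Ps _; rewrite !mulrSr mulr0n; lra.
  have := hdl _ hs; rewrite [w + _]addrC subrK => h.
  rewrite (_ : _ - _ = g s - g w - l * (s - w)); last by ring.
  by apply: le_trans h _; rewrite ler_wpM2l// divr_ge0// ltW.
have mP' : midconvex P'.
  move=> a b; rewrite /P' => ha hb.
  rewrite (_ : _ - _ = (a - w) / 2 + (b - w) / 2); last by field.
  apply: le_trans (cabsD _ _) _; rewrite !cabs_half; lra.
have PX' : P' X by rewrite /P'; move: hXw; rewrite !mulrSr !mulr0n; lra.
have P'of Y' : cabs (Y' - X) <= dd k -> P' Y'.
  move=> hY; rewrite /P' -(subrKA X); apply: le_trans (cabsD _ _) _.
  by rewrite mulrS; exact: lerD.
have := @ltri_bound m _ X Y Z P' (eps / 12 * (dd k *+ 3)) (dd k) mP' PX' (P'of _ h1) _ _ bnd h1 h2 h3.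
move=> /(_ (P'of _ _)) h; apply: le_trans (h _ _) _.
- by rewrite -cabsN opprB.
- by apply: mulr_ge0; [apply: divr_ge0 => //; exact: ltW|apply: mulrn_wge0; exact: ltW].
- have -> : eps / 12 * (dd k *+ 3) * dd k *+ 3 = eps * dd k ^+ 2 * (9 / 12).
    by field.
  by rewrite ler_piMr ?ler_pdivrMr ?mul1r ?ler_nat// mulr_ge0 ?exprn_ge0 ?ltW.
Qed.

End Goursat.

(** * Cauchy's formula on a square and Taylor expansion *)

Section Cauchy.
Variable R : realType.
Local Notation C := R[i].
Implicit Types (g h : C -> C) (P : C -> Prop).

Lemma midconvex_ball (c : C) (r : R) : midconvex (fun s => cabs (s - c) <= r).
Proof.
move=> a b ha hb; rewrite (_ : _ - _ = (a - c) / 2 + (b - c) / 2); last by field.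
by apply: le_trans (cabsD _ _) _; rewrite !cabs_half; lra.
Qed.

Lemma midconvexI P P' : midconvex P -> midconvex P' -> midconvex (fun s => P s /\ P' s).
Proof. by move=> hP hP' a b [? ?] [? ?]; split; [exact: hP|exact: hP']. Qed.

Lemma Re_half (z : C) : complex.Re (z / 2) = complex.Re z / 2.
Proof.
have -> : (2^-1 : C) = ((2^-1 : R)%:C)%C by rewrite fmorphV rmorphD.
by rewrite cReM /= mulr0 subr0.
Qed.

Lemma midconvex_half (u c : C) (b : R) : midconvex (fun s => b <= complex.Re (u * (s - c))).
Proof.
move=> a a' h h'; rewrite (_ : u * _ = u * (a - c) / 2 + u * (a' - c) / 2); last by field.
by rewrite cReD !Re_half; lra.
Qed.

Lemma closed_ball_adh (c : C) (r : R) : adherent_closed (fun s => cabs (s - c) <= r).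
Proof.
move=> s hs; apply/ler_addgt0Pr => e e0; have [s' h1 h2] := hs e e0.
rewrite -(subrKA s') -[s - s']opprB addrC.
by apply: le_trans (cabsD _ _) _; rewrite cabsN; exact: lerD.
Qed.

Lemma closed_half_adh (u c : C) (b : R) :
  adherent_closed (fun s => b <= complex.Re (u * (s - c))).
Proof.
move=> s hs; apply/ler_addgt0Pr => e e0.
have u0 : 0 < 1 + cabs u by rewrite ltr_pwDl// cabs_ge0.
have [s' h1 h2] := hs (e / (1 + cabs u)) (divr_gt0 e0 u0).
have h3 : complex.Re (u * (s' - s)) <= e.
  apply: le_trans (ler_norm _) _; apply: le_trans (cabs_Re _) _; rewrite cabsM.
  apply: le_trans (ler_wpM2l (cabs_ge0 _) h2) _.
  by rewrite mulrC shrink ?cabs_ge0// ltW.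
have : complex.Re (u * (s' - c)) = complex.Re (u * (s - c)) + complex.Re (u * (s' - s)).
  by rewrite -cReD; congr complex.Re; ring.
lra.
Qed.

Lemma closedI_adh P P' : adherent_closed P -> adherent_closed P' ->
  adherent_closed (fun s => P s /\ P' s).
Proof.
move=> hP hP' s hs; split; [apply: hP|apply: hP'] => e /hs[s' [? ?] ?]; by exists s'.
Qed.

(** The value at s = z is 0, as 0^-1 = 0; near z the slope enters through its boundedness. *)
Definition dslope g (z s : C) := (g s - g z) / (s - z).

Lemma cdiff_dslope g z s : s != z -> cdiff g s -> cdiff (dslope g z) s.
Proof.
move=> sz hg; apply: cdiffM; last exact: cdiffV_sub.
by apply: cdiffD => //; exact: cdiff_cst.
Qed.

(** At the corner z the slope is bounded, but Goursat's theorem does not apply there. Of the four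
    subtriangles, three lie in the half-plane [b / 2 <= Re (u * (s - z))], away from z, and fall
    under [goursat]; the fourth has its corner at z and half the size. After enough halvings it is
    so small that the bound M of the slope suffices. *)
Lemma ltri_corner g P z A B (u : C) (b : R) : midconvex P -> adherent_closed P ->
  (forall s, P s -> cdiff g s) -> P z -> P A -> P B -> 0 < b ->
  b <= complex.Re (u * (A - z)) -> b <= complex.Re (u * (B - z)) ->
  cto0 (fun m => ltri m (dslope g z) z A B).
Proof.
move=> hP cP hg Pz PA PB b0 hA hB.
have [M M0 [d d0 hM]] := cdiff_bounded (hg z Pz).
have kM s : cabs (s - z) < d -> cabs (dslope g z s) <= M.
  move=> hs; rewrite /dslope cabsM cabsV.
  have [->|sz] := eqVneq s z; first by rewrite !subrr cabs0 mul0r ltW.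
  rewrite ler_pdivrMr ?cabs_gt0 ?subr_eq0//.
  by have := hM _ hs; rewrite [z + _]addrC subrK.
move=> e e0.
(* For a triangle whose sides are at most 2 d', [ltri_bound] gives 6 M d' <= e / 2. *)
pose d' := Num.min (d / 2) (e / 2 / (M *+ 6)).
have d'0 : 0 < d' by rewrite lt_min !divr_gt0// mulrn_wgt0.
suff key i : forall A B b, P A -> P B -> 0 < b ->
    b <= complex.Re (u * (A - z)) -> b <= complex.Re (u * (B - z)) ->
    cabs (A - z) <= d' * 2 ^+ i -> cabs (B - z) <= d' * 2 ^+ i ->
    forall eta, 0 < eta ->
    eventually_small (fun m => ltri m (dslope g z) z A B) (e / 2 + eta).
  have [i hi] : exists i, (cabs (A - z) + cabs (B - z)) / d' <= 2 ^+ i.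
    exists (Num.truncn ((cabs (A - z) + cabs (B - z)) / d')).+1.
    apply: ltW; apply: lt_le_trans (truncnS_gt _) _.
    by rewrite -natrX ler_nat ltnW// ltn_expl.
  have hi' : cabs (A - z) + cabs (B - z) <= d' * 2 ^+ i by rewrite mulrC -ler_pdivrMr.
  rewrite [X in eventually_small _ X](splitr e); apply: (key i A B b) => //.
  - by apply: le_trans hi'; rewrite lerDl cabs_ge0.
  - by apply: le_trans hi'; rewrite lerDr cabs_ge0.
  - by rewrite divr_gt0.
elim: i => [|i IH] {A B b PA PB b0 hA hB} A B b PA PB b0 hA hB.
  rewrite expr0 mulr1 => hAd hBd eta eta0; exists 0%N => m _.
  have d'd : d' < d by rewrite /d'; apply: (@le_lt_trans _ _ (d / 2)); [rewrite ge_min lexx//|lra].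
  have hM' s : cabs (s - z) <= d' -> cabs (dslope g z s) <= M.
    by move=> hs; apply: kM; exact: le_lt_trans hs d'd.
  have := @ltri_bound R m (dslope g z) z A B _ M (d' *+ 2) (@midconvex_ball z d') _ hAd hBd (ltW M0) hM'.
  rewrite subrr cabs0 => h; apply: (le_trans (h _ _ _ _)).
  - exact: ltW.
  - by rewrite mulr2n; lra.
  - rewrite -(subrKA z) -[z - A]opprB; apply: le_trans (cabsD _ _) _.
    by rewrite cabsN mulr2n lerD.
  - by rewrite -cabsN opprB mulr2n; lra.
  have hd' : d' <= e / 2 / (M *+ 6) by rewrite /d' ge_min lexx orbT.
  have : M * d' *+ 6 <= e / 2.
    by move: hd'; rewrite ler_pdivlMr ?mulrn_wgt0// mulrnAr mulrC.
  rewrite -mulrnAr -!mulrnAr -mulrnA; lra.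
move=> hAd hBd eta eta0.
pose Q s := P s /\ b / 2 <= complex.Re (u * (s - z)).
have mQ : midconvex Q by apply: midconvexI => //; exact: midconvex_half.
have cQ : adherent_closed Q by apply: closedI_adh => //; exact: closed_half_adh.
have dQ s : Q s -> cdiff (dslope g z) s.
  move=> [Ps hs]; apply: cdiff_dslope; last exact: hg.
  by apply/eqP => sz; move: hs; rewrite sz subrr mulr0 /=; lra.
have halfz X : (z + X) / 2 - z = (X - z) / 2 by field.
have Qh X : P X -> b <= complex.Re (u * (X - z)) -> Q ((z + X) / 2).
  move=> PX hX; split; first exact: hP.
  by rewrite halfz mulrA Re_half; lra.
have QA : Q A by split=> //; lra.
have QB : Q B by split=> //; lra.
have QAB := mQ _ _ QA QB; have QzA := Qh A PA hA.
have QBz : Q ((B + z) / 2) by rewrite addrC; exact: Qh.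
have eta4 : 0 < eta / 4 by rewrite divr_gt0.
have [m1 h1] := goursat mQ cQ dQ QzA QA QAB eta4.
have [m2 h2] := goursat mQ cQ dQ QBz QAB QB eta4.
have [m3 h3] := goursat mQ cQ dQ QzA QAB QBz eta4.
have := IH ((z + A) / 2) ((z + B) / 2) (b / 2) QzA.1 (hP _ _ Pz PB) (divr_gt0 b0 (ltr0n _ 2)) QzA.2.
move=> /(_ (Qh B PB hB).2) => h.
have [||m0 h0] := h _ _ _ eta4.
- by rewrite halfz cabs_half; move: hAd; rewrite exprS; lra.
- by rewrite halfz cabs_half; move: hBd; rewrite exprS; lra.
exists (maxn (maxn m1 m2) (maxn m3 m0)).+1 => -[//|m].
rewrite ltnS !geq_max => /andP[/andP[/h1 {}h1 /h2 {}h2] /andP[/h3 {}h3 /h0 {}h0]].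
rewrite ltri_split [in X in X + _ + _ + _](addrC B z).
have -> : e / 2 + eta = (e / 2 + eta / 4) + eta / 4 + eta / 4 + eta / 4 by field.
apply: le_trans (cabsD _ _) (lerD _ h3).
apply: le_trans (cabsD _ _) (lerD _ h2).
exact: le_trans (cabsD _ _) (lerD _ h1).
Qed.

(** The square of circumradius 9/5 has inradius 9 / (5 sqrt 2) > 5/4. It lies in the disc where g is
    holomorphic and keeps a distance of at least 1/4 from the closed unit disc. *)
Definition crad : C := ((9 / 5 : R)%:C)%C.

(* The contour is the square with vertices [crad * 'i ^+ j]. *)
Definition cside m h (j : nat) := lseg m h (crad * 'i%C ^+ j) (crad * 'i%C ^+ j.+1).
Definition csum m h := \sum_(j < 4) cside m h j.

(** The part of the disc |s| <= 9/5 beyond the line through [crad] and [crad * 'i]. Every side of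
    the square is a rotation of this one by ['i ^+ j], so estimates on the contour are checked
    here. *)
Definition onside (s : C) := (1 <= complex.Re ((5 / 9 : R)%:C%C * (1 - 'i%C) * s)) /\ cabs s <= 9 / 5.

Lemma i4 : 'i%C ^+ 4 = 1 :> C.
Proof. by rewrite (exprM _ 2 2) sqr_i sqrrN expr1n. Qed.

Lemma cabs_i : cabs ('i%C : C) = 1.
Proof. by rewrite /cabs /= expr0n /= add0r expr1n sqrtr1. Qed.

Lemma i_neq0 j : 'i%C ^+ j != 0 :> C.
Proof. by rewrite expf_neq0// -cabs_gt0 cabs_i. Qed.

Lemma cabs_crad : cabs crad = 9 / 5.
Proof. by rewrite cabsR ger0_norm// divr_ge0. Qed.

Lemma csideE m h j : cside m h j = lseg m (fun s => 'i%C ^+ j * h ('i%C ^+ j * s)) crad (crad * 'i%C).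
Proof. by rewrite /cside mulrC exprSr mulrCA lseg_scale. Qed.

Lemma midconvex_onside : midconvex onside.
Proof.
move=> a b [a1 a2] [b1 b2]; split.
  by rewrite mulrA mulrDr Re_half cReD; lra.
by rewrite cabs_half; have := cabsD a b; lra.
Qed.

Lemma onside0 : onside crad.
Proof. by split; rewrite ?cabs_crad// /crad /=; lra. Qed.

Lemma onside1 : onside (crad * 'i%C).
Proof. by split; rewrite ?cabsM ?cabs_i ?cabs_crad ?mulr1// /crad /=; lra. Qed.

Lemma onside_ge s : onside s -> 5 / 4 <= cabs s.
Proof.
move=> [h1 _]; rewrite -(@ler_pXn2r _ 2) ?nnegrE ?cabs_ge0 ?divr_ge0// cabs_sqr.
move: h1; case: s => x y /= h.
have : 0 <= (x - y) ^+ 2 by exact: sqr_ge0.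
nra.
Qed.

Lemma side_len : cabs (crad * 'i%C - crad) <= 3.
Proof.
rewrite -(@ler_pXn2r _ 2)// ?nnegrE ?cabs_ge0// cabs_sqr /crad /=; lra.
Qed.

Lemma csum_bound m h (M : R) :
  (forall j s, onside s -> cabs (h ('i%C ^+ j * s)) <= M) -> cabs (csum m h) <= M * 12.
Proof.
move=> hM; have M0 : 0 <= M by apply: le_trans (hM 0%N _ onside0); exact: cabs_ge0.
apply: le_trans (cabs_sum _ _ _) _.
have -> : M * 12 = \sum_(j < 4) M * 3 by rewrite sumr_const card_ord -mulr_natr; lra.
apply: ler_sum => j _; rewrite csideE.
apply: le_trans (@lseg_bound _ m _ _ _ onside M midconvex_onside onside0 onside1 _) _.
  by move=> s hs; rewrite cabsM cabsX cabs_i expr1n mul1r; exact: hM.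
by rewrite ler_wpM2l// side_len.
Qed.

Lemma eq_csum m g h : (forall j s, onside s -> g ('i%C ^+ j * s) = h ('i%C ^+ j * s)) ->
  csum m g = csum m h.
Proof.
move=> gh; apply: eq_bigr => j _; rewrite !csideE.
by apply: (eq_lseg m midconvex_onside onside0 onside1) => s hs; rewrite gh.
Qed.

Lemma csumD m g h : csum m (fun s => g s + h s) = csum m g + csum m h.
Proof. by rewrite /csum -big_split; apply: eq_bigr => j _; exact: lsegD. Qed.

Lemma csumZ m c g : csum m (fun s => c * g s) = c * csum m g.
Proof. by rewrite /csum mulr_sumr; apply: eq_bigr => j _; exact: lsegZ. Qed.

Lemma csum_sum m T (F : nat -> C -> C) :
  csum m (fun s => \sum_(i < T) F i s) = \sum_(i < T) csum m (F i).
Proof.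
by rewrite /csum exchange_big; apply: eq_bigr => j _; exact: lseg_sum.
Qed.

(** The square is cut into four triangles with apex z, whose inner sides cancel in the sum. *)
Lemma csum_dslope g z : (forall s, cabs s <= 9 / 5 -> cdiff g s) -> cabs z <= 1 ->
  cto0 (fun m => csum m (dslope g z)).
Proof.
move=> hg hz.
have hD s : cabs (s - 0) <= 9 / 5 -> cdiff g s by rewrite subr0; exact: hg.
have vtx j : cabs (crad * 'i%C ^+ j - 0) <= 9 / 5.
  by rewrite subr0 cabsM cabs_crad cabsX cabs_i expr1n mulr1.
have rz (j : nat) : complex.Re ((1 - 'i%C) / 'i%C ^+ j * z) <= 3 / 2.
  apply: le_trans (ler_norm _) _; apply: le_trans (cabs_Re _) _.
  rewrite !cabsM cabsV cabsX cabs_i expr1n invr1 mulr1.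
  have : cabs (1 - 'i%C : C) <= 3 / 2.
    rewrite -(@ler_pXn2r _ 2)// ?nnegrE ?cabs_ge0 ?divr_ge0// cabs_sqr /=; lra.
  have := cabs_ge0 z; have := cabs_ge0 (1 - 'i%C : C); nra.
have tri (j : 'I_4) : cto0 (fun m => ltri m (dslope g z) z (crad * 'i%C ^+ j) (crad * 'i%C ^+ j.+1)).
  (* The line through each side is kept away from z by |1 - i| <= 3/2 and |z| <= 1, which leave the
     margin 9/5 - 3/2. *)
  apply: (@ltri_corner g _ z _ _ ((1 - 'i%C) * ('i%C ^+ j)^-1) (9 / 5 - 3 / 2) (@midconvex_ball 0 _) (@closed_ball_adh 0 _) hD) => //.
  - by rewrite subr0; apply: le_trans hz _; lra.
  - lra.
  - have -> : (1 - 'i%C) / 'i%C ^+ j * (crad * 'i%C ^+ j - z) = (1 - 'i%C) * crad - (1 - 'i%C) / 'i%C ^+ j * z.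
      by field; rewrite i_neq0.
    have := rz j; rewrite cReD cReN /crad /=; lra.
  - have -> : (1 - 'i%C) / 'i%C ^+ j * (crad * 'i%C ^+ j.+1 - z) = (1 - 'i%C) * crad * 'i%C - (1 - 'i%C) / 'i%C ^+ j * z.
      by rewrite exprS; field; rewrite i_neq0.
    have := rz j; rewrite cReD cReN /crad /=; lra.
have := cto0_sum (index_enum 'I_4) tri; apply: eq_cto0 => m.
rewrite /csum /ltri /cside !big_ord_recl !big_ord0 /= !addr0.
rewrite /bump /= !add1n i4 expr0 mulr1.
rewrite !(lsegN m _ _ z).
ring.
Qed.

Lemma onside_neq0 s : onside s -> s != 0.
Proof. by move=> /onside_ge h; rewrite -cabs_gt0; lra. Qed.

(** Doubling the square multiplies the sum of s^-(l+1) by 2^-l, while Goursat's theorem on the four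
    quadrilaterals between the square and its double makes the two sums agree in the limit. As 2^-l
    differs from 1, the sum tends to 0. *)
Lemma csum_powV l : (0 < l)%N -> cto0 (fun m => csum m (fun s => (s ^+ l.+1)^-1)).
Proof.
move=> l0.
pose h (s : C) := (s ^+ l.+1)^-1.
pose v j : C := crad * 'i%C ^+ j.
pose D (j : nat) s := (cabs (s - 0) <= 4) /\ 1 <= complex.Re ((5 / 9 : R)%:C%C * (1 - 'i%C) * ('i%C ^+ j)^-1 * (s - 0)).
have mD j : midconvex (D j) by apply: midconvexI; [exact: midconvex_ball|exact: midconvex_half].
have cD j : adherent_closed (D j).
  by apply: closedI_adh; [exact: closed_ball_adh|exact: closed_half_adh].
have dD j s : D j s -> cdiff h s.
  move=> [_ hs]; rewrite /h; under eq_fun do rewrite -exprVn.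
  apply: cdiffX; have := @cdiffV_sub R s 0; under eq_fun do rewrite subr0.
  by apply; apply/eqP => s0; move: hs; rewrite s0 subr0 mulr0 /=; lra.
have Dv j (k : R) : 1 <= k -> k <= 2 -> D j (k%:C%C * v j) /\ D j (k%:C%C * v j.+1).
  move=> k1 k2; rewrite /D !subr0 /v !cabsM !cabsX cabs_i !expr1n cabs_crad cabsR mulr1.
  rewrite ger0_norm; last lra.
  have -> : (5 / 9)%:C%C * (1 - 'i%C) / 'i%C ^+ j * (k%:C%C * (crad * 'i%C ^+ j)) =
     (5 / 9)%:C%C * (1 - 'i%C) * k%:C%C * crad by field; rewrite i_neq0.
  have -> : (5 / 9)%:C%C * (1 - 'i%C) / 'i%C ^+ j * (k%:C%C * (crad * 'i%C ^+ j.+1)) =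
     (5 / 9)%:C%C * (1 - 'i%C) * k%:C%C * crad * 'i%C.
    by rewrite exprS; field; rewrite i_neq0.
  by split; split; rewrite /crad /=; lra.
have D1 j : D j (v j) /\ D j (v j.+1).
  by have := Dv j 1 (lexx _) (ler1n _ 2); rewrite !mul1r.
have D2 j : D j (2 * v j) /\ D j (2 * v j.+1).
  by have := Dv j 2 (ler1n _ 2) (lexx _); rewrite rmorphD.
have quad j : cto0 (fun m => ltri m h (v j) (v j.+1) (2 * v j.+1) +
    ltri m h (v j) (2 * v j.+1) (2 * v j)).
  apply: cto0D; apply: (goursat (mD j) (cD j) (dD j)); by [exact: (D1 j).1|exact: (D1 j).2|exact: (D2 j).1|exact: (D2 j).2].
have hsum := cto0_sum (index_enum 'I_4) (fun j : 'I_4 => quad j).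
have key m : \sum_(j < 4) (ltri m h (v j) (v j.+1) (2 * v j.+1) +
    ltri m h (v j) (2 * v j.+1) (2 * v j)) = (1 - (2 ^+ l)^-1) * csum m h.
  have sc j : lseg m h (2 * v j) (2 * v j.+1) = (2 ^+ l)^-1 * lseg m h (v j) (v j.+1).
    rewrite lseg_scale -lsegZ; congr lseg; apply/funext => s.
    by rewrite /h exprMn invfM mulrA exprS invfM mulrA divff ?mul1r.
  (* The radial sides of the quadrilaterals; their contributions telescope around the square, since
     ['i ^+ 4 = 1]. *)
  pose p j := lseg m h (v j) (2 * v j).
  have step j : ltri m h (v j) (v j.+1) (2 * v j.+1) + ltri m h (v j) (2 * v j.+1) (2 * v j) =
      (1 - (2 ^+ l)^-1) * lseg m h (v j) (v j.+1) + (p j.+1 - p j).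
    rewrite /ltri /p (lsegN m h (v j) (2 * v j.+1)) (lsegN m h (v j) (2 * v j)).
    by rewrite (lsegN m h (2 * v j) (2 * v j.+1)) sc; ring.
  rewrite (eq_bigr _ (fun (j : 'I_4) _ => step j)) big_split /= -mulr_sumr /csum.
  rewrite [X in _ + X](_ : _ = 0) ?addr0//.
  have -> : \sum_(j < 4) (p j.+1 - p j) = p 4 - p 0%N.
    by rewrite -(big_mkord xpredT (fun j => p j.+1 - p j)) telescope_sumr.
  by rewrite /p /v i4 expr0 subrr.
have c0 : (1 - (2 ^+ l)^-1 : C) != 0.
  by rewrite subr_eq0 eq_sym invr_eq1 -natrX pnatr_eq1 -[1%N](expn0 2) eqn_exp2l// -lt0n.
have := cto0Z (1 - (2 ^+ l)^-1)^-1 hsum; apply: eq_cto0 => m.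
by rewrite key mulKf.
Qed.

(** [taylor] divides by this very sum in the place of 2 pi i, and the lower bound on its modulus
    keeps the quotients bounded. *)
Lemma csum_inv_Im m : 4 <= complex.Im (csum m (fun s => s^-1)).
Proof.
have side j : 1 <= complex.Im (cside m (fun s => s^-1) j).
  rewrite csideE (eq_lseg m (h := fun s => s^-1) midconvex_onside onside0 onside1); last first.
    by move=> s _; rewrite invfM mulrA divff ?mul1r ?i_neq0.
  rewrite -[leLHS]mulr1; apply: (@lseg_Im _ m _ _ _ onside 1 1 (crad * 'i%C - crad) midconvex_onside onside0 onside1 _ ler01).
    move=> s hs; have := onside_neq0 hs; have : cabs s ^+ 2 <= (9 / 5) ^+ 2.
      by rewrite ler_sqr ?nnegrE ?cabs_ge0 ?divr_ge0//; exact: hs.2.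
    move: hs => [+ _]; rewrite cabs_sqr; case: s => x y /= h1 h2.
    move=> _; have xy : 0 < x + y by lra.
    have n0 : 0 < x ^+ 2 + y ^+ 2.
      have := sqr_ge0 (x - y); have := exprn_gt0 2 xy; nra.
    rewrite [leRHS](_ : _ = 9 / 5 * (x + y) / (x ^+ 2 + y ^+ 2)); last by ring.
    by rewrite ler_pdivlMr// mul1r; lra.
  by rewrite mul1r.
have -> : complex.Im (csum m (fun s => s^-1)) = \sum_(j < 4) complex.Im (cside m (fun s => s^-1) j).
  by rewrite /csum; elim/big_ind2 : _ => [//|x1 x2 y1 y2 <- <-|//]; rewrite ?cImD.
have -> : 4 = \sum_(j < 4) 1 :> R by rewrite sumr_const card_ord.
exact: ler_sum.
Qed.

Lemma inv_sub_geom (s z : C) T : s != 0 -> s != z ->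
  (s - z)^-1 = \sum_(l < T) z ^+ l * (s ^+ l.+1)^-1 + z ^+ T * (s ^+ T * (s - z))^-1.
Proof.
move=> s0 sz; have sz0 : s - z != 0 by rewrite subr_eq0.
elim: T => [|T IH]; first by rewrite big_ord0 !expr0 add0r !mul1r.
by rewrite big_ord_recr /= IH -addrA; congr (_ + _); rewrite !exprS; field; rewrite s0 sz0 expf_neq0.
Qed.

Lemma onside_rot j s : onside s -> 5 / 4 <= cabs ('i%C ^+ j * s) <= 9 / 5.
Proof.
by move=> hs; rewrite cabsM cabsX cabs_i expr1n mul1r onside_ge//=; exact: hs.2.
Qed.

Lemma contour_facts j s z T : cabs z <= 1 -> onside s -> let w := 'i%C ^+ j * s in
  [/\ w != 0, w != z, cabs ((w - z)^-1) <= 4 & cabs ((w ^+ T)^-1) <= (4 / 5) ^+ T].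
Proof.
move=> hz /(onside_rot j) /andP[h1 h2] w; rewrite -/w in h1 h2.
have h3 : 1 / 4 <= cabs (w - z) by have := cabs_lerB w z; lra.
split.
- by rewrite -cabs_gt0; lra.
- by apply/eqP => wz; move: h1; rewrite wz; lra.
- rewrite cabsV -[leRHS]invrK lef_pV2 ?posrE ?invr_gt0//; lra.
- rewrite cabsV cabsX -exprVn lerXn2r ?nnegrE ?invr_ge0 ?cabs_ge0 ?divr_ge0//.
  rewrite -[leRHS]invrK lef_pV2 ?posrE ?invr_gt0 ?divr_gt0// ?invf_div//; lra.
Qed.

(** The remainder of the geometric series of 1/(s - z): 48 is the constant 12 of [csum_bound] times
    the bound 4 of |1/(s - z)| on the contour. *)
Lemma csum_cauchy_expand g M z T m : cabs z <= 1 -> (forall s, cabs s <= 9 / 5 -> cabs (g s) <= M) ->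
  cabs (csum m (fun s => g s * (s - z)^-1) -
        \sum_(l < T) z ^+ l * csum m (fun s => g s * (s ^+ l.+1)^-1)) <=
  M * (4 / 5 * cabs z) ^+ T * 48.
Proof.
move=> hz hM.
have M0 : 0 <= M by apply: le_trans (hM 0 _); rewrite ?cabs0 ?cabs_ge0.
have -> : csum m (fun s => g s * (s - z)^-1) =
   csum m (fun s => \sum_(l < T) z ^+ l * (g s * (s ^+ l.+1)^-1)) +
   z ^+ T * csum m (fun s => g s * (s ^+ T * (s - z))^-1).
  rewrite -csumZ -csumD; apply: eq_csum => j s hs.
  have [w0 wz _ _] := contour_facts j T hz hs.
  rewrite (inv_sub_geom T w0 wz) mulrDr mulr_sumr; congr (_ + _).
    by apply: eq_bigr => l _; rewrite mulrCA.
  by rewrite mulrCA.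
rewrite (csum_sum m T (fun l s => z ^+ l * (g s * (s ^+ l.+1)^-1))).
under [X in cabs (X + _ - _)]eq_bigr do rewrite csumZ.
rewrite addrAC subrr add0r cabsM cabsX exprMn.
have -> : M * ((4 / 5) ^+ T * cabs z ^+ T) * 48 = cabs z ^+ T * (M * (4 / 5) ^+ T * 4 * 12) by ring.
rewrite ler_wpM2l ?exprn_ge0 ?cabs_ge0//; apply: csum_bound => j s hs.
have [w0 wz h1 h2] := contour_facts j T hz hs.
rewrite cabsM invfM cabsM -mulrA; apply: ler_pM; rewrite ?mulr_ge0 ?cabs_ge0//.
  by apply: hM; have /andP[] := onside_rot j hs.
by apply: ler_pM; rewrite ?cabs_ge0.
Qed.

Lemma pow_small (x e : R) : 0 <= x -> x < 1 -> 0 < e -> exists T, x ^+ T < e.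
Proof.
move=> x0 x1 e0; have := @cvg_geometric R 1 x; rewrite ger0_norm// => /(_ x1).
move=> /cvgrPdist_lt /(_ e e0)[N _ /(_ N (leqnn _))] /=.
by rewrite sub0r normrN mul1r => hN; exists N; apply: le_lt_trans hN; exact: ler_norm.
Qed.

(** In the geometric expansion of 1/(s - z), all terms but 1/s tend to 0 by [csum_powV]. *)
Lemma csum_winding z : cabs z <= 1 ->
  cto0 (fun m => csum m (fun s => (s - z)^-1) - csum m (fun s => s^-1)).
Proof.
move=> hz e e0.
have [T hT] := @pow_small (4 / 5) (e / 96) ltac:(lra) ltac:(lra) (divr_gt0 e0 (ltr0n _ 96)).
have hl (l : 'I_T) : cto0 (fun m => z ^+ l.+1 * csum m (fun s => (s ^+ l.+2)^-1)).
  by apply: cto0Z; exact: csum_powV.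
have [m0 hm] := cto0_sum (index_enum 'I_T) hl (divr_gt0 e0 (ltr0n _ 2)).
exists m0 => m /hm {}hm.
have : cabs (csum m (fun s => (s - z)^-1) -
    \sum_(l < T.+1) z ^+ l * csum m (fun s => (s ^+ l.+1)^-1)) <= 1 * (4 / 5 * cabs z) ^+ T.+1 * 48.
  have h1 : forall s : C, cabs s <= 9 / 5 -> cabs (1 : C) <= 1 by move=> s _; rewrite cabs1.
  have := csum_cauchy_expand T.+1 m hz h1.
  have -> : (fun s => 1 * (s - z)^-1) = (fun s => (s - z)^-1).
    by apply/funext => s; rewrite mul1r.
  under eq_bigr => l _.
    have -> : (fun s : C => 1 * (s ^+ l.+1)^-1) = (fun s : C => (s ^+ l.+1)^-1).
      by apply/funext => s; rewrite mul1r.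
    over.
  by [].
rewrite big_ord_recl expr0 mul1r opprD addrA => h.
have -> : (fun s : C => s^-1) = (fun s => (s ^+ 1)^-1) by apply/funext => s; rewrite expr1.
rewrite -(subrK (\sum_(l < T) z ^+ l.+1 * csum m (fun s => (s ^+ l.+2)^-1)) (_ - _)).
rewrite (splitr e); apply: le_trans (cabsD _ _) (lerD _ hm).
apply: le_trans h _.
rewrite mul1r exprMn exprS.
have : cabs z ^+ T.+1 <= 1 by rewrite exprn_ile1 ?cabs_ge0.
have : 0 <= cabs z ^+ T.+1 by rewrite exprn_ge0 ?cabs_ge0.
have : 0 <= (4 / 5 : R) ^+ T by rewrite exprn_ge0 ?divr_ge0.
move: hT; move: ((4 / 5 : R) ^+ T) (cabs z ^+ T.+1) => x y; nra.
Qed.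

(** Cauchy's formula in the limit of Riemann sums. The coefficients are limits of [b m l / cm m]
    along one subsequence, obtained by diagonal extraction from their uniform bound. The constant 12
    is 48 divided by the lower bound 4 of the winding sum. *)
Theorem taylor g M : (forall s, cabs s <= 9 / 5 -> cdiff g s) ->
  (forall s, cabs s <= 9 / 5 -> cabs (g s) <= M) ->
  exists a : nat -> C, forall T z, cabs z <= 1 ->
    cabs (g z - \sum_(l < T) a l * z ^+ l) <= 12 * M * (4 / 5 * cabs z) ^+ T.
Proof.
move=> hg hM.
have M0 : 0 <= M by apply: le_trans (hM 0 _); rewrite ?cabs0 ?cabs_ge0.
pose cm m := csum m (fun s => s^-1).
have cm4 m : 4 <= cabs (cm m).
  by apply: le_trans (csum_inv_Im m) (le_trans (ler_norm _) (cabs_Im _)).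
have cm0 m : cm m != 0 by rewrite -cabs_gt0; apply: lt_le_trans (cm4 m).
pose b m l := csum m (fun s => g s * (s ^+ l.+1)^-1).
pose u m l := b m l / cm m.
have ub m l : cabs (u m l) <= M * 12.
  rewrite /u cabsM cabsV ler_pdivrMr ?cabs_gt0//.
  apply: (@le_trans _ _ (M * 12)).
    apply: csum_bound => j s hs; have [_ _ _ h2] := contour_facts j l.+1 (z := 0) ltac:(by rewrite cabs0) hs.
    rewrite cabsM -[leRHS]mulr1; apply: ler_pM; rewrite ?cabs_ge0//.
      by apply: hM; have /andP[] := onside_rot j hs.
    by apply: le_trans h2 _; rewrite exprn_ile1 ?divr_ge0//; lra.
  by rewrite ler_peMr ?mulr_ge0//; apply: le_trans (cm4 m); lra.
have [s [hs [a ha]]] := diagonal_cextraction ub.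
exists a => T z hz.
apply/ler_addgt0Pr => e e0.
have e1 : 0 < e / 3 by rewrite divr_gt0.
have [m1 h1] := csum_dslope hg hz e1.
have [m2 h2] := cto0Z (g z) (csum_winding hz) e1.
have [K hK] : exists K, forall k, (K <= k)%N ->
    cabs (\sum_(l < T) (u (s k) l - a l) * z ^+ l) <= e / 3.
  suff h : cto0 (fun k => \sum_(l < T) (u (s k) l - a l) * z ^+ l) by exact: h.
  apply: (@cto0_sum R 'I_T (index_enum 'I_T) (fun l k => (u (s k) l - a l) * z ^+ l)) => l.
  have : cto0 (fun k => z ^+ l * (u (s k) l - a l)).
    apply: cto0Z => d d0; have [K hK] := ha l d d0; exists K => k /hK /ltW //.
  by apply: eq_cto0 => k; rewrite mulrC.
pose k := maxn K (maxn m1 m2).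
have {}hK := hK k (leq_maxl _ _).
have skm : (maxn m1 m2 <= s k)%N by apply: leq_trans (sincr_ge hs k); exact: leq_maxr.
have {}h1 := h1 (s k) (leq_trans (leq_maxl _ _) skm).
have {}h2 := h2 (s k) (leq_trans (leq_maxr _ _) skm).
set m := s k in hK h1 h2.
have h3 := csum_cauchy_expand T m hz hM.
have E1 : csum m (dslope g z) = csum m (fun s => g s * (s - z)^-1) - g z * csum m (fun s => (s - z)^-1).
  rewrite -mulNr -csumZ -csumD; apply: eq_csum => j w _; rewrite /dslope; ring.
have E2 : g z - \sum_(l < T) a l * z ^+ l =
   (cm m)^-1 * ((csum m (fun s => g s * (s - z)^-1) - \sum_(l < T) z ^+ l * b m l)
     - csum m (dslope g z) - g z * (csum m (fun s => (s - z)^-1) - cm m))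
   + \sum_(l < T) (u m l - a l) * z ^+ l.
  have -> : \sum_(l < T) (u m l - a l) * z ^+ l =
      (cm m)^-1 * \sum_(l < T) z ^+ l * b m l - \sum_(l < T) a l * z ^+ l.
    rewrite mulr_sumr -sumrB; apply: eq_bigr => l _; rewrite /u; ring.
  by rewrite E1; field.
rewrite E2 (_ : 12 * M * _ + e = (12 * M * (4 / 5 * cabs z) ^+ T + e / 3 + e / 3) + e / 3); last by field.
apply: le_trans (cabsD _ _) (lerD _ hK).
rewrite cabsM cabsV mulrC ler_pdivrMr ?cabs_gt0//.
apply: le_trans (cabsB _ _) _; apply: le_trans (lerD (cabsB _ _) h2) _.
apply: le_trans (lerD (lerD h3 h1) (lexx _)) _.
have : 0 <= M * (4 / 5 * cabs z) ^+ T by rewrite mulr_ge0// exprn_ge0// mulr_ge0 ?cabs_ge0.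
move: (cm4 m) e0; move: (cabs (cm m)) => c c4 e0.
rewrite -[12 * M * _]mulrA; move: (M * _) => x x0; nra.
Qed.

End Cauchy.

(** * Inequalities for real powers *)

Section PowerInequalities.
Variable R : realType.

Lemma powR_le (p x y : R) : 0 <= p -> 0 <= x -> x <= y -> x `^ p <= y `^ p.
Proof. by move=> p0 x0 xy; apply: ge0_ler_powR; rewrite ?nnegrE// (le_trans x0). Qed.

Lemma powR_lt (p x y : R) : 0 < p -> 0 <= x -> x < y -> x `^ p < y `^ p.
Proof. by move=> p0 x0 xy; apply: gt0_ltr_powR; rewrite ?nnegrE// (le_trans x0)// ltW. Qed.

Lemma powRK (p x : R) : 0 < p -> 0 <= x -> (x `^ p^-1) `^ p = x.
Proof. by move=> p0 x0; rewrite -powRrM mulVf ?gt_eqF// powRr1. Qed.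

(** Holds for p < 1 as well: either x <= k y, where (1 + k)^p = 1 + e, or y < x / k and the second
    term takes everything. *)
Lemma powR_split (p e : R) : 0 < p -> 0 < e -> exists2 K : R, 0 <= K &
  forall x y, 0 <= x -> 0 <= y -> (x + y) `^ p <= (1 + e) * y `^ p + K * x `^ p.
Proof.
move=> p0 e0; pose k := (1 + e) `^ p^-1 - 1.
have k0 : 0 < k.
  have h1 : (1 : R) `^ p^-1 = 1 by rewrite powR1.
  rewrite /k subr_gt0 -[X in X < _]h1; apply: powR_lt; rewrite ?invr_gt0//.
  by rewrite ltrDl.
exists ((1 + k^-1) `^ p); first exact: powR_ge0.
move=> x y x0 y0; have [xy|xy] := leP x (k * y).
  apply: (@le_trans _ _ ((1 + e) * y `^ p)); last first.
    by rewrite lerDl mulr_ge0// powR_ge0.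
  rewrite -(@powRK p (1 + e))// ?addr_ge0 ?(ltW e0)//.
  rewrite -powRM ?powR_ge0//; apply: powR_le; rewrite ?addr_ge0 ?(ltW p0)//.
  have -> : (1 + e) `^ p^-1 = k + 1 by rewrite /k subrK.
  by rewrite mulrDl mul1r lerD2r.
apply: (@le_trans _ _ ((1 + k^-1) `^ p * x `^ p)); last first.
  by rewrite lerDr mulr_ge0 ?powR_ge0 ?addr_ge0 ?(ltW e0).
have k1 : 0 <= 1 + k^-1 by rewrite addr_ge0// invr_ge0 ltW.
rewrite -powRM//; apply: powR_le; rewrite ?addr_ge0 ?(ltW p0)//.
by rewrite mulrDl mul1r lerD2l mulrC ler_pdivlMr// mulrC ltW.
Qed.

End PowerInequalities.

(** * Schwarz estimates and polynomial approximation *)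

Section SchwarzRunge.
Variable R : realType.
Local Notation C := R[i].
Implicit Types (g : C -> C).

(* The disc of radius 9/5 contains the contour used in [taylor]. *)
Definition hol2 g := forall s, cabs s <= 9 / 5 -> cdiff g s.

(** Order 1 of [taylor], with 12 (4/5) rounded up to 10; order 2, with 12 (4/5)^2 rounded up to 8,
    gives [schwarz2]. The coefficient of order 0 is identified with g 0 by setting z = 0. *)
Lemma schwarz1 g (M : R) : hol2 g -> (forall s, cabs s <= 9 / 5 -> cabs (g s) <= M) ->
  forall z, cabs z <= 1 -> cabs (g z - g 0) <= 10 * M * cabs z.
Proof.
move=> hg hM z hz; have [a ha] := taylor hg hM.
have M0 : 0 <= M by apply: le_trans (hM 0 _); rewrite ?cabs0 ?cabs_ge0.
have := ha 1%N 0; rewrite cabs0 mulr0 expr1 mulr0 big_ord1 expr0 mulr1 => /(_ ler01) h0.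
have -> : g 0 = a 0%N.
  by apply/eqP; rewrite -subr_eq0; apply/eqP/cabs0_eq/eqP; rewrite -lte_anti ?h0 ?cabs_ge0// eq_le h0 cabs_ge0.
have := ha 1%N z hz; rewrite big_ord1 expr0 mulr1 expr1 => /le_trans; apply.
have := mulr_ge0 M0 (cabs_ge0 z); move: (cabs z) => x; nra.
Qed.

Lemma schwarz2 g (M : R) : hol2 g -> (forall s, cabs s <= 9 / 5 -> cabs (g s) <= M) ->
  exists l, forall z, cabs z <= 1 -> cabs (g z - g 0 - l * z) <= 8 * M * cabs z ^+ 2.
Proof.
move=> hg hM; have [a ha] := taylor hg hM.
have M0 : 0 <= M by apply: le_trans (hM 0 _); rewrite ?cabs0 ?cabs_ge0.
have := ha 1%N 0; rewrite cabs0 mulr0 expr1 mulr0 big_ord1 expr0 mulr1 => /(_ ler01) h0.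
have -> : g 0 = a 0%N.
  by apply/eqP; rewrite -subr_eq0; apply/eqP/cabs0_eq/eqP; rewrite eq_le h0 cabs_ge0.
exists (a 1%N) => z hz; have := ha 2%N z hz.
rewrite !big_ord_recl big_ord0 /= expr0 mulr1 /bump /= expr1 addr0 opprD addrA.
move=> /le_trans; apply; rewrite exprMn.
have := mulr_ge0 M0 (sqr_ge0 (cabs z)); move: (cabs z ^+ 2) => x; nra.
Qed.

Lemma runge g (M e : R) : hol2 g -> (forall s, cabs s <= 9 / 5 -> cabs (g s) <= M) ->
  0 < e -> exists P : {poly C}, forall z, cabs z <= 1 -> cabs (g z - P.[z]) <= e.
Proof.
move=> hg hM e0; have [a ha] := taylor hg hM.
have M0 : 0 <= M by apply: le_trans (hM 0 _); rewrite ?cabs0 ?cabs_ge0.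
have [T hT] := @pow_small R (4 / 5) (e / (12 * M + 1)) ltac:(lra) ltac:(lra)
  (divr_gt0 e0 (ltr_wpDl (mulr_ge0 (ler0n _ 12) M0) ltr01)).
exists (\poly_(l < T) a l) => z hz; rewrite horner_poly.
apply: le_trans (ha T z hz) _.
rewrite exprMn; have : cabs z ^+ T <= 1 by rewrite exprn_ile1 ?cabs_ge0.
have : 0 <= cabs z ^+ T by rewrite exprn_ge0 ?cabs_ge0.
have : 0 <= (4 / 5 : R) ^+ T by rewrite exprn_ge0 ?divr_ge0.
move: hT; rewrite ltr_pdivlMr ?ltr_wpDl ?mulr_ge0//.
move: ((4 / 5 : R) ^+ T) (cabs z ^+ T) => x y.
move=> h1 x0 y0 y1; have : x * y <= x by rewrite ler_piMr.
move: h1; nra.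
Qed.

End SchwarzRunge.

(** * Mean-value inequality for |g|^p *)

Section SubMean.
Variable R : realType.
Local Notation C := R[i].

Definition uroots N : seq C := sval (closed_field_poly_normal ('X^N - 1 : {poly C})).

Lemma uroots_prod N : (0 < N)%N -> 'X^N - 1 = \prod_(z <- uroots N) ('X - z%:P).
Proof.
move=> N0; rewrite /uroots; case: closed_field_poly_normal => r /= Dp.
by rewrite {1}Dp (monicP _) ?monicXnsubC// scale1r.
Qed.

Lemma size_uroots N : (0 < N)%N -> size (uroots N) = N.
Proof.
move=> N0; apply: succn_inj; rewrite -(size_prod_XsubC _ id) -uroots_prod//.
by rewrite size_XnsubC.
Qed.

Lemma uroots_prodE N (x : C) : (0 < N)%N -> \prod_(z <- uroots N) (x - z) = x ^+ N - 1.
Proof.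
move=> N0; have := congr1 (fun P : {poly C} => P.[x]) (uroots_prod N0).
rewrite hornerD hornerN hornerXn hornerC horner_prod => ->.
by apply: eq_bigr => z _; rewrite hornerXsubC.
Qed.

Lemma uroots_expn N z : (0 < N)%N -> z \in uroots N -> z ^+ N = 1.
Proof.
move=> N0 hz; apply/eqP; rewrite -subr_eq0 -uroots_prodE//.
by apply/eqP; rewrite (big_rem z)//= subrr mul0r.
Qed.

Lemma cabs_uroots N z : (0 < N)%N -> z \in uroots N -> cabs z = 1.
Proof.
move=> N0 /(uroots_expn N0) /(congr1 (@cabs R)); rewrite cabsX cabs1 => /eqP.
by rewrite pexpr_eq1 ?cabs_ge0// => /eqP.
Qed.

Lemma uroots_sum0 N : (1 < N)%N -> \sum_(z <- uroots N) z = 0.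
Proof.
move=> N1; have N0 : (0 < N)%N by exact: ltnW.
have := @coefPn_prod_XsubC _ (uroots N).
rewrite -(uroots_prod N0) size_uroots// => /(_ (lt0n_neq0 N0)).
have -> : ('X^N - 1 : {poly C})`_N.-1 = 0.
  rewrite coefB coefXn coef1; case: N N1 {N0} => // -[//|N] _ /=.
  by rewrite (ltn_eqF (ltnSn _)) subrr.
by move=> /eqP; rewrite eq_sym oppr_eq0 => /eqP.
Qed.

(** Roots of unity stand for the circle: products over them have a closed form, so that Jensen's
    inequality becomes algebraic. *)
Definition umean N (F : C -> R) : R := (\sum_(z <- uroots N) F z) / N%:R.

Lemma umean_AGM N (F : C -> R) : (0 < N)%N -> (forall z, 0 <= F z) ->
  \prod_(z <- uroots N) F z <= umean N F ^+ N.
Proof.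
move=> N0 F0; rewrite /umean.
have -> : \prod_(z <- uroots N) F z = \prod_(i < N) F (uroots N)`_i.
  by rewrite (big_nth 0) size_uroots// big_mkord.
have -> : \sum_(z <- uroots N) F z = \sum_(i < N) F (uroots N)`_i.
  by rewrite (big_nth 0) size_uroots// big_mkord.
have := @leif_AGM R 'I_N predT (fun i => F (uroots N)`_i) (fun i _ => F0 _).
by rewrite cardT size_enum_ord => -[].
Qed.

Lemma prod_const_seq (S : comNzRingType) (I : Type) (r : seq I) (x : S) :
  \prod_(i <- r) x = x ^+ size r.
Proof. by elim: r => [|i r IH]; rewrite ?big_nil ?expr0// big_cons IH exprS. Qed.

Lemma powR_prod (I : Type) (r : seq I) (F : I -> R) p : (forall i, 0 <= F i) ->
  (\prod_(i <- r) F i) `^ p = \prod_(i <- r) (F i `^ p).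
Proof.
move=> F0; elim: r => [|i r IH]; first by rewrite !big_nil powR1.
by rewrite !big_cons powRM ?IH// prodr_ge0.
Qed.

(** Yields |nu^N - 1| >= |nu|^N (1 - k^N) for roots nu inside and outside the unit circle alike. *)
Lemma gap_unit_circle (s : seq C) : (forall z, z \in s -> cabs z != 1) ->
  exists2 k : R, 0 <= k < 1 & forall z, z \in s -> cabs z <= k \/ 1 <= k * cabs z.
Proof.
elim: s => [_|x s IH h]; first by exists 0 => //; rewrite lexx ltr01.
have [|k /andP[k0 k1] hk] := IH; first by move=> z zs; apply: h; rewrite inE zs orbT.
have hx := h x (mem_head _ _).
have [kx /andP[kx0 kx1] hkx] : exists2 k : R, 0 <= k < 1 & cabs x <= k \/ 1 <= k * cabs x.
  have := hx; rewrite neq_lt => /orP[h1|h1].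
    by exists (cabs x); [rewrite cabs_ge0|left].
  have x0 : 0 < cabs x by rewrite (lt_trans ltr01).
  exists (cabs x)^-1; last by right; rewrite mulVf// gt_eqF.
  by rewrite invr_ge0 cabs_ge0/= invf_lt1.
exists (Num.max k kx); first by rewrite le_max k0 gt_max k1.
move=> z; rewrite inE => /orP[/eqP ->|/hk [h1|h1]].
- case: hkx => h1; [left|right]; first by rewrite le_max h1 orbT.
  by apply: le_trans h1 _; rewrite ler_wpM2r ?cabs_ge0// le_max lexx orbT.
- by left; rewrite le_max h1.
- by right; apply: le_trans h1 _; rewrite ler_wpM2r ?cabs_ge0// le_max lexx.
Qed.

(* Jensen's inequality through the arithmetic-geometric mean: the product of
   [|z - nu|] over the N-th roots of unity is [|nu ^ N - 1|]. *)
Lemma submean_split (c : C) (s : seq C) (p : R) : 0 < p ->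
  (forall z, z \in s -> cabs z != 1) -> forall e : R, 0 < e -> exists N0, forall N, (N0 <= N)%N ->
  (cabs (c * \prod_(nu <- s) (0 - nu))) `^ p * (1 - e) <=
  umean N (fun z => (cabs (c * \prod_(nu <- s) (z - nu))) `^ p).
Proof.
move=> p0 hs e e0.
have [k /andP[k0 k1] hk] := gap_unit_circle hs.
have [T hT] := @pow_small R k (Num.min e 1) k0 k1 ltac:(by rewrite lt_min e0 ltr01).
exists (maxn T.+1 (Num.truncn (p * (size s)%:R)).+1) => N; rewrite geq_max => /andP[TN pN].
have N0 : (0 < N)%N by exact: leq_trans TN.
pose F z := (cabs (c * \prod_(nu <- s) (z - nu))) `^ p.
pose A := cabs (c * \prod_(nu <- s) (0 - nu)); rewrite -/A -/F.
have F0 z : 0 <= F z by exact: powR_ge0.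
have kN : k ^+ N < Num.min e 1.
  by apply: le_lt_trans hT; rewrite ler_wiXn2l// ?(ltW k1)// ltnW.
have [kNe kN1] : k ^+ N < e /\ k ^+ N < 1 by move: kN; rewrite lt_min => /andP[].
have t0 : 0 < 1 - k ^+ N by rewrite subr_gt0.
have t1 : 1 - k ^+ N <= 1 by rewrite gerBl exprn_ge0.
have A0 : 0 <= A by exact: cabs_ge0.
have M0 : 0 <= umean N F by rewrite divr_ge0// sumr_ge0.
have key : (A ^+ N * (1 - k ^+ N) ^+ size s) <= \prod_(z <- uroots N) cabs (c * \prod_(nu <- s) (z - nu)).
  have -> : \prod_(z <- uroots N) cabs (c * \prod_(nu <- s) (z - nu)) =
      cabs c ^+ N * \prod_(nu <- s) cabs (nu ^+ N - 1).
    under eq_bigr do rewrite cabsM cabs_prod.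
    rewrite big_split /= prod_const_seq size_uroots//.
    congr (_ * _); rewrite exchange_big /=; apply: eq_bigr => nu _.
    by rewrite -uroots_prodE// cabs_prod; apply: eq_bigr => z _; rewrite cabs_distC.
  rewrite /A cabsM cabs_prod exprMn -mulrA ler_wpM2l ?exprn_ge0 ?cabs_ge0//.
  have -> : (1 - k ^+ N) ^+ size s = \prod_(nu <- s) (1 - k ^+ N).
    by rewrite prod_const_seq.
  rewrite -prodrXl -big_split /= [leLHS]big_seq [leRHS]big_seq.
  apply: ler_prod => nu /hk hnu; rewrite mulr_ge0 ?exprn_ge0 ?cabs_ge0 ?(ltW t0)//=.
  rewrite sub0r cabsN -cabsX.
  case: hnu => hnu.
    rewrite cabs_distC; apply: le_trans (cabs_lerB _ _); rewrite cabs1 cabsX.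
    have : cabs nu ^+ N <= k ^+ N by rewrite lerXn2r ?nnegrE ?cabs_ge0.
    have := exprn_ge0 N (cabs_ge0 nu); nra.
  apply: le_trans (cabs_lerB _ _); rewrite cabs1 cabsX mulrBr mulr1 lerB//.
  by rewrite mulrC -exprMn exprn_ege1.
(* N is at least p times the number of roots, so that after taking N-th roots the loss of all
   factors together is at most the factor 1 - k^N. *)
have hp : (1 - k ^+ N) ^+ N <= ((1 - k ^+ N) ^+ size s) `^ p.
  rewrite -(powR_mulrn (size s) (ltW t0)) -powRrM -[leLHS](powR_mulrn N (ltW t0)).
  rewrite ger_powR ?t0 ?t1// mulrC.
  apply: le_trans (ltW (truncnS_gt _)) _; by rewrite ler_nat.
apply: (@le_trans _ _ (A `^ p * (1 - k ^+ N))).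
  by rewrite ler_wpM2l ?powR_ge0// lerB// ltW.
rewrite -(@ler_pXn2r _ N) ?nnegrE// ?mulr_ge0 ?powR_ge0 ?(ltW t0)//.
apply: le_trans (umean_AGM N0 F0).
rewrite -powR_prod => [|z]; last exact: cabs_ge0.
apply: le_trans (powR_le (ltW p0) _ key); last first.
  by rewrite mulr_ge0 ?exprn_ge0 ?(ltW t0).
rewrite powRM ?exprn_ge0 ?(ltW t0)// exprMn.
have -> : (A `^ p) ^+ N = (A ^+ N) `^ p.
  by rewrite -(powR_mulrn N (powR_ge0 A p)) -(powR_mulrn N A0) -!powRrM mulrC.
by rewrite ler_wpM2l ?powR_ge0.
Qed.

Lemma powR_modulus (p M e : R) : 0 < p -> 0 < e -> exists2 d : R, 0 < d &
  forall x y, 0 <= x -> 0 <= y -> y <= M -> x <= y + d -> x `^ p <= y `^ p + e.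
Proof.
move=> p0 e0; pose M' := `|M| `^ p + 1.
have M'0 : 0 < M' by rewrite /M' ltr_wpDl ?powR_ge0.
have [K K0 hK] := powR_split p0 (divr_gt0 (divr_gt0 e0 (ltr0n _ 2)) M'0).
have K1 : 0 < e / 2 / (K + 1) by rewrite !divr_gt0// ltr_wpDl.
exists ((e / 2 / (K + 1)) `^ p^-1); first by rewrite powR_gt0.
move=> x y x0 y0 yM xy; set d := _ `^ _ in xy.
have d0 : 0 <= d by exact: powR_ge0.
apply: le_trans (powR_le (ltW p0) x0 xy) _; rewrite addrC.
apply: le_trans (hK d y d0 y0) _; rewrite /d powRK ?(ltW K1)// mulrDl mul1r -addrA.
rewrite lerD2l [leRHS]splitr; apply: lerD.
  have yM' : y `^ p <= M'.
    rewrite /M'; apply: (@le_trans _ _ (`|M| `^ p)); last by rewrite lerDl.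
    by apply: powR_le; rewrite ?(ltW p0)//; apply: le_trans yM (ler_norm _).
  by rewrite mulrAC ler_pdivrMr// ler_wpM2l// divr_ge0// (ltW e0).
by rewrite mulrC mulrAC ler_pdivrMr ?ltr_wpDl// ler_wpM2l ?lerDl// divr_ge0// (ltW e0).
Qed.

(** Every t < 1 close enough to 1 exceeds the finitely many moduli below 1. It serves to move the
    roots of a polynomial off the unit circle, as [submean_split] requires. *)
Lemma dilation_avoid (s : seq C) (d : R) : 0 < d -> exists t : R, [/\ 0 < t, t < 1, 1 - d <= t &
  forall z, z \in s -> cabs z != t].
Proof.
move=> d0.
have [t0 t01 ht0] : exists2 t0 : R, t0 < 1 & forall z, z \in s -> cabs z < 1 -> cabs z <= t0.
  elim: s => [|x s [t0 t01 ht0]]; first by exists 0.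
  have [x1|x1] := ltP (cabs x) 1.
    exists (Num.max t0 (cabs x)); first by rewrite gt_max t01.
    move=> z; rewrite inE => /orP[/eqP -> _|zs z1]; rewrite le_max ?lexx ?orbT//.
    by rewrite ht0.
  exists t0 => // z; rewrite inE => /orP[/eqP ->|zs z1]; last exact: ht0.
  by rewrite ltNge x1.
pose m := Num.max (Num.max t0 (1 - d)) 0.
have m1 : m < 1 by rewrite !gt_max t01 ltr01 gtrBl d0.
have mt0 : t0 <= m by rewrite !le_max lexx.
have m0 : 0 <= m by rewrite le_max lexx orbT.
have md : 1 - d <= m by rewrite !le_max lexx orbT.
exists ((m + 1) / 2); split; try lra.
move=> z zs; apply/eqP => hz; have := ht0 z zs; rewrite hz.
have : (m + 1) / 2 < 1 by lra.
move=> /[swap] /[apply]; lra.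
Qed.

Lemma poly_dilation (P : {poly C}) (e : R) : 0 < e -> exists2 d : R, 0 < d &
  forall t, 0 <= t <= 1 -> 1 - d <= t -> forall z, cabs z <= 1 -> cabs (P.[z] - P.[(t%:C)%C * z]) <= e.
Proof.
move=> e0.
pose K := \sum_(l < size P) cabs P`_l * l%:R.
have K0 : 0 <= K by apply: sumr_ge0 => l _; rewrite mulr_ge0 ?cabs_ge0.
exists (e / (K + 1)) => [|t /andP[t0 t1] td z hz]; first by rewrite divr_gt0// ltr_wpDl.
rewrite !horner_coef -sumrB; apply: le_trans (cabs_sum _ _ _) _.
apply: (@le_trans _ _ (K * (1 - t))).
  rewrite mulr_suml; apply: ler_sum => l _.
  rewrite exprMn (_ : _ - _ = P`_l * ((1 - t ^+ l)%:C)%C * z ^+ l); last first.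
    by rewrite rmorphB rmorphXn /=; ring.
  rewrite !cabsM cabsX cabsR -!mulrA ler_wpM2l ?cabs_ge0// -[leRHS]mulr1.
  rewrite ger0_norm; last by rewrite subr_ge0 exprn_ile1.
  apply: ler_pM => //; rewrite ?subr_ge0 ?exprn_ile1 ?exprn_ge0 ?cabs_ge0//.
  elim: (nat_of_ord l) => [|i IH]; first by rewrite expr0 subrr mul0r.
  rewrite exprS -natr1 mulrDl mul1r.
  have : t ^+ i <= 1 by rewrite exprn_ile1.
  have : 0 <= t ^+ i by rewrite exprn_ge0.
  by move: IH; move: (t ^+ i) (i%:R) => x y; nra.
have : 1 - t <= e / (K + 1) by lra.
have K1 : 0 < K + 1 by rewrite ltr_wpDl.
rewrite ler_pdivlMr//; have : 0 <= 1 - t by lra.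
nra.
Qed.

Lemma umean_le N (F G : C -> R) (e : R) : (0 < N)%N ->
  (forall z, cabs z = 1 -> F z <= G z + e) -> umean N F <= umean N G + e.
Proof.
move=> N0 h; rewrite /umean ler_pdivrMr ?ltr0n// mulrDl divfK ?pnatr_eq0 -?lt0n//.
have -> : e * N%:R = \sum_(z <- uroots N) e.
  by rewrite big_const_seq count_predT size_uroots// iter_addr_0 mulr_natr.
rewrite -big_split /= [leLHS]big_seq [leRHS]big_seq; apply: ler_sum => z zN.
by apply: h; exact: (cabs_uroots N0 zN).
Qed.

(** g is approximated by a polynomial through [runge], and the polynomial is dilated so that
    [submean_split] applies. Of the three errors e / 3, two come from the approximation, at 0 and on
    the circle, and one from [submean_split]. *)
Theorem submean (g : C -> C) (M p e : R) : hol2 g ->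
  (forall s, cabs s <= 9 / 5 -> cabs (g s) <= M) -> 0 < p -> 0 < e ->
  exists N0, (0 < N0)%N /\ forall N, (N0 <= N)%N ->
    cabs (g 0) `^ p <= umean N (fun z => cabs (g z) `^ p) + e.
Proof.
move=> hg hM p0 e0.
have M0 : 0 <= M by apply: le_trans (hM 0 _); rewrite ?cabs0 ?cabs_ge0.
have [d d0 hd] := @powR_modulus p (M + 1) (e / 3) p0 (divr_gt0 e0 (ltr0n _ 3)).
pose d1 := Num.min (d / 2) (1 / 2).
have d10 : 0 < d1 by rewrite lt_min !divr_gt0.
have [P hP] := runge hg hM d10.
have [dl dl0 hdl] := poly_dilation P d10.
have [P0|P0] := eqVneq P 0.
  exists 1%N; split=> // N N0.
  have h0 : cabs (g 0) <= d by have := hP 0; rewrite cabs0 P0 horner0 subr0 => /(_ ler01) /le_trans; apply; rewrite ge_min; apply/orP; left; lra.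
  have := hd (cabs (g 0)) 0 (cabs_ge0 _) (lexx _) (addr_ge0 M0 ler01).
  rewrite add0r powR0 ?gt_eqF// => /(_ h0) => h1.
  have : 0 <= umean N (fun z => cabs (g z) `^ p) by rewrite divr_ge0// sumr_ge0// => z _; exact: powR_ge0.
  lra.
have [r Pr] := closed_field_poly_normal P.
have [t [t0 t1 td ht]] := dilation_avoid r dl0.
pose tC := (t%:C)%C : C.
have tC0 : tC != 0 by rewrite -cabs_gt0 cabsR normr_gt0 gt_eqF.
pose c := lead_coef P * tC ^+ size r.
pose s := [seq nu / tC | nu <- r].
have Pt z : P.[tC * z] = c * \prod_(nu <- s) (z - nu).
  rewrite {1}Pr hornerZ horner_prod /c /s big_map -mulrA; congr (_ * _).
  rewrite -(prod_const_seq r tC) -big_split /=.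
  by apply: eq_bigr => nu _; rewrite hornerXsubC mulrBr [_ * (_ / _)]mulrC divfK.
have hs z : z \in s -> cabs z != 1.
  move=> /mapP[nu nur ->]; rewrite cabsM cabsV cabsR ger0_norm ?(ltW t0)//.
  by apply/eqP => h; have /eqP := ht nu nur; apply; rewrite -(divfK (lt0r_neq0 t0) (cabs nu)) h mul1r.
have gP z : cabs z <= 1 -> cabs (g z - P.[tC * z]) <= d.
  move=> hz; rewrite -(subrKA P.[z]); apply: le_trans (cabsD _ _) _.
  apply: le_trans (lerD (hP z hz) (hdl t _ td z hz)) _.
    by rewrite (ltW t0) (ltW t1).
  have : d1 <= d / 2 by rewrite ge_min lexx.
  lra.
have gP1 z : cabs z <= 1 -> cabs (P.[tC * z]) <= M + 1.
  move=> hz; have h1 : cabs (g z - P.[tC * z]) <= 1.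
    rewrite -(subrKA P.[z]); apply: le_trans (cabsD _ _) _.
    apply: le_trans (lerD (hP z hz) (hdl t _ td z hz)) _.
      by rewrite (ltW t0) (ltW t1).
    have : d1 <= 1 / 2 by rewrite ge_min lexx orbT.
    lra.
  have := cabs_lerB (P.[tC * z]) (g z); rewrite cabs_distC.
  have := hM z; have : cabs z <= 9 / 5 by lra.
  by move=> /[swap] /[apply]; lra.
have gM z : cabs z <= 1 -> cabs (g z) <= M + 1.
  by move=> hz; have : cabs (g z) <= M by [apply: hM; lra]; lra.
pose B := (M + 1) `^ p + 1.
have B0 : 0 < B by rewrite /B ltr_wpDl ?powR_ge0.
have [N1 hN1] := submean_split c p0 hs (divr_gt0 (divr_gt0 e0 (ltr0n _ 3)) B0).
exists N1.+1; split=> // N NN1; have N0 : (0 < N)%N by exact: leq_trans NN1.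
have := hN1 N (ltnW NN1); rewrite -Pt.
under [X in umean N X]eq_fun do rewrite -Pt.
move=> h.
have h0 : cabs (g 0) `^ p <= cabs (P.[tC * 0]) `^ p + e / 3.
  apply: hd; rewrite ?cabs_ge0//; first by apply: gP1; rewrite cabs0.
  have := gP 0; rewrite cabs0 => /(_ ler01); have := cabs_lerB (g 0) (P.[tC * 0]); lra.
have h2 : umean N (fun z => cabs P.[tC * z] `^ p) <= umean N (fun z => cabs (g z) `^ p) + e / 3.
  apply: umean_le => // z z1; apply: hd; rewrite ?cabs_ge0//; first by apply: gM; rewrite z1.
  have := gP z; rewrite z1 => /(_ (lexx _)); rewrite cabs_distC.
  have := cabs_lerB P.[tC * z] (g z); lra.
have h3 : cabs (P.[tC * 0]) `^ p * (e / 3 / B) <= e / 3.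
  rewrite mulrC mulrAC ler_pdivrMr// ler_wpM2l ?divr_ge0 ?(ltW e0)//.
  apply: (@le_trans _ _ ((M + 1) `^ p)); last by rewrite /B lerDl.
  by apply: powR_le; rewrite ?cabs_ge0 ?(ltW p0)//; apply: gP1; rewrite cabs0.
move: h; rewrite mulrBr mulr1; lra.
Qed.

End SubMean.

(** * Holomorphic functions on C^n *)

Section HermitianSpace.
Variables (R : realType) (n : nat).
Local Notation C := R[i].
Local Notation V := 'rV[C]_n.
Implicit Types (z w a : V) (c : C).

Lemma cinnerDl z w a : cinner (z + w) a = cinner z a + cinner w a.
Proof. by rewrite /cinner -big_split; apply: eq_bigr => j _; rewrite mxE mulrDl. Qed.

Lemma cinnerZl c z a : cinner (c *: z) a = c * cinner z a.
Proof. by rewrite /cinner mulr_sumr; apply: eq_bigr => j _; rewrite mxE mulrA. Qed.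

Lemma cinnerJ z w : cinner w z = ((cinner z w)^*)%C.
Proof.
rewrite /cinner rmorph_sum; apply: eq_bigr => j _.
by rewrite rmorphM /= conjcK mulrC.
Qed.

Lemma cinnerDr z w a : cinner a (z + w) = cinner a z + cinner a w.
Proof. by rewrite cinnerJ cinnerDl rmorphD /= -!cinnerJ. Qed.

Lemma cinnerZr c z a : cinner a (c *: z) = (c^*)%C * cinner a z.
Proof. by rewrite cinnerJ cinnerZl rmorphM /= -!cinnerJ. Qed.

Lemma cinnerNl z a : cinner (- z) a = - cinner z a.
Proof. by rewrite -scaleN1r cinnerZl mulN1r. Qed.

Lemma cinnerNr z a : cinner a (- z) = - cinner a z.
Proof. by rewrite cinnerJ cinnerNl rmorphN /= -cinnerJ. Qed.

Lemma cinner0l a : cinner (0 : V) a = 0.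
Proof. by rewrite -(scale0r (0 : V)) cinnerZl mul0r. Qed.

Lemma cinner0r a : cinner a (0 : V) = 0.
Proof. by rewrite cinnerJ cinner0l conjc0. Qed.

Lemma cabs_sqrC c : ((cabs c ^+ 2)%:C)%C = c * (c^*)%C.
Proof. by rewrite rmorphXn /= -sqr_normc. Qed.

Lemma sqnormE z : ((sqnorm z)%:C)%C = cinner z z.
Proof.
rewrite /sqnorm /cinner rmorph_sum; apply: eq_bigr => j _; exact: cabs_sqrC.
Qed.

Lemma sqnormER z : sqnorm z = complex.Re (cinner z z).
Proof. by rewrite -sqnormE. Qed.

Lemma sqnorm_ge0 z : 0 <= sqnorm z.
Proof. by apply: sumr_ge0 => j _; exact: sqr_ge0. Qed.

Lemma sqnorm0 : sqnorm (0 : V) = 0.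
Proof. by rewrite sqnormER cinner0l. Qed.

Lemma sqnorm0_eq z : sqnorm z = 0 -> z = 0.
Proof.
move=> /eqP; rewrite psumr_eq0 => [|j _]; last exact: sqr_ge0.
move=> /allP h; apply/rowP => j; rewrite mxE; have := h j (mem_index_enum _).
by rewrite sqrf_eq0 => /eqP/cabs0_eq.
Qed.

Lemma sqnormZ c z : sqnorm (c *: z) = cabs c ^+ 2 * sqnorm z.
Proof.
by rewrite /sqnorm mulr_sumr; apply: eq_bigr => j _; rewrite mxE cabsM exprMn.
Qed.

Lemma Re_conj c : complex.Re (c^*)%C = complex.Re c. Proof. by case: c. Qed.

Lemma sqnormD z w : sqnorm (z + w) = sqnorm z + complex.Re (cinner z w) *+ 2 + sqnorm w.
Proof.
rewrite !sqnormER cinnerDl !cinnerDr !cReD (cinnerJ z w) Re_conj mulr2n; ring.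
Qed.

Lemma sqnormN z : sqnorm (- z) = sqnorm z.
Proof. by rewrite -scaleN1r sqnormZ cabsN cabs1 expr1n mul1r. Qed.

Lemma sqnormB z w : sqnorm (z - w) = sqnorm z - complex.Re (cinner z w) *+ 2 + sqnorm w.
Proof. by rewrite sqnormD cinnerNr cReN sqnormN mulNrn. Qed.

Lemma cinner_CS z w : cabs (cinner z w) ^+ 2 <= sqnorm z * sqnorm w.
Proof.
have [w0|w0] := eqVneq (sqnorm w) 0.
  by rewrite (sqnorm0_eq w0) cinner0r cabs0 expr0n mulr_ge0// sqnorm_ge0.
have w1 : 0 < sqnorm w by rewrite lt_def w0 sqnorm_ge0.
have := sqnorm_ge0 ((sqnorm w)%:C%C *: z - cinner z w *: w).
rewrite sqnormB !sqnormZ cinnerZl cinnerZr cabsR ger0_norm ?sqnorm_ge0//.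
rewrite [(_^*)%C * _]mulrC -cabs_sqrC -rmorphM /= => h.
rewrite -(ler_pM2l w1); move: h.
move: (cabs (cinner z w) ^+ 2) (sqnorm w) (sqnorm z) => x y t; rewrite mulr2n expr2; nra.
Qed.

Lemma enorm_ge0 z : 0 <= enorm z. Proof. exact: sqrtr_ge0. Qed.

Lemma enorm_sqr z : enorm z ^+ 2 = sqnorm z.
Proof. by rewrite sqr_sqrtr// sqnorm_ge0. Qed.

Lemma enorm0 : enorm (0 : V) = 0. Proof. by rewrite /enorm sqnorm0 sqrtr0. Qed.

Lemma enormZ c z : enorm (c *: z) = cabs c * enorm z.
Proof. by rewrite /enorm sqnormZ sqrtrM ?sqr_ge0// sqrtr_sqr ger0_norm// cabs_ge0. Qed.

Lemma enormN z : enorm (- z) = enorm z. Proof. by rewrite /enorm sqnormN. Qed.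

Lemma cabs_cinner z w : cabs (cinner z w) <= enorm z * enorm w.
Proof.
rewrite -(@ler_pXn2r _ 2)// ?nnegrE ?mulr_ge0 ?enorm_ge0 ?cabs_ge0//.
by rewrite exprMn !enorm_sqr cinner_CS.
Qed.

Lemma enormD z w : enorm (z + w) <= enorm z + enorm w.
Proof.
rewrite -(@ler_pXn2r _ 2)// ?nnegrE ?addr_ge0 ?enorm_ge0//.
rewrite enorm_sqr sqnormD sqrrD !enorm_sqr lerD2r lerD2l lerMn2r/=.
by apply: le_trans (ler_norm _) _; apply: le_trans (cabs_Re _) (cabs_cinner _ _).
Qed.

Lemma cabs_coord z j : cabs (z 0 j) <= enorm z.
Proof.
rewrite -(@ler_pXn2r _ 2)// ?nnegrE ?enorm_ge0 ?cabs_ge0// enorm_sqr.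
by rewrite /sqnorm (bigD1 j)//= lerDl sumr_ge0// => i _; exact: sqr_ge0.
Qed.

Lemma enorm_delta j : enorm (delta_mx 0 j : V) = 1.
Proof.
rewrite /enorm /sqnorm (bigD1 j)//= mxE !eqxx cabs1 expr1n big1 ?addr0 ?sqrtr1//.
by move=> i ij; rewrite mxE (negbTE ij) andbF cabs0 expr0n.
Qed.

Lemma enorm_coord z (d : R) : (forall j, cabs (z 0 j) <= d) -> enorm z <= d * n%:R.
Proof.
move=> h; have -> : z = \sum_(j < n) z 0 j *: delta_mx 0 j.
  by rewrite [LHS]matrix_sum_delta big_ord1.
have -> : d * n%:R = \sum_(j < n) d by rewrite sumr_const card_ord mulr_natr.
elim/big_ind2 : _ => [|x1 x2 y1 y2 h1 h2|j _]; first by rewrite enorm0.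
  by apply: le_trans (enormD _ _) (lerD h1 h2).
by rewrite enormZ enorm_delta mulr1.
Qed.

Lemma BallE z : Ball z = (enorm z < 1 : Prop). Proof. by []. Qed.

Lemma Ball_sqnorm z : Ball z <-> sqnorm z < 1.
Proof.
rewrite BallE -enorm_sqr; split => [h|]; first by rewrite exprn_ilt1// enorm_ge0.
by move=> h; rewrite -(@ltr_pXn2r _ 2)// ?nnegrE ?enorm_ge0// expr1n.
Qed.

End HermitianSpace.

(** * Continuity and directional derivatives *)

Section Holomorphy.
Variables (R : realType) (n : nat).
Local Notation C := R[i].
Local Notation V := 'rV[C]_n.
Implicit Types (z w a : V) (f : V -> C).

Definition ceps f z := forall e : R, 0 < e -> exists2 d : R, 0 < d &
  forall w, enorm (w - z) < d -> cabs (f w - f z) < e.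

Definition ldiff f z t := cdiff (fun s : C => f (z + s *: t)) 0.

Lemma real_gt0C (e : C) : 0 < e -> e = ((complex.Re e)%:C)%C /\ 0 < complex.Re e.
Proof. by case: e => x y; rewrite ltcE /= => /andP[/eqP -> h]. Qed.

(** Row vectors carry the topology of the maximum norm; [enorm_coord] costs a factor n, whence the
    radius d / (n + 1). *)
Lemma ceps_continuous f z : {for z, continuous (f : Cvec R n -> C^o)} <-> ceps f z.
Proof.
split.
  move=> /cvgrPdist_lt h e e0.
  have e0C : (0 : C) < (e%:C)%C by rewrite ltcR.
  have := h _ e0C; rewrite -[nbhs _]/(nbhs (z : Cvec R n)) => /nbhs_ballP[d /= d0 hd].
  have [dE d0'] := real_gt0C d0.
  exists (complex.Re d) => // w hw.
  have : ball (z : Cvec R n) d (w : Cvec R n).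
    split=> // i j; rewrite ord1 /ball /= dE cabs_norm ltcR -cabsN opprB.
    by apply: le_lt_trans hw; apply: le_trans (cabs_coord (w - z) j); rewrite !mxE.
  by move=> /hd /=; rewrite cabs_norm ltcR cabs_distC.
move=> h A /nbhs_ballP[e /= e0 he]; have [eE e0'] := real_gt0C e0.
have [d d0 hd] := h _ e0'.
pose d' := d / (n%:R + 1).
have d'0 : 0 < d' by rewrite divr_gt0// ltr_wpDl.
have d'0C : (0 : C) < (d'%:C)%C by rewrite ltcR.
apply/(@nbhs_ballP _ (Cvec R n)); exists (d'%:C)%C => // w hw /=; apply: he.
rewrite /ball /= eE cabs_norm ltcR cabs_distC; apply: hd.
apply: (@le_lt_trans _ _ (d' * n%:R)).
  apply: enorm_coord => j; have := hw.2 ord0 j; rewrite /ball /= cabs_norm ltcR cabs_distC.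
  by rewrite !mxE => /ltW.
by rewrite /d' mulrAC ltr_pdivrMr ?ltr_wpDl// ltr_pM2l// ltrDl.
Qed.

Lemma cderiv_cvg f z (t : V) l : ((fun h : C^o => ((f (z + h *: t) - f z) / h : C^o))
         @ (0 : C^o)^' --> (l : C^o)) <-> cderiv (fun s : C => f (z + s *: t)) 0 l.
Proof.
split.
  move=> /cvgrPdist_lt h e e0.
  have e0C : (0 : C) < (e%:C)%C by rewrite ltcR.
  have := h _ e0C; rewrite near_withinE => /nbhs_ballP[d /= d0 hd].
  have [dE d0'] := real_gt0C d0.
  exists (complex.Re d) => // s hs; rewrite add0r scale0r addr0.
  have [->|s0] := eqVneq s 0; first by rewrite scale0r addr0 subrr mulr0 subrr cabs0 mulr0.
  have : ball (0 : C^o) d s by rewrite /ball /= dE sub0r cabs_norm ltcR cabsN.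
  move=> /hd /(_ s0) /=; rewrite cabs_norm ltcR cabs_distC => /ltW h1.
  have -> : f (z + s *: t) - f z - l * s = ((f (z + s *: t) - f z) / s - l) * s by field.
  by rewrite cabsM ler_wpM2r ?cabs_ge0.
move=> h; apply/cvgrPdist_lt => e e0; have [eE e0'] := real_gt0C e0.
have [d d0 hd] := h _ (divr_gt0 e0' (ltr0n _ 2)).
have d0C : (0 : C) < (d%:C)%C by rewrite ltcR.
rewrite near_withinE; apply/nbhs_ballP; exists (d%:C)%C => // s hs s0 /=.
rewrite eE cabs_norm ltcR cabs_distC.
have hs' : cabs s < d by move: hs; rewrite /ball /= sub0r cabs_norm ltcR cabsN.
have := hd s hs'; rewrite add0r scale0r addr0 => h1.
have -> : (f (z + s *: t) - f z) / s - l = (f (z + s *: t) - f z - l * s) / s by field.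
rewrite cabsM cabsV ltr_pdivrMr ?cabs_gt0//; apply: le_lt_trans h1 _.
by rewrite ltr_pM2r ?cabs_gt0//; lra.
Qed.

Lemma holomorphic_onP (D : set V) f : holomorphic_on D f <->
  (forall z, D z -> ceps f z) /\ (forall z, D z -> forall j, ldiff f z (delta_mx 0 j)).
Proof.
split=> -[h1 h2]; split=> z Dz.
- by apply/ceps_continuous; exact: h1.
- by move=> j; have [l /cderiv_cvg hl] := h2 z Dz j; exists l.
- by apply/ceps_continuous; exact: h1.
- by move=> j; have [l hl] := h2 z Dz j; exists l; apply/cderiv_cvg.
Qed.

Definition eopen (D : set V) := forall z, D z -> exists2 d : R, 0 < d &
  forall w, enorm (w - z) < d -> D w.

Lemma eopen_Ball : eopen (@Ball R n).
Proof.
move=> z Dz; exists (1 - enorm z); first by rewrite subr_gt0.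
move=> w hw; rewrite BallE -(subrK z w); apply: le_lt_trans (enormD _ _) _.
by rewrite -ltrBrDr.
Qed.

(* Second-order Taylor bound in the j-th coordinate, uniform near z. *)
Lemma partial_expansion (D : set V) f z : eopen D -> holomorphic_on D f -> D z ->
  exists M r : R, [/\ 0 < M, 0 < r & exists l : 'I_n -> V -> C,
    (forall j w, enorm (w - z) < r -> forall s, cabs s <= r ->
       cabs (f (w + s *: delta_mx 0 j) - f w - l j w * s) <= M * cabs s ^+ 2)].
Proof.
move=> oD /holomorphic_onP[cf df] Dz.
have [d1 d10 h1] := oD z Dz; have [d2 d20 h2] := cf z Dz 1 ltr01.
pose r := Num.min d1 d2 / 4.
have r0 : 0 < r by rewrite divr_gt0// lt_min d10.
pose M0 := cabs (f z) + 1.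
have M00 : 0 < M0 by rewrite ltr_wpDl ?cabs_ge0.
have rd1 : 4 * r <= d1 by rewrite /r mulrC divfK// ge_min lexx.
have rd2 : 4 * r <= d2 by rewrite /r mulrC divfK// ge_min lexx orbT.
have near j w s : enorm (w - z) < r -> cabs s <= 9 / 5 ->
    enorm (w + (r%:C%C * s) *: delta_mx 0 j - z) < 4 * r.
  move=> hw hs; rewrite addrAC; apply: le_lt_trans (enormD _ _) _.
  rewrite enormZ enorm_delta mulr1 cabsM cabsR (ger0_norm (ltW r0)).
  have : r * cabs s <= r * (9 / 5) by rewrite ler_wpM2l// ltW.
  lra.
have rr0 : 0 < r ^+ 2 by exact: exprn_gt0.
exists (8 * M0 / r ^+ 2), r; split => //; first by apply: divr_gt0 => //; exact: mulr_gt0.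
have : forall p : 'I_n * V, exists l : C, enorm (p.2 - z) < r -> forall s, cabs s <= r ->
    cabs (f (p.2 + s *: delta_mx 0 p.1) - f p.2 - l * s) <= 8 * M0 / r ^+ 2 * cabs s ^+ 2.
  move=> [j w] /=.
  have [hw|_] := boolP (enorm (w - z) < r); last by exists 0.
  pose g s := f (w + (0 + r%:C%C * s) *: delta_mx 0 j).
  have gh : hol2 g.
    move=> s hs; apply: (@cdiff_affine R (fun s => f (w + s *: delta_mx 0 j))).
    have Dw : D (w + (r%:C%C * s) *: delta_mx 0 j).
      by apply: h1; apply: lt_le_trans rd1; exact: near.
    have [l hl] := df _ Dw j; exists l => e /hl[d d0 hd]; exists d => // h /hd.
    by rewrite !add0r scale0r addr0 -[w + _ + _]addrA -scalerDl.
  have gM s : cabs s <= 9 / 5 -> cabs (g s) <= M0.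
    move=> hs; have := h2 (w + (r%:C%C * s) *: delta_mx 0 j) (lt_le_trans (near j w s hw hs) rd2).
    rewrite /g add0r /M0; have := cabs_lerB (f (w + (r%:C%C * s) *: delta_mx 0 j)) (f z); lra.
  have [l hl] := schwarz2 gh gM.
  exists (l / r%:C%C) => _ s hs.
  have rC0 : (r%:C)%C != 0 :> C by rewrite -cabs_gt0 cabsR normr_gt0 gt_eqF.
  have := hl (s / r%:C%C); rewrite cabsM cabsV cabsR (ger0_norm (ltW r0)) ler_pdivrMr// mul1r => /(_ hs).
  rewrite /g add0r mulrC divfK// mulr0 add0r scale0r addr0 => h.
  apply: le_trans (le_trans _ h) _; first by rewrite [l / _ * s]mulrAC mulrA.
  by rewrite exprMn exprVn [_ ^+ 2 * _]mulrC mulrA.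
move=> /choice[l hl]; exists (fun j w => l (j, w)) => j w hw s hs.
exact: (hl (j, w) hw s hs).
Qed.

(** Continuity and separate differentiability give differentiability along any vector. The partial
    derivatives are continuous because, by [partial_expansion], difference quotients of a fixed
    small step approximate them uniformly near z; the coordinates of t are then added one at a
    time. *)
Lemma holomorphic_line (D : set V) f : eopen D -> holomorphic_on D f ->
  forall z t, D z -> ldiff f z t.
Proof.
move=> oD hf z t Dz.
have [cf _] := (holomorphic_onP D f).1 hf.
have [M [r [M0 r0 [l hl]]]] := partial_expansion oD hf Dz.
have lcont (j : 'I_n) : forall e : R, 0 < e -> exists2 d : R, 0 < d &
    forall w, enorm (w - z) < d -> cabs (l j w - l j z) <= e.
  move=> e e0.
  have [d1 d10 h1] := oD z Dz.
  (* The quotients of step s miss the partial derivatives at z and at w by at most M s <= e / 4, and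
     the two quotients approach each other as w tends to z. *)
  pose s := Num.min (Num.min r (e / (M *+ 4))) (d1 / 2).
  have s0 : 0 < s by rewrite !lt_min r0 divr_gt0// ?divr_gt0// mulrn_wgt0.
  have sr : s <= r by rewrite !ge_min lexx.
  have se : s * M *+ 4 <= e by rewrite -mulrnAr -ler_pdivlMr ?mulrn_wgt0// !ge_min lexx orbT.
  have sC : cabs (s%:C%C : C) = s by rewrite cabsR ger0_norm// ltW.
  have s0C : (s%:C)%C != 0 :> C by rewrite -cabs_gt0 sC.
  have Dz' : D (z + s%:C%C *: delta_mx 0 j).
    apply: h1; rewrite addrAC subrr add0r enormZ enorm_delta mulr1 sC.
    have : s <= d1 / 2 by rewrite ge_min lexx orbT.
    lra.
  have es0 : 0 < e * s / 4 by rewrite divr_gt0// mulr_gt0.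
  have [d2 d20 h2] := cf _ Dz' _ es0.
  have [d3 d30 h3] := cf _ Dz _ es0.
  exists (Num.min r (Num.min d2 d3)) => [|w]; first by rewrite !lt_min r0 d20.
  rewrite !lt_min => /andP[wr /andP[wd2 wd3]].
  have e1 := hl j w wr s%:C%C; rewrite sC in e1; have {}e1 := e1 sr.
  have e2 := hl j z; rewrite subrr enorm0 in e2; have {}e2 := e2 r0 s%:C%C; rewrite sC in e2; have {}e2 := e2 sr.
  have {}h3 := h3 w wd3.
  have {}h2 : cabs (f (w + s%:C%C *: delta_mx 0 j) - f (z + s%:C%C *: delta_mx 0 j)) < e * s / 4.
    by apply: h2; rewrite opprD addrACA subrr addr0.
  rewrite -(ler_pM2r s0) -{1}sC -cabsM.
  have -> : (l j w - l j z) * s%:C%C = (f (z + s%:C%C *: delta_mx 0 j) - f z - l j z * s%:C%C)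
     - (f (w + s%:C%C *: delta_mx 0 j) - f w - l j w * s%:C%C)
     + (f (w + s%:C%C *: delta_mx 0 j) - f (z + s%:C%C *: delta_mx 0 j)) - (f w - f z) by ring.
  apply: le_trans (cabsB _ _) _; apply: le_trans (lerD (cabsD _ _) (ltW h3)) _.
  apply: le_trans (lerD (lerD (cabsB _ _) (ltW h2)) (lexx _)) _.
  apply: le_trans (lerD (lerD (lerD e2 e1) (lexx _)) (lexx _)) _.
  have : M * s ^+ 2 *+ 4 <= e * s.
    by rewrite expr2 mulrA -mulrnAl ler_wpM2r ?(ltW s0)// mulrC.
  rewrite -[_ *+ 4]mulr_natr; lra.
(* [tr k] keeps the coordinates of t of index below k. *)
pose tr k : V := \sum_(j < n | (j < k)%N) t 0 j *: delta_mx 0 j.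
suff key k : (k <= n)%N -> exists L, cderiv (fun s : C => f (z + s *: tr k)) 0 L.
  have [L hL] := key n (leqnn _); exists L.
  have -> : t = tr n.
    rewrite /tr [LHS]matrix_sum_delta big_ord1; apply: eq_bigl => j; by rewrite ltn_ord.
  by [].
elim: k => [_|k IH kn].
  exists 0; have -> : tr 0%N = 0 by rewrite /tr big_pred0.
  by under eq_fun do rewrite scaler0; exact: cderiv_cst.
have [L hL] := IH (ltnW kn).
pose j := Ordinal kn.
have trS : tr k.+1 = tr k + t 0 j *: delta_mx 0 j.
  rewrite /tr (bigD1 j)//= addrC; congr (_ + _); apply: eq_bigl => i.
  rewrite ltnS leq_eqVlt -(inj_eq val_inj) /=.
  by case: (ltngtP i k).
exists (L + l j z * t 0 j) => e e0.
have e30 : 0 < e / 3 by rewrite divr_gt0.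
have [d1 d10 h1] := hL _ e30.
pose T := 1 + cabs (t 0 j). have T0 : 0 < T by rewrite /T ltr_pwDl ?cabs_ge0.
pose N := 1 + enorm (tr k). have N0 : 0 < N by rewrite /N ltr_pwDl ?enorm_ge0.
have [d2 d20 h2] := lcont j _ (divr_gt0 e30 T0).
pose d3 := e / 3 / (M * T ^+ 2).
have d30 : 0 < d3 by rewrite !divr_gt0// mulr_gt0// exprn_gt0.
exists (Num.min (Num.min d1 d3) (Num.min (Num.min d2 r / N) (r / T))) => [|s].
  by rewrite !lt_min d10 d30 !divr_gt0// lt_min d20 r0.
rewrite !lt_min => /andP[/andP[/h1 {}h1 hd3] /andP[hN hT]].
rewrite add0r !scale0r !addr0 in h1 *; rewrite ltr_pdivlMr// in hN; rewrite ltr_pdivlMr// in hT.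
pose w := z + s *: tr k.
have wz : enorm (w - z) < Num.min d2 r.
  rewrite /w addrAC subrr add0r enormZ; apply: le_lt_trans hN.
  by rewrite ler_wpM2l ?cabs_ge0// lerDr.
move: wz; rewrite lt_min => /andP[/h2 {}h2 wr].
have st : cabs (s * t 0 j) <= cabs s * T by rewrite cabsM ler_wpM2l ?cabs_ge0// lerDr.
have h3 := hl j w wr (s * t 0 j) (le_trans st (ltW hT)).
have -> : z + s *: tr k.+1 = w + (s * t 0 j) *: delta_mx 0 j.
  by rewrite trS scalerDr scalerA addrA.
have -> : f (w + (s * t 0 j) *: delta_mx 0 j) - f z - (L + l j z * t 0 j) * s =
  (f (w + (s * t 0 j) *: delta_mx 0 j) - f w - l j w * (s * t 0 j)) +
  (l j w - l j z) * (s * t 0 j) + (f w - f z - L * s) by ring.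
have -> : e * cabs s = e / 3 * cabs s + e / 3 * cabs s + e / 3 * cabs s by field.
apply: le_trans (cabsD _ _) (lerD (le_trans (cabsD _ _) (lerD _ _)) h1).
  apply: le_trans h3 _.
  apply: (@le_trans _ _ (M * (cabs s * T) ^+ 2)).
    by rewrite ler_wpM2l ?(ltW M0)// ler_sqr ?nnegrE ?mulr_ge0 ?cabs_ge0// ltW.
  have -> : M * (cabs s * T) ^+ 2 = (cabs s * (M * T ^+ 2)) * cabs s by ring.
  by rewrite ler_wpM2r ?cabs_ge0// -ler_pdivlMr ?mulr_gt0 ?exprn_gt0// ltW.
rewrite cabsM; apply: le_trans (ler_pM (cabs_ge0 _) (cabs_ge0 _) h2 st) _.
by rewrite mulrCA mulrC divfK// gt_eqF.
Qed.

End Holomorphy.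

(** * Borel sets and volume of C^n *)

Section BorelCn.
Variables (R : realType) (n : nat).
Local Notation C := R[i].
Local Notation V := 'rV[C]_n.
Local Notation Cn := (Cn R n).

Lemma eopen_open (U : set V) : eopen U -> @open (Cvec R n) U.
Proof.
move=> oU; rewrite openE => z /oU[d d0 hd]; rewrite /interior.
pose d' := d / (n%:R + 1).
have d'0 : 0 < d' by rewrite divr_gt0// ltr_wpDl.
have d'0C : (0 : C) < (d'%:C)%C by rewrite ltcR.
apply/(@nbhs_ballP _ (Cvec R n)); exists (d'%:C)%C => // w hw; apply: hd.
apply: (@le_lt_trans _ _ (d' * n%:R)).
  apply: enorm_coord => j; have := hw.2 ord0 j; rewrite /ball /= cabs_norm ltcR cabs_distC.
  by rewrite !mxE => /ltW.
by rewrite /d' mulrAC ltr_pdivrMr ?ltr_wpDl// ltr_pM2l// ltrDl.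
Qed.

Lemma open_eopen (U : set V) : @open (Cvec R n) U -> eopen U.
Proof.
rewrite openE => oU z /oU; rewrite /interior => /(@nbhs_ballP _ (Cvec R n))[d /= d0 hd].
have [dE d0'] := real_gt0C d0.
exists (complex.Re d) => // w hw; apply: hd.
split=> // i j; rewrite ord1 /ball /= dE cabs_norm ltcR -cabsN opprB.
by apply: le_lt_trans hw; apply: le_trans (cabs_coord (w - z) j); rewrite !mxE.
Qed.

Lemma eopen_measurable (U : set V) : eopen U -> measurable (U : set Cn).
Proof. by move=> /eopen_open oU; apply: sub_sigma_algebra. Qed.

Definition rat_box (q : {ffun 'I_n -> rat * rat * (rat * rat)}) : set V :=
  box (fun j => ratr (q j).1.1) (fun j => ratr (q j).1.2)
      (fun j => ratr (q j).2.1) (fun j => ratr (q j).2.2).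

Lemma eopen_bigcup (U : set V) : eopen U ->
  U = \bigcup_q (if `[< rat_box q `<=` U >] then rat_box q else set0).
Proof.
move=> oU; apply/seteqP; split; last first.
  by move=> z [q _]; case: ifPn => // /asboolP; apply.
move=> z /oU[d d0 hd].
pose e := d / (2 * n%:R + 1).
have e0 : 0 < e by rewrite divr_gt0// ltr_wpDl// mulr_ge0.
have ex (x : R) : exists ab : rat * rat, ratr ab.1 <= x <= ratr ab.2 /\
    (x - ratr ab.1 < e / 2 /\ ratr ab.2 - x < e / 2 :> R).
  have [a] := @rat_in_itvoo R (x - e / 2) x ltac:(lra); rewrite in_itv /= => /andP[a1 a2].
  have [b] := @rat_in_itvoo R x (x + e / 2) ltac:(lra); rewrite in_itv /= => /andP[b1 b2].
  by exists (a, b) => /=; split; [rewrite (ltW a2) (ltW b1)|split; lra].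
have /choice[F hF] := ex.
pose q := [ffun j : 'I_n => (F (complex.Re (z 0 j)), F (complex.Im (z 0 j)))].
exists q => //; rewrite ifT; last first.
  apply/asboolP => w hw; apply: hd.
  apply: (@le_lt_trans _ _ (2 * e * n%:R)).
    apply: enorm_coord => j; apply: le_trans (cabs_le_ReIm _) _.
    rewrite !mxE cReD cImD cReN cImN.
    have [/andP[h1 h2] /andP[h3 h4]] := hw j; rewrite !ffunE /= in h1 h2 h3 h4.
    have [/andP[k1 k2] [k3 k4]] := hF (complex.Re (z 0 j)).
    have [/andP[l1 l2] [l3 l4]] := hF (complex.Im (z 0 j)).
    have a1 : `|complex.Re (w 0 j) - complex.Re (z 0 j)| <= e by rewrite ler_norml; apply/andP; split; lra.
    have a2 : `|complex.Im (w 0 j) - complex.Im (z 0 j)| <= e by rewrite ler_norml; apply/andP; split; lra.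
    lra.
  have he : e * (2 * n%:R + 1) = d by rewrite /e divfK// gt_eqF// ltr_wpDl// mulr_ge0.
  have -> : 2 * e * n%:R = d - e by rewrite -[in RHS]he; ring.
  by rewrite gtrBl.
by move=> j; rewrite !ffunE /=; have [-> _] := hF (complex.Re (z 0 j)); have [-> _] := hF (complex.Im (z 0 j)).
Qed.

Lemma coord_ceps j z : ceps (fun z : V => z 0 j) z.
Proof.
move=> e e0; exists e => // w; apply: le_lt_trans; apply: le_trans (cabs_coord _ j).
by rewrite !mxE.
Qed.

Lemma ceps_measurable (D : set V) (g : V -> R) : eopen D ->
  (forall z, D z -> forall e, 0 < e -> exists2 d : R, 0 < d &
     forall w, enorm (w - z) < d -> `|g w - g z| < e) ->
  measurable_fun (D : set Cn) (g : Cn -> R).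
Proof.
move=> oD hg.
apply: (@measurability _ _ _ _ (D : set Cn) g _ (RGenOInfty.measurableE R)) => _ [_ [x ->] <-].
apply: eopen_measurable => z [Dz] /=; rewrite in_itv /= andbT => xz.
have [d1 d10 h1] := oD z Dz.
have [d2 d20 h2] := hg z Dz (g z - x) ltac:(by rewrite subr_gt0).
exists (Num.min d1 d2); first by rewrite lt_min d10.
move=> w; rewrite lt_min => /andP[/h1 Dw /h2]; rewrite ltr_norml => /andP[h _].
by split=> //; rewrite /= in_itv /= andbT; lra.
Qed.

Lemma ceps_measurable_cabs (D : set V) (f : V -> C) : eopen D -> (forall z, D z -> ceps f z) ->
  measurable_fun (D : set Cn) (fun z : Cn => cabs (f z)).
Proof.
move=> oD hf; apply: ceps_measurable => // z Dz e /(hf z Dz)[d d0 hd]; exists d => // w /hd.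
apply: le_lt_trans; rewrite ler_norml cabs_lerB andbT.
by have := cabs_lerB (f z) (f w); rewrite cabs_distC; lra.
Qed.

Lemma ceps_measurable_ReIm (D : set V) (f : V -> C) : eopen D -> (forall z, D z -> ceps f z) ->
  measurable_fun (D : set Cn) (fun z : Cn => complex.Re (f z)) /\
  measurable_fun (D : set Cn) (fun z : Cn => complex.Im (f z)).
Proof.
move=> oD hf; split; apply: ceps_measurable => // z Dz e /(hf z Dz)[d d0 hd]; exists d => // w /hd;
  apply: le_lt_trans; rewrite -?cReN -?cImN -?cReD -?cImD; [exact: cabs_Re|exact: cabs_Im].
Qed.

Lemma eopen_setT : eopen [set: V]. Proof. by move=> z _; exists 1. Qed.

Lemma measurable_Re j : measurable_fun [set: Cn] (fun z : Cn => complex.Re ((z : V) 0 j)).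
Proof. by apply: (ceps_measurable_ReIm eopen_setT (fun z _ => coord_ceps j z)).1. Qed.

Lemma measurable_Im j : measurable_fun [set: Cn] (fun z : Cn => complex.Im ((z : V) 0 j)).
Proof. by apply: (ceps_measurable_ReIm eopen_setT (fun z _ => coord_ceps j z)).2. Qed.

Lemma measurable_enorm : measurable_fun [set: Cn] (fun z : Cn => enorm (z : V)).
Proof.
apply: ceps_measurable; first exact: eopen_setT.
move=> z _ e e0; exists e => // w; apply: le_lt_trans.
have := enormD (w - z) z; have := enormD (z - w) w; rewrite !subrK -[z - w]opprB enormN => h1 h2.
by rewrite ler_norml; apply/andP; split; lra.
Qed.

Lemma measurable_box a b c d : measurable (@box R n a b c d : set Cn).
Proof.
rewrite (_ : box a b c d = \bigcap_(j in [set: 'I_n])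
   ((setT `&` (fun z : Cn => complex.Re ((z : V) 0 j)) @^-1` `[a j, b j]) `&`
    (setT `&` (fun z : Cn => complex.Im ((z : V) 0 j)) @^-1` `[c j, d j]))); last first.
  apply/seteqP; split => [z hz j _|z hz j].
    by have [h1 h2] := hz j; rewrite /= !in_itv /=.
  by have := hz j I; rewrite /= !in_itv /= => -[[_ ->] [_ ->]].
apply: fin_bigcap_measurable; first exact: finite_finset.
move=> j _; apply: measurableI; [apply: measurable_Re|apply: measurable_Im] => //; exact: measurable_itv.
Qed.

Lemma measurable_Cn_fun d (T : measurableType d) (D : set T) (X : T -> Cn) :
  (forall j, measurable_fun D (fun x => complex.Re ((X x : V) 0 j))) ->
  (forall j, measurable_fun D (fun x => complex.Im ((X x : V) 0 j))) ->
  measurable_fun D X.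
Proof.
move=> hRe hIm mD; apply: (@measurability _ _ _ _ D X (@open (Cvec R n))) => // _ [U oU <-].
rewrite (eopen_bigcup (open_eopen oU)) preimage_bigcup setI_bigcupr.
apply: countable_bigcupT_measurable; [exact: countableP|move=> q].
case: ifP => _; last by rewrite preimage_set0 setI0.
rewrite (_ : D `&` _ = \bigcap_(j in [set: 'I_n])
   ((D `&` (fun x => complex.Re ((X x : V) 0 j)) @^-1` `[ratr (q j).1.1, ratr (q j).1.2]) `&`
    (D `&` (fun x => complex.Im ((X x : V) 0 j)) @^-1` `[ratr (q j).2.1, ratr (q j).2.2])) `&` D); last first.
  apply/seteqP; split => [z [Dz hz]|z [hz Dz]].
    by split => // j _; have [h1 h2] := hz j; rewrite /= !in_itv /=.
  by split=> // j; have := hz j I; rewrite /= !in_itv /= => -[[_ ->] [_ ->]].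
apply: measurableI => //; apply: fin_bigcap_measurable; first exact: finite_finset.
move=> j _; apply: measurableI; [apply: hRe|apply: hIm] => //; exact: measurable_itv.
Qed.

Definition boxes : set (set Cn) := [set A | exists a b c d, A = @box R n a b c d].

Lemma boxes_generate : @measurable _ Cn = <<s boxes >>.
Proof.
apply/seteqP; split.
  apply: smallest_sub; first exact: smallest_sigma_algebra.
  move=> U oU; rewrite (eopen_bigcup (open_eopen oU)).
  rewrite -[_ (\bigcup_q _)]/(@measurable _ (g_sigma_algebraType boxes) (\bigcup_q _)).
  apply: countable_bigcupT_measurable; [exact: countableP|move=> q].
  case: ifP => _; last exact: measurable0.
  by apply: sub_sigma_algebra; do 4 eexists.
apply: smallest_sub; first exact: sigma_algebra_measurable.
by move=> _ [a [b [c [d ->]]]]; exact: measurable_box.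
Qed.

Lemma boxes_setI : setI_closed boxes.
Proof.
move=> _ _ [a [b [c [d ->]]]] [a' [b' [c' [d' ->]]]].
exists (fun j => Num.max (a j) (a' j)), (fun j => Num.min (b j) (b' j)),
  (fun j => Num.max (c j) (c' j)), (fun j => Num.min (d j) (d' j)).
apply/seteqP; split => [z [h h'] j|z h].
  have [/andP[h1 h2] /andP[h3 h4]] := h j; have [/andP[h1' h2'] /andP[h3' h4']] := h' j.
  by rewrite !ge_max !le_min h1 h1' h2 h2' h3 h3' h4 h4'.
split=> j; have [/andP[+ +] /andP[+ +]] := h j; rewrite !ge_max !le_min.
  by move=> /andP[-> _] /andP[-> _] /andP[-> _] /andP[-> _].
by move=> /andP[_ ->] /andP[_ ->] /andP[_ ->] /andP[_ ->].
Qed.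

Lemma box_empty (a b c d : 'I_n -> R) : ~ (forall j, a j <= b j /\ c j <= d j) ->
  box a b c d = set0.
Proof.
move=> /existsNP[j hj]; apply/seteqP; split => // z /(_ j)[/andP[h1 h2] /andP[h3 h4]].
by apply: hj; split; [exact: le_trans h1 h2|exact: le_trans h3 h4].
Qed.

Lemma box_measure_unique (m1 m2 : {measure set Cn -> \bar R}) :
  (forall a b c d : 'I_n -> R, (forall j, a j <= b j /\ c j <= d j) ->
     m1 (box a b c d) = m2 (box a b c d)) ->
  (forall a b c d : 'I_n -> R, m1 (box a b c d) < +oo)%E ->
  forall A, measurable A -> m1 A = m2 A.
Proof.
move=> h hfin.
pose g (k : nat) : set Cn := @box R n (fun=> - k%:R) (fun=> k%:R) (fun=> - k%:R) (fun=> k%:R).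
apply: (measure_unique boxes g boxes_generate boxes_setI).
- by move=> k; do 4 eexists.
- apply/seteqP; split => // z _; exists (Num.truncn (enorm (z : V))).+1 => // j.
  have hz : enorm (z : V) <= (Num.truncn (enorm (z : V))).+1%:R by rewrite ltW// truncnS_gt.
  rewrite -!ler_norml; split; apply: le_trans (le_trans (cabs_coord z j) hz); [exact: cabs_Re|exact: cabs_Im].
- move=> _ [a [b [c [d ->]]]].
  by have [hj|hj] := pselect (forall j, a j <= b j /\ c j <= d j); [exact: h|rewrite box_empty// !measure0].
- by move=> k; exact: hfin.
Qed.

End BorelCn.

(** * Tonelli's theorem and image measures *)

Section Tonelli.
Local Open Scope ereal_scope.

(** A synonym of m that carries a proof of sigma-finiteness, so that [fubini_tonelli] applies to
    measures for which this property is a hypothesis and not an instance. *)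
Definition sfmeas d (T : measurableType d) (R : realType) (m : {measure set T -> \bar R})
  (s : sigma_finite setT m) : set T -> \bar R := m.
HB.instance Definition _ d (T : measurableType d) (R : realType)
  (m : {measure set T -> \bar R}) (s : sigma_finite setT m) := Measure.copy (sfmeas s) m.
HB.instance Definition _ d (T : measurableType d) (R : realType)
  (m : {measure set T -> \bar R}) (s : sigma_finite setT m) :=
  Measure_isSigmaFinite.Build d T R (sfmeas s) s.

Lemma tonelli d1 d2 (T1 : measurableType d1) (T2 : measurableType d2) (R : realType)
  (m1 : {measure set T1 -> \bar R}) (m2 : {measure set T2 -> \bar R}) (f : T1 * T2 -> \bar R) :
  sigma_finite setT m1 -> sigma_finite setT m2 ->
  measurable_fun [set: T1 * T2] f -> (forall x, 0 <= f x) ->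
  \int[m1]_x \int[m2]_y f (x, y) = \int[m2]_y \int[m1]_x f (x, y).
Proof.
move=> s1 s2 mf f0.
exact: (@fubini_tonelli _ _ _ _ _ (sfmeas s1) (sfmeas s2) f mf f0).
Qed.

Definition pushm d d' (T1 : measurableType d) (T2 : measurableType d') (R : realType)
  (m : {measure set T1 -> \bar R}) (f : T1 -> T2) (mf : measurable_fun [set: T1] f) :
  {measure set T2 -> \bar R} :=
  measure_function_pushforward__canonical__measure_function_Measure m mf.

Lemma pushmE d d' (T1 : measurableType d) (T2 : measurableType d') (R : realType)
  (m : {measure set T1 -> \bar R}) (f : T1 -> T2) (mf : measurable_fun [set: T1] f) A :
  pushm m mf A = m (f @^-1` A).
Proof. by []. Qed.

Lemma integral_pushm d d' (T1 : measurableType d) (T2 : measurableType d') (R : realType)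
  (m : {measure set T1 -> \bar R}) (f : T1 -> T2) (mf : measurable_fun [set: T1] f)
  (G : T2 -> \bar R) : measurable_fun setT G -> (forall x, 0 <= G x) ->
  \int[pushm m mf]_y G y = \int[m]_x G (f x).
Proof.
move=> mG G0; have := @ge0_integral_pushforward _ _ _ _ R f mf m setT G measurableT mG.
by rewrite preimage_setT => -> // y _; exact: G0.
Qed.

End Tonelli.

(** * Invariance of the volume *)

Section Volume.
Variables (R : realType) (n : nat).
Local Notation C := R[i].
Local Notation Vec := 'rV[C]_n.
Local Notation Cn := (Cn R n).
Variables (V : {measure set Cn -> \bar R}) (hV : normalized_volume V).
Local Open Scope ereal_scope.

Lemma vol_box_fin a b c d : V (box a b c d) < +oo.
Proof.
have [k [k0 [hb _]]] := hV.
have [hj|hj] := pselect (forall j, (a j <= b j /\ c j <= d j)%R).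
  by rewrite hb// ltry.
by rewrite box_empty// measure0 ltry.
Qed.

Lemma vol_sigma_finite : sigma_finite setT V.
Proof.
exists (fun k => @box R n (fun=> - k%:R)%R (fun=> k%:R)%R (fun=> - k%:R)%R (fun=> k%:R)%R).
  apply/esym/seteqP; split => // z _; exists (Num.truncn (enorm (z : Vec))).+1 => // j.
  have hz : (enorm (z : Vec) <= (Num.truncn (enorm (z : Vec))).+1%:R)%R by rewrite ltW// truncnS_gt.
  rewrite -!ler_norml; split; apply: le_trans (le_trans (cabs_coord z j) hz); [exact: cabs_Re|exact: cabs_Im].
by move=> k; split; [exact: measurable_box|exact: vol_box_fin].
Qed.

Lemma measurable_ceps_map (L : Vec -> Vec) :
  (forall j z, ceps (fun z => L z 0%R j) z) -> measurable_fun [set: Cn] (L : Cn -> Cn).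
Proof.
move=> hL; apply: measurable_Cn_fun => j.
  by apply: (ceps_measurable_ReIm (@eopen_setT R n) (fun z _ => hL j z)).1.
by apply: (ceps_measurable_ReIm (@eopen_setT R n) (fun z _ => hL j z)).2.
Qed.

Lemma lipschitz_ceps (L : Vec -> Vec) (K : R) :
  (forall z w, enorm (L w - L z) <= K * enorm (w - z))%R ->
  forall j z, ceps (fun z => L z 0%R j) z.
Proof.
move=> hL j z e e0.
have K1 : (0 < `|K| + 1)%R by rewrite ltr_wpDl.
exists (e / (`|K| + 1))%R => [|w hw]; first by rewrite divr_gt0.
have := cabs_coord (L w - L z) j; rewrite !mxE => /le_lt_trans; apply.
apply: le_lt_trans (hL z w) _; apply: (@le_lt_trans _ _ ((`|K| + 1) * enorm (w - z)))%R.
  by rewrite ler_wpM2r ?enorm_ge0// (le_trans (ler_norm _))// lerDl.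
by rewrite mulrC -ltr_pdivlMr.
Qed.

Lemma measurable_add2 : measurable_fun [set: Cn * Cn] (fun p : Cn * Cn => (p.1 : Vec) + p.2 : Cn)%R.
Proof.
apply: measurable_Cn_fun => j.
- under eq_fun do rewrite mxE cReD.
  apply: measurable_funD.
    exact: (measurableT_comp (@measurable_Re R n j) measurable_fst).
  exact: (measurableT_comp (@measurable_Re R n j) measurable_snd).
- under eq_fun do rewrite mxE cImD.
  apply: measurable_funD.
    exact: (measurableT_comp (@measurable_Im R n j) measurable_fst).
  exact: (measurableT_comp (@measurable_Im R n j) measurable_snd).
Qed.

Lemma measurable_sub2 : measurable_fun [set: Cn * Cn] (fun p : Cn * Cn => (p.1 : Vec) - p.2 : Cn)%R.
Proof.
apply: measurable_Cn_fun => j.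
- under eq_fun do rewrite !mxE cReD cReN.
  apply: measurable_funB.
    exact: (measurableT_comp (@measurable_Re R n j) measurable_fst).
  exact: (measurableT_comp (@measurable_Re R n j) measurable_snd).
- under eq_fun do rewrite !mxE cImD cImN.
  apply: measurable_funB.
    exact: (measurableT_comp (@measurable_Im R n j) measurable_fst).
  exact: (measurableT_comp (@measurable_Im R n j) measurable_snd).
Qed.

Lemma measurable_addr (a : Vec) : measurable_fun [set: Cn] (fun z : Cn => (z : Vec) + a : Cn)%R.
Proof.
apply: measurable_ceps_map; apply: (@lipschitz_ceps _ 1%R) => z w.
by rewrite mul1r opprD addrACA subrr addr0.
Qed.

Lemma measurable_scale (t : C) : measurable_fun [set: Cn] (fun z : Cn => t *: (z : Vec) : Cn)%R.
Proof.
apply: measurable_ceps_map; apply: (@lipschitz_ceps _ (cabs t)) => z w.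
by rewrite -scalerBr enormZ.
Qed.

Lemma vol_translate (a : Vec) (G : Cn -> \bar R) : measurable_fun setT G -> (forall z, 0 <= G z) ->
  \int[V]_z G ((z : Vec) + a)%R = \int[V]_z G z.
Proof.
move=> mG G0; rewrite -(integral_pushm V (measurable_addr a) mG G0).
apply: eq_measure_integral => A mA _; apply: box_measure_unique => //.
- move=> x y z t h; rewrite pushmE.
  have -> : (fun w : Cn => (w : Vec) + a)%R @^-1` box x y z t =
     box (fun j => x j - complex.Re (a 0 j))%R (fun j => y j - complex.Re (a 0 j))%R
         (fun j => z j - complex.Im (a 0 j))%R (fun j => t j - complex.Im (a 0 j))%R.
    by apply/seteqP; split => w hw j; have := hw j; rewrite /= !mxE cReD cImD !lerBlDr !lerBrDr.
  have [k [k0 [hb _]]] := hV; rewrite !hb//; last first.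
    by move=> j; have [h1 h2] := h j; rewrite !lerD2r.
  by congr (_ * _)%:E; apply: eq_bigr => j _; congr (_ * _)%R; ring.
- move=> x y z t; rewrite pushmE.
  have -> : (fun w : Cn => (w : Vec) + a)%R @^-1` box x y z t =
     box (fun j => x j - complex.Re (a 0 j))%R (fun j => y j - complex.Re (a 0 j))%R
         (fun j => z j - complex.Im (a 0 j))%R (fun j => t j - complex.Im (a 0 j))%R.
    by apply/seteqP; split => w hw j; have := hw j; rewrite /= !mxE cReD cImD !lerBlDr !lerBrDr.
  exact: vol_box_fin.
Qed.

Lemma vol_scale (t : R) (G : Cn -> \bar R) : (0 < t)%R -> measurable_fun setT G ->
  (forall z, 0 <= G z) ->
  \int[V]_z G z = (t ^+ (2 * n))%:E * \int[V]_z G ((t%:C)%C *: (z : Vec))%R.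
Proof.
move=> t0 mG G0; rewrite -(integral_pushm V (measurable_scale (t%:C)%C) mG G0).
have tn0 : (0 <= t ^+ (2 * n))%R by rewrite exprn_ge0// ltW.
rewrite -(ge0_integral_mscale _ measurableT (NngNum tn0) mG)//=.
apply/esym/eq_measure_integral => A mA _; apply: box_measure_unique => //.
- move=> x y z s h.
  transitivity ((t ^+ (2 * n))%:E * V ((fun w : Cn => (t%:C)%C *: (w : Vec))%R @^-1` box x y z s)); first by [].
  have -> : (fun w : Cn => (t%:C)%C *: (w : Vec))%R @^-1` box x y z s =
     box (fun j => x j / t)%R (fun j => y j / t)%R (fun j => z j / t)%R (fun j => s j / t)%R.
    apply/seteqP; split => w hw j; have := hw j; rewrite /= !mxE cReM cImM /= !mul0r subr0 addr0;
      by rewrite !ler_pdivrMr// !ler_pdivlMr// ![(_ * t)%R]mulrC.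
  have [k [k0 [hb _]]] := hV; rewrite !hb//; last first.
    by move=> j; have [h1 h2] := h j; rewrite !ler_pM2r ?invr_gt0.
  rewrite -EFinM; congr (_%:E); rewrite mulrCA; congr (_ * _)%R.
  have -> : (t ^+ (2 * n) = \prod_(j < n) t ^+ 2)%R by rewrite prodr_const card_ord exprM.
  rewrite -big_split /=; apply: eq_bigr => j _; field; exact: lt0r_neq0.
- move=> x y z s.
  have : (t ^+ (2 * n))%:E * V ((fun w : Cn => (t%:C)%C *: (w : Vec))%R @^-1` box x y z s) < +oo; last by [].
  have -> : (fun w : Cn => (t%:C)%C *: (w : Vec))%R @^-1` box x y z s =
     box (fun j => x j / t)%R (fun j => y j / t)%R (fun j => z j / t)%R (fun j => s j / t)%R.
    apply/seteqP; split => w hw j; have := hw j; rewrite /= !mxE cReM cImM /= !mul0r subr0 addr0;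
      by rewrite !ler_pdivrMr// !ler_pdivlMr// ![(_ * t)%R]mulrC.
  by apply: lte_mul_pinfty; rewrite ?lee_fin// vol_box_fin.
Qed.

Lemma measurable_Ball : measurable (@Ball R n : set Cn).
Proof. exact: (eopen_measurable (@eopen_Ball R n)). Qed.

(* Uniqueness of Haar measure, applied to V and to its image under L; the
   normalising constant is found by evaluating both measures on the ball. *)
Lemma vol_isometry (L L' : Vec -> Vec) (G : Cn -> \bar R) :
  (forall z w, L (z + w) = L z + L w)%R -> (forall z, enorm (L z) = enorm z) ->
  (forall z, L (L' z) = z) -> measurable_fun setT G -> (forall z, 0 <= G z) ->
  \int[V]_z G (L z) = \int[V]_z G z.
Proof.
move=> LD Liso LK mG G0.
have L0 : (L 0 = 0)%R by apply: (addrI (L 0)%R); rewrite -LD !addr0.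
have LN z : (L (- z) = - L z)%R by apply: (addrI (L z)); rewrite -LD !subrr.
have mL : measurable_fun [set: Cn] (L : Cn -> Cn).
  apply: measurable_ceps_map; apply: (@lipschitz_ceps _ 1%R) => z w.
  by rewrite mul1r -LN -LD Liso.
rewrite -(integral_pushm V mL mG G0); apply: eq_measure_integral => E mE _.
pose M := pushm V mL; rewrite -/M.
have MB : M (@Ball R n) = 1.
  rewrite pushmE; have [k [_ [_ hB]]] := hV; rewrite -hB; congr (V _).
  by apply/seteqP; split => z; rewrite /= !BallE Liso.
have VB : V (@Ball R n) = 1 by have [k [_ [_ hB]]] := hV.
have Mtr (a : Vec) (F : Cn -> \bar R) : measurable_fun setT F -> (forall z, 0 <= F z) ->
    \int[M]_z F ((z : Vec) + a)%R = \int[M]_z F z.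
  move=> mF F0; rewrite (integral_pushm V mL mF F0).
  rewrite (integral_pushm V mL (measurableT_comp mF (measurable_addr a)) (fun z => F0 _)).
  rewrite -[RHS](vol_translate (L' a) (measurableT_comp mF mL) (fun z => F0 _)).
  by apply: eq_integral => z _ /=; rewrite LD LK.
have Msf : sigma_finite setT M.
  exists (fun k => [set z : Cn | enorm (z : Vec) <= k%:R]%R).
    apply/esym/seteqP; split => // z _; exists (Num.truncn (enorm (z : Vec))).+1 => //=.
    by rewrite ltW// truncnS_gt.
  have mk k : measurable [set z : Cn | enorm (z : Vec) <= k%:R]%R.
    rewrite (_ : [set _ | _] = setT `&` (fun z : Cn => enorm (z : Vec)) @^-1` `]-oo, k%:R]); last first.
      by apply/seteqP; split => z; rewrite /= in_itv /=; [|case].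
    by apply: measurable_enorm => //; exact: measurable_itv.
  move=> k; split => //; rewrite pushmE.
  apply: (@le_lt_trans _ _ (V (@box R n (fun=> - k%:R)%R (fun=> k%:R)%R (fun=> - k%:R)%R (fun=> k%:R)%R))).
    apply: le_measure; rewrite ?inE.
    - by rewrite -[X in measurable X]setTI; apply: (mL measurableT); exact: mk.
    - exact: measurable_box.
    - move=> z /= hz j; rewrite Liso in hz.
      rewrite -!ler_norml; split; apply: le_trans (le_trans (cabs_coord z j) hz); [exact: cabs_Re|exact: cabs_Im].
  exact: vol_box_fin.
pose IB z := (\1_(@Ball R n) z : R)%:E.
pose IE z := (\1_E z : R)%:E.
have mIB : measurable_fun [set: Cn] (IB : Cn -> \bar R).
  by apply/measurable_EFinP; apply: measurable_indic; exact: measurable_Ball.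
have mIE : measurable_fun [set: Cn] (IE : Cn -> \bar R).
  by apply/measurable_EFinP; exact: measurable_indic.
have IB0 z : 0 <= IB z by rewrite lee_fin.
have IE0 z : 0 <= IE z by rewrite lee_fin.
have intIB (m : {measure set Cn -> \bar R}) : \int[m]_z IB z = m (@Ball R n).
  by rewrite integral_indic// ?setIT//; exact: measurable_Ball.
have intIE (m : {measure set Cn -> \bar R}) : \int[m]_z IE z = m E.
  by rewrite integral_indic// setIT.
(* The double integral of 1_B(y) 1_E(x + y) is M E, by translation invariance of M and V B = 1. The
   substitution of y - x for y and integration in x turn it into V E, since the ball is symmetric
   and M B = 1. *)
have e1 : \int[M]_x \int[V]_y (IB y * IE (x + y)%R) = M E.
  rewrite (@tonelli _ _ _ _ R M V (fun p => IB p.2 * IE ((p.1 : Vec) + p.2)%R))//=.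
  - transitivity (\int[V]_y (IB y * M E)).
      apply: eq_integral => y _.
      have mIEy : measurable_fun [set: Cn] (fun x : Cn => IE ((x : Vec) + y)%R).
        exact: measurableT_comp mIE (measurable_addr y).
      rewrite (ge0_integralZl M measurableT mIEy (fun x _ => IE0 _) (IB0 y)).
      by rewrite (Mtr y IE mIE IE0) intIE.
    have ME0 : 0 <= M E by exact: measure_ge0.
    by rewrite (ge0_integralZr V measurableT mIB (fun z _ => IB0 z) ME0) intIB VB mul1e.
  - exact: vol_sigma_finite.
  - apply: emeasurable_funM; first exact: measurableT_comp mIB measurable_snd.
    exact: measurableT_comp mIE measurable_add2.
  - by move=> p; rewrite mule_ge0.
rewrite -e1.
transitivity (\int[M]_x \int[V]_y (IB ((y : Vec) - x)%R * IE y)).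
  apply: eq_integral => x _.
  rewrite -[LHS](vol_translate (- (x : Vec))%R); last 2 first.
  - apply: emeasurable_funM => //.
    by under eq_fun do rewrite addrC; exact: measurableT_comp mIE (measurable_addr x).
  - by move=> y; rewrite mule_ge0.
  by apply: eq_integral => y _; rewrite [(x + _)%R]addrC subrK.
rewrite (@tonelli _ _ _ _ R M V (fun p => IB ((p.2 : Vec) - p.1)%R * IE p.2))//=; last 3 first.
- exact: vol_sigma_finite.
- apply: emeasurable_funM; last exact: measurableT_comp mIE measurable_snd.
  have msw := measurableT_comp measurable_sub2
    (measurable_fun_pair (@measurable_snd _ _ Cn Cn) (@measurable_fst _ _ Cn Cn)).
  exact: (measurableT_comp mIB msw).
- by move=> p; rewrite mule_ge0.
transitivity (\int[V]_y (1 * IE y)); last by rewrite -intIE; under eq_integral do rewrite mul1e.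
apply: eq_integral => y _.
have IBN z : IB (- z)%R = IB z.
  rewrite /IB !indicE; congr ((nat_of_bool _)%:R%:E).
  by apply/idP/idP; rewrite !inE !BallE enormN.
have mfx : measurable_fun [set: Cn] (fun x : Cn => IB ((y : Vec) - x)%R).
  under eq_fun do rewrite -IBN opprB.
  exact: measurableT_comp mIB (measurable_addr (- (y : Vec))%R).
rewrite ge0_integralZr//; congr (_ * _).
under eq_integral do rewrite -IBN opprB.
by rewrite (Mtr (- (y : Vec))%R IB mIB IB0) intIB MB.
Qed.

End Volume.

(** * Geometry of the ball *)

Section BallGeometry.
Variables (R : realType) (n : nat).
Local Notation C := R[i].
Local Notation Vec := 'rV[C]_n.
Implicit Types (z w a b y : Vec).

(* [bdef] is the defining function of the ball and [kd] its nonisotropic quasi-distance. *)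
Definition bdef z : R := 1 - sqnorm z.
Definition kd z a : R := cabs (1 - cinner z a).

Lemma kd_ge0 z a : 0 <= kd z a. Proof. exact: cabs_ge0. Qed.

Lemma kdC z a : kd z a = kd a z.
Proof. by rewrite /kd (cinnerJ a z) -(@cabsJ _ (1 - cinner a z)) rmorphB rmorph1. Qed.

Lemma bdef_gt0 z : Ball z -> 0 < bdef z.
Proof. by move=> /Ball_sqnorm h; rewrite subr_gt0. Qed.

Lemma bdef_le1 z : bdef z <= 1. Proof. by rewrite gerBl sqnorm_ge0. Qed.

Lemma bdef_enorm z : bdef z = (1 - enorm z) * (1 + enorm z).
Proof. by rewrite /bdef -enorm_sqr; ring. Qed.

Lemma kd_ge z a : 1 - enorm z * enorm a <= kd z a.
Proof.
apply: le_trans (cabs_lerB _ _); rewrite cabs1 lerD2l lerN2; exact: cabs_cinner.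
Qed.

Lemma bdef_le_kd z a : enorm z <= 1 -> enorm a <= 1 -> bdef a <= 2 * kd z a.
Proof.
move=> z1 a1; have := kd_ge z a; rewrite bdef_enorm.
have := enorm_ge0 z; have := enorm_ge0 a; nra.
Qed.

Lemma kd_le2 z a : enorm z <= 1 -> enorm a <= 1 -> kd z a <= 2.
Proof.
move=> z1 a1; apply: le_trans (cabsB _ _) _; rewrite cabs1.
have := cabs_cinner z a; have := enorm_ge0 z; have := enorm_ge0 a; nra.
Qed.

Lemma sqnormB_le_kd z a : enorm z <= 1 -> enorm a <= 1 -> sqnorm (z - a) <= 2 * kd z a.
Proof.
move=> z1 a1; rewrite sqnormB.
have h : 1 - complex.Re (cinner z a) <= kd z a.
  apply: le_trans (ler_norm _) _; apply: le_trans (cabs_Re (1 - cinner z a)).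
  by rewrite cReD cReN.
have : sqnorm z <= 1 by rewrite -enorm_sqr exprn_ile1 ?enorm_ge0.
have : sqnorm a <= 1 by rewrite -enorm_sqr exprn_ile1 ?enorm_ge0.
rewrite mulr2n; lra.
Qed.

(** Expansion around a: the terms beyond [kd z a] and [kd a w] are [bdef a] and <z - a, w - a>. Each
    of them is at most kd z a + kd a w, by [bdef_le_kd] and [sqnormB_le_kd], whence the factor 3. *)
Lemma kd_triangle z a w : enorm z <= 1 -> enorm a <= 1 -> enorm w <= 1 ->
  kd z w <= 3 * (kd z a + kd a w).
Proof.
move=> z1 a1 w1; rewrite {1}/kd.
have -> : 1 - cinner z w = (1 - cinner z a) + (1 - cinner a w) - (bdef a)%:C%C - cinner (z - a) (w - a).
  rewrite !cinnerDl !cinnerDr !cinnerNl !cinnerNr rmorphB /= sqnormE; ring.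
apply: le_trans (cabsB _ _) _; apply: le_trans (lerD (cabsB _ _) (cabs_cinner _ _)) _.
rewrite cabsR ger0_norm; last by rewrite subr_ge0 -enorm_sqr exprn_ile1 ?enorm_ge0.
have h1 := sqnormB_le_kd z1 a1; have h2 := sqnormB_le_kd w1 a1.
have h3 := bdef_le_kd z1 a1; have h4 := bdef_le_kd w1 a1; rewrite [kd w a]kdC in h2 h4.
rewrite -!enorm_sqr in h1 h2.
have := cabsD (1 - cinner z a) (1 - cinner a w); rewrite -/(kd z a) -/(kd a w).
have := sqr_ge0 (enorm (z - a) - enorm (w - a)).
move: h1 h2 h3 h4; move: (enorm (z - a)) (enorm (w - a)) => s t; nra.
Qed.

Lemma one_sub_sqnorm z : 1 - (sqnorm z)%:C%C = (bdef z)%:C%C :> C.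
Proof. by rewrite rmorphB. Qed.

Lemma kd_diag z : 0 <= bdef z -> kd z z = bdef z.
Proof. by move=> z0; rewrite /kd -sqnormE one_sub_sqnorm cabsR ger0_norm. Qed.

Lemma kd_gt0 z a : Ball z -> Ball a -> 0 < kd z a.
Proof.
move=> Bz Ba; have := @bdef_le_kd z a (ltW Bz) (ltW Ba); have := bdef_gt0 Ba.
move: (bdef a) (kd z a) => s t; lra.
Qed.

Lemma bdefD a y : bdef (a + y) = bdef a - 2 * complex.Re (cinner y a) - sqnorm y.
Proof. rewrite /bdef sqnormD (_ : complex.Re (cinner a y) = complex.Re (cinner y a)); last first.
  by rewrite (cinnerJ y a) /conjc; case: (cinner y a).
by rewrite mulr_natl !opprD !addrA. Qed.

(** A quantitative form of pseudohyperbolic proximity, in which distances compose up to constants: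
    [kd] is compared with [bdef] at both points, in view of the identity [pseudohyp_kd]. *)
Definition bnear (M : R) z a := kd z a <= M * bdef z /\ kd z a <= M * bdef a.

Lemma bnearC M z a : bnear M z a -> bnear M a z.
Proof. by move=> [h1 h2]; split; rewrite kdC. Qed.

Lemma bnear_refl M z : Ball z -> 1 <= M -> bnear M z z.
Proof.
move=> Bz M1; have h := bdef_gt0 Bz.
by rewrite /bnear kd_diag ?(ltW h)//; split; rewrite ler_peMl// ltW.
Qed.

Lemma bnear_le M N z a : Ball z -> Ball a -> M <= N -> bnear M z a -> bnear N z a.
Proof.
move=> /bdef_gt0 hz /bdef_gt0 ha MN [h1 h2]; split.
  by apply: le_trans h1 _; rewrite ler_pM2r.
by apply: le_trans h2 _; rewrite ler_pM2r.
Qed.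

Lemma bnear_bdef M z a : Ball z -> Ball a -> bnear M z a -> bdef a <= 2 * M * bdef z.
Proof.
move=> Bz Ba [h1 _]; have := @bdef_le_kd z a (ltW Bz) (ltW Ba); rewrite -mulrA; lra.
Qed.

Lemma bnear_trans M N z a w : 0 <= M -> 0 <= N -> Ball z -> Ball a -> Ball w ->
  bnear M z a -> bnear N a w -> bnear (6 * (M + N) ^+ 2) z w.
Proof.
move=> M0 N0 Bz Ba Bw za aw.
have h := @kd_triangle z a w (ltW Bz) (ltW Ba) (ltW Bw).
have h1 := bnear_bdef Bz Ba za; have h2 := bnear_bdef Bw Ba (bnearC aw).
have z0 := bdef_gt0 Bz; have a0 := bdef_gt0 Ba; have w0 := bdef_gt0 Bw.
case: za aw => za1 za2 [aw1 aw2].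
have h3 : kd z w <= 3 * (M + N) * bdef a by lra.
split.
  apply: le_trans h3 _; apply: (@le_trans _ _ (3 * (M + N) * (2 * M * bdef z))).
    by rewrite ler_wpM2l// mulr_ge0// addr_ge0.
  have := mulr_ge0 N0 (ltW z0); have := mulr_ge0 M0 (ltW z0); rewrite expr2; nra.
apply: le_trans h3 _; apply: (@le_trans _ _ (3 * (M + N) * (2 * N * bdef w))).
  by rewrite ler_wpM2l// mulr_ge0// addr_ge0.
have := mulr_ge0 N0 (ltW w0); have := mulr_ge0 M0 (ltW w0); rewrite expr2; nra.
Qed.

(* Polydisc-like neighbourhoods, of size [bdef a] in the direction of a and of
   size [sqrt (bdef a)] in the complex tangential directions. *)
Definition Qset a : set Vec := [set y | cabs (cinner y a) <= bdef a / 16 /\ sqnorm y <= bdef a / 16].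

(** The bound 2 on |l| exceeds the radius 9/5 of [hol2], so the one-variable estimates apply along
    the complex line through a in the direction y. *)
Lemma Qset_Ball a y (l : C) : Ball a -> Qset a y -> cabs l <= 2 ->
  Ball (a + l *: y) /\ bnear 4 (a + l *: y) a.
Proof.
move=> Ba [h1 h2] l2; have a0 := bdef_gt0 Ba.
have h3 : cabs (cinner (l *: y) a) <= bdef a / 8.
  by rewrite cinnerZl cabsM; have := cabs_ge0 (cinner y a); have := cabs_ge0 l; nra.
have h4 : sqnorm (l *: y) <= bdef a / 4.
  rewrite sqnormZ; have : cabs l ^+ 2 <= 4 by have := cabs_ge0 l; nra.
  have := sqnorm_ge0 y; have := sqr_ge0 (cabs l); nra.
have h5 : bdef a / 2 <= bdef (a + l *: y).
  rewrite bdefD; have := le_trans (le_trans (ler_norm _) (cabs_Re _)) h3.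
  move: h4 a0; move: (bdef a) (complex.Re _) (sqnorm _) => s t u' h4 a0 h3'; lra.
have h6 : kd (a + l *: y) a <= 2 * bdef a.
  rewrite /kd cinnerDl -sqnormE opprD addrA one_sub_sqnorm.
  by apply: le_trans (cabsB _ _) _; rewrite cabsR gtr0_norm//; move: h3 a0; move: (bdef a) (cabs _) => s t; lra.
split; first by apply/Ball_sqnorm; move: h5 a0; rewrite /bdef; lra.
by split; lra.
Qed.

(** With y = b - a, the numerator of the automorphism is -(P y + s Q y), a sum of orthogonal
    vectors. The formula involves no division by |a|, hence no special role of a = 0. *)
Lemma pseudohyp_sqr a b : Ball a -> Ball b ->
  (pseudohyp a b * kd b a) ^+ 2 = cabs (cinner (b - a) a) ^+ 2 + bdef a * sqnorm (b - a).
Proof.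
move=> Ba Bb.
have k0 : kd b a != 0.
  by rewrite gt_eqF// kd_gt0.
rewrite /pseudohyp /ball_aut enormZ cabsV -/(kd b a) mulrAC mulVf// mul1r enorm_sqr.
have [y yE] : exists y, y = b - a by exists (b - a).
pose s := Num.sqrt (1 - sqnorm a).
have s2 : s ^+ 2 = bdef a by rewrite sqr_sqrtr// ltW// bdef_gt0.
have PaD x x' : Pa a (x + x') = Pa a x + Pa a x' by rewrite /Pa cinnerDl mulrDl scalerDl.
have Paa : Pa a a = a.
  rewrite /Pa; have [->|a0] := eqVneq a 0; first by rewrite scaler0.
  rewrite divff ?scale1r// -sqnormE (inj_eq (@complexI _)).
  by apply: contra a0 => /eqP/sqnorm0_eq ->.
have PaE : b = a + y by rewrite yE addrC subrK.
have -> : a - Pa a b - (s%:C)%C *: Qa a b = - (Pa a y + (s%:C)%C *: (y - Pa a y)).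
  rewrite /Qa PaE !PaD Paa opprD addrA subrr add0r opprD.
  by congr (_ - _ *: _); rewrite addrA [a + y]addrC addrK.
rewrite sqnormN sqnormD cinnerZr (sqnormZ (s%:C)%C) cabsR.
have orth : cinner (Pa a y) (y - Pa a y) = 0.
  rewrite cinnerDr cinnerNr /Pa cinnerZl cinnerZr !cinnerZl.
  have [->|a0] := eqVneq a 0; first by rewrite !(cinner0l, cinner0r) !mulr0 subrr.
  rewrite -sqnormE; have S0 : ((sqnorm a)%:C)%C != 0 :> C.
    by rewrite (inj_eq (@complexI _)); apply: contra a0 => /eqP/sqnorm0_eq ->.
  have SV : ((sqnorm a)%:C)%C^-1 = ((sqnorm a)^-1%:C)%C :> C by rewrite fmorphV.
  have cS : (((sqnorm a)%:C)%C^-1^*)%C = ((sqnorm a)%:C)%C^-1.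
    by rewrite SV; apply/eqP; rewrite eq_complex /= oppr0 !eqxx.
  have cE : ((cinner y a / ((sqnorm a)%:C)%C)^*)%C = cinner a y / ((sqnorm a)%:C)%C.
    by rewrite rmorphM (cinnerJ y a); congr (_ * _); exact: cS.
  by rewrite cE divfK// mulrAC [X in X * _]mulrC mulrAC subrr.
have Pyn : sqnorm a * sqnorm (Pa a y) = cabs (cinner y a) ^+ 2.
  rewrite /Pa sqnormZ; have [->|a0] := eqVneq a 0.
    by rewrite sqnorm0 cinner0r cabs0 !mul0r expr0n.
  rewrite -sqnormE cabsM cabsV cabsR ger0_norm ?sqnorm_ge0//.
  by field; apply: contra a0 => /eqP/sqnorm0_eq ->.
have Qn : sqnorm y = sqnorm (Pa a y) + sqnorm (y - Pa a y).
  rewrite (_ : sqnorm y = sqnorm (Pa a y + (y - Pa a y))); last by rewrite addrC subrK.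
  by rewrite (sqnormD (Pa a y) (y - Pa a y)) orth /= mul0rn addr0.
rewrite orth mulr0 mul0rn addr0 -yE -Pyn Qn ger0_norm ?sqrtr_ge0// s2 /bdef; ring.
Qed.

(** The classical formula for 1 - |phi_a(b)|^2, cleared of its denominator. The symmetry of the
    distance, its comparison with [bnear] and its measurability are read off from it. *)
Lemma pseudohyp_kd a b : Ball a -> Ball b ->
  (1 - pseudohyp a b ^+ 2) * kd b a ^+ 2 = bdef a * bdef b.
Proof.
move=> Ba Bb; rewrite mulrBl mul1r -exprMn pseudohyp_sqr//.
have bE : b = a + (b - a) by rewrite addrC subrK.
have -> : kd b a ^+ 2 = (bdef a - complex.Re (cinner (b - a) a)) ^+ 2 + complex.Im (cinner (b - a) a) ^+ 2.
  rewrite /kd cabs_sqr {1 2}bE cinnerDl -sqnormE !cReD !cImD !cReN !cImN !cReD !cImD /=.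
  by rewrite /bdef; ring.
rewrite (_ : bdef b = bdef (a + (b - a))); last by rewrite -bE.
by rewrite bdefD cabs_sqr; ring.
Qed.

Lemma pseudohyp_ge0 a b : 0 <= pseudohyp a b. Proof. exact: enorm_ge0. Qed.

Lemma pseudohypC a b : Ball a -> Ball b -> pseudohyp a b = pseudohyp b a.
Proof.
move=> Ba Bb; have h1 := pseudohyp_kd Ba Bb; have h2 := pseudohyp_kd Bb Ba.
have k0 := kd_gt0 Bb Ba.
have e : (1 - pseudohyp a b ^+ 2) = (1 - pseudohyp b a ^+ 2).
  apply: (mulIf (lt0r_neq0 (exprn_gt0 2 k0))).
  by apply: etrans h1 _; apply: etrans (mulrC _ _) _; rewrite [kd b a]kdC.
move: e (pseudohyp_ge0 a b) (pseudohyp_ge0 b a); move: (pseudohyp a b) (pseudohyp b a) => s t e s0 t0.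
by apply/eqP; rewrite -(@eqrXn2 _ 2)//; apply/eqP; move: e; clear; lra.
Qed.

Lemma pseudohyp_bnear a b (r : R) : 0 < r -> r < 1 -> Ball a -> Ball b -> pseudohyp a b < r ->
  bnear (2 / (1 - r ^+ 2)) b a.
Proof.
move=> r0 r1 Ba Bb hr; have h := pseudohyp_kd Ba Bb.
have p0 := pseudohyp_ge0 a b.
have r2 : 0 < 1 - r ^+ 2 by rewrite subr_gt0 exprn_ilt1// ltW.
have k0 := kd_gt0 Bb Ba.
have h1 : (1 - r ^+ 2) * kd b a ^+ 2 <= bdef a * bdef b.
  by rewrite -h ler_pM2r ?exprn_gt0// lerD2l lerN2 ler_sqr ?nnegrE ?(ltW r0)// ltW.
have h2 := @bdef_le_kd b a (ltW Bb) (ltW Ba).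
have h3 := @bdef_le_kd a b (ltW Ba) (ltW Bb); rewrite kdC in h3.
have a0 := bdef_gt0 Ba; have b0 := bdef_gt0 Bb.
move: h1 h2 h3 k0 a0 b0; rewrite /bnear; move: (kd b a) (bdef a) (bdef b) => k s t h1 h2 h3 k0 s0 t0.
have e1 : s * t <= 2 * k * t by rewrite ler_pM2r.
have e2 : s * t <= 2 * k * s by rewrite mulrC ler_pM2r.
split; rewrite mulrAC ler_pdivlMr// -(ler_pM2r k0) [k * _]mulrC -mulrA -expr2.
  by apply: le_trans h1 _; apply: le_trans e1 _; rewrite mulrAC.
by apply: le_trans h1 _; apply: le_trans e2 _; rewrite mulrAC.
Qed.

(** Large enough both for the neighbourhoods of [Qset_Ball], which need 4, and for the
    pseudohyperbolic ball of radius r, which needs 2 / (1 - r^2). *)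
Definition lipM (r : R) : R := 4 + 2 / (1 - r ^+ 2).

Lemma lipM_ge4 (r : R) : 0 < r -> r < 1 -> 4 <= lipM r.
Proof.
move=> r0 r1; rewrite /lipM lerDl divr_ge0// subr_ge0 exprn_ile1// ltW//.
Qed.

Lemma hol_line_cdiff (f : Vec -> C) z y s : holomorphic_on (@Ball R n) f -> Ball (z + s *: y) ->
  cdiff (fun s => f (z + s *: y)) s.
Proof.
move=> hf Bs; have [l hl] := holomorphic_line (@eopen_Ball R n) hf y Bs.
exists l => e /hl[d d0 hd]; exists d => // h /hd; rewrite !add0r scale0r addr0.
by rewrite scalerDl addrA.
Qed.

(** Schwarz's estimate on the complex line through a and b. The step y = (b - a) / t lies in
    [Qset a] for t = 16 M p, with p the pseudohyperbolic distance; 160 is 10 times 16. *)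
Lemma pseudohyp_lipschitz (f : Vec -> C) a b (r S : R) : holomorphic_on (@Ball R n) f ->
  0 < r -> r < 1 -> Ball a -> Ball b -> pseudohyp a b < r ->
  (forall w, Ball w -> bnear (lipM r) w a -> cabs (f w) <= S) ->
  cabs (f b - f a) <= 160 * lipM r * pseudohyp a b * S.
Proof.
move=> hf r0 r1 Ba Bb hr hS.
have M4 := lipM_ge4 r0 r1; set M := lipM r in M4 hS *.
have S0 : 0 <= S by apply: le_trans (hS a Ba (bnear_refl Ba _)); rewrite ?cabs_ge0//; lra.
have p0 := pseudohyp_ge0 a b; set p := pseudohyp a b in hr p0 *.
have r2 : 0 < 1 - r ^+ 2 by rewrite subr_gt0 exprn_ilt1// ltW.
have nb : bnear M b a.
  apply: bnear_le (pseudohyp_bnear r0 r1 Ba Bb hr) => //.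
  by rewrite /M /lipM lerDr.
(* If 16 M p exceeds 1 the trivial bound 2 S is enough; otherwise it is an admissible parameter in
   [schwarz1]. *)
have [pM|pM] := leP (16 * M * p) 1; last first.
  apply: le_trans (cabsB _ _) _.
  apply: le_trans (lerD (hS b Bb nb) (hS a Ba (bnear_refl Ba _))) _; first lra.
  have : S <= 16 * M * p * S by rewrite ler_peMl// ltW.
  lra.
have [p00|pn0] := eqVneq p 0.
  have := pseudohyp_sqr Ba Bb; rewrite -/p p00 mul0r expr0n /=.
  move=> /esym/eqP; rewrite paddr_eq0 ?sqr_ge0 ?mulr_ge0 ?sqnorm_ge0 ?(ltW (bdef_gt0 Ba))//.
  move=> /andP[_]; rewrite mulf_eq0 (gt_eqF (bdef_gt0 Ba)) /= => /eqP/sqnorm0_eq/eqP.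
  rewrite subr_eq0 => /eqP ->; by rewrite subrr cabs0 mulr0 mul0r.
have pp : 0 < p by rewrite lt_def pn0.
pose t := 16 * M * p.
have t0 : 0 < t by rewrite /t !mulr_gt0//; lra.
have tC0 : (t%:C)%C != 0 :> C by rewrite (inj_eq (@complexI _)) gt_eqF.
pose y := (t%:C)%C^-1 *: (b - a).
have a0 := bdef_gt0 Ba.
have kM : kd b a <= M * bdef a by case: nb.
have hsq := pseudohyp_sqr Ba Bb; rewrite -/p in hsq.
have pMa : 0 <= p * (M * bdef a) by rewrite !mulr_ge0 ?(ltW a0)//; lra.
have pk : (p * kd b a) ^+ 2 <= (p * (M * bdef a)) ^+ 2.
  by rewrite lerXn2r ?nnegrE// ?(mulr_ge0 p0) ?kd_ge0// ler_pM2l.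
have Qy : Qset a y.
  split.
    rewrite /y cinnerZl cabsM cabsV cabsR gtr0_norm// mulrC ler_pdivrMr//.
    have : cabs (cinner (b - a) a) <= p * (M * bdef a).
      rewrite -(@ler_pXn2r _ 2)// ?nnegrE ?cabs_ge0//.
      apply: le_trans pk; rewrite hsq lerDl mulr_ge0 ?sqnorm_ge0//; exact: ltW.
    by rewrite /t; lra.
  rewrite /y sqnormZ cabsV cabsR gtr0_norm// exprVn mulrC ler_pdivrMr ?exprn_gt0//.
  have : bdef a * sqnorm (b - a) <= (p * (M * bdef a)) ^+ 2.
    by apply: le_trans pk; rewrite hsq lerDr sqr_ge0.
  rewrite (_ : (p * _) ^+ 2 = bdef a * ((p * M) ^+ 2 * bdef a)); last by ring.
  rewrite ler_pM2l// => /le_trans; apply.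
  rewrite /t (_ : _ * (16 * M * p) ^+ 2 = 16 * ((p * M) ^+ 2 * bdef a)); last by field.
  by rewrite ler_peMl// ?mulr_ge0 ?sqr_ge0 ?(ltW a0)//; lra.
pose g (s : C) := f (a + s *: y).
have gh : hol2 g.
  move=> s hs; have s2 : cabs s <= 2 by apply: le_trans hs _; lra.
  have [Bs _] := Qset_Ball Ba Qy s2.
  exact: hol_line_cdiff.
have gS s : cabs s <= 9 / 5 -> cabs (g s) <= S.
  move=> hs; have s2 : cabs s <= 2 by apply: le_trans hs _; lra.
  have [Bs ns] := Qset_Ball Ba Qy s2.
  by apply: hS => //; apply: bnear_le ns.
have := schwarz1 gh gS (z := (t%:C)%C); rewrite cabsR gtr0_norm// => /(_ pM).
have -> : g (t%:C)%C = f b by rewrite /g /y scalerA divff// scale1r addrC subrK.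
rewrite /g scale0r addr0.
by move=> /le_trans; apply; rewrite /t; lra.
Qed.

End BallGeometry.

(** * Householder coordinates and volumes of nonisotropic sets *)

Section BallVolumes.
Variables (R : realType) (n : nat).
Local Notation C := R[i].
Local Notation Vec := 'rV[C]_n.
Local Notation Cn := (Cn R n).
Implicit Types (z w a y : Vec).

Lemma conjcMR (c : C) (k : R) : ((c * (k%:C)%C)^* = c^* * (k%:C)%C)%C.
Proof. by case: c => x y; apply/eqP; rewrite eq_complex /=; apply/andP; split; apply/eqP; ring. Qed.

Lemma cinner_delta y (c : C) j : cinner y (c *: delta_mx 0 j) = (c^*)%C * y 0 j.
Proof.
rewrite /cinner (bigD1 j)//= big1 ?addr0.
  by rewrite !mxE !eqxx mulr1 mulrC.
by move=> i ij; rewrite !mxE (negbTE ij) andbF mulr0 conjc0 mulr0.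
Qed.

(* A Householder reflection carries a to a multiple of the basis vector j. *)
Lemma householder (j : 'I_n) a : exists L : Vec -> Vec,
  [/\ forall z w, L (z + w) = L z + L w, forall z, enorm (L z) = enorm z,
      forall z, L (L z) = z &
      exists2 g : C, cabs g = enorm a & forall y, cinner y a = g * L y 0 j].
Proof.
have [->|a0] := eqVneq a 0.
  by exists id; split=> //; exists 0; [rewrite cabs0 enorm0|move=> y; rewrite cinner0r mul0r].
have ea0 : 0 < enorm a.
  rewrite lt_def enorm_ge0 andbT; apply: contra a0 => /eqP h.
  by apply/eqP/sqnorm0_eq; rewrite -enorm_sqr h expr0n.
(* The phase of c makes conj(c) a_j real and nonpositive, which keeps v = a - e away from 0: |v|^2 =
   2 (|a|^2 + m). *)
have [c [ca [m m0 hm]]] : exists c : C, cabs c = enorm a /\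
    exists2 m : R, 0 <= m & (c^*)%C * a 0 j = ((- m)%:C)%C.
  have [aj|aj] := eqVneq (a 0 j) 0.
    exists ((enorm a)%:C)%C; split; first by rewrite cabsR ger0_norm ?enorm_ge0.
    by exists 0; rewrite // aj mulr0 oppr0.
  have aj0 : 0 < cabs (a 0 j).
    by rewrite lt_def cabs_ge0 andbT; apply: contra aj => /eqP/cabs0_eq ->.
  pose k := - (enorm a / cabs (a 0 j)).
  exists (a 0 j * (k%:C)%C); split.
    by rewrite cabsM cabsR normrN ger0_norm ?divr_ge0 ?ltW// mulrC divfK// gt_eqF.
  exists (enorm a * cabs (a 0 j)); first by rewrite mulr_ge0 ?ltW.
  rewrite conjcMR mulrAC [_ * a 0 j]mulrC -cabs_sqrC -rmorphM /k; congr (_%:C)%C.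
  by field; rewrite gt_eqF.
pose e : Vec := c *: delta_mx 0 j.
have ye y : cinner y e = (c^*)%C * y 0 j by exact: cinner_delta.
have se : sqnorm e = sqnorm a by rewrite sqnormZ -(enorm_sqr (delta_mx 0 j)) enorm_delta expr1n mulr1 ca enorm_sqr.
pose v := a - e; pose S := sqnorm v.
have vv : (S%:C)%C = ((2 * (sqnorm a + m))%:C)%C :> C.
  rewrite /S sqnormE /v !cinnerDl !cinnerDr !cinnerNl !cinnerNr -!sqnormE se.
  rewrite (cinnerJ a e) ye hm; apply/eqP; rewrite eq_complex /=.
  by apply/andP; split; apply/eqP; ring.
have S0 : 0 < S.
  move/(@complexI R): vv => ->; rewrite mulr_gt0// ltr_wpDr// -enorm_sqr exprn_gt0//.
pose k := 2 / S.
pose L y := y - (cinner y v * (k%:C)%C) *: v.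
have kS : (k%:C)%C * (S%:C)%C = 2 :> C.
  by rewrite -rmorphM /k divfK ?gt_eqF// rmorph_nat.
have Lv y : cinner (L y) v = - cinner y v.
  rewrite /L cinnerDl cinnerNl cinnerZl -sqnormE -mulrA kS; ring.
have LL z : L (L z) = z.
  by rewrite {1}/L Lv mulNr scaleNr opprK /L subrK.
have Liso y z : cinner (L y) (L z) = cinner y z.
  have h y' : cinner y' (L z) = cinner y' z - ((cinner z v * (k%:C)%C)^*)%C * cinner y' v.
    by rewrite /L cinnerDr cinnerNr cinnerZr.
  have hc : ((cinner z v * (k%:C)%C)^*)%C = cinner v z * (k%:C)%C by rewrite conjcMR (cinnerJ z v).
  rewrite h hc Lv /L cinnerDl cinnerNl cinnerZl; ring.
exists L; split=> //.
- by move=> z w; rewrite /L cinnerDl mulrDl scalerDl opprD addrACA.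
- by move=> z; rewrite /enorm !sqnormER Liso.
exists (c^*)%C; first by rewrite cabsJ.
move=> y; rewrite -ye /L cinnerDl cinnerNl cinnerZl.
have -> : cinner v e = - ((2^-1)%:C)%C * (S%:C)%C.
  rewrite vv /v cinnerDl cinnerNl -sqnormE se ye hm -rmorphN -rmorphN -rmorphD -rmorphM.
  by congr (_%:C)%C; field.
have h2 : ((2^-1)%:C)%C * 2 = 1 :> C.
  by rewrite -(rmorph_nat (real_complex R)) -rmorphM mulVf// rmorph1.
have -> : cinner y v * (k%:C)%C * (- ((2^-1)%:C)%C * (S%:C)%C) =
    - (cinner y v * ((2^-1)%:C)%C * ((k%:C)%C * (S%:C)%C)) by ring.
by rewrite kS -mulrA h2 mulr1 opprK /v cinnerDr cinnerNr addrC subrK.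
Qed.

Lemma sqnorm_two z (i j : 'I_n) : i != j -> cabs (z 0 i) ^+ 2 + cabs (z 0 j) ^+ 2 <= sqnorm z.
Proof.
move=> ij; rewrite /sqnorm (bigD1 i)//= (bigD1 j) /=; last by rewrite eq_sym.
by rewrite addrA lerDl sumr_ge0// => l _; rewrite sqr_ge0.
Qed.

Lemma measurable_cabs_cinner a : measurable_fun [set: Cn] (fun z : Cn => cabs (cinner (z : Vec) a)).
Proof.
apply: ceps_measurable; first exact: eopen_setT.
move=> z _ e e0; exists (e / (enorm a + 1)) => [|w]; first by rewrite divr_gt0// ltr_wpDl ?enorm_ge0.
rewrite ltr_pdivlMr ?ltr_wpDl ?enorm_ge0// => h.
apply: (@le_lt_trans _ _ (enorm (w - z) * enorm a)).
  apply: le_trans (cabs_cinner _ _); rewrite cinnerDl cinnerNl ler_norml cabs_lerB andbT.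
  by have := cabs_lerB (cinner z a) (cinner w a); rewrite cabs_distC; lra.
by apply: le_lt_trans h; rewrite ler_wpM2l ?enorm_ge0// lerDl.
Qed.

Lemma measurable_kd a : measurable_fun [set: Cn] (fun z : Cn => kd (z : Vec) a).
Proof.
apply: ceps_measurable; first exact: eopen_setT.
move=> z _ e e0; exists (e / (enorm a + 1)) => [|w]; first by rewrite divr_gt0// ltr_wpDl ?enorm_ge0.
rewrite ltr_pdivlMr ?ltr_wpDl ?enorm_ge0// => h.
apply: (@le_lt_trans _ _ (enorm (z - w) * enorm a)).
  apply: le_trans (cabs_cinner _ _); rewrite cinnerDl cinnerNl.
  have -> : cinner z a - cinner w a = (1 - cinner w a) - (1 - cinner z a) by ring.
  rewrite ler_norml cabs_lerB andbT.
  by have := cabs_lerB (1 - cinner z a) (1 - cinner w a); rewrite cabs_distC /kd; lra.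
by rewrite -opprB enormN; apply: le_lt_trans h; rewrite ler_wpM2l ?enorm_ge0// lerDl.
Qed.

Lemma measurable_le_set (g : Cn -> R) (c : R) : measurable_fun setT g -> measurable [set z | g z <= c].
Proof.
move=> mg; rewrite (_ : [set _ | _] = setT `&` g @^-1` `]-oo, c]); first exact: mg.
by apply/seteqP; split => z; rewrite /= in_itv /=; [|case].
Qed.

Lemma measurable_Qset a : measurable (Qset a : set Cn).
Proof.
rewrite (_ : (Qset a : set Cn) = [set z : Cn | cabs (cinner (z : Vec) a) <= bdef a / 16] `&`
    [set z : Cn | enorm (z : Vec) <= Num.sqrt (bdef a / 16)] `&`
    [set z : Cn | 0 <= bdef a / 16]); last first.
  apply/seteqP; split => z /=.
    move=> [h1 h2]; have p : 0 <= bdef a / 16 by apply: le_trans h2; exact: sqnorm_ge0.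
    by split=> //; split=> //; rewrite /enorm ler_sqrt.
  by move=> [[h1 h2] p]; split=> //; move: h2; rewrite /enorm ler_sqrt.
apply: measurableI; last exact: measurable_le_set (measurable_cst _).
apply: measurableI; first exact: measurable_le_set (measurable_cabs_cinner a).
exact: measurable_le_set (@measurable_enorm R n).
Qed.

(** The nonisotropic ball around a, truncated beyond the unit sphere: the polar estimate uses it on
    the shell 1 <= |z| <= 1 + rho. *)
Definition Kset a (rho : R) := [set z | kd z a <= rho /\ enorm z <= 1 + rho].

Lemma measurable_Kset a rho : measurable (Kset a rho : set Cn).
Proof.
apply: (@measurableI _ _ [set z : Cn | kd (z : Vec) a <= rho] [set z : Cn | enorm (z : Vec) <= 1 + rho]).
  exact: measurable_le_set (measurable_kd a).
exact: measurable_le_set (@measurable_enorm R n).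
Qed.

Variables (V : {measure set Cn -> \bar R}) (hV : normalized_volume V).

Lemma vol_isometry_set (L L' : Vec -> Vec) (A : set Cn) :
  (forall z w, L (z + w) = L z + L w) -> (forall z, enorm (L z) = enorm z) ->
  (forall z, L (L' z) = z) -> measurable A -> measurable ((L : Cn -> Cn) @^-1` A) ->
  V ((L : Cn -> Cn) @^-1` A) = V A.
Proof.
move=> LD Liso LK mA mLA.
have mI : measurable_fun [set: Cn] (fun z => (\1_A z : R)%:E).
  by apply/measurable_EFinP; exact: measurable_indic.
have I0 (z : Cn) : (0 <= (\1_A z : R)%:E)%E by rewrite lee_fin.
have := vol_isometry hV LD Liso LK mI I0; rewrite [RHS]integral_indic// setIT => <-.
transitivity (\int[V]_z (\1_((L : Cn -> Cn) @^-1` A) z : R)%:E)%E; first by rewrite integral_indic// setIT.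
by apply: eq_integral => z _; rewrite !indicE; congr ((nat_of_bool _)%:R%:E).
Qed.

Lemma isometry_measurable (L : Vec -> Vec) : (forall z w, L (z + w) = L z + L w) ->
  (forall z, enorm (L z) = enorm z) -> measurable_fun [set: Cn] (L : Cn -> Cn).
Proof.
move=> LD Liso.
have L0 : L 0 = 0 by apply: (addrI (L 0)); rewrite -LD !addr0.
have LN z : L (- z) = - L z by apply: (addrI (L z)); rewrite -LD !subrr.
by apply: measurable_ceps_map; apply: (@lipschitz_ceps _ _ _ 1) => z w; rewrite mul1r -LN -LD Liso.
Qed.

Lemma vol_isometry_box (L : Vec -> Vec) (a b c d : 'I_n -> R) : (forall z w, L (z + w) = L z + L w) ->
  (forall z, enorm (L z) = enorm z) -> (forall z, L (L z) = z) ->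
  measurable ((L : Cn -> Cn) @^-1` box a b c d) /\
  V ((L : Cn -> Cn) @^-1` box a b c d) = V (box a b c d).
Proof.
move=> LD Liso LK.
have m : measurable ((L : Cn -> Cn) @^-1` box a b c d).
  by rewrite -[X in measurable X]setTI; apply: (isometry_measurable LD Liso) => //; exact: measurable_box.
by split=> //; apply: vol_isometry_set LK _ m => //; exact: measurable_box.
Qed.

Lemma prod_except (j : 'I_n) (x y : R) :
  \prod_(i < n) (if i == j then x else y) = x * y ^+ n.-1.
Proof.
rewrite (bigD1 j)//= eqxx; congr (_ * _).
rewrite (eq_bigr (fun=> y)); last by move=> i /negbTE ->.
by rewrite prodr_const; congr (_ ^+ _); have := cardC1 j; rewrite card_ord => <-; apply: eq_card.
Qed.

(** With x = bdef a and in coordinates adapted to a, [Qset a] contains a box of half-side x / 32 in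
    one complex direction and sqrt x / (16 n) in the n - 1 others. *)
Lemma vol_Qset : (0 < n)%N -> exists2 k : R, 0 < k & forall a, Ball a ->
  ((k * bdef a ^+ n.+1)%:E <= V (Qset a))%E.
Proof.
move=> n0; pose j := Ordinal n0.
have [c [c0 [hb _]]] := hV.
have nn : 0 < n%:R :> R by rewrite ltr0n.
exists (c * (256^-1 * (64 * n%:R ^+ 2)^-1 ^+ n.-1)) => [|a Ba].
  rewrite !mulr_gt0 ?invr_gt0 ?ltr0n ?exprn_gt0 ?invr_gt0// mulr_gt0 ?ltr0n ?exprn_gt0//.
have x0 := bdef_gt0 Ba; have x1 := bdef_le1 a; set x := bdef a in x0 x1 *.
have [L [LD Liso LK [g ga hg]]] := householder j a.
pose s (i : 'I_n) := if i == j then x / 32 else Num.sqrt x / (16 * n%:R).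
have s0 i : 0 < s i by rewrite /s; case: ifP => _; rewrite divr_gt0// ?sqrtr_gt0// mulr_gt0.
have [mLb vLb] := @vol_isometry_box L (fun i => - s i) s (fun i => - s i) s LD Liso LK.
have -> : (c * (256^-1 * (64 * n%:R ^+ 2)^-1 ^+ n.-1) * x ^+ n.+1)%:E =
    V ((L : Cn -> Cn) @^-1` box (fun i => - s i) s (fun i => - s i) s).
  rewrite vLb hb => [|i]; last by have := s0 i; split; lra.
  congr (_%:E); rewrite -!mulrA; congr (_ * _).
  rewrite (eq_bigr (fun i => if i == j then (x / 16) ^+ 2 else x / (64 * n%:R ^+ 2))); last first.
    move=> i _; rewrite /s; case: ifP => _; first by field.
    move: (sqr_sqrtr (ltW x0)); move: (Num.sqrt x) => t <-; field.
    by rewrite gt_eqF.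
  have -> : x ^+ n.+1 = x ^+ 2 * x ^+ n.-1 by rewrite -exprD add2n prednK.
  rewrite prod_except (exprMn n.-1 x); by move: (x ^+ n.-1) (_ ^+ n.-1) => t1 t2; field.
apply: le_measure; rewrite ?inE//; first exact: measurable_Qset.
move=> y /= hy.
have cb i : cabs (L y 0 i) <= 2 * s i.
  have [h1 h2] := hy i; have := cabs_le_ReIm (L y 0 i); rewrite -!ler_norml in h1 h2; lra.
split.
  rewrite hg cabsM ga; have := cb j; rewrite /s eqxx.
  have : enorm a < 1 by exact: Ba.
  have := cabs_ge0 (L y 0 j); have := enorm_ge0 a; move: (cabs _) (enorm a) => u' v'; rewrite -/x; nra.
rewrite -enorm_sqr -Liso enorm_sqr /sqnorm (bigD1 j)//= -/x.
have h1 : cabs (L y 0 j) ^+ 2 <= x / 32.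
  have := cb j; rewrite /s eqxx; have := cabs_ge0 (L y 0 j); move: (cabs _) => u'; nra.
have h2 : \sum_(i < n | i != j) cabs (L y 0 i) ^+ 2 <= x / 64.
  apply: (@le_trans _ _ (\sum_(i < n) x / (64 * n%:R))); last first.
    by rewrite sumr_const card_ord -[_ *+ n]mulr_natr invfM mulrA mulrVK ?unitfE ?gt_eqF.
  rewrite [leRHS](bigD1 j)//= ler_wpDl//; first by rewrite divr_ge0 ?ltW// mulr_gt0.
  apply: ler_sum => i ij; have := cb i; rewrite /s (negbTE ij) => h.
  apply: (@le_trans _ _ ((2 * (Num.sqrt x / (16 * n%:R))) ^+ 2)).
    by rewrite lerXn2r// nnegrE ?cabs_ge0// mulr_ge0// divr_ge0 ?sqrtr_ge0// mulr_ge0// ltW.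
  rewrite (_ : _ ^+ 2 = Num.sqrt x ^+ 2 / (64 * n%:R ^+ 2)); last by field; rewrite gt_eqF.
  rewrite sqr_sqrtr ?(ltW x0)// ler_wpM2l ?(ltW x0)// lef_pV2 ?posrE ?mulr_gt0 ?exprn_gt0//.
  by rewrite ler_pM2l// expr2 ler_peMr ?(ltW nn)// ler1n.
lra.
Qed.

(** For rho < 1/4 the set lies in a box of half-side 2 rho in the direction of a and 2 sqrt rho in
    the others; for larger rho a fixed box that depends on r is enough. *)
Lemma vol_Kset (r : R) : (0 < n)%N -> exists2 k : R, 0 < k & forall a rho, Ball a -> 0 < rho -> rho <= r ->
  (V (Kset a rho) <= (k * rho ^+ n.+1)%:E)%E.
Proof.
move=> n0; pose j := Ordinal n0.
have [c [c0 [hb _]]] := hV.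
pose B := c * \prod_(i < n) ((2 * (1 + `|r|)) * (2 * (1 + `|r|))).
have B0 : 0 < B by rewrite mulr_gt0// prodr_gt0// => i _; rewrite !mulr_gt0// ltr_pwDl.
exists (c * 16 ^+ n + B * 4 ^+ n.+1) => [|a rho Ba r0 rr].
  by rewrite addr_gt0// mulr_gt0// exprn_gt0.
have [rh|rh] := leP 4^-1 rho.
  apply: (@le_trans _ _ B%:E).
    pose s (i : 'I_n) := 1 + `|r|.
    have -> : B%:E = V (box (fun i => - s i) s (fun i => - s i) s).
      rewrite hb => [|i]; last by rewrite /s; have := normr_ge0 r; split; lra.
      by congr (_ * _)%:E; apply: eq_bigr => i _; rewrite /s; ring.
    apply: le_measure; rewrite ?inE; [exact: measurable_Kset|exact: measurable_box|].
    move=> z [_ hz] i; have h : enorm z <= s i by apply: le_trans hz _; rewrite lerD2l (le_trans rr)// ler_norm.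
    rewrite -!ler_norml; split; apply: le_trans (le_trans (cabs_coord z i) h); [exact: cabs_Re|exact: cabs_Im].
  rewrite lee_fin mulrDl; apply: (@le_trans _ _ (B * 4 ^+ n.+1 * rho ^+ n.+1)).
    by rewrite -mulrA -exprMn ler_peMr ?(ltW B0)//; apply: exprn_ege1; lra.
  by rewrite lerDr !mulr_ge0 ?exprn_ge0// ltW.
have [L [LD Liso LK [g ga hg]]] := householder j a.
pose s (i : 'I_n) := if i == j then 2 * rho else 2 * Num.sqrt rho.
(* The centre of the box: <z, a> = g (L z)_j is within rho of 1, so (L z)_j is close to 1/g. The
   other coordinates have square at most (1 + rho)^2 - (1 - rho)^2 = 4 rho. *)
pose u (i : 'I_n) : C := if i == j then g^-1 else 0.
have s0 i : 0 < s i by rewrite /s; case: ifP => _; rewrite mulr_gt0// sqrtr_gt0.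
have [mLb vLb] := @vol_isometry_box L (fun i => complex.Re (u i) - s i) (fun i => complex.Re (u i) + s i)
  (fun i => complex.Im (u i) - s i) (fun i => complex.Im (u i) + s i) LD Liso LK.
apply: (@le_trans _ _ (c * 16 ^+ n * rho ^+ n.+1)%:E); last first.
  rewrite lee_fin ler_pM2r ?exprn_gt0// lerDl mulr_ge0 ?exprn_ge0// ltW//.
have -> : (c * 16 ^+ n * rho ^+ n.+1)%:E = V ((L : Cn -> Cn) @^-1` box (fun i => complex.Re (u i) - s i) (fun i => complex.Re (u i) + s i)
  (fun i => complex.Im (u i) - s i) (fun i => complex.Im (u i) + s i)).
  rewrite vLb hb => [|i]; last by have := s0 i; split; lra.
  congr (_%:E); rewrite -!mulrA; congr (_ * _).
  rewrite (eq_bigr (fun i => if i == j then (4 * rho) ^+ 2 else 16 * rho)); last first.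
    move=> i _; rewrite /s; case: ifP => _; first by ring.
    by move: (sqr_sqrtr (ltW r0)); move: (Num.sqrt rho) => t <-; ring.
  have -> : rho ^+ n.+1 = rho ^+ 2 * rho ^+ n.-1 by rewrite -exprD add2n prednK.
  have -> : 16 ^+ n = 16 * 16 ^+ n.-1 :> R by rewrite -exprS prednK.
  rewrite prod_except (exprMn n.-1 16); move: (rho ^+ n.-1) (_ ^+ n.-1) => t1 t2; ring.
apply: le_measure; rewrite ?inE//; first exact: measurable_Kset.
move=> z [hz1 hz2] i.
have g0 : 3 / 5 <= cabs g.
  rewrite ga; have := kd_ge z a; have := enorm_ge0 a; have := enorm_ge0 z; nra.
have g1 : cabs g < 1 by rewrite ga; exact: Ba.
have gn : g != 0 by apply/eqP => h; move: g0; rewrite h cabs0; lra.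
have hk : cabs (1 - g * L z 0 j) <= rho by rewrite -hg.
have d : cabs (L z 0 j - g^-1) <= 2 * rho.
  have e : g * (L z 0 j - g^-1) = - (1 - g * L z 0 j) by rewrite mulrBr mulfV//; ring.
  move: (congr1 (@cabs R) e); rewrite cabsM cabsN => e'.
  rewrite -e' in hk; have := cabs_ge0 (L z 0 j - g^-1); nra.
have lb : 1 - rho <= cabs (L z 0 j).
  have := cabs_lerB 1 (1 - (1 - g * L z 0 j)); rewrite cabs1 => _.
  have := cabsD (1 - g * L z 0 j) (g * L z 0 j); rewrite subrK cabs1 cabsM.
  have := cabs_ge0 (L z 0 j); nra.
have cb : cabs (L z 0 i - u i) <= s i.
  rewrite /u /s; case: eqP => [->//|/eqP ij]; rewrite subr0.
  have h : cabs (L z 0 i) ^+ 2 <= 4 * rho.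
    have := sqnorm_two (L z) ij; rewrite -enorm_sqr Liso.
    have := enorm_ge0 z; nra.
  rewrite -(@ler_pXn2r _ 2)// ?nnegrE ?cabs_ge0 ?mulr_ge0 ?sqrtr_ge0//.
  by apply: le_trans h _; rewrite exprMn sqr_sqrtr ?(ltW r0)//; lra.
have := le_trans (cabs_Re _) cb; have := le_trans (cabs_Im _) cb.
by rewrite cReD cImD cReN cImN !ler_distl.
Qed.

End BallVolumes.

(** * Mean values and radial monotonicity *)

Section FatouBound.
Variable R : realType.
Local Open Scope ereal_scope.

(** Fatou's lemma with the lower limit unfolded into an epsilon condition; it removes every
    truncation made below. *)
Lemma fatou_le d (T : measurableType d) (m : {measure set T -> \bar R}) (F : nat -> T -> R)
  (f : T -> R) (B : \bar R) :
  (forall k, measurable_fun setT (F k)) -> (forall k x, (0 <= F k x)%R) ->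
  measurable_fun setT f -> (forall x, (0 <= f x)%R) ->
  (forall x (e : R), (0 < e)%R -> exists K, forall k, (K <= k)%N -> (f x <= F k x + e)%R) ->
  (forall k, \int[m]_x (F k x)%:E <= B) -> \int[m]_x (f x)%:E <= B.
Proof.
move=> mF F0 mf f0 hl hB.
have mF' k : measurable_fun setT (fun x => (F k x)%:E) by exact/measurable_EFinP.
have le1 x : (f x)%:E <= limn_einf (fun k => (F k x)%:E).
  apply/lee_addgt0Pr => e e0; rewrite limn_einf_lim -leeBlDr//.
  have [K hK] := hl x e e0; apply: lime_ge; first exact: is_cvg_einfs.
  exists K => // k /= Kk; apply: le_ereal_inf_tmp => _ [l /= kl <-].
  by rewrite -EFinB lee_fin lerBlDr; apply: hK; exact: leq_trans kl.
apply: (@le_trans _ _ (\int[m]_x limn_einf (fun k => (F k x)%:E))).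
  apply: ge0_le_integral => //; first by move=> x _; rewrite lee_fin.
    exact/measurable_EFinP.
  rewrite /limn_einf; apply: measurableT_comp => //.
  by apply: measurable_fun_limn_esup => k; exact: measurableT_comp.
apply: le_trans (fatou m measurableT mF' (fun k x _ => F0 k x)) _.
rewrite limn_einf_lim; apply: lime_le; first exact: is_cvg_einfs.
apply: nearW => k; apply: le_trans (hB k); apply: ereal_inf_lbound.
by exists k => //=.
Qed.
End FatouBound.

(** * Integrated mean-value inequalities *)

Section MeanValues.
Variables (R : realType) (n : nat).
Local Notation C := R[i].
Local Notation Vec := 'rV[C]_n.
Local Notation Cn := (Cn R n).
Implicit Types (z w a y : Vec) (f : Vec -> C).

(** Compactness of the closed ball by extraction: if |f(u_k)| > k, continuity fails at the limit of
    a convergent subsequence of the u_k. *)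
Lemma ceps_bounded f (r : R) : (forall z, enorm z <= r -> ceps f z) ->
  exists M, forall z, enorm z <= r -> cabs (f z) <= M.
Proof.
move=> hf; apply: contrapT => /forallNP hM.
have /choice[u hu] : forall k : nat, exists z, enorm z <= r /\ k%:R < cabs (f z).
  move=> k; have /existsNP[z /not_implyP[h1 /negP h2]] := hM k%:R.
  by exists z; split=> //; rewrite ltNge.
pose v k j := if insub j is Some i then u k 0 (i : 'I_n) else 0.
have [k j|s [hs [L hL]]] := @diagonal_cextraction R v (fun=> `|r|).
  rewrite /v; case: insubP => [i _ _|_]; last by rewrite cabs0.
  by apply: le_trans (cabs_coord _ _) _; apply: le_trans (hu k).1 _; exact: ler_norm.
pose z : Vec := \row_(j < n) L j.
have conv (e : R) : 0 < e -> exists K, forall k, (K <= k)%N -> enorm (u (s k) - z) < e.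
  move=> e0; pose d := e / (n%:R + 1).
  have n1 : 0 < n%:R + 1 :> R by rewrite ltr_wpDl.
  have d0 : 0 < d by rewrite divr_gt0.
  have /choice[K hK] : forall j : 'I_n, exists K, forall k, (K <= k)%N -> cabs (u (s k) 0 j - L j) < d.
    move=> j; have [K hK] := hL j d d0; exists K => k /hK.
    by rewrite /v; case: insubP => [i _ /val_inj ->|]; rewrite ?ltn_ord.
  exists (\max_(j < n) K j) => k hk.
  apply: (@le_lt_trans _ _ (d * n%:R)).
    apply: enorm_coord => j; rewrite !mxE ltW// hK//; apply: leq_trans hk; exact: leq_bigmax.
  by rewrite /d mulrAC ltr_pdivrMr// ltr_pM2l// ltrDl.
have zr : enorm z <= r.
  rewrite leNgt; apply/negP => h; have [K hK] := conv (enorm z - r) ltac:(by rewrite subr_gt0).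
  have := hK K (leqnn _); have := (hu (s K)).1; have := enormD (u (s K)) (z - u (s K)).
  by rewrite addrC subrK -[z - _]opprB enormN; lra.
have [d d0 hd] := hf z zr 1 ltr01.
have [K hK] := conv d d0.
pose k := maxn K (Num.truncn (cabs (f z) + 1)).+1.
have := hd _ (hK k (leq_maxl _ _)); have h2 := (hu (s k)).2.
have h3 : cabs (f z) + 1 < k%:R.
  by apply: (lt_le_trans (truncnS_gt _)); rewrite ler_nat leq_maxr.
have h4 : k%:R <= (s k)%:R :> R by rewrite ler_nat; exact: sincr_ge.
have := cabs_lerB (f (u (s k))) (f z); lra.
Qed.

Lemma hol_ceps f z : holomorphic_on (@Ball R n) f -> Ball z -> ceps f z.
Proof. by move=> /holomorphic_onP[h _]; exact: h. Qed.

Lemma hol_bounded f (r : R) : holomorphic_on (@Ball R n) f -> r < 1 ->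
  exists M, forall z, enorm z <= r -> cabs (f z) <= M.
Proof.
move=> hf r1; apply: ceps_bounded => z zr; apply: hol_ceps => //.
by rewrite BallE; exact: le_lt_trans r1.
Qed.

Lemma hol_line f z y (r : R) : holomorphic_on (@Ball R n) f -> r < 1 ->
  (forall s : C, cabs s <= 9 / 5 -> enorm (z + s *: y) <= r) ->
  hol2 (fun s => f (z + s *: y)) /\
  exists M, forall s, cabs s <= 9 / 5 -> cabs (f (z + s *: y)) <= M.
Proof.
move=> hf r1 hr; split.
  by move=> s /hr hs; apply: hol_line_cdiff => //; rewrite BallE; exact: le_lt_trans r1.
by have [M hM] := hol_bounded hf r1; exists M => s /hr /hM.
Qed.

(** The extension by 0 allows f to be dilated and translated under integrals over the whole
    space. *)
Definition bmod f z : R := if z \in @Ball R n then cabs (f z) else 0.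

Lemma bmod_ge0 f z : 0 <= bmod f z.
Proof. by rewrite /bmod; case: ifP => // _; exact: cabs_ge0. Qed.

Lemma bmodE f z : Ball z -> bmod f z = cabs (f z).
Proof. by move=> Bz; rewrite /bmod mem_set. Qed.

Lemma bmod0 f z : ~ Ball z -> bmod f z = 0.
Proof. by move=> Bz; rewrite /bmod memNset. Qed.

Lemma measurable_bmod f : holomorphic_on (@Ball R n) f -> measurable_fun [set: Cn] (bmod f : Cn -> R).
Proof.
move=> hf; apply: ((measurable_restrictT _ (@measurable_Ball R n)).1).
apply: ceps_measurable_cabs => [|z Bz]; [exact: eopen_Ball|exact: hol_ceps].
Qed.

Lemma measurable_bmod_powR f p : holomorphic_on (@Ball R n) f ->
  measurable_fun [set: Cn] (fun z : Cn => bmod f z `^ p).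
Proof. move=> hf; exact: measurableT_comp (measurable_powR p) (measurable_bmod hf). Qed.

Variables (V : {measure set Cn -> \bar R}) (hV : normalized_volume V).

Lemma integral_umean N (F : Cn -> C -> R) (b : C -> R) : (0 < N)%N ->
  (forall w : C, cabs w = 1 -> measurable_fun setT (F ^~ w)) -> (forall z (w : C), 0 <= F z w) ->
  (forall w : C, cabs w = 1 -> (\int[V]_z (F z w)%:E <= (b w)%:E)%E) ->
  (\int[V]_z (umean N (F z))%:E <= (umean N b)%:E)%E.
Proof.
move=> N0 mF F0 hb; have N0R : 0 < N%:R :> R by rewrite ltr0n.
have s1 (i : 'I_(size (uroots R N))) : cabs (nth 0 (uroots R N) i) = 1.
  by apply: cabs_uroots N0 _; apply: mem_nth.
have uE G : umean N G = N%:R^-1 * \sum_(i < size (uroots R N)) G (nth 0 (uroots R N) i).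
  by rewrite /umean mulrC (big_nth 0) big_mkord.
rewrite uE EFinM -sumEFin.
pose S (z : Cn) := \sum_(i < size (uroots R N)) F z (nth 0 (uroots R N) i).
rewrite (eq_integral (fun z : Cn => (N%:R^-1)%:E * (S z)%:E)%E); last first.
  by move=> z _; rewrite uE EFinM.
rewrite ge0_integralZl//; last 2 first.
- by apply/measurable_EFinP; apply: measurable_sum => i; exact: mF.
- by move=> z _; rewrite lee_fin sumr_ge0.
apply: lee_wpmul2l; first by rewrite lee_fin invr_ge0 ltW.
under eq_integral do rewrite -sumEFin.
rewrite ge0_integral_sum//; last first.
- by move=> i z _; rewrite lee_fin.
- by move=> i; apply/measurable_EFinP; exact: mF.
by apply: lee_sum => i _; exact: hb.
Qed.

(** The rank from which [submean] holds depends on z, and so does its error once multiplied by G z;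
    [fatou_le] needs no uniformity in z. The indices start at 2 because the roots of unity sum to 0
    for N > 1 only. *)
Lemma subint (G : Cn -> R) (g : Cn -> C -> C) (p : R) (b : C -> R) (B : R) : 0 < p ->
  (forall z, 0 <= G z) ->
  (forall z, G z != 0 -> hol2 (g z) /\ exists M, forall s, cabs s <= 9 / 5 -> cabs (g z s) <= M) ->
  (forall s, cabs s <= 1 -> measurable_fun setT (fun z : Cn => G z * cabs (g z s) `^ p)) ->
  (forall w : C, cabs w = 1 -> (\int[V]_z (G z * cabs (g z w) `^ p)%:E <= (b w)%:E)%E) ->
  (forall N, (1 < N)%N -> umean N b <= B) ->
  (\int[V]_z (G z * cabs (g z 0) `^ p)%:E <= B%:E)%E.
Proof.
move=> p0 G0 hg hm hb hB.
apply: (@fatou_le _ _ _ V (fun k z => umean k.+2 (fun s => G z * cabs (g z s) `^ p))).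
- move=> k; rewrite [X in measurable_fun _ X](_ : _ = fun z : Cn => (\sum_(i < size (uroots R k.+2)) (G z * cabs (g z (nth 0 (uroots R k.+2) i)) `^ p)) * k.+2%:R^-1); last first.
    by apply/funext => z; rewrite /umean (big_nth 0) big_mkord.
  apply: measurable_funM; last exact: measurable_cst.
  apply: measurable_sum => i; apply: hm; rewrite (@cabs_uroots _ k.+2)//; exact: mem_nth.
- by move=> k z; rewrite divr_ge0// sumr_ge0// => s _; rewrite mulr_ge0 ?powR_ge0.
- by apply: hm; rewrite cabs0.
- by move=> z; rewrite mulr_ge0 ?powR_ge0.
- move=> z e e0; have [Gz|Gz] := eqVneq (G z) 0.
    by exists 0%N => k _; rewrite Gz mul0r (addr_ge0 _ (ltW e0))// divr_ge0// sumr_ge0// => s _; rewrite mul0r.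
  have [h1 [M hM]] := hg z Gz.
  have Gp : 0 < G z by rewrite lt_def Gz G0.
  have [N0 [_ hN]] := submean h1 hM p0 (divr_gt0 e0 Gp).
  exists N0 => k kN; have := hN k.+2 (leq_trans kN (leq_trans (leqnSn _) (leqnSn _))).
  rewrite -(ler_pM2l Gp) mulrDr [_ * (e / _)]mulrCA mulfV// mulr1 => /le_trans; apply.
  by rewrite lerD2r /umean mulrA mulr_sumr.
- move=> k; apply: le_trans (@integral_umean k.+2 (fun z s => G z * cabs (g z s) `^ p) b _ _ _ hb) _ => //.
  + by move=> s s1; apply: hm; rewrite s1.
  + by move=> z s; rewrite mulr_ge0 ?powR_ge0.
  + by rewrite lee_fin; exact: hB.
Qed.

Lemma umean_cst N (c : R) : (0 < N)%N -> umean N (fun=> c) = c.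
Proof.
move=> N0; rewrite /umean big_const_seq count_predT size_uroots// iter_addr_0 -[c *+ N]mulr_natr.
by rewrite mulfK// pnatr_eq0 -lt0n.
Qed.

Lemma Qset_enorm a y (l : C) : Ball a -> Qset a y -> cabs l <= 2 ->
  enorm (a + l *: y) <= Num.sqrt (1 - bdef a / 8).
Proof.
move=> Ba Qy l2; have [Bs [n1 n2]] := Qset_Ball Ba Qy l2.
have := bdef_le_kd (ltW Bs) (ltW Ba) => h; rewrite /enorm ler_sqrt.
  have : bdef a <= 8 * bdef (a + l *: y) by lra.
  by move: (bdef a) => t; rewrite /bdef; lra.
have := bdef_le1 a; lra.
Qed.

Lemma QsetZ a y (w : C) : cabs w = 1 -> Qset a (w *: y) <-> Qset a y.
Proof. by move=> w1; rewrite /Qset /= cinnerZl cabsM sqnormZ w1 expr1n !mul1r. Qed.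

(** Both V and [Qset a] are invariant under multiplication of y by w with |w| = 1. All the rotated
    integrals have the same value I, and [subint] compares I with the value at the centre. *)
Lemma pointwise_mean f a (p : R) : holomorphic_on (@Ball R n) f -> Ball a -> 0 < p ->
  ((cabs (f a) `^ p)%:E * V (Qset a) <= \int[V]_z (\1_(Qset a) (z - a : Cn) * bmod f z `^ p)%:E)%E.
Proof.
move=> hf Ba p0; set I := (\int[V]_z _)%E.
have mQ := @measurable_Qset R n a.
have mI1 : measurable_fun [set: Cn] (\1_(Qset a) : Cn -> R) by exact: measurable_indic.
have maff (s : C) : measurable_fun [set: Cn] (fun y : Cn => a + s *: (y : Vec) : Cn).
  under eq_fun do rewrite addrC.
  exact: measurableT_comp (measurable_addr a) (measurable_scale s).
pose g (y : Cn) (s : C) := f (a + s *: (y : Vec)).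
have gE s y : cabs s <= 2 -> \1_(Qset a) y * cabs (g y s) `^ p = \1_(Qset a) y * bmod f (a + s *: y) `^ p :> R.
  move=> s2; rewrite indicE; have [/set_mem Qy|_] := boolP (y \in Qset a); last by rewrite !mul0r.
  by rewrite bmodE//; case: (Qset_Ball Ba Qy s2).
have mg s : cabs s <= 2 -> measurable_fun setT (fun y : Cn => \1_(Qset a) y * cabs (g y s) `^ p : R).
  move=> s2; under eq_fun do rewrite gE//.
  apply: measurable_funM => //; exact: measurableT_comp (measurable_bmod_powR p hf) (maff s).
have IE (w : C) : cabs w = 1 -> (\int[V]_y (\1_(Qset a) y * cabs (g y w) `^ p)%:E = I)%E.
  move=> w1; have w2 : cabs w <= 2 by rewrite w1 ler1n.
  have w0 : w != 0 by apply: contra_eq_neq w1 => ->; rewrite cabs0 eq_sym oner_eq0.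
  pose H (y : Cn) := (\1_(Qset a) y * bmod f (a + y) `^ p)%:E : \bar R.
  have mH : measurable_fun setT H.
    apply/measurable_EFinP; apply: measurable_funM => //.
    by apply: measurableT_comp (measurable_bmod_powR p hf) _; have := maff 1; under eq_fun do rewrite scale1r.
  have H0 y : (0 <= H y)%E by rewrite lee_fin mulr_ge0 ?powR_ge0// indicE.
  have -> : (I = \int[V]_y H y)%E.
    rewrite -(vol_translate hV (- a) mH H0); apply: eq_integral => z _.
    by rewrite /H [a + _]addrC subrK.
  transitivity (\int[V]_y H (w *: (y : Vec)))%E.
    apply: eq_integral => y _; rewrite gE// /H !indicE.
    by rewrite (_ : (w *: y \in Qset a) = (y \in Qset a))//; apply/idP/idP => /set_mem/QsetZ h; apply/mem_set/h.
  apply: (vol_isometry hV (L := fun y => w *: y) (L' := fun y => w^-1 *: y) _ _ _ mH H0).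
  - by move=> z z'; rewrite scalerDr.
  - by move=> z; rewrite enormZ w1 mul1r.
  - by move=> z; rewrite scalerA mulfV// scale1r.
have I0 : (0 <= I)%E by apply: integral_ge0 => z _; rewrite lee_fin mulr_ge0 ?powR_ge0// indicE.
have [->|Ify] := eqVneq I +oo%E; first by rewrite leey.
have IF : I = (fine I)%:E by rewrite fineK// ge0_fin_numE// ltey.
have -> : ((cabs (f a) `^ p)%:E * V (Qset a) = \int[V]_y (\1_(Qset a) y * cabs (g y 0) `^ p)%:E)%E.
  have -> : V (Qset a) = (\int[V]_y (\1_(Qset a) y : R)%:E)%E by rewrite integral_indic// setIT.
  rewrite -ge0_integralZl//.
  - by apply: eq_integral => y _; rewrite -EFinM mulrC /g scale0r addr0.
  - exact/measurable_EFinP.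
  by rewrite lee_fin powR_ge0.
rewrite IF; apply: (@subint _ g p (fun=> fine I)) => //.
- move=> y; rewrite indicE pnatr_eq0 eqb0 negbK => /set_mem Qy.
  apply: (@hol_line f a y (Num.sqrt (1 - bdef a / 8))) => // [|s hs].
    by rewrite -[ltRHS]sqrtr1 ltr_sqrt//; have := bdef_gt0 Ba; lra.
  by apply: Qset_enorm => //; apply: le_trans hs _; lra.
- by move=> s s1; apply: mg; apply: le_trans s1 _; rewrite ler1n.
- by move=> w w1; rewrite IE// -IF.
- by move=> N N1; rewrite umean_cst// (ltn_trans _ N1).
Qed.

End MeanValues.

(** * Monotonicity of integrals under dilation *)

Section RadialMonotonicity.
Variables (R : realType) (n : nat).
Local Notation C := R[i].
Local Notation Vec := 'rV[C]_n.
Local Notation Cn := (Cn R n).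
Variables (V : {measure set Cn -> \bar R}) (hV : normalized_volume V).
Variables (f : Vec -> C) (p : R) (hf : holomorphic_on (@Ball R n) f) (p0 : 0 < p).

Lemma int_le_Ball (h : Cn -> R) (K : R) : measurable_fun setT h -> (forall z, 0 <= h z) ->
  (forall z, h z <= K) -> (forall z, ~ Ball (z : Vec) -> h z = 0) ->
  (\int[V]_z (h z)%:E <= K%:E)%E.
Proof.
move=> mh h0 hK hB.
have K0 : 0 <= K by apply: le_trans (h0 0) (hK 0).
have VB : V (@Ball R n) = 1%E by case: hV => k [_ [_ ->]].
have mB := @measurable_Ball R n.
apply: (@le_trans _ _ (\int[V]_z (K%:E * (\1_(@Ball R n : set Cn) z : R)%:E))%E).
  apply: ge0_le_integral => //.
  - by move=> z _; rewrite lee_fin.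
  - by apply/measurable_EFinP.
  - apply/measurable_EFinP; apply: measurable_funM => //; exact: measurable_indic.
  - move=> z _; rewrite -EFinM lee_fin indicE; have [Bz|Bz] := boolP (z \in _); first by rewrite mulr1.
    by rewrite mulr0 hB// => Bz'; move/negP: Bz; apply; exact: mem_set.
rewrite ge0_integralZl//.
- by rewrite integral_indic// setIT [X in (_ * X)%E]VB mule1.
- by apply/measurable_EFinP; exact: measurable_indic.
Qed.

Lemma measurable_bmod_scale (G : Cn -> R) (s : C) : measurable_fun setT G ->
  measurable_fun setT (fun z : Cn => G z * bmod f (s *: (z : Vec)) `^ p).
Proof.
move=> mG; apply: measurable_funM => //.
exact: measurableT_comp (measurable_bmod_powR p hf) (measurable_scale s).
Qed.

Lemma integral_rot (G : Cn -> R) (s s' : C) : measurable_fun setT G -> (forall z, 0 <= G z) ->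
  (forall (c : C) z, cabs c = 1 -> G (c *: (z : Vec)) = G z) -> cabs s = cabs s' ->
  (\int[V]_z (G z * bmod f (s *: (z : Vec)) `^ p)%:E = \int[V]_z (G z * bmod f (s' *: (z : Vec)) `^ p)%:E)%E.
Proof.
move=> mG G0 Grot ss.
have [s0|s0] := eqVneq s' 0.
  by move: ss; rewrite s0 cabs0 => /cabs0_eq ->.
pose c := s / s'.
have sn : cabs s' != 0 by apply: contra s0 => /eqP/cabs0_eq ->.
have c1 : cabs c = 1 by rewrite cabsM cabsV ss divff.
have c0 : c != 0 by apply: contra_eq_neq c1 => ->; rewrite cabs0 eq_sym oner_eq0.
have mH : measurable_fun setT (fun z : Cn => (G z * bmod f (s' *: (z : Vec)) `^ p)%:E).
  by apply/measurable_EFinP; exact: measurable_bmod_scale.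
have H0 (z : Cn) : (0 <= (G z * bmod f (s' *: (z : Vec)) `^ p)%:E)%E.
  by rewrite lee_fin mulr_ge0 ?powR_ge0.
have sE : s' * c = s by rewrite /c mulrC divfK.
transitivity (\int[V]_z (G (c *: (z : Vec)) * bmod f (s' *: (c *: (z : Vec))) `^ p)%:E)%E.
  by apply: eq_integral => z _; rewrite Grot// scalerA sE.
apply: (vol_isometry hV (L := fun z => c *: z) (L' := fun z => c^-1 *: z) _ _ _ mH H0).
- by move=> z w; rewrite scalerDr.
- by move=> z; rewrite enormZ c1 mul1r.
- by move=> z; rewrite scalerA mulfV// scale1r.
Qed.

(** The term linear in w drops out because the roots of unity sum to 0. *)
Lemma umean_quad N (S eta s0 e : R) : (1 < N)%N ->
  umean N (fun w : C => S - eta * cabs (s0%:C%C + e%:C%C * w) ^+ 2) = S - eta * (s0 ^+ 2 + e ^+ 2).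
Proof.
move=> N1; have N0 : (0 < N)%N by rewrite (ltn_trans _ N1).
have hs : \sum_(w <- uroots R N) complex.Re w = 0.
  transitivity (complex.Re (\sum_(w <- uroots R N) w)); last by rewrite uroots_sum0.
  by elim: (uroots R N) => [|a l IH]; rewrite ?big_nil// !big_cons cReD IH.
rewrite /umean (eq_big_seq (fun w => S - eta * (s0 ^+ 2 + e ^+ 2) + (- (2 * eta * s0 * e)) * complex.Re w)).
  rewrite big_split/= -mulr_sumr hs mulr0 addr0.
  by rewrite big_const_seq count_predT size_uroots// iter_addr_0 -[_ *+ N]mulr_natr mulfK// pnatr_eq0 -lt0n.
move=> w /(cabs_uroots N0) w1; have := cabs_sqr w; rewrite w1 expr1n => h.
rewrite cabs_sqr !cReD !cImD !cReM !cImM /= !mul0r !subr0 !addr0 add0r.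
have -> : (s0 + e * complex.Re w) ^+ 2 + (e * complex.Im w) ^+ 2 =
  s0 ^+ 2 + 2 * s0 * e * complex.Re w + e ^+ 2 * (complex.Re w ^+ 2 + complex.Im w ^+ 2) by ring.
rewrite -h; ring.
Qed.

Section Compact.
Variables (G : Cn -> R) (r0 t BG : R).
Hypotheses (mG : measurable_fun setT G) (G0 : forall z, 0 <= G z)
  (GB : forall z, G z <= BG)
  (Grot : forall (c : C) z, cabs c = 1 -> G (c *: (z : Vec)) = G z)
  (r00 : 0 <= r0) (t1 : 1 <= t) (rt : r0 * t < 1)
  (Gsupp : forall z, G z != 0 -> enorm (z : Vec) <= r0).

Let scaled (e : R) (z : Vec) (s : C) : G z != 0 -> cabs s <= t + e -> enorm (s *: z) <= r0 * (t + e).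
Proof.
move=> Gz hs; rewrite enormZ mulrC; apply: ler_pM => //; rewrite ?enorm_ge0 ?cabs_ge0//.
exact: Gsupp.
Qed.

Let t0 : 0 < t. Proof. exact: lt_le_trans ltr01 t1. Qed.

Let supp_Ball z : ~ Ball (z : Vec) -> G z = 0.
Proof.
move=> Bz; have [//|Gz] := eqVneq (G z) 0.
exfalso; apply: Bz; rewrite BallE; apply: le_lt_trans (Gsupp Gz) _; apply: le_lt_trans rt.
by rewrite ler_peMr.
Qed.

Let dilation_room : exists2 e : R, 0 < e & r0 * (t + 2 * e) < 1.
Proof.
have r1 : 0 < r0 + 1 by rewrite ltr_wpDl.
exists ((1 - r0 * t) / (4 * (r0 + 1))); first by rewrite divr_gt0// ?subr_gt0// mulr_gt0.
have : 4 * ((r0 + 1) * ((1 - r0 * t) / (4 * (r0 + 1)))) = 1 - r0 * t by field; rewrite gt_eqF.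
have : 0 < (1 - r0 * t) / (4 * (r0 + 1)) by rewrite divr_gt0// ?subr_gt0// mulr_gt0.
by move: (_ / _) => e; move: r00 rt; nra.
Qed.

Let Ubnd : exists B : R, forall s : R, 0 <= s -> s <= t ->
  (\int[V]_z (G z * bmod f ((s%:C)%C *: (z : Vec)) `^ p)%:E <= B%:E)%E.
Proof.
have [M hM] := hol_bounded hf rt.
exists (BG * M `^ p) => s s0 st.
have sc z : G z != 0 -> enorm ((s%:C)%C *: (z : Vec)) <= r0 * t.
  by move=> Gz; rewrite -[t]addr0; apply: scaled => //; rewrite cabsR ger0_norm// addr0.
apply: int_le_Ball.
- exact: measurable_bmod_scale.
- by move=> z; rewrite mulr_ge0 ?powR_ge0.
- move=> z; have [->|Gz] := eqVneq (G z) 0.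
    by rewrite mul0r mulr_ge0 ?powR_ge0// (le_trans (G0 0) (GB 0)).
  apply: ler_pM; rewrite ?powR_ge0//; apply: powR_le; rewrite ?bmod_ge0 ?(ltW p0)//.
  rewrite bmodE; first by apply: hM; exact: sc.
  by rewrite BallE; exact: le_lt_trans (sc z Gz) rt.
- by move=> z /supp_Ball ->; rewrite mul0r.
Qed.

Section RadialIntegral.
Variable U : R -> R.
Hypothesis UE : forall s : R, 0 <= s -> s <= t ->
  (\int[V]_z (G z * bmod f ((s%:C)%C *: (z : Vec)) `^ p)%:E = (U s)%:E)%E.

(** Semicontinuity at the end point t, around which circles would leave |s| <= t; it keeps nearly
    maximal points at a distance from t. *)
Let Uusc (k : R) : 0 < k -> exists2 d : R, 0 < d & forall s, 0 <= s -> s <= t -> t - d <= s -> U s <= U t + k.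
Proof.
move=> k0; have [e e0 re] := dilation_room.
have [M hM] := hol_bounded hf re.
have te0 : 0 <= t + 2 * e by rewrite addr_ge0 ?(ltW t0)// mulr_ge0 ?(ltW e0).
have M0 : 0 <= M by apply: le_trans (hM 0 _); rewrite ?cabs_ge0// enorm0 mulr_ge0.
have BG0 : 0 <= BG by exact: le_trans (G0 0) (GB 0).
have B1 : 0 < BG + 1 by rewrite ltr_wpDl.
have [d d0 hd] := powR_modulus M p0 (divr_gt0 k0 B1).
have M1 : 0 < 10 * M + 1 by rewrite ltr_wpDl// mulr_ge0.
have [D [D0 De Dd]] : exists D, [/\ 0 < D, D <= e & D * (10 * M + 1) <= d * e].
  exists (Num.min e (d * e / (10 * M + 1))).
  rewrite lt_min e0 divr_gt0 ?mulr_gt0// ge_min lexx; split=> //.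
  by rewrite -ler_pdivlMr// ge_min lexx orbT.
exists D => // s s0 st ts.
have key z : G z != 0 -> bmod f ((s%:C)%C *: z) `^ p <= bmod f ((t%:C)%C *: z) `^ p + k / (BG + 1).
  move=> Gz.
  have sc (c : C) : cabs c <= t + 2 * e -> Ball (c *: z) /\ cabs (f (c *: z)) <= M.
    by move=> hc; have h := scaled Gz hc; split; [rewrite BallE; exact: le_lt_trans re|exact: hM].
  have ct : cabs ((t%:C)%C : C) <= t + 2 * e.
    by rewrite cabsR (gtr0_norm t0) lerDl mulr_ge0// ltW.
  have cs : cabs ((s%:C)%C : C) <= t + 2 * e.
    by apply: le_trans ct; rewrite !cabsR (ger0_norm s0) (gtr0_norm t0).
  have [Bs Ms] := sc _ cs; have [Bt Mt] := sc _ ct.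
  rewrite !bmodE//.
  have lin (c : C) : ((t%:C)%C + c * (e%:C)%C) *: z = (t%:C)%C *: z + c *: ((e%:C)%C *: z).
    by rewrite scalerDl scalerA.
  have hl (c : C) : cabs c <= 9 / 5 -> enorm ((t%:C)%C *: z + c *: ((e%:C)%C *: z)) <= r0 * (t + 2 * e).
    move=> hc; rewrite -lin; apply: scaled => //; apply: le_trans (cabsD _ _) _.
    rewrite cabsM !cabsR (gtr0_norm t0) (gtr0_norm e0) lerD2l.
    by rewrite ler_wpM2r ?(ltW e0)// (le_trans hc)// ler_pdivrMr// -natrM ler_nat.
  have [g1 [M' _]] := hol_line hf re hl.
  have g2 c : cabs c <= 9 / 5 -> cabs (f ((t%:C)%C *: z + c *: ((e%:C)%C *: z))) <= M by move=> /hl/hM.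
  pose c : C := (((s - t) / e)%:C)%C.
  have tsD : t - s <= D by rewrite lerBlDr -lerBlDl.
  have tse : t - s <= e by exact: le_trans tsD De.
  have cc : cabs c = (t - s) / e.
    by rewrite cabsR normrM normfV (gtr0_norm e0) distrC ger0_norm// subr_ge0.
  have c1 : cabs c <= 1 by rewrite cc ler_pdivrMr// mul1r.
  have := schwarz1 g1 g2 c1; rewrite scale0r addr0 -lin.
  have -> : (t%:C)%C + c * (e%:C)%C = (s%:C)%C :> C.
    by rewrite /c -rmorphM -rmorphD divfK ?gt_eqF// addrC subrK.
  rewrite cc => h.
  apply: (hd _ _ (cabs_ge0 _) (cabs_ge0 _) Mt).
  have h3 : cabs (f ((s%:C)%C *: z) - f ((t%:C)%C *: z)) <= d.
    apply: le_trans h _; rewrite mulrA ler_pdivrMr//.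
    apply: le_trans Dd; apply: (@le_trans _ _ (10 * M * D)); first by rewrite ler_wpM2l ?mulr_ge0.
    by rewrite mulrDr mulr1 [D * _]mulrC lerDl ltW.
  rewrite -lerBlDl; apply: le_trans h3; exact: cabs_lerB.
rewrite -lee_fin EFinD -!UE ?(ltW t0)//.
have kB0 : 0 <= k / (BG + 1) by rewrite divr_ge0 ?(ltW k0)// ltW.
apply: (@le_trans _ _ (\int[V]_z ((G z * bmod f ((t%:C)%C *: (z : Vec)) `^ p)%:E + (G z * (k / (BG + 1)))%:E))%E).
  apply: ge0_le_integral => //.
  - by move=> z _; rewrite lee_fin mulr_ge0 ?powR_ge0.
  - by apply/measurable_EFinP; exact: measurable_bmod_scale.
  - apply: emeasurable_funD; apply/measurable_EFinP; first exact: measurable_bmod_scale.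
    by apply: measurable_funM => //; exact: measurable_cst.
  - move=> z _; rewrite -EFinD -mulrDr lee_fin; have [Gz|Gz] := eqVneq (G z) 0.
      by rewrite Gz !mul0r.
    by rewrite ler_wpM2l// key.
rewrite ge0_integralD//; last 4 first.
- by move=> z _; rewrite lee_fin mulr_ge0 ?powR_ge0.
- by apply/measurable_EFinP; exact: measurable_bmod_scale.
- by move=> z _; rewrite lee_fin mulr_ge0.
- by apply/measurable_EFinP; apply: measurable_funM => //; exact: measurable_cst.
apply: leeD => //; apply: int_le_Ball.
- by apply: measurable_funM => //; exact: measurable_cst.
- by move=> z; rewrite mulr_ge0.
- move=> z; rewrite mulrA ler_pdivrMr// mulrC ler_pM2l//.
  by apply: le_trans (GB z) _; rewrite lerDl.
- by move=> z /supp_Ball ->; rewrite mul0r.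
Qed.

(* Maximum principle for the radial function U(|s|) + eta |s|^2 on the disc
   |s| <= t; U is subharmonic in the mean-value sense by [subint]. *)
Lemma radial_mono_bounded : U 1 <= U t.
Proof.
rewrite leNgt; apply/negP => hU.
(* eta is small enough for F(s) = U(s) + eta s^2 to satisfy F(t) < F(1); the quadratic term makes
   the mean-value inequality strict. *)
have [eta eta0 hF] : exists2 eta, 0 < eta & U t + eta * t ^+ 2 < U 1 + eta * 1 ^+ 2.
  have t2 : 0 < t ^+ 2 by rewrite exprn_gt0.
  exists ((U 1 - U t) / (2 * t ^+ 2)); first by rewrite divr_gt0 ?subr_gt0// mulr_gt0.
  have -> : (U 1 - U t) / (2 * t ^+ 2) * t ^+ 2 = (U 1 - U t) / 2 by field; rewrite gt_eqF.
  have : 0 < (U 1 - U t) / (2 * t ^+ 2) by rewrite divr_gt0 ?subr_gt0// mulr_gt0.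
  by move: (_ / (2 * _)) => x; move: hU; rewrite expr1n mulr1; lra.
pose F s := U s + eta * s ^+ 2.
have [k k0 kE] : exists2 k, 0 < k & F 1 = F t + 2 * k.
  exists ((F 1 - F t) / 2); first by rewrite divr_gt0// subr_gt0.
  by rewrite mulrC divfK// addrC subrK.
have [d d0 hd] := Uusc k0.
have [e' e'0 re'] := dilation_room.
have [e [e0 ed re]] : exists e, [/\ 0 < e, e <= d & r0 * (t + e) < 1].
  exists (Num.min d e'); rewrite lt_min d0 e'0 ge_min lexx; split=> //.
  apply: le_lt_trans re'; rewrite ler_wpM2l// lerD2l.
  by apply: (@le_trans _ _ e'); rewrite ?ge_min ?lexx ?orbT// ler_peMl ?ler1n// ltW.
pose A := [set F s | s in [set s | 0 <= s <= t]].
have t1' := t1.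
have A1 : A (F 1) by exists 1 => //=; rewrite ler01.
have Abnd : has_ubound A.
  have [B hB] := Ubnd; exists (B + eta * t ^+ 2) => _ [s /= /andP[s0 st] <-]; rewrite /F lerD//.
    by rewrite -lee_fin -UE//; exact: hB.
  by rewrite ler_pM2l// lerXn2r// nnegrE ?(ltW t0).
have Ale s : 0 <= s -> s <= t -> U s <= sup A - eta * s ^+ 2.
  by move=> s0 st; rewrite lerBrDr; apply: (ub_le_sup Abnd); exists s => //=; rewrite s0.
have eps0 : 0 < Num.min (eta * e ^+ 2) k by rewrite lt_min mulr_gt0 ?exprn_gt0.
(* s0 is maximal for F up to an error of at most eta e^2. The mean of the bound on U over the circle
   of radius e around s0 is sup A - eta (s0^2 + e^2), so [subint] gives F(s0) <= sup A - eta e^2, a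
   contradiction. *)
have [_ [s0 /= /andP[s00 s0t] <-]] := sup_adherent eps0 (conj (ex_intro _ _ A1) Abnd).
have m1 : Num.min (eta * e ^+ 2) k <= eta * e ^+ 2 by rewrite ge_min lexx.
have m2 : Num.min (eta * e ^+ 2) k <= k by rewrite ge_min lexx orbT.
move=> hs0; have SF1 : F 1 <= sup A by exact: ub_le_sup.
have s0td : s0 < t - d.
  rewrite ltNge; apply/negP => h; have h2 := hd s0 s00 s0t h.
  have h3 : eta * s0 ^+ 2 <= eta * t ^+ 2 by rewrite ler_pM2l// lerXn2r// nnegrE ?(ltW t0).
  have h4 : F s0 <= F t + k by rewrite /F addrAC lerD.
  move: h4 hs0 m2 SF1 kE; move: (Num.min _ _) (sup A) (F s0) (F t) (F 1) => x1 x2 x3 x4 x5.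
  by lra.
have s0e : s0 + e <= t by apply: le_trans (_ : t - d + e <= _); [rewrite lerD2r ltW|rewrite -lerBrDr lerD2l lerN2].
pose g (z : Cn) (s : C) := f ((s0%:C)%C *: (z : Vec) + s *: ((e%:C)%C *: (z : Vec))).
have gE z s : g z s = f (((s0%:C)%C + (e%:C)%C * s) *: (z : Vec)).
  by rewrite /g scalerDl scalerA [s * _]mulrC.
have cse (x : R) (s : C) : 0 <= x -> cabs s <= x -> cabs ((s0%:C)%C + (e%:C)%C * s) <= s0 + e * x.
  move=> x0 hs; apply: le_trans (cabsD _ _) _; rewrite cabsM !cabsR (ger0_norm s00) (gtr0_norm e0).
  by rewrite lerD2l ler_pM2l.
have gb (z : Cn) s : cabs s <= 1 -> G z * cabs (g z s) `^ p = G z * bmod f (((s0%:C)%C + (e%:C)%C * s) *: (z : Vec)) `^ p.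
  move=> hs; have [->|Gz] := eqVneq (G z) 0; first by rewrite !mul0r.
  rewrite bmodE ?gE// BallE; apply: le_lt_trans re; apply: scaled => //.
  apply: le_trans (cse 1 s ler01 hs) _; rewrite mulr1; apply: le_trans s0e _; rewrite lerDl; exact: ltW.
have H : (\int[V]_z (G z * cabs (g z 0%R) `^ p)%:E <= (sup A - eta * (s0 ^+ 2 + e ^+ 2))%:E)%E.
  apply: (@subint _ _ V G g p (fun w => sup A - eta * cabs ((s0%:C)%C + (e%:C)%C * w) ^+ 2)) => //.
  - move=> z Gz; apply: (hol_line hf re) => s hs; rewrite scalerA -scalerDl [s * _]mulrC.
    apply: scaled => //; apply: le_trans (cse _ _ _ hs) _; first by [].
    have : e * (9 / 5) <= e + e by move: e0; lra.
    by move: s0e; lra.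
  - move=> s hs; under eq_fun do rewrite gb//; exact: measurable_bmod_scale.
  - move=> w w1; have w1' : cabs w <= 1 by rewrite w1.
    under eq_integral do rewrite gb//.
    rewrite (@integral_rot G _ ((cabs ((s0%:C)%C + (e%:C)%C * w))%:C)%C)//; last first.
      by rewrite cabsR ger0_norm ?cabs_ge0.
    have cle : cabs ((s0%:C)%C + (e%:C)%C * w) <= t.
      by apply: le_trans (cse 1 w ler01 w1') _; rewrite mulr1.
    by rewrite UE ?cabs_ge0// lee_fin; apply: Ale; rewrite ?cabs_ge0.
  - by move=> N N1; rewrite umean_quad.
move: H; under eq_integral do rewrite gb ?cabs0 ?ler01// mulr0 addr0.
rewrite UE// lee_fin; move: hs0 m1; rewrite /F; move: (Num.min _ _) (U s0) (sup A) => x1 x2 x3.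
rewrite mulrDr; move: (eta * s0 ^+ 2) (eta * e ^+ 2) => x4 x5; lra.
Qed.

End RadialIntegral.

Lemma radial_mono_bounded_int : (\int[V]_z (G z * bmod f z `^ p)%:E <=
  \int[V]_z (G z * bmod f ((t%:C)%C *: (z : Vec)) `^ p)%:E)%E.
Proof.
have [U UE] : exists U : R -> R, forall s : R, 0 <= s -> s <= t ->
  (\int[V]_z (G z * bmod f ((s%:C)%C *: (z : Vec)) `^ p)%:E = (U s)%:E)%E.
  have [B hB] := Ubnd.
  exists (fun s => fine (\int[V]_z (G z * bmod f ((s%:C)%C *: (z : Vec)) `^ p)%:E)%E) => s s0 st.
  rewrite fineK// ge0_fin_numE; last by apply: integral_ge0 => z _; rewrite lee_fin mulr_ge0 ?powR_ge0.
  by apply: le_lt_trans (hB s s0 st) _; exact: ltry.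
rewrite (UE _ (ltW t0) (lexx t)) (_ : (\int[V]_z _ = (U 1)%:E)%E); first by rewrite lee_fin; exact: radial_mono_bounded.
by rewrite -(UE _ ler01 t1); apply: eq_integral => z _; rewrite (_ : (1%:C)%C = 1) ?scale1r.
Qed.

End Compact.

(** The truncations min(G, k) fall under [radial_mono_bounded_int], and [fatou_le] removes the bound
    k. *)
Lemma radial_mono (G : Cn -> R) (r0 t : R) : measurable_fun setT G -> (forall z, 0 <= G z) ->
  (forall (c : C) z, cabs c = 1 -> G (c *: (z : Vec)) = G z) ->
  0 <= r0 -> 1 <= t -> r0 * t < 1 -> (forall z, G z != 0 -> enorm (z : Vec) <= r0) ->
  (\int[V]_z (G z * bmod f z `^ p)%:E <= \int[V]_z (G z * bmod f ((t%:C)%C *: (z : Vec)) `^ p)%:E)%E.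
Proof.
move=> mG G0 Grot r00 t1 rt Gsupp.
pose Gk (k : nat) (z : Cn) := Num.min (G z) k%:R.
have mGk k : measurable_fun setT (Gk k) by apply: measurable_minr => //; exact: measurable_cst.
have Gk0 k z : 0 <= Gk k z by rewrite /Gk le_min G0 ler0n.
have GkG k z : Gk k z <= G z by rewrite /Gk ge_min lexx.
apply: (@fatou_le _ _ _ V (fun k z => Gk k z * bmod f z `^ p)).
- by move=> k; apply: measurable_funM => //; exact: measurable_bmod_powR.
- by move=> k z; rewrite mulr_ge0 ?powR_ge0.
- by apply: measurable_funM => //; exact: measurable_bmod_powR.
- by move=> z; rewrite mulr_ge0 ?powR_ge0.
- move=> z e e0; exists (Num.truncn (G z)).+1 => k hk.
  suff -> : Gk k z = G z by rewrite lerDl ltW.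
  by apply/min_idPl; apply: le_trans (ltW (truncnS_gt _)) _; rewrite ler_nat.
- move=> k; apply: le_trans (@radial_mono_bounded_int (Gk k) r0 t k%:R _ _ _ _ _ _ _ _) _ => //.
  + by move=> z; rewrite /Gk ge_min lexx orbT.
  + by move=> c z c1; rewrite /Gk Grot.
  + by move=> z Gz; apply: Gsupp; apply: contra Gz => /eqP h; rewrite /Gk h min_l ?ler0n.
  apply: ge0_le_integral => //.
  + by move=> z _; rewrite lee_fin mulr_ge0 ?powR_ge0.
  + by apply/measurable_EFinP; exact: measurable_bmod_scale.
  + by apply/measurable_EFinP; exact: measurable_bmod_scale.
  + by move=> z _; rewrite lee_fin ler_wpM2r ?powR_ge0.
Qed.
End RadialMonotonicity.

(** * Radial weights *)

Definition bR {R : realType} (b : bool) : R := if b then 1 else 0.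

Section Dyadic.
Variable R : realType.

Lemma bR_ge0 b : 0 <= bR b :> R. Proof. by case: b. Qed.

Lemma bR_le (b c : bool) : (b -> c) -> bR b <= bR c :> R.
Proof. by case: b c => -[] // /(_ isT). Qed.

Lemma bR_le1 b : bR b <= 1 :> R. Proof. by case: b. Qed.

Lemma measurable_bR d (T : measurableType d) (f g : T -> R) : measurable_fun setT f ->
  measurable_fun setT g -> measurable_fun setT (fun x => bR (f x <= g x) : R).
Proof.
move=> mf mg; apply: measurable_fun_ifT; [exact: measurable_fun_ler|exact: measurable_cst|exact: measurable_cst].
Qed.

Lemma powRN_le (e x y : R) : 0 <= e -> 0 < x -> x <= y -> y `^ (- e) <= x `^ (- e).
Proof.
move=> e0 x0 xy; have y0 : 0 < y by exact: lt_le_trans xy.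
by rewrite !powRN lef_pV2 ?posrE ?powR_gt0//; apply: powR_le => //; exact: ltW.
Qed.

(** D lies in some shell between k^j X and k^(j+1) X, where Phi D is at most Phi (k^j X). The
    indicators retain only the outer bound of the shell, so the sums to come run over balls and not
    over annuli. *)
Lemma dyadic (k X D : R) (Phi : R -> R) J : 1 < k -> 0 < X -> X <= D -> D <= k ^+ J.+1 * X ->
  (forall x, 0 <= Phi x) -> (forall x y, 0 < x -> x <= y -> Phi y <= Phi x) ->
  Phi D <= \sum_(j < J.+1) Phi (k ^+ j * X) * bR (D <= k ^+ j.+1 * X).
Proof.
move=> k1 X0 XD + P0 Pm; have k0 : 0 < k by apply: lt_trans k1.
elim: J => [|J IH] DJ.
  by rewrite big_ord1 expr0 mul1r DJ mulr1; exact: Pm.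
rewrite big_ord_recr /=; have [DJ'|DJ'] := leP D (k ^+ J.+1 * X).
  by apply: le_trans (IH DJ') _; rewrite lerDl mulr_ge0 ?bR_ge0.
rewrite DJ mulr1; apply: ler_wpDl; first by apply: sumr_ge0 => j _; rewrite mulr_ge0 ?bR_ge0.
by apply: Pm; [rewrite mulr_gt0// exprn_gt0|exact: ltW].
Qed.

Lemma geometric_le (q : R) J : 0 <= q -> q < 1 -> \sum_(j < J) q ^+ j <= (1 - q)^-1.
Proof.
move=> q0 q1; rewrite -[(1 - q)^-1]mul1r ler_pdivlMr ?subr_gt0//.
have -> : (\sum_(j < J) q ^+ j) * (1 - q) = 1 - q ^+ J.
  elim: J => [|J IH]; first by rewrite big_ord0 mul0r expr0 subrr.
  by rewrite big_ord_recr /= mulrDl IH exprSr; ring.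
by rewrite gerBl exprn_ge0.
Qed.

Lemma powR_ln_ratio (k x : R) : 1 < k -> 0 < x -> k `^ (ln x / ln k) = x.
Proof.
move=> k1 x0; have k0 : 0 < k by apply: lt_trans k1.
by rewrite /powR gt_eqF// divfK ?lnK ?posrE// gt_eqF// ln_gt0.
Qed.

Lemma lebesgue_scale (c : R) (g : R -> \bar R) : 0 < c -> measurable_fun setT g ->
  (forall s, 0 <= g s)%E ->
  (\int[@lebesgue_measure R]_s g s = c%:E * \int[@lebesgue_measure R]_s g (c * s)%R)%E.
Proof.
move=> c0 mg g0.
have ms : measurable_fun [set: measurableTypeR R] (fun s : measurableTypeR R => c * s : measurableTypeR R).
  exact: mulrl_measurable.
pose m : {measure set (measurableTypeR R) -> \bar R} :=
  mscale (NngNum (ltW c0)) (pushm (@lebesgue_measure R) ms).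
transitivity (\int[m]_s g s)%E; last first.
  have mg' : measurable_fun [set: measurableTypeR R] g by [].
  have h := ge0_integral_mscale (pushm (@lebesgue_measure R) ms) measurableT (NngNum (ltW c0)) mg' (fun s _ => g0 s).
  transitivity (c%:E * \int[pushm (@lebesgue_measure R) ms]_s g s)%E; first exact: h.
  by congr (_ * _)%E; exact: (integral_pushm (@lebesgue_measure R) ms mg' g0).
apply: (@eq_measure_integral _ _ R setT m (@lebesgue_measure R)) => A mA _.
apply: lebesgue_measure_unique => // _ [[a b] _ <-] /=.
pose S : set R := (fun s : R => c * s) @^-1` `]a, b].
transitivity (c%:E * (@lebesgue_measure R) S)%E; last by [].
have -> : S = `]a / c, b / c]%classic.
  by apply/seteqP; split => s /=; rewrite !in_itv /= ltr_pdivrMr// ler_pdivlMr// mulrC.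
rewrite !lebesgue_measure_itv /= !lte_fin ltr_pM2r ?invr_gt0//.
case: ifP => _; last by rewrite mule0.
rewrite -[LHS]/((b - a)%:E) -[RHS]/((c * (b / c - a / c))%:E); congr (_%:E).
by field; rewrite gt_eqF.
Qed.

End Dyadic.

(** * Tail integrals of a radial weight *)

Section RadialWeight.
Variable R : realType.
Local Notation lam := (@lebesgue_measure R).
Variables (w : R -> R) (hw : radial_weight w) (hwD : Dclass w).

Definition wext (s : R) : R := if 0 <= s < 1 then w s else 0.

Lemma wext_ge0 s : 0 <= wext s.
Proof. by rewrite /wext; case: ifP => // /hw.1/ltW. Qed.

Lemma wext_out s : ~~ (0 <= s < 1) -> wext s = 0.
Proof. by rewrite /wext => /negbTE ->. Qed.

Lemma measurable_wext : measurable_fun [set: R] wext.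
Proof.
have /(measurable_restrictT _ (measurable_itv _)) := hw.2.1.
congr (measurable_fun _ _); apply/funext => s; rewrite /patch /wext.
by have [/set_mem|/negP h] := boolP (s \in _); rewrite /= ?in_itv /=; [move=> ->|case: ifP => // hs; case: h; apply/mem_set; rewrite /= in_itv].
Qed.

Lemma measurable_ge_nat (c : R) : measurable_fun [set: R] (fun s : R => bR (c <= s) : R).
Proof. by apply: measurable_bR => //; exact: measurable_cst. Qed.

(* [Hw d] is [what w (1 - d)], as a real number and frozen for d >= 1. *)
Definition Hw (d : R) : R := fine (\int[lam]_s (wext s * bR (1 - d <= s))%:E)%E.

Lemma measurable_wext_tail d : measurable_fun [set: R] (fun s => wext s * bR (1 - d <= s)).
Proof. by apply: measurable_funM; [exact: measurable_wext|exact: measurable_ge_nat]. Qed.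

Lemma wext_tail_ge0 d s : 0 <= wext s * bR (1 - d <= s).
Proof. by rewrite mulr_ge0 ?wext_ge0 ?bR_ge0. Qed.

Lemma what_tail (r : R) : 0 <= r -> what w r = (\int[lam]_s (wext s * bR (1 - (1 - r) <= s))%:E)%E.
Proof.
move=> r0; rewrite /what [LHS]integral_mkcond; apply: eq_integral => s _.
rewrite subKr /patch /wext; have [/set_mem|/negP h] := boolP (s \in _); rewrite /= ?in_itv /=.
  by move=> /andP[rs s1]; rewrite (le_trans r0 rs) s1 rs mulr1.
case: ifP => [/andP[s0 s1]|_]; last by rewrite mul0r.
case: (leP r s) => rs; last by rewrite mulr0.
by case: h; apply/mem_set; rewrite /= in_itv /= rs.
Qed.

Lemma wext_fin : (\int[lam]_s (wext s * bR (1 - 1 <= s))%:E < +oo)%E.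
Proof.
rewrite (_ : (\int[lam]_s _ = what w 0)%E); last first.
  by rewrite what_tail//; apply: eq_integral => s _; rewrite subr0.
have /integrableP[_] := hw.2.2; apply: le_lt_trans; rewrite /what.
apply: ge0_le_integral => //.
- by move=> s; rewrite /= in_itv /= => /hw.1/ltW; rewrite lee_fin.
- by apply/measurable_EFinP; exact: hw.2.1.
- apply: measurableT_comp => //; apply/measurable_EFinP; exact: hw.2.1.
- by move=> s _; exact: lee_abs.
Qed.

Lemma HwE d : (\int[lam]_s (wext s * bR (1 - d <= s))%:E = (Hw d)%:E)%E.
Proof.
rewrite /Hw fineK// ge0_fin_numE; last by apply: integral_ge0 => s _; rewrite lee_fin wext_tail_ge0.
apply: le_lt_trans wext_fin; apply: ge0_le_integral => //.
- by move=> s _; rewrite lee_fin wext_tail_ge0.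
- by apply/measurable_EFinP; exact: measurable_wext_tail.
- by apply/measurable_EFinP; exact: measurable_wext_tail.
move=> s _; rewrite lee_fin subrr; have [s0|s0] := leP 0 s.
  by rewrite ler_wpM2l ?wext_ge0// bR_le1.
by rewrite wext_out ?mul0r// negb_and -ltNge s0.
Qed.

Lemma whatE (r : R) : 0 <= r -> what w r = (Hw (1 - r))%:E.
Proof. by move=> r0; rewrite what_tail// HwE. Qed.

Lemma Hw_ge0 d : 0 <= Hw d.
Proof. by rewrite -lee_fin -HwE; apply: integral_ge0 => s _; rewrite lee_fin wext_tail_ge0. Qed.

Lemma Hw_mono d e : d <= e -> Hw d <= Hw e.
Proof.
move=> de; rewrite -lee_fin -!HwE; apply: ge0_le_integral => //.
- by move=> s _; rewrite lee_fin wext_tail_ge0.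
- by apply/measurable_EFinP; exact: measurable_wext_tail.
- by apply/measurable_EFinP; exact: measurable_wext_tail.
move=> s _; rewrite lee_fin ler_wpM2l ?wext_ge0//; apply: bR_le => h.
by rewrite (le_trans _ h)// lerD2l lerN2.
Qed.

Lemma Hw_top d : 1 <= d -> Hw d = Hw 1.
Proof.
move=> d1; apply: EFin_inj; rewrite -!HwE; apply: eq_integral => s _; congr (_%:E).
have [s0|s0] := leP 0 s; last by rewrite wext_out ?mul0r// negb_and -ltNge s0.
by rewrite subrr s0 (le_trans _ s0)// subr_le0.
Qed.

Lemma Hw_gt0 d : 0 < d -> 0 < Hw d.
Proof.
wlog d1 : d / d <= 1 => [wl|d0].
  have [d1|d1] := leP d 1; first exact: wl.
  by move=> _; rewrite (Hw_top (ltW d1)); apply: wl.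
rewrite lt_def Hw_ge0 andbT; apply/eqP => h0.
have := HwE d; rewrite h0 => hi.
have mf := measurable_wext_tail d.
have : (\int[lam]_s `|(wext s * bR (1 - d <= s))%:E| = 0)%E.
  by rewrite -[RHS]hi; apply: eq_integral => s _; rewrite gee0_abs// lee_fin wext_tail_ge0.
move/(ae_eq_integral_abs lam measurableT (iffRL (measurable_EFinP _ _) mf)).
move=> [N [mN N0 hN]].
have sub : `[1 - d, 1[%classic `<=` N.
  move=> s; rewrite /= in_itv /= => /andP[ds s1]; apply: hN => /= /(_ I).
  have s0 : 0 <= s by apply: le_trans ds; rewrite subr_ge0.
  have s01 : 0 <= s < 1 by rewrite s0.
  by rewrite /wext s01 ds mulr1 => -[] /eqP; rewrite gt_eqF//; exact: hw.1.
have : (lam (`[(1 - d)%R, 1%R[%classic) <= lam N)%E by apply: le_measure; rewrite ?inE.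
rewrite [X in (_ <= X)%E]N0 lebesgue_measure_itv /= lte_fin ltrBlDr ltrDl d0.
by rewrite -EFinB lee_fin subKr leNgt d0.
Qed.

Lemma Hw_doubling : exists2 K : R, 1 <= K & forall d, 0 < d -> Hw (2 * d) <= K * Hw d.
Proof.
have [[K [K1 hK]] _] := hwD; exists K => // d d0.
have K0 : 0 <= K by apply: le_trans K1.
have [d2|d2] := leP (2 * d) 1.
  have := hK (1 - 2 * d); rewrite subr_ge0 d2 ltrBlDr ltrDl mulr_gt0// => /(_ isT).
  rewrite !whatE ?subr_ge0//; last by rewrite divr_ge0// addr_ge0// subr_ge0.
  rewrite subKr -EFinM lee_fin; congr (_ <= K * Hw _); by field.
have := hK 0; rewrite lexx ltr01 => /(_ isT).
rewrite !whatE ?addr0 ?subr0 ?divr_ge0// -EFinM lee_fin => h.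
rewrite (Hw_top (ltW d2)); apply: le_trans h _; rewrite ler_wpM2l//; apply: Hw_mono.
have : 1 - 1 / 2 = 1 / 2 :> R by field.
by move=> ->; rewrite ler_pdivrMr// mulrC ltW.
Qed.

Lemma Hw_doubling_pow : exists2 K : R, 1 <= K & forall j d, 0 < d -> Hw (2 ^+ j * d) <= K ^+ j * Hw d.
Proof.
have [K K1 hK] := Hw_doubling; exists K => // j d d0; elim: j => [|j IH]; first by rewrite !expr0 !mul1r.
rewrite !exprS -!mulrA; apply: le_trans (hK _ _) _; first by rewrite mulr_gt0// exprn_gt0.
by rewrite ler_wpM2l// (le_trans ler01).
Qed.

Lemma Hw_check : exists K1 K2 : R, [/\ 1 < K1, 1 < K2 & forall d, 0 < d -> d <= 1 -> K1 * Hw (d / K2) <= Hw d].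
Proof.
have [_ [K1 [K2 [h1 [h2 h]]]]] := hwD; exists K1, K2; split=> // d d0 d1.
have K20 : 0 < K2 by apply: lt_trans h2.
have := h (1 - d); rewrite subr_ge0 d1 ltrBlDr ltrDl d0 => /(_ isT).
rewrite subKr !whatE ?subKr// subr_ge0 ?d1//.
by rewrite ler_pdivrMr// mul1r (le_trans d1)// ltW.
Qed.

Lemma Hw_check_pow K1 K2 : 1 < K1 -> 1 < K2 -> (forall d, 0 < d -> d <= 1 -> K1 * Hw (d / K2) <= Hw d) ->
  forall j d, 0 < d -> d <= 1 -> Hw (d / K2 ^+ j) <= Hw d / K1 ^+ j.
Proof.
move=> h1 h2 h j d d0 d1; have K10 : 0 < K1 by apply: lt_trans h1.
have K20 : 0 < K2 by apply: lt_trans h2.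
rewrite ler_pdivlMr ?exprn_gt0// mulrC.
elim: j => [|j IH]; first by rewrite !expr0 mul1r divr1.
rewrite exprSr -mulrA; apply: le_trans IH; rewrite ler_pM2l ?exprn_gt0//.
rewrite (_ : d / K2 ^+ j.+1 = d / K2 ^+ j / K2); last by rewrite exprSr invfM mulrA.
apply: h.
- by rewrite divr_gt0// exprn_gt0.
- rewrite ler_pdivrMr ?exprn_gt0// mul1r (le_trans d1)// exprn_ege1// ltW//.
Qed.

Definition vw (e s : R) : R := (1 - s) `^ (- e) * wext s.

Lemma vw_ge0 e s : 0 <= vw e s. Proof. by rewrite mulr_ge0 ?powR_ge0 ?wext_ge0 ?bR_ge0. Qed.

Lemma measurable_vw e : measurable_fun [set: R] (vw e).
Proof.
apply: measurable_funM measurable_wext; apply: measurableT_comp (measurable_powR (- e)) _.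
by apply: measurable_funB => //; exact: measurable_cst.
Qed.

(** Reverse doubling makes the tails decay geometrically over shells of ratio [K2], which leaves
    room for a small negative power of 1 - s. The truncation s <= 1 - X J keeps the number of shells
    finite and is removed by [fatou_le]. *)
Lemma weight_tail : exists e C : R, [/\ 0 < e, 0 < C & forall d, 0 < d -> d <= 2 ->
  (\int[lam]_s (vw e s * bR (1 - d <= s))%:E <= (C * d `^ (- e) * Hw d)%:E)%E].
Proof.
have [K1 [K2 [h1 h2 h]]] := Hw_check.
have K10 : 0 < K1 by apply: lt_trans h1.
have K20 : 0 < K2 by apply: lt_trans h2.
pose s1 := Num.sqrt K1.
have s1K : s1 ^+ 2 = K1 by rewrite sqr_sqrtr// ltW.
have s11 : 1 < s1 by rewrite -[ltLHS]sqrtr1 ltr_sqrt.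
have s10 : 0 < s1 by apply: lt_trans s11.
(* Chosen so that K2^e is the square root of K1: on the j-th shell the power of 1 - s grows like
   K1^(j/2) while the tail decays like K1^-j. *)
pose e := ln s1 / ln K2.
have e0 : 0 < e by rewrite divr_gt0// ln_gt0.
have K2e : K2 `^ e = s1 by exact: powR_ln_ratio.
pose q := s1^-1.
have q0 : 0 <= q by rewrite invr_ge0 ltW.
have q1 : q < 1 by rewrite invf_lt1.
have main d : 0 < d -> d <= 1 -> (\int[lam]_s (vw e s * bR (1 - d <= s))%:E <= (s1 * (1 - q)^-1 * d `^ (- e) * Hw d)%:E)%E.
  move=> d0 d1; pose X J := d / K2 ^+ J.+1.
  have X0 J : 0 < X J by rewrite divr_gt0// exprn_gt0.
  have XE J j : (j <= J.+1)%N -> K2 ^+ j * X J = d / K2 ^+ (J.+1 - j).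
    by move=> jJ; rewrite /X -{1}(subnK jJ) exprD; field; rewrite !gt_eqF ?exprn_gt0.
  have mfac J : measurable_fun [set: R] (fun s => vw e s * bR (1 - d <= s) * bR (s <= 1 - X J)).
    apply: measurable_funM; first by apply: measurable_funM; [exact: measurable_vw|exact: measurable_ge_nat].
    by apply: measurable_bR => //; exact: measurable_cst.
  apply: (@fatou_le _ _ _ lam (fun J s => vw e s * bR (1 - d <= s) * bR (s <= 1 - X J))).
  - exact: mfac.
  - by move=> J s; rewrite mulr_ge0 ?bR_ge0// mulr_ge0 ?bR_ge0 ?vw_ge0.
  - by apply: measurable_funM; [exact: measurable_vw|exact: measurable_ge_nat].
  - by move=> s; rewrite mulr_ge0 ?vw_ge0 ?bR_ge0.
  - move=> s eps eps0; have [s1'|s1'] := leP 1 s.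
      have w0 : wext s = 0 by rewrite wext_out// negb_and -!leNgt s1' orbT.
      by exists 0%N => J _; rewrite /vw w0 mulr0 !mul0r add0r ltW.
    have [J0 hJ0] : exists J0, forall J, (J0 <= J)%N -> X J <= 1 - s.
      have sd0 : 0 < (1 - s) / d by rewrite divr_gt0// subr_gt0.
      have Kv0 : 0 <= K2^-1 by rewrite invr_ge0 ltW.
      have Kv1 : K2^-1 < 1 by rewrite invf_lt1.
      have [J0 hJ0] := pow_small Kv0 Kv1 sd0.
      exists J0 => J hJ; rewrite /X mulrC -ler_pdivlMr// -exprVn; apply: le_trans (ltW hJ0).
      by apply: ler_wiXn2l => //; [exact: ltW|exact: leq_trans (leqnSn _)].
    exists J0 => J /hJ0 hJ; rewrite lerBrDr addrC -lerBrDr in hJ.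
    by rewrite hJ mulr1 lerDl ltW.
  move=> J.
  have pw s : vw e s * bR (1 - d <= s) * bR (s <= 1 - X J) <=
      \sum_(j < J.+1) (K2 ^+ j * X J) `^ (- e) * (wext s * bR (1 - K2 ^+ j.+1 * X J <= s)).
    have [sX|sX] := leP s (1 - X J); last by rewrite mulr0 sumr_ge0// => j _; rewrite !mulr_ge0 ?powR_ge0 ?wext_ge0 ?bR_ge0.
    have [sd|sd] := leP (1 - d) s; last by rewrite mulr0 mul0r sumr_ge0// => j _; rewrite !mulr_ge0 ?powR_ge0 ?wext_ge0 ?bR_ge0.
    rewrite !mulr1 /vw; have D1 : X J <= 1 - s by rewrite lerBrDr addrC -lerBrDr.
    have D2 : 1 - s <= K2 ^+ J.+1 * X J by rewrite XE// subnn expr0 divr1 lerBlDr addrC -lerBlDr.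
    have := @dyadic _ K2 (X J) (1 - s) (fun x => x `^ (- e)) J h2 (X0 J) D1 D2 (fun x => powR_ge0 _ _).
    move=> /(_ _)/(ler_wpM2r (wext_ge0 s)) H; apply: le_trans (H _) _.
      by move=> x y; apply: powRN_le; exact: ltW.
    rewrite mulr_suml; apply: ler_sum => j _; rewrite -mulrA ler_wpM2l ?powR_ge0// mulrC.
    by rewrite lerBlDr addrC -lerBlDr.
  apply: (@le_trans _ _ (\int[lam]_s (\sum_(j < J.+1) (K2 ^+ j * X J) `^ (- e) * (wext s * bR (1 - K2 ^+ j.+1 * X J <= s)))%:E)%E).
    apply: ge0_le_integral => //.
    - by move=> s _; rewrite lee_fin mulr_ge0 ?bR_ge0// mulr_ge0 ?bR_ge0 ?vw_ge0.
    - by apply/measurable_EFinP; exact: mfac.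
    - apply/measurable_EFinP; apply: measurable_sum => j; apply: measurable_funM; first exact: measurable_cst.
      exact: measurable_wext_tail.
    - by move=> s _; rewrite lee_fin.
  under eq_integral do rewrite -sumEFin.
  rewrite ge0_integral_sum//; last 2 first.
  - move=> j; apply/measurable_EFinP; apply: measurable_funM; first exact: measurable_cst.
    exact: measurable_wext_tail.
  - by move=> j s _; rewrite lee_fin !mulr_ge0 ?powR_ge0 ?wext_ge0 ?bR_ge0.
  have -> : \sum_(j < J.+1) (\int[lam]_s ((K2 ^+ j * X J) `^ (- e) * (wext s * bR (1 - K2 ^+ j.+1 * X J <= s)))%:E)%E =
     (\sum_(j < J.+1) (K2 ^+ j * X J) `^ (- e) * Hw (K2 ^+ j.+1 * X J))%:E.
    rewrite -sumEFin; apply: eq_bigr => j _; rewrite EFinM -HwE -ge0_integralZl//.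
    - by apply/measurable_EFinP; exact: measurable_wext_tail.
    - by move=> s _; rewrite lee_fin wext_tail_ge0.
    - by rewrite lee_fin powR_ge0.
  rewrite lee_fin (reindex_inj rev_ord_inj) /=.
  apply: (@le_trans _ _ (\sum_(j < J.+1) s1 * (d `^ (- e) * Hw d) * q ^+ j)).
    apply: ler_sum => j _; rewrite subSS XE ?leq_subr//; last by rewrite (leq_trans (leq_subr _ _)).
    rewrite XE ?subSS; last by rewrite ltnS leq_subr.
    have -> : (J.+1 - (J - j) = j.+1)%N by rewrite subSn ?leq_subr// subKn// -ltnS.
    have -> : (J - (J - j) = j)%N by rewrite subKn// -ltnS.
    have -> : (d / K2 ^+ j.+1) `^ (- e) = s1 ^+ j.+1 * d `^ (- e).
      rewrite !powRN powRM ?invr_ge0 ?exprn_ge0 ?(ltW d0) ?(ltW K20)// invfM mulrC; congr (_ * _).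
      elim: (j.+1) => [|m IH]; first by rewrite !expr0 invr1 powR1 invr1.
      rewrite !exprS invfM powRM ?invr_ge0 ?exprn_ge0 ?(ltW K20)// invfM IH; congr (_ * _).
      by rewrite -(powR_inv1 (ltW K20)) -powRrM mulN1r powRN invrK K2e.
    apply: (@le_trans _ _ (s1 ^+ j.+1 * d `^ (- e) * (Hw d / K1 ^+ j))).
      by rewrite ler_wpM2l ?mulr_ge0 ?powR_ge0 ?exprn_ge0 ?(ltW s10)//; exact: Hw_check_pow.
    rewrite -s1K -exprM mulnC exprM expr2 exprS le_eqVlt; apply/orP; left; apply/eqP.
    have sj : s1 ^+ j != 0 by rewrite gt_eqF// exprn_gt0.
    by rewrite /q exprVn; field; rewrite sj.
  rewrite -mulr_sumr mulrAC -!mulrA [(1 - q)^-1 * _]mulrC ler_wpM2l ?(ltW s10)//.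
  by rewrite [leRHS]mulrC ler_wpM2r ?mulr_ge0 ?powR_ge0 ?Hw_ge0//; exact: geometric_le.
(* The factor 2^e pays for 1 < d <= 2, where [Hw] is frozen while d^-e still decreases. *)
exists e, (s1 * (1 - q)^-1 * 2 `^ e); split=> //.
  by rewrite !mulr_gt0 ?powR_gt0// invr_gt0 subr_gt0.
move=> d d0 d2; have [d1|d1] := leP d 1.
  apply: le_trans (main d d0 d1) _; rewrite lee_fin ler_wpM2r ?Hw_ge0// ler_wpM2r ?powR_ge0//.
  rewrite ler_peMr ?mulr_ge0 ?invr_ge0 ?subr_ge0 ?(ltW q1) ?(ltW s10)//.
  by have := @powR_le _ e 1 2 (ltW e0) ler01 ltac:(by rewrite ler1n); rewrite powR1.
have -> : (\int[lam]_s (vw e s * bR (1 - d <= s))%:E = \int[lam]_s (vw e s * bR (1 - 1 <= s))%:E)%E.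
  apply: eq_integral => s _; congr (_%:E); rewrite /vw -!mulrA; congr (_ * _).
  have [s0|s0] := leP 0 s; last by rewrite wext_out ?mul0r// negb_and -ltNge s0.
  by rewrite subrr s0 (le_trans _ s0)// subr_le0 ltW.
apply: le_trans (main 1 ltr01 (lexx _)) _; rewrite lee_fin (Hw_top (ltW d1)) ler_wpM2r ?Hw_ge0//.
have X0 : 0 <= s1 / (1 - q) by rewrite divr_ge0 ?subr_ge0 ?(ltW q1) ?(ltW s10).
move: (s1 / (1 - q)) X0 => X X0.
rewrite -[leRHS]mulrA powR1 /= mulr1; apply: ler_peMr => //.
rewrite powRN ler_pdivlMr ?powR_gt0// mul1r; apply: powR_le => //; exact: ltW.
Qed.

End RadialWeight.

(** * Weighted volume of nonisotropic balls *)

Section PolarEstimate.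
Variables (R : realType) (n : nat).
Local Notation C := R[i].
Local Notation Vec := 'rV[C]_n.
Local Notation Cn := (Cn R n).
Local Notation lam := (@lebesgue_measure R).
Variables (V : {measure set Cn -> \bar R}) (hV : normalized_volume V) (n_gt0 : (0 < n)%N).

Lemma lam_sigma_finite : sigma_finite setT lam.
Proof. exact: sigma_finiteT. Qed.

Lemma measurable_scale2 : measurable_fun [set: Cn * measurableTypeR R]
  (fun x : Cn * measurableTypeR R => (x.2%:C)%C *: (x.1 : Vec) : Cn).
Proof.
have m2 : measurable_fun [set: Cn * measurableTypeR R] (fun x : Cn * measurableTypeR R => x.2 : R).
  exact: measurable_snd.
apply: measurable_Cn_fun => j.
  rewrite (_ : (fun _ => _) = (fun x : Cn * measurableTypeR R => x.2 * complex.Re ((x.1 : Vec) 0 j))).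
    apply: measurable_funM => //; exact: measurableT_comp (measurable_Re j) measurable_fst.
  by apply/funext => x; rewrite !mxE cReM /= mul0r subr0.
rewrite (_ : (fun _ => _) = (fun x : Cn * measurableTypeR R => x.2 * complex.Im ((x.1 : Vec) 0 j))).
  apply: measurable_funM => //; exact: measurableT_comp (measurable_Im j) measurable_fst.
by apply/funext => x; rewrite !mxE cImM /= mul0r addr0.
Qed.

Lemma vol_point0 : V [set (0 : Vec)] = 0%E.
Proof.
have [c [c0 [hb _]]] := hV.
have -> : [set (0 : Vec)] = box (fun _ : 'I_n => 0) (fun=> 0) (fun=> 0) (fun=> 0).
  apply/seteqP; split => [z /= ->|z hz] /=; first by move=> j; rewrite !mxE /= lexx.
  apply/rowP => j; rewrite mxE; have [/andP[h1 h2] /andP[h3 h4]] := hz j.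
  by apply/eqP; rewrite eq_complex !eq_le /= h1 h2 h3 h4.
rewrite hb//; congr (_%:E); rewrite (bigD1 (Ordinal n_gt0))//= subrr mul0r mul0r mulr0//.
Qed.

Lemma integral_off0 (F : Cn -> R) : measurable_fun setT F -> (forall z, 0 <= F z) ->
  (\int[V]_z (F z)%:E = \int[V]_z (F z * bR (~~ (enorm (z : Vec) <= 0)))%:E)%E.
Proof.
move=> mF F0.
have mF' : measurable_fun setT (fun z : Cn => F z * bR (~~ (enorm (z : Vec) <= 0))).
  apply: measurable_funM => //; rewrite (_ : (fun _ => _) = (fun z : Cn => 1 - bR (enorm (z : Vec) <= 0))).
    apply: measurable_funB; first exact: measurable_cst.
    by apply: measurable_bR; [exact: measurable_enorm|exact: measurable_cst].
  by apply/funext => z; case: (_ <= _); rewrite /= ?subrr ?subr0.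
apply: ge0_ae_eq_integral => //.
- exact/measurable_EFinP.
- exact/measurable_EFinP.
- by move=> z _; rewrite lee_fin.
- by move=> z _; rewrite lee_fin mulr_ge0 ?bR_ge0.
exists [set (0 : Vec)]; split.
- have -> : [set (0 : Vec)] = box (fun _ : 'I_n => 0) (fun=> 0) (fun=> 0) (fun=> 0) :> set Cn.
    apply/seteqP; split => [z /= ->|z hz] /=; first by move=> j; rewrite !mxE /= lexx.
    apply/rowP => j; rewrite mxE; have [/andP[h1 h2] /andP[h3 h4]] := hz j.
    by apply/eqP; rewrite eq_complex !eq_le /= h1 h2 h3 h4.
  exact: measurable_box.
- exact: vol_point0.
- move=> z /= h; apply: contrapT => z0; apply: h => _; rewrite -ltNge.
  rewrite lt_def enorm_ge0 andbT; case: eqP => [e|_]; last by rewrite mulr1.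
  by case: z0; apply: sqnorm0_eq; rewrite -enorm_sqr e expr0n.
Qed.

(** The points z of the shell outside the ball stand for directions, and t runs along the ray
    through z. *)
Definition polarK (F : Cn -> R) (rho : R) (x : Cn * measurableTypeR R) : R :=
  bR (1 <= enorm (x.1 : Vec)) * bR (enorm (x.1 : Vec) <= 1 + rho) *
  (bR (0 <= x.2) * bR (x.2 <= 1) * (x.2 ^+ (2 * n).-1 * F ((x.2%:C)%C *: (x.1 : Vec)))).

Lemma measurable_polarK F rho : measurable_fun setT F -> measurable_fun setT (polarK F rho).
Proof.
move=> mF.
have m1 : measurable_fun [set: Cn * measurableTypeR R] (fun x : Cn * measurableTypeR R => enorm (x.1 : Vec)).
  exact: measurableT_comp (@measurable_enorm R n) measurable_fst.
have m2 : measurable_fun [set: Cn * measurableTypeR R] (fun x : Cn * measurableTypeR R => x.2 : R).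
  exact: measurable_snd.
have mc (c : R) : measurable_fun [set: Cn * measurableTypeR R] (fun=> c) by exact: measurable_cst.
apply: measurable_funM; first by apply: measurable_funM; apply: measurable_bR.
apply: measurable_funM; first by apply: measurable_funM; apply: measurable_bR.
apply: measurable_funM; last exact: measurableT_comp mF measurable_scale2.
by apply: measurable_funX.
Qed.

Lemma polarK_ge0 F rho : (forall z, 0 <= F z) -> forall x, 0 <= polarK F rho x.
Proof.
move=> F0 x; rewrite /polarK; have [t0|t0] := leP 0 x.2; last by rewrite mul0r mul0r mulr0.
by rewrite !mulr_ge0 ?bR_ge0 ?exprn_ge0.
Qed.

Lemma measurable_polarK_int (F : Cn -> R) rho : measurable_fun setT F -> (forall z, 0 <= F z) ->
  measurable_fun setT (fun z : Cn => (\int[lam]_t (polarK F rho (z, t))%:E)%E).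
Proof.
move=> mF F0.
have := @measurable_fun_fubini_tonelli_F _ _ _ _ R (sfmeas lam_sigma_finite) (fun x => (polarK F rho x)%:E).
by apply; [apply/measurable_EFinP; exact: measurable_polarK|move=> x; rewrite lee_fin polarK_ge0].
Qed.

(* Polar integration by averaging the dilations z |-> tz over a spherical
   shell; the weight t^(2n-1) compensates the Jacobian. *)
Lemma polar_le (F : Cn -> R) (rho : R) : measurable_fun setT F -> (forall z, 0 <= F z) ->
  (forall z, F z != 0 -> 0 < enorm (z : Vec) /\ enorm (z : Vec) <= 1) -> 0 < rho -> rho <= 2 ->
  ((rho / 3)%:E * \int[V]_z (F z)%:E <=
   \int[V]_z \int[lam]_t (polarK F rho (z, t))%:E)%E.
Proof.
move=> mF F0 Fs r0 r2.
have r1 : 0 < 1 + rho by rewrite addr_gt0.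
have n2 : (0 < 2 * n)%N by rewrite muln_gt0.
pose K := polarK F rho.
(* The kernel after the change of variables u = t z. For fixed u the parameter t runs over
   [|u| / (1 + rho), |u|], whose length divided by |u| is rho / (1 + rho) >= rho / 3. *)
pose L (x : Cn * measurableTypeR R) : R := bR (x.2 <= 1) * bR (x.2 <= enorm (x.1 : Vec)) *
   bR (enorm (x.1 : Vec) <= x.2 * (1 + rho)) * (enorm (x.1 : Vec) `^ (- 1) * F x.1).
have m1 : measurable_fun [set: Cn * measurableTypeR R] (fun x : Cn * measurableTypeR R => enorm (x.1 : Vec)).
  exact: measurableT_comp (@measurable_enorm R n) measurable_fst.
have m2 : measurable_fun [set: Cn * measurableTypeR R] (fun x : Cn * measurableTypeR R => x.2 : R).
  exact: measurable_snd.
have mc (c : R) : measurable_fun [set: Cn * measurableTypeR R] (fun=> c) by exact: measurable_cst.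
have mK : measurable_fun setT K by exact: measurable_polarK.
have mL : measurable_fun setT L.
  apply: measurable_funM; last first.
    apply: measurable_funM; last exact: measurableT_comp mF measurable_fst.
    exact: measurableT_comp (measurable_powR (- 1)) m1.
  apply: measurable_funM; first by apply: measurable_funM; apply: measurable_bR.
  by apply: measurable_bR => //; apply: measurable_funM.
have K0 x : 0 <= K x by exact: polarK_ge0.
have L0 x : 0 <= L x by rewrite /L !mulr_ge0 ?bR_ge0 ?powR_ge0.
have KL t : (\int[V]_u (L (u, t))%:E <= \int[V]_z (K (z, t))%:E)%E.
  have [t0|t0] := leP t 0.
    rewrite (eq_integral (fun=> 0%E)) ?integral0.
      by apply: integral_ge0 => z _; rewrite lee_fin K0.
    move=> u _; congr (_%:E); rewrite /L /=.
    have [Fu|/Fs [u0 _]] := eqVneq (F u) 0; first by rewrite Fu !mulr0.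
    have [h|_] := leP (enorm (u : Vec)) (t * (1 + rho)); last by rewrite mulr0 mul0r.
    have : t * (1 + rho) <= 0 by rewrite mulr_le0_ge0// ltW.
    by move=> /(le_trans h); rewrite leNgt u0.
  pose G (u : Cn) := (bR (t <= 1) * bR (t <= enorm (u : Vec)) * bR (enorm (u : Vec) <= t * (1 + rho)) * (t^-1 * F u))%:E : \bar R.
  have mG : measurable_fun setT G.
    apply/measurable_EFinP; apply: measurable_funM; last by apply: measurable_funM => //; exact: measurable_cst.
    by apply: measurable_funM; [apply: measurable_funM; [exact: measurable_cst|]|];
      apply: measurable_bR; rewrite ?measurable_enorm//; exact: measurable_cst || exact: measurable_enorm.
  have G0 u : (0 <= G u)%E by rewrite lee_fin !mulr_ge0 ?bR_ge0// invr_ge0 ltW.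
  apply: (@le_trans _ _ (\int[V]_u G u)%E).
    apply: ge0_le_integral => //.
    - by move=> u _; rewrite lee_fin.
    - by apply/measurable_EFinP; exact: measurableT_comp mL (measurable_pair2 _).
    - move=> u _; rewrite lee_fin /L /=.
      have [tu|_] := leP t (enorm (u : Vec)); last by rewrite !(mulr0, mul0r).
      rewrite ler_wpM2l ?mulr_ge0 ?bR_ge0// ler_wpM2r// powR_inv1 ?enorm_ge0//.
      by rewrite lef_pV2// posrE (lt_le_trans t0).
  rewrite (vol_scale hV t0 mG G0) -ge0_integralZl//; last 2 first.
  - exact: measurableT_comp mG (measurable_scale _).
  - by rewrite lee_fin exprn_ge0// ltW.
  rewrite le_eqVlt; apply/orP; left; apply/eqP.
  apply: eq_integral => z _; rewrite -EFinM; congr (_%:E); rewrite /G /K /polarK /= (ltW t0) mul1r.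
  rewrite enormZ cabsR (gtr0_norm t0) ler_pMr// ler_pM2l//.
  have -> : t ^+ (2 * n) = t * t ^+ (2 * n).-1 by rewrite -exprS prednK.
  by field; rewrite gt_eqF.
have inner u : (((rho / 3) * F u)%:E <= \int[lam]_t (L (u, t))%:E)%E.
  have [->|Fu] := eqVneq (F u) 0.
    by rewrite mulr0; apply: integral_ge0 => t _; rewrite lee_fin.
  have [u0 u1] := Fs u Fu; set s := enorm (u : Vec) in u0 u1.
  have s2 : s / (1 + rho) <= s by rewrite ler_pdivrMr// ler_peMr ?(ltW u0)// lerDl ltW.
  rewrite (eq_integral (fun t : measurableTypeR R => (s^-1 * F u)%:E * (\1_(`[s / (1 + rho), s]%classic : set R) t : R)%:E)%E); last first.
    move=> t _; rewrite -EFinM; congr (_%:E); rewrite /L /= -/s powR_inv1 ?enorm_ge0// mulrC; congr (_ * _).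
    rewrite indicE mem_setE in_itv /= ler_pdivrMr// andbC.
    have [ts|_] := leP t s; last by rewrite mulr0 mul0r.
    by rewrite (le_trans ts u1) !mul1r; case: (_ <= _).
  rewrite ge0_integralZl//; last 2 first.
  - by apply/measurable_EFinP; apply: measurable_indic; exact: measurable_itv.
  - by rewrite lee_fin mulr_ge0// invr_ge0 ltW.
  rewrite integral_indic//.
  have hl : lam (`[s / (1 + rho), s]%classic `&` setT) = (s - s / (1 + rho))%:E.
    rewrite setIT lebesgue_measure_itv /= lte_fin.
    by rewrite ltr_pdivrMr// ltr_pMr// ltrDl r0 EFinB.
  apply: (@le_trans _ _ ((s^-1 * F u)%:E * (s - s / (1 + rho))%:E)%E); last by rewrite -hl.
  rewrite -EFinM lee_fin.
  have -> : s^-1 * F u * (s - s / (1 + rho)) = rho / (1 + rho) * F u.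
    by field; rewrite !gt_eqF.
  by rewrite ler_wpM2r// ler_wpM2l ?(ltW r0)// lef_pV2 ?posrE//; lra.
rewrite (@tonelli _ _ _ _ R V lam (fun x => (K x)%:E)); last 4 first.
- exact: vol_sigma_finite.
- exact: lam_sigma_finite.
- exact/measurable_EFinP.
- by move=> x; rewrite lee_fin.
apply: (@le_trans _ _ (\int[lam]_t \int[V]_u (L (u, t))%:E)%E); last first.
  apply: ge0_le_integral => //.
  - by move=> t _; apply: integral_ge0 => u _; rewrite lee_fin.
  - have := @measurable_fun_fubini_tonelli_G _ _ _ _ R (sfmeas (vol_sigma_finite hV)) (fun x => (L x)%:E).
    by apply; [exact/measurable_EFinP|move=> x; rewrite lee_fin].
  - have := @measurable_fun_fubini_tonelli_G _ _ _ _ R (sfmeas (vol_sigma_finite hV)) (fun x => (K x)%:E).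
    by apply; [exact/measurable_EFinP|move=> x; rewrite lee_fin].
rewrite -(@tonelli _ _ _ _ R V lam (fun x => (L x)%:E)); last 4 first.
- exact: vol_sigma_finite.
- exact: lam_sigma_finite.
- exact/measurable_EFinP.
- by move=> x; rewrite lee_fin.
rewrite -ge0_integralZl//; last 3 first.
- exact/measurable_EFinP.
- by move=> u _; rewrite lee_fin.
- by rewrite lee_fin divr_ge0// ltW.
apply: ge0_le_integral => //.
- by move=> u _; rewrite -EFinM lee_fin mulr_ge0// divr_ge0// ltW.
- by apply/measurable_EFinP; apply: measurable_funM => //; exact: measurable_cst.
- have := @measurable_fun_fubini_tonelli_F _ _ _ _ R (sfmeas lam_sigma_finite) (fun x => (L x)%:E).
  by apply; [exact/measurable_EFinP|move=> x; rewrite lee_fin].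
- by move=> u _; rewrite -EFinM; exact: inner.
Qed.

Variables (w : R -> R) (hw : radial_weight w) (hwD : Dclass w).

(** If a ray through z of the shell meets the nonisotropic ball of radius rho, then z lies in
    [Kset a (3 * rho)], and the integral along the ray is bounded by [weight_tail]. The factor
    3^(n+2) collects the volume of [Kset] at scale 3 rho and the division by rho / 3 in
    [polar_le]. *)
Lemma omega_tail : exists e Ct : R, [/\ 0 < e, 0 < Ct & forall a rho, Ball (a : Vec) -> 0 < rho -> rho <= 2 ->
  (\int[V]_z (vw w e (enorm (z : Vec)) * bR (kd (z : Vec) a <= rho))%:E <=
   (Ct * (rho ^+ n * rho `^ (- e)) * Hw w rho)%:E)%E].
Proof.
have [e [C0 [e0 C00 ht]]] := weight_tail hw hwD.
have [k k0 hk] := vol_Kset hV 6 n_gt0.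
exists e, (k * 3 ^+ n.+2 * C0); split=> //; first by rewrite mulr_gt0// mulr_gt0// exprn_gt0.
move=> a rho Ba r0 r2.
pose F (z : Cn) := vw w e (enorm (z : Vec)) * bR (kd (z : Vec) a <= rho) * bR (~~ (enorm (z : Vec) <= 0)).
have mvz : measurable_fun setT (fun z : Cn => vw w e (enorm (z : Vec))).
  exact: measurableT_comp (measurable_vw hw e) (@measurable_enorm R n).
have mv0 : measurable_fun setT (fun z : Cn => vw w e (enorm (z : Vec)) * bR (kd (z : Vec) a <= rho)).
  by apply: measurable_funM => //; apply: measurable_bR; [exact: measurable_kd|exact: measurable_cst].
have F00 z : 0 <= vw w e (enorm (z : Vec)) * bR (kd (z : Vec) a <= rho) by rewrite mulr_ge0 ?bR_ge0 ?vw_ge0.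
rewrite (integral_off0 mv0 F00) -/F.
have mF : measurable_fun setT F.
  apply: measurable_funM => //; rewrite (_ : (fun _ => _) = (fun z : Cn => 1 - bR (enorm (z : Vec) <= 0))).
    apply: measurable_funB; first exact: measurable_cst.
    by apply: measurable_bR; [exact: measurable_enorm|exact: measurable_cst].
  by apply/funext => z; case: (_ <= _); rewrite /= ?subrr ?subr0.
have F0 z : 0 <= F z by rewrite mulr_ge0 ?bR_ge0.
have Fs (z : Cn) : F z != 0 -> 0 < enorm (z : Vec) /\ enorm (z : Vec) <= 1.
  rewrite /F => FN0; have [z0|z0] := leP (enorm (z : Vec)) 0; first by move: FN0; rewrite z0 mulr0 eqxx.
  split=> //; rewrite leNgt; apply/negP => h; move: FN0.
  by rewrite /vw wext_out ?(mulr0, mul0r) ?eqxx// negb_and -!leNgt (ltW h) orbT.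
have W0 : 0 <= C0 * rho `^ (- e) * Hw w rho by rewrite !mulr_ge0 ?powR_ge0 ?Hw_ge0// ltW.
have key (z : Cn) : (\int[lam]_t (polarK F rho (z, t))%:E <=
      (C0 * rho `^ (- e) * Hw w rho)%:E * (\1_(Kset a (3 * rho) : set Cn) z : R)%:E)%E.
  rewrite /polarK /=; have [z1|_] := leP 1 (enorm (z : Vec)); last first.
    by rewrite (eq_integral (fun=> 0%E)) ?integral0 ?mule_ge0// => t _; rewrite !mul0r.
  have [z2|_] := leP (enorm (z : Vec)) (1 + rho); last first.
    by rewrite (eq_integral (fun=> 0%E)) ?integral0 ?mule_ge0// => t _; rewrite mulr0 !mul0r.
  have z0 : 0 < enorm (z : Vec) by apply: lt_le_trans z1.
  pose g (s : R) := (vw w e s * bR (1 - rho <= s))%:E : \bar R.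
  have mg : measurable_fun setT g.
    by apply/measurable_EFinP; apply: measurable_funM; [exact: measurable_vw|exact: measurable_ge_nat].
  have g0 s : (0 <= g s)%E by rewrite lee_fin mulr_ge0 ?bR_ge0 ?vw_ge0.
  have pw (t : R) : 0 <= t -> t <= 1 -> F ((t%:C)%C *: (z : Vec)) <=
     \1_(Kset a (3 * rho) : set Cn) z * (vw w e (enorm (z : Vec) * t) * bR (1 - rho <= enorm (z : Vec) * t)).
    move=> t0 t1; rewrite /F enormZ cabsR (ger0_norm t0) [t * _]mulrC.
    apply: le_trans (_ : vw w e (enorm (z : Vec) * t) * bR (kd ((t%:C)%C *: (z : Vec)) a <= rho) <= _).
      by rewrite ler_piMr ?bR_le1// mulr_ge0 ?bR_ge0 ?vw_ge0.
    have [zt1|zt1] := leP 1 (enorm (z : Vec) * t).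
      by rewrite /vw wext_out ?(mulr0, mul0r)// negb_and -!leNgt zt1 orbT.
    have [hk1|hk1] := leP (kd ((t%:C)%C *: (z : Vec)) a) rho; last by rewrite mulr0 mulr_ge0// mulr_ge0 ?bR_ge0 ?vw_ge0.
    have a1 : enorm a < 1 by exact: Ba.
    have h1 : 1 - rho <= enorm (z : Vec) * t.
      have := kd_ge ((t%:C)%C *: (z : Vec)) a; rewrite enormZ cabsR (ger0_norm t0) [t * _]mulrC => h.
      have : enorm (z : Vec) * t * enorm a <= enorm (z : Vec) * t by rewrite ler_piMr ?mulr_ge0 ?enorm_ge0// ltW.
      lra.
    have h2 : kd (z : Vec) a <= 3 * rho.
      have e1 : 1 - cinner (z : Vec) a = (1 - cinner ((t%:C)%C *: (z : Vec)) a) - ((1 - t)%:C)%C * cinner (z : Vec) a.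
        by rewrite cinnerZl rmorphB /=; ring.
      rewrite /kd e1; apply: le_trans (cabsB _ _) _; rewrite -/(kd _ _) cabsM cabsR ger0_norm ?subr_ge0//.
      have := cabs_cinner (z : Vec) a => h3.
      have h4 : cabs (cinner (z : Vec) a) <= enorm (z : Vec) by apply: le_trans h3 _; rewrite ler_piMr ?enorm_ge0// ltW.
      have h5 : (1 - t) * cabs (cinner (z : Vec) a) <= (1 - t) * enorm (z : Vec) by rewrite ler_wpM2l ?subr_ge0.
      have h6 : (1 - t) * enorm (z : Vec) = enorm (z : Vec) - enorm (z : Vec) * t by ring.
      lra.
    rewrite h1 !mulr1 indicE mem_set ?mul1r//; split=> //=.
    by apply: le_trans z2 _; rewrite lerD2l ler_peMl ?ler1n// ltW.
  apply: (@le_trans _ _ (\int[lam]_t ((\1_(Kset a (3 * rho) : set Cn) z : R)%:E * g (enorm (z : Vec) * t)%R))%E).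
    apply: ge0_le_integral => //.
    - move=> t _; rewrite lee_fin !mulr1 mul1r.
      have [t0|t0] := leP 0 t; last by rewrite mul0r mul0r.
      by move: (F0 ((t%:C)%C *: (z : Vec))); move: (F _) => y y0; rewrite !mulr_ge0 ?bR_ge0 ?exprn_ge0.
    - apply/measurable_EFinP; apply: measurable_funM; first exact: measurable_cst.
      apply: measurable_funM; first by apply: measurable_funM; apply: measurable_bR => //; exact: measurable_cst.
      apply: measurable_funM; first exact: measurable_funX.
      exact: measurableT_comp mF (measurableT_comp measurable_scale2 (measurable_pair1 (z : Cn))).
    - apply: measurable_funeM; apply: measurableT_comp mg _; exact: mulrl_measurable.
    - move=> t _; rewrite -EFinM lee_fin !mulr1 mul1r.
      have [t0|t0] := leP 0 t; last by rewrite mul0r mul0r mulr_ge0// mulr_ge0 ?bR_ge0 ?vw_ge0.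
      have [t1|t1] := leP t 1; last by rewrite mulr0 mul0r mulr_ge0// mulr_ge0 ?bR_ge0 ?vw_ge0.
      rewrite !mul1r; apply: le_trans (pw t t0 t1).
      by rewrite ler_piMl// exprn_ile1.
  rewrite ge0_integralZl//; last first.
  - apply: measurableT_comp mg _; exact: mulrl_measurable.
  rewrite muleC; apply: lee_wpmul2r; first by rewrite lee_fin.
  apply: le_trans (ht rho r0 r2); rewrite -[X in (_ <= X)%E]/(\int[lam]_s g s)%E (lebesgue_scale z0 mg g0).
  rewrite -[leLHS]mul1e; apply: lee_wpmul2r; last by rewrite lee_fin.
  by apply: integral_ge0 => t _.
have pol := polar_le mF F0 Fs r0 r2.
have r3 : 0 < rho / 3 by rewrite divr_gt0.
have le2 : ((rho / 3)%:E * \int[V]_z (F z)%:E <= (C0 * rho `^ (- e) * Hw w rho)%:E * V (Kset a (3 * rho)))%E.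
  apply: le_trans pol _.
  have mI : measurable_fun setT (fun z : Cn => (\1_(Kset a (3 * rho) : set Cn) z : R)%:E).
    by apply/measurable_EFinP; apply: measurable_indic; exact: measurable_Kset.
  have -> : V (Kset a (3 * rho)) = (\int[V]_z (\1_(Kset a (3 * rho) : set Cn) z : R)%:E)%E.
    by rewrite integral_indic ?setIT//; exact: measurable_Kset.
  rewrite -ge0_integralZl//.
  apply: ge0_le_integral => //.
  - by move=> z _; apply: integral_ge0 => t _; rewrite lee_fin polarK_ge0.
  - exact: measurable_polarK_int.
  - exact: measurable_funeM.
rewrite -(@lee_pmul2l _ (rho / 3)%:E) ?lte_fin//; apply: le_trans le2 _.
apply: (@le_trans _ _ ((C0 * rho `^ (- e) * Hw w rho)%:E * (k * (3 * rho) ^+ n.+1)%:E)%E).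
  apply: lee_wpmul2l; first by rewrite lee_fin.
  apply: hk => //; first by rewrite mulr_gt0.
  lra.
rewrite -!EFinM lee_fin le_eqVlt; apply/orP; left; apply/eqP.
by rewrite exprMn !exprS; field.
Qed.

End PolarEstimate.

(** * Comparison of the tail weight with w *)

Section TailWeight.
Variables (R : realType) (n : nat).
Local Notation C := R[i].
Local Notation Vec := 'rV[C]_n.
Local Notation Cn := (Cn R n).
Local Notation lam := (@lebesgue_measure R).
Variables (V : {measure set Cn -> \bar R}) (hV : normalized_volume V) (n_gt0 : (0 < n)%N).
Variables (w : R -> R) (hw : radial_weight w) (hwD : Dclass w).
Variables (f : Vec -> C) (p : R) (hf : holomorphic_on (@Ball R n) f) (p0 : 0 < p).

Let P (z : Cn) : R := bmod f z `^ p.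
Let P0 z : 0 <= P z. Proof. exact: powR_ge0. Qed.
Let mP : measurable_fun setT P. Proof. exact: measurable_bmod_powR. Qed.
Let menorm := @measurable_enorm R n.

(* Up to constants, [tailw] is constant on the sets a + [Qset a]; the weight w need not be. *)
Definition tailw (z : Cn) : R := Hw w (1 - enorm (z : Vec)) * (1 - enorm (z : Vec)) `^ (- 1).

Lemma tailw_ge0 z : 0 <= tailw z. Proof. by rewrite mulr_ge0 ?powR_ge0 ?Hw_ge0. Qed.

Lemma measurable_tailw : measurable_fun setT tailw.
Proof.
have m1 : measurable_fun setT (fun z : Cn => 1 - enorm (z : Vec)).
  by apply: measurable_funB => //; exact: measurable_cst.
apply: measurable_funM; last exact: measurableT_comp (measurable_powR (- 1)) m1.
apply: measurableT_comp m1; apply: nondecreasing_measurable => // x y xy; exact: Hw_mono.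
Qed.

(** By reverse doubling the annulus r <= s <= 1 - (1 - r) / k carries a fixed share of the tail
    [Hw w (1 - r)]. With s = r t, the tail weight at |z| = r is therefore at most a multiple of the
    integral of [dil k (r, t)] in t. *)
Let dil (k : R) (x : R * R) : R :=
  bR (1 <= x.2) * bR (2^-1 <= x.1) * ((1 - x.1) `^ (- 1) * (wext w (x.1 * x.2) * bR (x.1 * x.2 <= 1 - (1 - x.1) / k))).

Let dil_ge0 k x : 0 <= dil k x.
Proof. by rewrite !mulr_ge0 ?bR_ge0 ?powR_ge0 ?wext_ge0. Qed.

Let measurable_dil k : measurable_fun setT (dil k : measurableTypeR R * measurableTypeR R -> R).
Proof.
have m1 : measurable_fun setT (fun x : measurableTypeR R * measurableTypeR R => x.1 : R) by exact: measurable_fst.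
have m2 : measurable_fun setT (fun x : measurableTypeR R * measurableTypeR R => x.2 : R) by exact: measurable_snd.
have mc (c : R) : measurable_fun setT (fun _ : measurableTypeR R * measurableTypeR R => c) by exact: measurable_cst.
have m12 : measurable_fun setT (fun x : measurableTypeR R * measurableTypeR R => x.1 * x.2) by exact: measurable_funM.
have m11 : measurable_fun setT (fun x : measurableTypeR R * measurableTypeR R => 1 - x.1) by exact: measurable_funB.
apply: measurable_funM; first by apply: measurable_funM; apply: measurable_bR.
apply: measurable_funM; first exact: measurableT_comp (measurable_powR (- 1)) m11.
apply: measurable_funM; first exact: measurableT_comp (measurable_wext hw) m12.
apply: measurable_bR => //; apply: measurable_funB => //; exact: measurable_funM.
Qed.

Let sfV := sfmeas (vol_sigma_finite hV).
Let sfL := sfmeas (@lam_sigma_finite R).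

(* For fixed t, radial monotonicity replaces f(z) by f(tz); a change of
   variables then puts the weight w at |z|. *)
Let dil_swap (k t : R) : 1 < k ->
  (\int[V]_z (dil k (enorm (z : Vec), t) * P z)%:E <=
   \int[V]_z (dil k (enorm (z : Vec) * t `^ (- 1), t) * P z)%:E)%E.
Proof.
move=> k1; have k0 : 0 < k by apply: lt_trans k1.
have [t1|t1] := ltP t 1.
  rewrite (eq_integral (fun=> 0%E)) ?integral0; last first.
    by move=> z _; rewrite /dil /= leNgt t1 !mul0r.
  by apply: integral_ge0 => z _; rewrite lee_fin mulr_ge0.
have t0 : 0 < t by apply: lt_le_trans t1.
pose G (z : Cn) := dil k (enorm (z : Vec), t).
have mG : measurable_fun setT G.
  by apply: measurableT_comp (@measurable_dil k) _; exact: measurable_fun_pair.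
have G0 z : 0 <= G z by exact: dil_ge0.
have step : (\int[V]_z (G z * P z)%:E <= \int[V]_z (G z * bmod f ((t%:C)%C *: (z : Vec)) `^ p)%:E)%E.
  have [te|tn] := eqVneq t 1.
    rewrite (eq_integral (fun z : Cn => (G z * bmod f ((t%:C)%C *: (z : Vec)) `^ p)%:E))// => z _.
    by rewrite te (_ : (1%:C)%C = 1 :> C)// scale1r.
  have tt : 1 < t by rewrite lt_neqAle eq_sym tn.
  (* The solution of r t = 1 - (1 - r) / k: the support of G is contained in |z| <= r0, and r0 t <
     1. *)
  pose r0 := (1 - k^-1) / (t - k^-1).
  have kv : k^-1 < 1 by rewrite invf_lt1.
  have tk : 0 < t - k^-1 by lra.
  have r00 : 0 <= r0 by apply: divr_ge0; [rewrite subr_ge0 ltW|exact: ltW].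
  have rt : r0 * t < 1.
    rewrite /r0 mulrAC ltr_pdivrMr// mul1r mulrBl mul1r ltrD2l ltrN2.
    by rewrite ltr_pMr// invr_gt0.
  apply: (radial_mono hV hf p0 mG G0 _ r00 (ltW tt) rt).
    by move=> c z c1; rewrite /G enormZ c1 mul1r.
  move=> z; rewrite /G /dil /=.
  have [h|_] := leP (enorm (z : Vec) * t) (1 - (1 - enorm (z : Vec)) / k); last by rewrite !mulr0 eqxx.
  move=> _; rewrite /r0 ler_pdivlMr//; move: h; rewrite mulrBl mul1r.
  by move=> h; rewrite mulrBr; lra.
apply: (le_trans step).
pose H (u : Cn) : \bar R := (dil k (enorm (u : Vec) * t `^ (- 1), t) * P u)%:E.
have mH : measurable_fun setT H.
  apply/measurable_EFinP; apply: measurable_funM => //.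
  apply: measurableT_comp (@measurable_dil k) _; apply: measurable_fun_pair => //.
  by apply: measurable_funM => //; exact: measurable_cst.
have H0 u : (0 <= H u)%E by rewrite lee_fin mulr_ge0.
rewrite -[X in (_ <= X)%E]/(\int[V]_u H u)%E (vol_scale hV t0 mH H0).
rewrite (eq_integral (fun z : Cn => H ((t%:C)%C *: (z : Vec)))); last first.
  move=> z _; rewrite /H /G /P enormZ cabsR (gtr0_norm t0) powR_inv1 ?(ltW t0)//.
  by rewrite [t * _]mulrC mulfK// gt_eqF.
rewrite -[leLHS]mul1e; apply: lee_wpmul2r; first by apply: integral_ge0.
by rewrite lee_fin exprn_ege1.
Qed.

(** On the support of the integrand t lies in [1, 1 + 2 k (1 - s)], and there the integrand is at
    most w(s) / (1 - s). *)
Let inner_t (k s : R) : 1 < k ->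
  (\int[lam]_t (dil k (s * t `^ (- 1), t))%:E <= (2 * k * wext w s)%:E)%E.
Proof.
move=> k1; have k0 : 0 < k by apply: lt_trans k1.
have [s01|s01] := boolP (0 <= s < 1); last first.
  rewrite (eq_integral (fun=> 0%E)) ?integral0 ?lee_fin ?mulr_ge0 ?wext_ge0 ?(ltW k0)//.
  move=> t _; rewrite /dil /=; have [t1|t1] := leP 1 t; last by rewrite !mul0r.
  have t0 : 0 < t by apply: lt_le_trans t1.
  by rewrite powR_inv1 ?(ltW t0)// mulfVK ?gt_eqF// wext_out// mul0r !mulr0.
have /andP[s0 s1] := s01.
pose b := 1 + 2 * k * (1 - s).
have b1 : 1 <= b by rewrite lerDl !mulr_ge0 ?subr_ge0 ?(ltW k0)// ltW.
have mJ : measurable_fun setT (fun t : measurableTypeR R => dil k (s * t `^ (- 1), t)).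
  apply: measurableT_comp (@measurable_dil k) _; apply: measurable_fun_pair => //.
  apply: measurable_funM; first exact: measurable_cst.
  exact: measurable_powR.
apply: (@le_trans _ _ (\int[lam]_t (((1 - s)^-1 * wext w s)%:E * (\1_(`[1, b]%classic : set R) t : R)%:E))%E).
  apply: ge0_le_integral => //.
  - by move=> t _; rewrite lee_fin.
  - exact/measurable_EFinP.
  - by apply: measurable_funeM; apply/measurable_EFinP; exact: measurable_indic.
  move=> t _; rewrite -EFinM lee_fin /dil /=.
  have [t1|t1] := leP 1 t; last by rewrite !mul0r mulr_ge0// mulr_ge0 ?invr_ge0 ?subr_ge0 ?wext_ge0// ltW.
  have t0 : 0 < t by apply: lt_le_trans t1.
  rewrite powR_inv1 ?(ltW t0)// mulfVK ?gt_eqF// !mul1r.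
  have R0 : 0 <= (1 - s)^-1 * wext w s * \1_(`[1, b]%classic : set R) t.
    by rewrite mulr_ge0// mulr_ge0 ?invr_ge0 ?subr_ge0 ?wext_ge0// ltW.
  have [h1|_] := leP 2^-1 (s / t); last by rewrite mul0r.
  have [h2|_] := leP s (1 - (1 - s / t) / k); last by rewrite !mulr0.
  have st : s / t <= s by rewrite ler_pdivrMr// ler_peMr.
  have e1 : (1 - s / t) <= k * (1 - s) by rewrite -ler_pdivrMl// mulrC; lra.
  have tb : t <= b.
    rewrite ler_pdivlMr// in h1.
    have e2 : (1 - s / t) * t <= k * (1 - s) * t by rewrite ler_pM2r.
    rewrite mulrBl mul1r divfK ?gt_eqF// in e2.
    have : k * (1 - s) * t <= k * (1 - s) * 2.
      by rewrite ler_wpM2l ?mulr_ge0 ?subr_ge0 ?(ltW k0) ?(ltW s1)//; lra.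
    rewrite /b; lra.
  rewrite indicE mem_set ?mulr1 ?mul1r; last by rewrite /= in_itv /= t1 tb.
  rewrite ler_wpM2r ?wext_ge0// powR_inv1; last by lra.
  by rewrite lef_pV2 ?posrE; lra.
rewrite ge0_integralZl//; last 2 first.
- by apply/measurable_EFinP; exact: measurable_indic.
- by rewrite lee_fin mulr_ge0 ?invr_ge0 ?subr_ge0 ?wext_ge0// ltW.
rewrite integral_indic//.
have hl : lam (`[1, b]%classic `&` setT) = (b - 1)%:E.
  rewrite setIT lebesgue_measure_itv /= lte_fin; case: ltP => [//|h].
  by congr (_%:E); apply/eqP; rewrite eq_sym subr_eq0; apply/eqP/le_anti; rewrite h b1.
apply: (@le_trans _ _ (((1 - s)^-1 * wext w s)%:E * (b - 1)%:E)%E); first by rewrite -hl.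
rewrite -EFinM lee_fin /b le_eqVlt; apply/orP; left; apply/eqP; field.
by rewrite subr_eq0 gt_eqF.
Qed.

(** The tail weight is written as an integral of [dil] over t, each t is treated by [dil_swap], and
    [inner_t] integrates in t after the order of integration has been restored. The factor (1 -
    1/K1)^-1 is the inverse of the share of the tail carried by the annulus. *)
Lemma tailw_outer (K1 k : R) : 1 < K1 -> 1 < k ->
  (forall d, 0 < d -> d <= 1 -> K1 * Hw w (d / k) <= Hw w d) ->
  (\int[V]_z (bR (2^-1 <= enorm (z : Vec)) * (P z * tailw z))%:E <=
   ((1 - K1^-1)^-1 * (2 * k))%:E * \int[V]_z (P z * wext w (enorm (z : Vec)))%:E)%E.
Proof.
move=> h1 k1 hk.
have k0 : 0 < k by apply: lt_trans k1.
have K10 : 0 < K1 by apply: lt_trans h1.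
pose c1 := (1 - K1^-1)^-1.
have c10 : 0 < c1 by rewrite invr_gt0 subr_gt0 invf_lt1.
pose A (x : Cn * measurableTypeR R) : \bar R := (dil k (enorm (x.1 : Vec), x.2) * P x.1)%:E.
pose B (x : Cn * measurableTypeR R) : \bar R := (dil k (enorm (x.1 : Vec) * x.2 `^ (- 1), x.2) * P x.1)%:E.
have m1 : measurable_fun [set: Cn * measurableTypeR R] (fun x : Cn * measurableTypeR R => enorm (x.1 : Vec)).
  exact: measurableT_comp menorm measurable_fst.
have m2 : measurable_fun [set: Cn * measurableTypeR R] (fun x : Cn * measurableTypeR R => x.2 : R).
  exact: measurable_snd.
have mP1 : measurable_fun [set: Cn * measurableTypeR R] (fun x : Cn * measurableTypeR R => P x.1).
  exact: measurableT_comp mP measurable_fst.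
have mA : measurable_fun setT A.
  apply/measurable_EFinP; apply: measurable_funM => //.
  by apply: measurableT_comp (@measurable_dil k) _; exact: measurable_fun_pair.
have mB : measurable_fun setT B.
  apply/measurable_EFinP; apply: measurable_funM => //.
  apply: measurableT_comp (@measurable_dil k) _; apply: measurable_fun_pair => //.
  by apply: measurable_funM => //; exact: measurableT_comp (measurable_powR (- 1)) m2.
have A0 x : (0 <= A x)%E by rewrite lee_fin mulr_ge0.
have B0 x : (0 <= B x)%E by rewrite lee_fin mulr_ge0.
have key (z : Cn) : ((bR (2^-1 <= enorm (z : Vec)) * (P z * tailw z))%:E <= c1%:E * \int[lam]_t A (z, t))%E.
  have I0 : (0 <= c1%:E * \int[lam]_t A (z, t))%E.
    by rewrite mule_ge0 ?lee_fin ?(ltW c10)//; apply: integral_ge0.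
  have [Bz|Bz] := pselect (Ball (z : Vec)); last by rewrite /P bmod0// powR0 ?gt_eqF// mul0r mulr0.
  set r := enorm (z : Vec) in I0 *.
  have r1 : r < 1 by exact: Bz.
  have [r2|r2] := leP 2^-1 r; last by rewrite mul0r.
  have r0 : 0 < r by apply: lt_le_trans r2; rewrite invr_gt0.
  pose d := 1 - r.
  have d0 : 0 < d by rewrite subr_gt0.
  have d1 : d <= 1 by rewrite lerBlDr lerDl ltW.
  pose g (s : R) := (wext w s * (bR (r <= s) * bR (s <= 1 - d / k)))%:E : \bar R.
  have mg : measurable_fun setT g.
    apply/measurable_EFinP; apply: measurable_funM; first exact: measurable_wext.
    by apply: measurable_funM; apply: measurable_bR => //; exact: measurable_cst.
  have g0 s : (0 <= g s)%E by rewrite lee_fin !mulr_ge0 ?bR_ge0 ?wext_ge0.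
  have gH : ((Hw w d)%:E <= \int[lam]_s g s + (Hw w (d / k))%:E)%E.
    rewrite -!HwE// -ge0_integralD//; last 2 first.
    - by move=> s _; rewrite lee_fin wext_tail_ge0.
    - by apply/measurable_EFinP; exact: measurable_wext_tail.
    apply: ge0_le_integral => //.
    - by move=> s _; rewrite lee_fin wext_tail_ge0.
    - by apply/measurable_EFinP; exact: measurable_wext_tail.
    - by apply: emeasurable_funD => //; apply/measurable_EFinP; exact: measurable_wext_tail.
    move=> s _; rewrite -EFinD lee_fin -mulrDr ler_wpM2l ?wext_ge0// /d subKr.
    have [rs|_] := leP r s; last by rewrite mul0r add0r bR_ge0.
    rewrite mul1r; have [h|h] := leP s (1 - (1 - r) / k); first by rewrite lerDl bR_ge0.
    by rewrite add0r (ltW h).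
  have gA : (((1 - r) `^ (- 1) * P z)%:E * \int[lam]_s g s <= \int[lam]_t A (z, t))%E.
    rewrite (lebesgue_scale r0 mg g0).
    apply: (@le_trans _ _ (((1 - r) `^ (- 1) * P z)%:E * \int[lam]_t g (r * t)%R)%E).
      apply: lee_wpmul2l; first by rewrite lee_fin mulr_ge0 ?powR_ge0.
      rewrite -[leRHS]mul1e; apply: lee_wpmul2r; first by apply: integral_ge0.
      by rewrite lee_fin ltW.
    rewrite -ge0_integralZl//; last 2 first.
    - apply: measurableT_comp mg _; exact: mulrl_measurable.
    - by rewrite lee_fin mulr_ge0 ?powR_ge0.
    apply: ge0_le_integral => //.
    - by move=> t _; rewrite mule_ge0// lee_fin mulr_ge0 ?powR_ge0.
    - apply: measurable_funeM; apply: measurableT_comp mg _; exact: mulrl_measurable.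
    - exact: measurableT_comp mA (measurable_pair1 z).
    move=> t _; rewrite -EFinM lee_fin /dil /= -/r r2 mulr1.
    rewrite [bR (r <= _)](_ : _ = bR (1 <= t)); last by rewrite -{1}[r]mulr1 ler_pM2l.
    rewrite le_eqVlt; apply/orP; left; apply/eqP; rewrite /d; ring.
  have hH : Hw w d <= c1 * fine (\int[lam]_s g s)%E /\ (\int[lam]_s g s < +oo)%E.
    have gfin : (\int[lam]_s g s < +oo)%E.
      apply: (@le_lt_trans _ _ (Hw w d)%:E); last exact: ltry.
      rewrite -HwE//; apply: ge0_le_integral => //.
        by apply/measurable_EFinP; exact: measurable_wext_tail.
      move=> s _; rewrite lee_fin ler_wpM2l ?wext_ge0// /d subKr.
      by rewrite ler_piMr ?bR_ge0 ?bR_le1.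
    split=> //; have gE : (\int[lam]_s g s = (fine (\int[lam]_s g s))%:E)%E.
      by rewrite fineK// ge0_fin_numE//; apply: integral_ge0.
    move: gH; rewrite {1}gE -EFinD lee_fin; have := hk d d0 d1.
    move: (fine _) (Hw w d) (Hw w (d / k)) => x y y' e1 e2.
    rewrite /c1 ler_pdivlMl ?subr_gt0 ?invf_lt1//.
    have : y' <= K1^-1 * y by rewrite ler_pdivlMl.
    by rewrite mulrBl mul1r; move: (K1^-1 * y) => q; lra.
  have gE : (\int[lam]_s g s = (fine (\int[lam]_s g s))%:E)%E.
    by rewrite fineK// ge0_fin_numE ?hH.2//; apply: integral_ge0.
  apply: (@le_trans _ _ (c1%:E * (((1 - r) `^ (- 1) * P z)%:E * \int[lam]_s g s))%E); last first.
    by apply: lee_wpmul2l gA; rewrite lee_fin ltW.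
  rewrite gE -!EFinM lee_fin mul1r /tailw -/r -/d.
  have := ler_wpM2l (mulr_ge0 (powR_ge0 d (- 1)) (P0 z)) hH.1.
  by move=> /le_trans; rewrite [leLHS](_ : _ = d `^ (- 1) * P z * Hw w d); [apply|]; rewrite mulrCA//; ring.
have mtw := measurable_tailw.
have mAint : measurable_fun setT (fun z : Cn => (\int[lam]_t A (z, t))%E).
  exact: (@measurable_fun_fubini_tonelli_F _ _ _ _ R sfL A mA A0).
apply: (@le_trans _ _ (\int[V]_z (c1%:E * \int[lam]_t A (z, t)))%E).
  apply: ge0_le_integral => //.
  - by move=> z _; rewrite lee_fin mulr_ge0 ?bR_ge0// mulr_ge0// tailw_ge0.
  - apply/measurable_EFinP; apply: measurable_funM; last exact: measurable_funM.
    by apply: measurable_bR => //; exact: measurable_cst.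
  - exact: measurable_funeM.
rewrite ge0_integralZl//; last 2 first.
- by move=> z _; apply: integral_ge0.
- by rewrite lee_fin ltW.
rewrite EFinM -muleA; apply: lee_wpmul2l; first by rewrite lee_fin ltW.
rewrite (@tonelli _ _ _ _ R V lam A (vol_sigma_finite hV) (@lam_sigma_finite R) mA A0).
apply: (@le_trans _ _ (\int[lam]_t \int[V]_z B (z, t))%E).
  apply: ge0_le_integral => //.
  - by move=> t _; apply: integral_ge0.
  - exact: (@measurable_fun_fubini_tonelli_G _ _ _ _ R sfV A mA A0).
  - exact: (@measurable_fun_fubini_tonelli_G _ _ _ _ R sfV B mB B0).
  - by move=> t _; exact: dil_swap.
rewrite -(@tonelli _ _ _ _ R V lam B (vol_sigma_finite hV) (@lam_sigma_finite R) mB B0).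
have mPw : measurable_fun setT (fun z : Cn => P z * wext w (enorm (z : Vec))).
  by apply: measurable_funM => //; exact: measurableT_comp (measurable_wext hw) menorm.
rewrite -ge0_integralZl//; last 3 first.
- exact/measurable_EFinP.
- by move=> z _; rewrite lee_fin mulr_ge0 ?wext_ge0.
- by rewrite lee_fin mulr_ge0// ltW.
apply: ge0_le_integral => //.
- by move=> z _; apply: integral_ge0.
- exact: (@measurable_fun_fubini_tonelli_F _ _ _ _ R sfL B mB B0).
- by apply: measurable_funeM; exact/measurable_EFinP.
move=> z _; rewrite /B /=.
under eq_integral do rewrite EFinM muleC.
have mJ : measurable_fun setT (fun t : measurableTypeR R => dil k (enorm (z : Vec) * t `^ (- 1), t)).
  apply: measurableT_comp (@measurable_dil k) _; apply: measurable_fun_pair => //.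
  apply: measurable_funM; first exact: measurable_cst.
  exact: measurable_powR.
rewrite ge0_integralZl//; last 3 first.
- exact/measurable_EFinP.
- by move=> t _; rewrite lee_fin.
- by rewrite lee_fin.
apply: (@le_trans _ _ ((P z)%:E * (2 * k * wext w (enorm (z : Vec)))%:E)%E).
  by apply: lee_wpmul2l; [rewrite lee_fin|exact: inner_t].
by rewrite -!EFinM lee_fin mulrCA.
Qed.

(** Let A(c) be the integral over |z| <= c and M the integral over the annulus. Dilation by 3/2
    gives A(1/2) <= (4/9) A(3/4) <= (4/9) (A(1/2) + M), as n > 0, and A(1/2) is finite. *)
Lemma tailw_inner : (\int[V]_z (bR (enorm (z : Vec) <= 2^-1) * P z)%:E <=
  \int[V]_z (bR (2^-1 <= enorm (z : Vec)) * bR (enorm (z : Vec) <= 3 / 4) * P z)%:E)%E.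
Proof.
set M := (X in (_ <= X)%E); pose A (c : R) := (\int[V]_z (bR (enorm (z : Vec) <= c) * P z)%:E)%E.
have mb (c : R) : measurable_fun setT (fun z : Cn => bR (enorm (z : Vec) <= c) * P z).
  by apply: measurable_funM => //; apply: measurable_bR => //; exact: measurable_cst.
have mM : measurable_fun setT (fun z : Cn => bR (2^-1 <= enorm (z : Vec)) * bR (enorm (z : Vec) <= 3 / 4) * P z).
  apply: measurable_funM => //; apply: measurable_funM; apply: measurable_bR => //; exact: measurable_cst.
have Afin : (A (2^-1)%R < +oo)%E.
  have [B hB] := @hol_bounded R n f (2^-1) hf ltac:(lra).
  have B0 : 0 <= B by apply: le_trans (hB 0 _); rewrite ?cabs_ge0// enorm0; lra.
  apply: (@le_lt_trans _ _ (B `^ p)%:E); last exact: ltry.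
  apply: (int_le_Ball hV) => //.
  - by move=> z; rewrite mulr_ge0 ?bR_ge0.
  - move=> z; have [h|_] := leP (enorm (z : Vec)) 2^-1; last by rewrite mul0r powR_ge0.
    rewrite mul1r; apply: powR_le; rewrite ?bmod_ge0 ?(ltW p0)// bmodE ?hB// BallE; lra.
  - by move=> z Bz; rewrite /P bmod0// powR0 ?mulr0// gt_eqF.
have M0 : (0 <= M)%E by apply: integral_ge0 => z _; rewrite lee_fin !mulr_ge0 ?bR_ge0 ?powR_ge0.
have [->|Mfin] := eqVneq M +oo%E; first by rewrite leey.
have AM : (A (3 / 4)%R <= A (2^-1)%R + M)%E.
  rewrite /A /M -ge0_integralD//; last 4 first.
  - by move=> z _; rewrite lee_fin mulr_ge0 ?bR_ge0.
  - exact/measurable_EFinP.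
  - by move=> z _; rewrite lee_fin !mulr_ge0 ?bR_ge0 ?powR_ge0.
  - exact/measurable_EFinP.
  apply: ge0_le_integral => //.
  - by move=> z _; rewrite lee_fin mulr_ge0 ?bR_ge0.
  - exact/measurable_EFinP.
  - by apply: emeasurable_funD; exact/measurable_EFinP.
  move=> z _; rewrite -EFinD lee_fin -mulrDl ler_wpM2r//.
  have [h|h] := leP (enorm (z : Vec)) 2^-1; first by apply: le_trans (bR_le1 _ _) _; rewrite lerDl mulr_ge0 ?bR_ge0.
  by rewrite add0r (ltW h) mul1r.
have AA : (A (2^-1)%R <= (4 / 9)%:E * A (3 / 4)%R)%E.
  have rt : (2^-1 : R) * (3 / 2) < 1 by lra.
  have t1 : 1 <= 3 / 2 :> R by lra.
  have t0 : 0 < 3 / 2 :> R by lra.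
  have mG : measurable_fun setT (fun z : Cn => bR (enorm (z : Vec) <= 2^-1) : R).
    by apply: measurable_bR => //; exact: measurable_cst.
  have := @radial_mono R n V hV f p hf p0 (fun z => bR (enorm (z : Vec) <= 2^-1)) 2^-1 (3 / 2) mG
    (fun=> bR_ge0 _ _) _ _ t1 rt _.
  move=> /(_ _ _ _)/le_trans; apply.
  - by move=> c z c1; rewrite enormZ c1 mul1r.
  - lra.
  - by move=> z; case: (leP (enorm (z : Vec)) 2^-1) => //; rewrite eqxx.
  pose H (z : Cn) : \bar R := (bR (enorm (z : Vec) <= 3 / 4) * P z)%:E.
  have mH : measurable_fun setT H by exact/measurable_EFinP.
  have H0 z : (0 <= H z)%E by rewrite lee_fin mulr_ge0 ?bR_ge0.
  rewrite -[A (3 / 4)%R]/(\int[V]_z H z)%E (vol_scale hV t0 mH H0) muleA -EFinM.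
  rewrite (eq_integral (fun z : Cn => H (((3 / 2)%:C)%C *: (z : Vec)))); last first.
    move=> z _; rewrite /H enormZ cabsR (gtr0_norm t0) /P; congr ((bR _ * _)%:E).
    by apply/idP/idP; lra.
  rewrite -[leLHS]mul1e; apply: lee_wpmul2r; first by apply: integral_ge0.
  rewrite lee_fin -(prednK n_gt0) mulnS exprD.
  have -> : (3 / 2) ^+ 2 = 9 / 4 :> R by field.
  by rewrite mulrA (_ : 4 / 9 * (9 / 4) = 1 :> R) ?mul1r ?exprn_ege1//; field.
have fA : A (2^-1)%R = (fine (A (2^-1)%R))%:E.
  by rewrite fineK// ge0_fin_numE//; apply: integral_ge0 => z _; rewrite lee_fin mulr_ge0 ?bR_ge0.
have fM : M = (fine M)%:E by rewrite fineK// ge0_fin_numE// ltey.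
have k0 : (0 <= (4 / 9 : R)%:E)%E by rewrite lee_fin; lra.
have H := le_trans AA (lee_wpmul2l k0 AM).
rewrite fA fM -EFinD -EFinM lee_fin in H; rewrite fM lee_fin in M0.
rewrite -[leLHS]/(A (2^-1)%R) fA fM lee_fin; move: (fine _) (fine M) M0 H => x y y0; lra.
Qed.

End TailWeight.

Lemma tailw_le (R : realType) (n : nat) (V : {measure set (Cn R n) -> \bar R}) (w : R -> R) :
  normalized_volume V -> (0 < n)%N -> radial_weight w -> Dclass w ->
  exists2 c : R, 0 < c & forall (f : 'rV[R[i]]_n -> R[i]) p, holomorphic_on (@Ball R n) f -> 0 < p ->
  (\int[V]_z (bmod f z `^ p * tailw w z)%:E <=
   c%:E * \int[V]_z (bmod f z `^ p * wext w (enorm (z : 'rV[R[i]]_n)))%:E)%E.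
Proof.
move=> hV n0 hw hwD; have [K1 [k [h1 k1 hk]]] := Hw_check hw hwD.
pose c1 := (1 - K1^-1)^-1 * (2 * k).
have c10 : 0 < c1.
  have k0 : 0 < k by apply: lt_trans k1.
  have K10 : 0 < K1 by apply: lt_trans h1.
  by rewrite !mulr_gt0// invr_gt0 subr_gt0 invf_lt1.
have H40 : 0 < Hw w 4^-1 by apply: (Hw_gt0 hw); rewrite invr_gt0.
have H10 := Hw_ge0 hw 1.
(* [tailw] is at most 2 [Hw w 1] for |z| < 1/2 and at least [Hw w 4^-1] on the annulus of
   [tailw_inner]. *)
pose c2 := 2 * Hw w 1 / Hw w 4^-1.
have c20 : 0 <= c2 by rewrite !mulr_ge0 ?invr_ge0// ltW.
exists (c1 + c2 * c1) => [|f p hf p0]; first by rewrite ltr_wpDr// mulr_ge0// ltW.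
pose P (z : Cn R n) := bmod f z `^ p.
have P0 z : 0 <= P z by exact: powR_ge0.
have mP : measurable_fun setT P by exact: measurable_bmod_powR.
have menorm := @measurable_enorm R n.
have mt : measurable_fun setT (@tailw R n w) by exact: measurable_tailw.
have mb1 : measurable_fun setT (fun z : Cn R n => bR (2^-1 <= enorm (z : 'rV[R[i]]_n)) * (P z * tailw w z)).
  apply: measurable_funM; last exact: measurable_funM.
  by apply: measurable_bR => //; exact: measurable_cst.
have mb2 : measurable_fun setT (fun z : Cn R n => bR (enorm (z : 'rV[R[i]]_n) <= 2^-1) * P z).
  by apply: measurable_funM => //; apply: measurable_bR => //; exact: measurable_cst.
have out := tailw_outer hV hw hf p0 h1 k1 hk; rewrite -/c1 -/P in out.
have inn := tailw_inner hV n0 hf p0; rewrite -/P in inn.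
set W := (\int[V]_z (bmod f z `^ p * wext w (enorm (z : 'rV[R[i]]_n)))%:E)%E in out *.
have out0 z : 0 <= bR (2^-1 <= enorm (z : 'rV[R[i]]_n)) * (P z * tailw w z).
  by rewrite mulr_ge0 ?bR_ge0// mulr_ge0 ?tailw_ge0.
have step1 : (\int[V]_z (P z * tailw w z)%:E <=
    \int[V]_z (bR (2^-1 <= enorm (z : 'rV[R[i]]_n)) * (P z * tailw w z))%:E +
    (2 * Hw w 1)%:E * \int[V]_z (bR (enorm (z : 'rV[R[i]]_n) <= 2^-1) * P z)%:E)%E.
  rewrite -ge0_integralZl//; last 3 first.
  - exact/measurable_EFinP.
  - by move=> z _; rewrite lee_fin mulr_ge0 ?bR_ge0.
  - by rewrite lee_fin mulr_ge0.
  rewrite -ge0_integralD//; last 4 first.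
  - by move=> z _; rewrite lee_fin.
  - exact/measurable_EFinP.
  - by move=> z _; rewrite -EFinM lee_fin !mulr_ge0 ?bR_ge0 ?powR_ge0.
  - by apply: measurable_funeM; exact/measurable_EFinP.
  apply: ge0_le_integral => //.
  - by move=> z _; rewrite lee_fin mulr_ge0 ?tailw_ge0.
  - by apply/measurable_EFinP; exact: measurable_funM.
  - apply: emeasurable_funD; first exact/measurable_EFinP.
    by apply: measurable_funeM; exact/measurable_EFinP.
  move=> z _; rewrite -EFinM -EFinD lee_fin.
  have [h|h] := leP 2^-1 (enorm (z : 'rV[R[i]]_n)).
    by rewrite mul1r lerDl !mulr_ge0 ?bR_ge0.
  rewrite mul0r add0r (ltW h) mul1r mulrC ler_wpM2r// /tailw mulrC.
  have h2 : 2^-1 <= 1 - enorm (z : 'rV[R[i]]_n) by lra.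
  have h3 : 0 < 1 - enorm (z : 'rV[R[i]]_n) by lra.
  apply: ler_pM; rewrite ?powR_ge0 ?Hw_ge0//.
    by rewrite powR_inv1 ?(ltW h3)// -[leRHS]invrK lef_pV2// posrE.
  by apply: (Hw_mono hw); rewrite gerBl enorm_ge0.
have step2 : ((Hw w 4^-1)%:E * \int[V]_z (bR (enorm (z : 'rV[R[i]]_n) <= 2^-1) * P z)%:E <=
    \int[V]_z (bR (2^-1 <= enorm (z : 'rV[R[i]]_n)) * (P z * tailw w z))%:E)%E.
  apply: le_trans (lee_wpmul2l _ inn) _; first by rewrite lee_fin ltW.
  have mM : measurable_fun setT (fun z : Cn R n => bR (2^-1 <= enorm (z : 'rV[R[i]]_n)) * bR (enorm (z : 'rV[R[i]]_n) <= 3 / 4) * P z).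
    apply: measurable_funM => //; apply: measurable_funM; apply: measurable_bR => //; exact: measurable_cst.
  rewrite -ge0_integralZl//; last 3 first.
  - exact/measurable_EFinP.
  - by move=> z _; rewrite lee_fin !mulr_ge0 ?bR_ge0 ?powR_ge0.
  - by rewrite lee_fin ltW.
  apply: ge0_le_integral => //.
  - by move=> z _; rewrite -EFinM lee_fin !mulr_ge0 ?bR_ge0 ?powR_ge0// ltW.
  - by apply: measurable_funeM; exact/measurable_EFinP.
  - exact/measurable_EFinP.
  move=> z _; rewrite -EFinM lee_fin -mulrA mulrCA ler_wpM2l ?bR_ge0//.
  have [h|h] := leP (enorm (z : 'rV[R[i]]_n)) (3 / 4); last by rewrite mul0r mulr0 mulr_ge0 ?tailw_ge0.
  rewrite mul1r mulrC ler_wpM2l ?powR_ge0// /tailw -[leLHS]mulr1.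
  have h3 : 0 < 1 - enorm (z : 'rV[R[i]]_n) by lra.
  apply: ler_pM; rewrite ?(ltW H40)//; first by apply: (Hw_mono hw); lra.
  by rewrite powR_inv1 ?(ltW h3)// invf_ge1// gerBl enorm_ge0.
apply: le_trans step1 _; rewrite (EFinD c1) ge0_muleDl ?lee_fin ?(ltW c10) ?(mulr_ge0 c20 (ltW c10))//.
apply: leeD => //.
apply: le_trans (_ : (c2%:E * ((Hw w 4^-1)%:E * \int[V]_z (bR (enorm (z : 'rV[R[i]]_n) <= 2^-1) * P z)%:E) <= _)%E).
  by rewrite muleA -EFinM /c2 divfK ?gt_eqF.
rewrite (EFinM c2) -muleA; apply: lee_wpmul2l; first by rewrite lee_fin.
exact: le_trans step2 out.
Qed.

(** * Separated families and oscillation *)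

Section SeparatedFamilies.
Variables (R : realType) (n : nat).
Local Notation C := R[i].
Local Notation Vec := 'rV[C]_n.
Local Notation Cn := (Cn R n).
Variables (V : {measure set Cn -> \bar R}) (hV : normalized_volume V) (n_gt0 : (0 < n)%N).

(* 384 = 6 * (4 + 4) ^ 2 makes the sets a_k + [Qset (a k)] pairwise disjoint, by [bnear_trans]. *)
Definition sepfam m (a : 'I_m -> Vec) :=
  (forall k, Ball (a k)) /\ forall k l, k != l -> ~ bnear 384 (a k) (a l).

Lemma sum_at_most_one (m : nat) (F : 'I_m -> R) (c : R) : 0 <= c -> (forall k, F k <= c) ->
  (forall k l, F k != 0 -> F l != 0 -> k = l) -> \sum_k F k <= c.
Proof.
move=> c0 Fc Fu; have [/existsP[k Fk]|/existsPn h] := boolP [exists k, F k != 0].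
  rewrite (bigD1 k)//= big1 ?addr0// => l lk; apply/eqP/negPn/negP => /Fu/(_ Fk) e.
  by rewrite e eqxx in lk.
by rewrite big1// => k _; apply/eqP/negPn; exact: h.
Qed.

Lemma Qset_bnear (a y : Vec) : Ball a -> Qset a y -> Ball (a + y) /\ bnear 4 (a + y) a.
Proof.
move=> Ba Qy; have := @Qset_Ball R n a y 1 Ba Qy; rewrite cabs1 scale1r; apply.
by rewrite ler1n.
Qed.

Lemma measurable_Qset_shift (a : Vec) : measurable_fun [set: Cn] (fun z : Cn => \1_(Qset a) (z - a : Cn) : R).
Proof.
apply: measurableT_comp (measurable_addr (- a)); apply: measurable_indic; exact: measurable_Qset.
Qed.

Lemma int_Qset_shift (a : Vec) : (\int[V]_z (\1_(Qset a) (z - a : Cn) : R)%:E = V (Qset a))%E.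
Proof.
have mI : measurable_fun [set: Cn] (fun z : Cn => (\1_(Qset a) z : R)%:E).
  by apply/measurable_EFinP; apply: measurable_indic; exact: measurable_Qset.
have I0 (z : Cn) : (0 <= (\1_(Qset a) z : R)%:E)%E by rewrite lee_fin.
rewrite (vol_translate hV (- a) mI I0) integral_indic ?setIT//; exact: measurable_Qset.
Qed.

(** The sets a_j + [Qset (a j)] are disjoint, of volume at least c bdef(a_j)^(n+1), and those with
    kd z a_j <= rho lie in [Kset z (27 * rho)] when z is taken as centre: for w in such a set, kd w
    a_j <= 4 bdef(a_j) <= 8 rho, and 27 = 3 (8 + 1). *)
Lemma packing : exists2 k : R, 0 < k & forall m (a : 'I_m -> Vec), sepfam a -> forall z rho,
  Ball z -> 0 < rho -> \sum_k (bdef (a k) ^+ n.+1 * bR (kd z (a k) <= rho)) <= k * rho ^+ n.+1.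
Proof.
have [c c0 hc] := vol_Qset hV n_gt0.
have [k k0 hk] := vol_Kset hV 54 n_gt0.
exists (k * 27 ^+ n.+1 / c) => [|m a [aB asep] z rho Bz r0].
  by rewrite divr_gt0// mulr_gt0// exprn_gt0.
wlog r2 : rho r0 / rho <= 2 => [wl|].
  have [r2|r2] := leP rho 2; first exact: wl.
  apply: (@le_trans _ _ (\sum_k0 (bdef (a k0) ^+ n.+1 * bR (kd z (a k0) <= 2)))).
    apply: ler_sum => j _; rewrite ler_wpM2l ?exprn_ge0 ?(ltW (bdef_gt0 (aB j)))//.
    by apply: bR_le => _; apply: kd_le2; apply: ltW => //; exact: aB.
  apply: le_trans (wl 2 _ (lexx _)) _ => //; rewrite ler_wpM2l//.
    by rewrite divr_ge0 ?(ltW c0)// mulr_ge0 ?exprn_ge0// ltW.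
  by rewrite lerXn2r// ?nnegrE ltW.
have K1 : (V (Kset z (27 * rho)) <= (k * (27 * rho) ^+ n.+1)%:E)%E.
  by apply: hk => //; [rewrite mulr_gt0|lra].
pose T j (w : Cn) := bR (kd z (a j) <= rho) * \1_(Qset (a j)) (w - a j : Cn) : R.
have mT j : measurable_fun setT (T j).
  by apply: measurable_funM; [exact: measurable_cst|exact: measurable_Qset_shift].
have T0 j w : 0 <= T j w by rewrite mulr_ge0 ?bR_ge0.
have TE j w : T j w != 0 -> kd z (a j) <= rho /\ Qset (a j) (w - a j).
  rewrite /T indicE; have [h|_] := leP (kd z (a j)) rho; last by rewrite mul0r eqxx.
  by have [/set_mem|_] := boolP (_ \in _); last by rewrite mulr0 eqxx.
have sumT (w : Cn) : \sum_j T j w <= \1_(Kset z (27 * rho)) w.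
  have [/existsP[j Tj]|/existsPn h] := boolP [exists j, T j w != 0]; last first.
    by rewrite big1// => j _; apply/eqP/negPn; exact: h.
  have [hz hq] := TE _ _ Tj; have [Bw nw] := Qset_bnear (aB j) hq.
  rewrite addrC subrK in Bw nw.
  have Kw : Kset z (27 * rho) w.
    split; last by rewrite ltW// (lt_le_trans (Bw : enorm (w : Vec) < 1))// lerDl mulr_ge0// ltW.
    have h1 := @bdef_le_kd R n z (a j) (ltW Bz) (ltW (aB j)); have h2 := nw.2.
    have h3 := @kd_triangle R n (w : Vec) (a j) z (ltW Bw) (ltW (aB j)) (ltW Bz).
    by rewrite [kd (a j) z]kdC in h3; lra.
  rewrite indicE mem_set//; apply: sum_at_most_one => //.
    by move=> l; rewrite /T indicE mulr_ile1 ?bR_ge0 ?bR_le1//; case: (_ \in _).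
  move=> i l /TE[_ hi] /TE[_ hl]; apply/eqP/negPn/negP => il; apply: (asep _ _ il).
  have [_ ni] := Qset_bnear (aB i) hi; have [_ nl] := Qset_bnear (aB l) hl.
  rewrite addrC subrK in ni; rewrite addrC subrK in nl.
  have := @bnear_trans R n 4 4 (a i) (w : Vec) (a l) _ _ (aB i) Bw (aB l) (bnearC ni) nl.
  by rewrite (_ : 6 * (4 + 4) ^+ 2 = 384 :> R); [apply|ring].
have I1 : (\sum_(j < m) (c * (bdef (a j) ^+ n.+1 * bR (kd z (a j) <= rho)))%:E <= V (Kset z (27 * rho)))%E.
  have -> : V (Kset z (27 * rho)) = (\int[V]_w (\1_(Kset z (27 * rho)) w : R)%:E)%E.
    by rewrite integral_indic ?setIT//; exact: measurable_Kset.
  apply: (@le_trans _ _ (\int[V]_w (\sum_j T j w)%:E)%E); last first.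
    apply: ge0_le_integral => //.
    - by move=> w _; rewrite lee_fin sumr_ge0.
    - by apply/measurable_EFinP; apply: measurable_sum.
    - by apply/measurable_EFinP; apply: measurable_indic; exact: measurable_Kset.
    - by move=> w _; rewrite lee_fin.
  under [leRHS]eq_integral do rewrite -sumEFin.
  rewrite ge0_integral_sum//; last 2 first.
  - by move=> j; apply/measurable_EFinP.
  - by move=> j w _; rewrite lee_fin.
  apply: lee_sum => j _; rewrite /T; under eq_integral do rewrite EFinM.
  rewrite ge0_integralZl//; last 2 first.
  - by apply/measurable_EFinP; exact: measurable_Qset_shift.
  - by rewrite lee_fin bR_ge0.
  rewrite int_Qset_shift mulrA mulrC EFinM; apply: lee_wpmul2l; first by rewrite lee_fin bR_ge0.
  exact: hc.
have := le_trans I1 K1; rewrite sumEFin lee_fin -mulr_sumr exprMn => h.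
by rewrite mulrAC ler_pdivlMr// mulrC mulrA in h *.
Qed.

Lemma powRD0 (x r s : R) : 0 < x -> x `^ (r + s) = x `^ r * x `^ s.
Proof. by move=> x0; rewrite powRD// (gt_eqF x0) implybT. Qed.

Lemma powR_expr (x s : R) k : 0 <= x -> (x ^+ k) `^ s = (x `^ s) ^+ k.
Proof.
move=> x0; elim: k => [|k IH]; first by rewrite !expr0 powR1.
by rewrite !exprS powRM ?exprn_ge0// IH.
Qed.

(** The last shell has to reach 2, the largest value of [kd] on the ball; the first power that does
    so stays below 4. *)
Lemma dyadic_cover (X : R) : 0 < X -> X <= 2^-1 -> exists J, 2 ^+ J.+1 * X <= 4 /\ 2 <= 2 ^+ J.+1 * X.
Proof.
move=> X0 X2; have X20 : 0 < X / 2 by rewrite divr_gt0.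
have h0 : (0 : R) <= 2^-1 by rewrite invr_ge0.
have h1 : (2^-1 : R) < 1 by rewrite invf_lt1// ltr1n.
have [T hT] := pow_small h0 h1 X20.
have ex : exists T, 2 <= 2 ^+ T * X.
  exists T; rewrite exprVn ltr_pdivlMr// in hT.
  have p0 : 0 < 2 ^+ T :> R by rewrite exprn_gt0.
  by rewrite -(ler_pM2l (_ : 0 < (2 ^+ T)^-1)) ?invr_gt0// mulrA mulVf ?gt_eqF// mul1r ltW.
case: (ex_minnP ex) => -[|J] hJ minJ; first by move: hJ; rewrite expr0 mul1r; lra.
exists J; split=> //; rewrite leNgt; apply/negP => h.
have h2 : 2 <= 2 ^+ J * X by move: h; rewrite exprS; move: (2 ^+ J) => y; nra.
by have := minJ J h2; rewrite ltnn.
Qed.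

Lemma powR_neg2 (t : R) : 0 < t -> 2 `^ (- t) < 1 :> R.
Proof.
move=> t0; rewrite powRN invf_lt1 ?powR_gt0//.
by have := @powR_lt R t 1 2 t0 ler01 ltac:(by rewrite ltr1n); rewrite powR1.
Qed.

(** Schur's test with the test function bdef^-t. As bdef(a_j) <= 2 kd z a_j, the exponent b may be
    lowered to n + 1 + t at the cost of a constant; [packing] on dyadic shells then leaves a
    geometric series of ratio 2^-t. *)
Lemma schur_sum (t : R) (b : nat) : 0 < t -> n.+1%:R + t <= b%:R -> exists2 k : R, 0 < k &
  forall m (a : 'I_m -> Vec), sepfam a -> forall z, Ball z ->
  \sum_j ((bdef (a j) / kd z (a j)) ^+ b * bdef (a j) `^ (- t)) <= k * bdef z `^ (- t).
Proof.
move=> t0 tb; have [c c0 hc] := packing.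
have [q [q0 q1 qE]] : exists q : R, [/\ 0 <= q, q < 1 & q = 2 `^ (- t)].
  by exists (2 `^ (- t)); rewrite powR_ge0 powR_neg2.
have [be [be0 beE]] : exists be : R, 0 <= be /\ b%:R = be + n.+1%:R + t.
  by exists (b%:R - n.+1%:R - t); split; [lra|ring].
have [s [s0 sE]] : exists s : R, 0 < s /\ s = n.+1%:R + t.
  by exists (n.+1%:R + t); rewrite addr_gt0 ?ltr0n.
exists (2 `^ be * (c * 2 ^+ n.+1 * (2 `^ t) / (1 - q))).
  apply: mulr_gt0; first exact: powR_gt0.
  by apply: divr_gt0; [rewrite !mulr_gt0 ?powR_gt0 ?exprn_gt0|rewrite subr_gt0].
move=> m a sa z Bz; have [aB _] := sa.
have z0 := bdef_gt0 Bz; have z1 := bdef_le1 z.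
have [X [X0 XE]] : exists X : R, 0 < X /\ X = bdef z / 2.
  by exists (bdef z / 2); rewrite divr_gt0.
have [J [_ hJ]] := @dyadic_cover X X0 ltac:(by rewrite XE; lra).
have Phi0 (D : R) : 0 <= D `^ (- s) by exact: powR_ge0.
have PhiD (x y : R) : 0 < x -> x <= y -> y `^ (- s) <= x `^ (- s) by exact/powRN_le/ltW.
have tE j : (bdef (a j) / kd z (a j)) ^+ b * bdef (a j) `^ (- t) <=
    2 `^ be * (bdef (a j) ^+ n.+1 * kd z (a j) `^ (- s)).
  have x0 := bdef_gt0 (aB j); have D0 := kd_gt0 Bz (aB j).
  have xD := bdef_le_kd (ltW Bz) (ltW (aB j)); move: (kd z (a j)) (bdef (a j)) x0 D0 xD => D x x0 D0 xD.
  have [y [y0 y2 ->]] : exists y, [/\ 0 < y, y <= 2 & x = y * D].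
    by exists (x / D); rewrite divr_gt0// ler_pdivrMr//; split=> //; rewrite divfK ?gt_eqF.
  rewrite mulfK ?gt_eqF// -powR_mulrn ?(ltW y0)// beE !powRD0// powR_mulrn ?(ltW y0)//.
  rewrite powRM ?(ltW y0) ?(ltW D0)// exprMn sE opprD powRD0// [D `^ (- n.+1%:R)]powRN powR_mulrn ?(ltW D0)//.
  have -> : y `^ be * y ^+ n.+1 * y `^ t * (y `^ (- t) * D `^ (- t)) =
      y `^ be * y ^+ n.+1 * (y `^ t * y `^ (- t)) * D `^ (- t) by ring.
  rewrite -powRD0// subrr powRr0 mulr1.
  have -> : y ^+ n.+1 * D ^+ n.+1 * ((D ^+ n.+1)^-1 * D `^ (- t)) =
      y ^+ n.+1 * (D ^+ n.+1 / D ^+ n.+1) * D `^ (- t) by ring.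
  rewrite divff ?gt_eqF ?exprn_gt0// mulr1 mulrA ler_wpM2r ?powR_ge0// ler_wpM2r ?exprn_ge0 ?(ltW y0)//.
  by apply: powR_le => //; exact: ltW.
apply: le_trans (ler_sum _ (fun j _ => tE j)) _; rewrite -mulr_sumr -mulrA.
rewrite ler_wpM2l ?powR_ge0//.
apply: (@le_trans _ _ (\sum_j \sum_(i < J.+1) (2 ^+ i * X) `^ (- s) * (bdef (a j) ^+ n.+1 * bR (kd z (a j) <= 2 ^+ i.+1 * X)))).
  apply: ler_sum => j _.
  have D2 : kd z (a j) <= 2 ^+ J.+1 * X by apply: le_trans hJ; apply: kd_le2; apply: ltW => //; exact: aB.
  have XD : X <= kd z (a j).
    have := bdef_le_kd (ltW (aB j)) (ltW Bz); rewrite XE [kd z _]kdC; lra.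
  have x0 := bdef_gt0 (aB j).
  have := @dyadic R 2 X (kd z (a j)) (fun D => D `^ (- s)) J _ X0 XD D2 Phi0 PhiD.
  rewrite ltr1n => /(_ isT) h.
  apply: le_trans (ler_wpM2l (exprn_ge0 _ (ltW x0)) h) _.
  by rewrite mulr_sumr; apply: ler_sum => i _; rewrite mulrCA.
rewrite exchange_big/=.
apply: (@le_trans _ _ (\sum_(i < J.+1) (c * 2 ^+ n.+1 * X `^ (- t) * q ^+ i))); last first.
  rewrite -mulr_sumr XE powRM ?invr_ge0 ?(ltW z0)//.
  have -> : (2^-1 : R) `^ (- t) = 2 `^ t by rewrite -powR_inv1 -?powRrM ?mulN1r ?opprK.
  have -> : c * 2 ^+ n.+1 * 2 `^ t / (1 - q) * bdef z `^ (- t) =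
      c * 2 ^+ n.+1 * (bdef z `^ (- t) * 2 `^ t) * (1 - q)^-1 by ring.
  rewrite ler_wpM2l ?geometric_le//.
  by apply: mulr_ge0; [apply: mulr_ge0; [exact: ltW|exact: exprn_ge0]|apply: mulr_ge0; exact: powR_ge0].
apply: ler_sum => i _; rewrite -mulr_sumr.
have p0 : 0 < 2 ^+ i :> R by rewrite exprn_gt0.
have h := hc m a sa z (2 ^+ i.+1 * X) Bz; rewrite mulr_gt0 ?exprn_gt0// in h.
apply: le_trans (ler_wpM2l (Phi0 _) (h isT)) _.
have -> : q ^+ i = (2 ^+ i) `^ (- t).
  by rewrite qE powR_expr.
rewrite [2 ^+ i.+1]exprS -[2 * _ * X]mulrA; move: (2 ^+ i) p0 => P P0.
rewrite sE opprD powRD0 ?mulr_gt0// [(_ * _) `^ (- n.+1%:R)]powRN powR_mulrn ?(ltW (mulr_gt0 _ _))//.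
rewrite [(2 * _) ^+ _]exprMn powRM ?(ltW P0) ?(ltW X0)//.
have : (P * X) ^+ n.+1 != 0 by rewrite gt_eqF ?exprn_gt0 ?mulr_gt0.
move: ((P * X) ^+ n.+1) (2 ^+ n.+1) (_ `^ _) (_ `^ _) => y1 y2 y3 y4 y0.
by rewrite le_eqVlt; apply/orP; left; apply/eqP; field.
Qed.

Variable w : R -> R.
Hypotheses (hw : radial_weight w) (hwD : Dclass w).

(** Dyadic shells around a, each bounded by [omega_tail]. The exponent e precedes p in the
    statement, so that [kernel_sum] may take t = e / p in the Schur test. *)
Lemma kernel_tail : exists2 e : R, 0 < e & forall p, 0 < p -> exists b0 : nat, forall b, (b0 <= b)%N ->
  exists2 k, 0 < k & forall a : Vec, Ball a ->
  (\int[V]_z (((bdef a / kd (z : Vec) a) ^+ b) `^ p * vw w e (enorm (z : Vec)))%:E <=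
    (k * (bdef a ^+ n * bdef a `^ (- e) * Hw w (bdef a)))%:E)%E.
Proof.
have [e [Ct [e0 Ct0 hO]]] := omega_tail hV n_gt0 hw hwD; exists e => // p p0.
(* [omega_tail] stops at radius 2, whereas [dyadic_cover] ends with a radius between 2 and 4. *)
have hO4 (a : Vec) rho : Ball a -> 0 < rho -> rho <= 4 ->
    (\int[V]_z (vw w e (enorm (z : Vec)) * bR (kd (z : Vec) a <= rho))%:E <=
    (2 `^ e * Ct * (rho ^+ n * rho `^ (- e)) * Hw w rho)%:E)%E.
  move=> Ba r0 r4; have one : 1 <= 2 `^ e :> R.
    by have := @powR_le R e 1 2 (ltW e0) ler01 ltac:(by rewrite ler1n); rewrite powR1.
  have [r2|r2] := leP rho 2.
    apply: le_trans (hO a rho Ba r0 r2) _; rewrite lee_fin -!mulrA ler_peMl//.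
    by rewrite mulr_ge0 ?(ltW Ct0)// mulr_ge0 ?exprn_ge0 ?(ltW r0)// mulr_ge0 ?powR_ge0 ?Hw_ge0.
  apply: le_trans (le_trans (hO a 2 Ba ltac:(by []) (lexx _)) _).
    apply: ge0_le_integral => //.
    - by move=> z _; rewrite lee_fin mulr_ge0 ?vw_ge0 ?bR_ge0.
    - apply/measurable_EFinP; apply: measurable_funM.
        by apply: measurableT_comp (measurable_vw hw e) _; exact: measurable_enorm.
      by apply: measurable_bR; [exact: measurable_kd|exact: measurable_cst].
    - apply/measurable_EFinP; apply: measurable_funM.
        by apply: measurableT_comp (measurable_vw hw e) _; exact: measurable_enorm.
      by apply: measurable_bR; [exact: measurable_kd|exact: measurable_cst].
    move=> z _; rewrite lee_fin; have [z1|z1] := ltP (enorm (z : Vec)) 1.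
      rewrite ler_wpM2l ?vw_ge0//; apply: bR_le => _; apply: kd_le2; exact: ltW.
    by rewrite /vw wext_out ?mulr0 ?mul0r// negb_and -!leNgt z1 orbT.
  rewrite lee_fin; apply: ler_pM; rewrite ?Hw_ge0 ?(Hw_mono hw (ltW r2))//.
    by rewrite mulr_ge0 ?(ltW Ct0)// mulr_ge0 ?exprn_ge0 ?powR_ge0.
  rewrite [2 `^ e * Ct]mulrC -mulrA ler_wpM2l ?(ltW Ct0)// mulrCA.
  apply: ler_pM; rewrite ?exprn_ge0 ?powR_ge0//; first by rewrite lerXn2r ?nnegrE ?(ltW r0) ?(ltW r2).
  apply: (@le_trans _ _ (2 `^ e * 4 `^ (- e))); last first.
    by rewrite ler_wpM2l ?powR_ge0//; apply: powRN_le => //; exact: ltW.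
  rewrite (_ : 4 = 2 * 2 :> R) ?powRM//; last by rewrite -natrM.
  by rewrite mulrA -powRD0// subrr powRr0 mul1r.
have [K K1 hK] := Hw_doubling_pow hw hwD.
have K0 : 0 < K by apply: lt_le_trans K1.
have d0 : 0 < (2 ^+ n.+1 * K)^-1 by rewrite invr_gt0 mulr_gt0 ?exprn_gt0.
have p2 := powR_neg2 p0.
(* On the i-th shell the kernel contributes 2^(-i b p), the volume 2^(i n) and the doubling of [Hw]
   K^i; b0 makes the ratio q of this geometric series less than 1. *)
have [b0 hb0] := pow_small (powR_ge0 _ _) p2 d0.
exists b0 => b bb.
have [q [q0 q1 qE]] : exists q : R, [/\ 0 <= q, q < 1 & q = (2 `^ (- p)) ^+ b * (2 ^+ n * K)].
  exists ((2 `^ (- p)) ^+ b * (2 ^+ n * K)); split=> //.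
    by rewrite mulr_ge0 ?exprn_ge0 ?powR_ge0// mulr_ge0 ?exprn_ge0 ?(ltW K0).
  rewrite -ltr_pdivlMr ?mulr_gt0 ?exprn_gt0// mul1r.
  apply: (@le_lt_trans _ _ ((2 `^ (- p)) ^+ b0)).
    by rewrite ler_wiXn2l ?powR_ge0 ?(ltW p2).
  apply: lt_le_trans hb0 _; rewrite lef_pV2 ?posrE ?mulr_gt0 ?exprn_gt0//.
  by rewrite ler_pM2r// exprS ler_peMl ?exprn_ge0// ler1n.
pose B : R := b%:R * p.
have B0 : 0 <= B by rewrite mulr_ge0 ?ler0n// ltW.
exists (2 `^ B * (2 `^ e * Ct) / (1 - q)).
  by rewrite divr_gt0 ?subr_gt0// !mulr_gt0 ?powR_gt0.
move=> a Ba; have x0 := bdef_gt0 Ba; have x1 := bdef_le1 a.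
have mvw : measurable_fun [set: Cn] (fun z : Cn => vw w e (enorm (z : Vec))).
  by apply: measurableT_comp (measurable_vw hw e) _; exact: measurable_enorm.
have mkd := @measurable_kd R n a.
have mkdb rho : measurable_fun [set: Cn] (fun z : Cn => bR (kd (z : Vec) a <= rho) : R).
  by apply: measurable_bR => //; exact: measurable_cst.
have [X [X0 XE]] : exists X : R, 0 < X /\ X = bdef a / 2.
  by exists (bdef a / 2); rewrite divr_gt0.
have [J [hJ4 hJ]] := @dyadic_cover X X0 ltac:(by rewrite XE; lra).
pose u (i : nat) (z : Cn) := (bdef a `^ B * (2 ^+ i * X) `^ (- B)) * (vw w e (enorm (z : Vec)) * bR (kd (z : Vec) a <= 2 ^+ i.+1 * X)).
have u0 i z : 0 <= u i z.
  by rewrite /u; apply: mulr_ge0; [apply: mulr_ge0; exact: powR_ge0|apply: mulr_ge0; [exact: vw_ge0|exact: bR_ge0]].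
have mu i : measurable_fun setT (u i).
  by apply: measurable_funM; [exact: measurable_cst|exact: measurable_funM].
have Phi0 (D : R) : 0 <= D `^ (- B) by exact: powR_ge0.
have PhiD (y z : R) : 0 < y -> y <= z -> z `^ (- B) <= y `^ (- B) by exact/powRN_le.
have ptw (z : Cn) : ((bdef a / kd (z : Vec) a) ^+ b) `^ p * vw w e (enorm (z : Vec)) <= \sum_(i < J.+1) u i z.
  have [z1|z1] := ltP (enorm (z : Vec)) 1; last first.
    by rewrite /vw wext_out ?mulr0 ?sumr_ge0// negb_and -!leNgt z1 orbT.
  have D2 : kd (z : Vec) a <= 2 ^+ J.+1 * X by apply: le_trans hJ; apply: kd_le2; apply: ltW.
  have XD : X <= kd (z : Vec) a.
    by have := bdef_le_kd (ltW z1) (ltW Ba); rewrite XE; lra.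
  have := @dyadic R 2 X (kd (z : Vec) a) (fun D => D `^ (- B)) J _ X0 XD D2 Phi0 PhiD.
  rewrite ltr1n => /(_ isT) h.
  have D0 : 0 < kd (z : Vec) a by apply: lt_le_trans XD.
  have -> : ((bdef a / kd (z : Vec) a) ^+ b) `^ p = bdef a `^ B * kd (z : Vec) a `^ (- B).
    rewrite -powR_mulrn ?divr_ge0 ?(ltW x0) ?(ltW D0)// -powRrM powRM ?invr_ge0 ?(ltW x0) ?(ltW D0)//.
    by rewrite -powR_inv1 ?(ltW D0)// -powRrM mulN1r.
  rewrite mulrAC; have v0 := vw_ge0 hw e (enorm (z : Vec)).
  apply: le_trans (ler_wpM2l (mulr_ge0 (powR_ge0 (bdef a) B) v0) h) _.
  rewrite mulr_sumr; apply: ler_sum => i _; rewrite /u le_eqVlt; apply/orP; left; apply/eqP.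
  by move: (_ `^ _) (_ `^ _) (vw _ _ _) (bR _) => y1 y2 y3 y4; ring.
apply: (@le_trans _ _ (\int[V]_z (\sum_(i < J.+1) u i z)%:E)%E).
  apply: ge0_le_integral => //.
  - by move=> z _; rewrite lee_fin mulr_ge0 ?powR_ge0 ?vw_ge0.
  - apply/measurable_EFinP; apply: measurable_funM => //.
    apply: measurableT_comp (measurable_powR p) _; apply: measurable_funX.
    apply: measurable_funM => //.
    rewrite (_ : (fun z : Cn => _) = (fun z : Cn => kd (z : Vec) a `^ (-1))); last first.
      by apply/funext => z; rewrite powR_inv1 ?kd_ge0.
    exact: measurableT_comp (measurable_powR _) mkd.
  - by apply/measurable_EFinP; apply: measurable_sum.
  - by move=> z _; rewrite lee_fin.
under eq_integral do rewrite -sumEFin.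
rewrite ge0_integral_sum//; last 2 first.
- by move=> i; apply/measurable_EFinP.
- by move=> i z _; rewrite lee_fin.
apply: (@le_trans _ _ (\sum_(i < J.+1) (2 `^ B * (2 `^ e * Ct) * (bdef a ^+ n * bdef a `^ (- e) * Hw w (bdef a)) * q ^+ i)%:E)%E); last first.
  rewrite sumEFin lee_fin -mulr_sumr [X in _ <= X]mulrAC ler_wpM2l ?geometric_le//.
  apply: mulr_ge0; last by rewrite mulr_ge0 ?Hw_ge0// mulr_ge0 ?powR_ge0// exprn_ge0// ltW.
  by apply: mulr_ge0; [exact: powR_ge0|rewrite mulr_ge0 ?powR_ge0// ltW].
apply: lee_sum => i _; rewrite /u.
under eq_integral do rewrite EFinM.
rewrite ge0_integralZl//; last 2 first.
- by move=> z _; rewrite lee_fin mulr_ge0 ?vw_ge0 ?bR_ge0.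
- by rewrite lee_fin mulr_ge0 ?powR_ge0.
2: by apply/measurable_EFinP; apply: measurable_funM.
have iJ : 2 ^+ i.+1 * X <= 4.
  by apply: le_trans hJ4; rewrite ler_pM2r// ler_weXn2l ?ler1n//; exact: ltn_ord.
have X20 : 0 < 2 ^+ i.+1 * X by rewrite mulr_gt0 ?exprn_gt0.
apply: le_trans (lee_wpmul2l _ (hO4 a _ Ba X20 iJ)) _.
  by rewrite lee_fin mulr_ge0 ?powR_ge0.
rewrite -EFinM lee_fin.
have XX : 2 ^+ i.+1 * X = 2 ^+ i * bdef a by rewrite XE exprS; field.
have HH := hK i _ x0; rewrite XX.
have Q0 : 0 < 2 ^+ i :> R by rewrite exprn_gt0.
have Q1 : 1 <= 2 ^+ i :> R by rewrite exprn_ege1// ler1n.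
have qi : q ^+ i = (2 ^+ i) `^ (- B) * ((2 ^+ i) ^+ n * K ^+ i).
  rewrite qE !exprMn -!exprM [(n * i)%N]mulnC; congr (_ * _).
  by rewrite powR_expr// exprM /B -mulrN mulrC powRrM powR_mulrn ?powR_ge0// -!exprM mulnC.
rewrite qi; move: (Hw w (2 ^+ i * bdef a)) (Hw w (bdef a)) (K ^+ i) HH (Hw_ge0 hw (2 ^+ i * bdef a)) (Hw_ge0 hw (bdef a)) => H1 H0 Ki HH H10 H00.
rewrite XE; move: (2 ^+ i) Q0 Q1 => Q Q0 Q1; move: (bdef a) x0 => x x0.
have -> : x `^ B * (Q * (x / 2)) `^ (- B) = 2 `^ B * Q `^ (- B).
  rewrite !powRM ?invr_ge0 ?(ltW x0) ?(ltW Q0) ?divr_ge0 ?(ltW x0)//.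
  have -> : (2^-1 : R) `^ (- B) = 2 `^ B by rewrite -powR_inv1 -?powRrM ?mulN1r ?opprK.
  rewrite mulrCA [x `^ B * _]mulrA -powRD0// subrr powRr0 mul1r mulrC//.
rewrite powRM ?(ltW x0) ?(ltW Q0)// exprMn.
have Qe : Q `^ (- e) <= 1.
  by have := @powRN_le R e 1 Q (ltW e0) ltr01 Q1; rewrite powR1.
have -> : 2 `^ B * Q `^ (- B) * (2 `^ e * Ct * (Q ^+ n * x ^+ n * (Q `^ (- e) * x `^ (- e))) * H1) =
  (2 `^ B * Q `^ (- B) * (2 `^ e * Ct) * (Q ^+ n * x ^+ n * x `^ (- e))) * (Q `^ (- e) * H1) by ring.
have -> : 2 `^ B * (2 `^ e * Ct) * (x ^+ n * x `^ (- e) * H0) * (Q `^ (- B) * (Q ^+ n * Ki)) =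
  (2 `^ B * Q `^ (- B) * (2 `^ e * Ct) * (Q ^+ n * x ^+ n * x `^ (- e))) * (Ki * H0) by ring.
apply: ler_wpM2l; last first.
  by apply: le_trans HH; rewrite ler_piMl.
apply: mulr_ge0; first by rewrite mulr_ge0// ?mulr_ge0 ?powR_ge0// ltW.
by apply: mulr_ge0; [apply: mulr_ge0; apply: exprn_ge0; exact: ltW|exact: powR_ge0].
Qed.

End SeparatedFamilies.

(** * Holomorphic kernels and local maxima *)

Section HolomorphicSums.
Variables (R : realType) (n : nat).
Local Notation C := R[i].
Local Notation Vec := 'rV[C]_n.
Implicit Types (f g : Vec -> C).

Lemma holomorphic_cst (c : C) : holomorphic_on (@Ball R n) (fun=> c).
Proof.
apply/holomorphic_onP; split=> z _ => [e e0|j]; last exact: cdiff_cst.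
by exists 1 => // w _; rewrite subrr cabs0.
Qed.

Lemma holomorphicD f g : holomorphic_on (@Ball R n) f -> holomorphic_on (@Ball R n) g ->
  holomorphic_on (@Ball R n) (fun z => f z + g z).
Proof.
move=> /holomorphic_onP[f1 f2] /holomorphic_onP[g1 g2]; apply/holomorphic_onP; split=> z Bz => [e e0|j].
  have e20 : 0 < e / 2 by rewrite divr_gt0.
  have [d d0 hd] := f1 z Bz _ e20; have [d' d'0 hd'] := g1 z Bz _ e20.
  exists (Num.min d d') => [|w]; rewrite lt_min; first by rewrite d0.
  move=> /andP[/hd h /hd' h']; have := cabsD (f w - f z) (g w - g z).
  have -> : f w - f z + (g w - g z) = f w + g w - (f z + g z) by ring.
  lra.
by apply: cdiffD; [exact: f2|exact: g2].
Qed.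

Lemma holomorphicZ (c : C) f : holomorphic_on (@Ball R n) f ->
  holomorphic_on (@Ball R n) (fun z => c * f z).
Proof.
move=> /holomorphic_onP[f1 f2]; apply/holomorphic_onP; split=> z Bz => [e e0|j].
  have c0 := cabs_ge0 c.
  have [d d0 hd] := f1 z Bz (e / (1 + cabs c)) ltac:(by rewrite divr_gt0// ltr_pwDl).
  exists d => // w /hd h; rewrite -mulrBr cabsM.
  have h1 : cabs c * cabs (f w - f z) <= cabs c * (e / (1 + cabs c)) by rewrite ler_wpM2l// ltW.
  apply: le_lt_trans h1 _.
  by rewrite mulrA ltr_pdivrMr ?ltr_pwDl// mulrC ltr_pM2l// ltrDr.
by apply: cdiffM; [exact: cdiff_cst|exact: f2].
Qed.

Lemma holomorphic_sum (I : Type) (s : seq I) (F : I -> Vec -> C) :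
  (forall i, holomorphic_on (@Ball R n) (F i)) -> holomorphic_on (@Ball R n) (fun z => \sum_(i <- s) F i z).
Proof.
move=> hF; elim: s => [|i s IH].
  by rewrite (_ : (fun z => _) = (fun=> 0)) ?big_nil; [exact: holomorphic_cst|apply/funext => z; rewrite big_nil].
rewrite (_ : (fun z => _) = (fun z => F i z + \sum_(j <- s) F j z)); last by apply/funext => z; rewrite big_cons.
exact: holomorphicD.
Qed.

Lemma holomorphic_inner (g : C -> C) (a : Vec) : (forall z, Ball z -> cdiff g (cinner z a)) ->
  holomorphic_on (@Ball R n) (fun z => g (cinner z a)).
Proof.
move=> hg; apply/holomorphic_onP; split=> z Bz => [e e0|j].
  have [M M0 [d d0 hd]] := cdiff_bounded (hg z Bz).
  have a0 := enorm_ge0 a; have a1 : 0 < 1 + enorm a by rewrite ltr_pwDl.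
  exists (Num.min d (e / M) / (1 + enorm a)) => [|w].
    by rewrite divr_gt0// lt_min d0 divr_gt0.
  rewrite ltr_pdivlMr// => h.
  have hh : cabs (cinner (w - z) a) < Num.min d (e / M).
    apply: le_lt_trans (cabs_cinner _ _) _; apply: le_lt_trans h.
    by rewrite ler_wpM2l ?enorm_ge0// lerDr.
  rewrite lt_min in hh; case/andP: hh => h1 h2.
  have := hd _ h1; rewrite -cinnerDl [z + _]addrC subrK => h3.
  by apply: le_lt_trans h3 _; rewrite mulrC -ltr_pdivlMr.
rewrite /ldiff (_ : (fun s => _) = (fun s => g (cinner z a + cinner (delta_mx 0 j) a * s))).
  by apply: cdiff_affine; rewrite mulr0 addr0; exact: hg.
by apply/funext => s; rewrite cinnerDl cinnerZl mulrC.
Qed.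

Lemma one_sub_cinner_neq0 (z a : Vec) : Ball z -> Ball a -> 1 - cinner z a != 0.
Proof. by move=> Bz Ba; rewrite -cabs_gt0; exact: kd_gt0. Qed.

Lemma holomorphic_kernel (a : Vec) (c : C) N : Ball a ->
  holomorphic_on (@Ball R n) (fun z => (c / (1 - cinner z a)) ^+ N).
Proof.
move=> Ba; apply: (@holomorphic_inner (fun s => (c / (1 - s)) ^+ N)) => z Bz.
apply: cdiffX; apply: cdiffM; first exact: cdiff_cst.
have -> : (fun s : C => (1 - s)^-1) = (fun s => -1 * (s - 1)^-1).
  by apply/funext => s; rewrite mulN1r -invrN opprB.
apply: cdiffM; first exact: cdiff_cst.
by apply: cdiffV_sub; rewrite eq_sym -subr_eq0; exact: one_sub_cinner_neq0.
Qed.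

(** The points near a have |w| <= 1 - bdef a / (4 M), where f is bounded, so the supremum is finite
    and some value exceeds half of it. If f vanishes near a, the point a itself will do. *)
Lemma near_max f (a : Vec) (M : R) : holomorphic_on (@Ball R n) f -> Ball a -> 1 <= M ->
  exists z, [/\ Ball z, bnear M z a & forall w, Ball w -> bnear M w a -> cabs (f w) <= 2 * cabs (f z)].
Proof.
move=> hf Ba M1.
have M0 : 0 < M by exact: lt_le_trans M1.
have x0 := bdef_gt0 Ba; pose r := 1 - bdef a / (4 * M).
have r1 : r < 1 by rewrite gtrBl divr_gt0// mulr_gt0.
have [S hS] := hol_bounded hf r1.
have nr w : Ball w -> bnear M w a -> enorm w <= r.
  move=> Bw /(bnear_bdef Bw Ba) h.
  have w1 : enorm w < 1 := Bw.
  have {}h : bdef a <= 4 * M * (1 - enorm w).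
    apply: le_trans h _; rewrite bdef_enorm.
    have -> : 2 * M * ((1 - enorm w) * (1 + enorm w)) = (2 * M * (1 - enorm w)) * (1 + enorm w) by ring.
    rewrite [leRHS](_ : _ = 2 * M * (1 - enorm w) * 2); last by ring.
    apply: ler_wpM2l; last by lra.
    by rewrite mulr_ge0 ?subr_ge0 ?(ltW w1)// mulr_ge0// ltW.
  by rewrite /r lerBrDl -lerBrDr ler_pdivrMr ?mulr_gt0// mulrC.
have [[w0 [Bw0 nw0 fw0]]|h0] := pselect (exists w, [/\ Ball w, bnear M w a & 0 < cabs (f w)]); last first.
  exists a; split=> //; first exact: bnear_refl.
  move=> w Bw nw; apply: le_trans (_ : 0 <= _); last by rewrite mulr_ge0 ?cabs_ge0.
  by rewrite leNgt; apply/negP => h; apply: h0; exists w.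
pose E : set R := [set cabs (f w) | w in [set w | Ball w /\ bnear M w a]].
have Eub : has_ubound E by exists S => _ [w [Bw nw] <-]; apply: hS; exact: nr.
have E0 : E (cabs (f w0)) by exists w0.
have Esup : has_sup E by split=> //; exists (cabs (f w0)).
have s0 : 0 < sup E by apply: lt_le_trans fw0 _; exact: ub_le_sup.
have [_ [z [Bz nz] <-]] := sup_adherent (divr_gt0 s0 (ltr0n _ 2)) Esup.
move=> hz; exists z; split=> // w Bw nw.
have : cabs (f w) <= sup E by apply: ub_le_sup => //; exists w.
lra.
Qed.

End HolomorphicSums.

Section SignAverages.
Variable R : realType.
Local Notation C := R[i].

Definition flip m (k : 'I_m) (e : {ffun 'I_m -> bool}) : {ffun 'I_m -> bool} :=
  [ffun j => if j == k then ~~ e j else e j].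

Lemma flipK m (k : 'I_m) : involutive (flip k).
Proof. by move=> e; apply/ffunP => j; rewrite !ffunE; case: eqP => // _; rewrite negbK. Qed.

(* Flipping the k-th sign changes the sum by twice its k-th term. *)
Lemma sign_average m (x : 'I_m -> C) (q : R) (k : 'I_m) : 0 < q ->
  #|{ffun 'I_m -> bool}|%:R * cabs (x k) `^ q <=
  2 * \sum_(e : {ffun 'I_m -> bool}) cabs (\sum_j (-1) ^+ e j * x j) `^ q.
Proof.
move=> q0; pose S (e : {ffun 'I_m -> bool}) := \sum_j (-1) ^+ e j * x j.
have SE e : cabs (S e - S (flip k e)) = 2 * cabs (x k).
  rewrite /S -sumrB (bigD1 k)//= big1 => [|j jk]; last by rewrite ffunE (negbTE jk) subrr.
  rewrite addr0 ffunE eqxx -mulrBl cabsM; congr (_ * _).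
  have c2 : cabs (2 : C) = 2 by rewrite -[2 in LHS](rmorph_nat (@real_complex R)) cabsR ger0_norm.
  by rewrite signrN opprK -mulr2n -[_ ^+ _ *+ 2]mulr_natl cabsM c2 cabsX cabsN cabs1 expr1n mulr1.
have SM e : cabs (x k) `^ q <= cabs (S e) `^ q + cabs (S (flip k e)) `^ q.
  have : 2 * cabs (x k) <= cabs (S e) + cabs (S (flip k e)) by rewrite -(SE e); exact: cabsB.
  have := cabs_ge0 (x k); have := cabs_ge0 (S e); have := cabs_ge0 (S (flip k e)).
  move: (cabs (x k)) (cabs (S e)) (cabs (S (flip k e))) => t y z z0 y0 t0 h.
  have [ty|yt] := leP t y.
    by apply: le_trans (powR_le (ltW q0) t0 ty) _; rewrite lerDl powR_ge0.
  have tz : t <= z by lra.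
  by apply: le_trans (powR_le (ltW q0) t0 tz) _; rewrite lerDr powR_ge0.
rewrite mulr2n mulrDl mul1r {2}(reindex_inj (inv_inj (flipK k)))/= -big_split/=.
rewrite mulr_natl -sumr_const; apply: ler_sum => e _; exact: SM.
Qed.

End SignAverages.

(** * Maximal separated families *)

Section MaximalFamilies.
Variables (R : realType) (n : nat).
Local Notation C := R[i].
Local Notation Vec := 'rV[C]_n.
Local Notation Cn := (Cn R n).
Variables (V : {measure set Cn -> \bar R}) (hV : normalized_volume V) (n_gt0 : (0 < n)%N).

Lemma bdef_ge (z : Vec) (r : R) : enorm z <= r -> r < 1 -> 1 - r <= bdef z.
Proof.
move=> zr r1; rewrite bdef_enorm; have z0 := enorm_ge0 z.
have : 0 <= enorm z * (1 - enorm z) by rewrite mulr_ge0// subr_ge0; lra.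
lra.
Qed.

(** [packing] around 0 at scale 2, which covers the ball, bounds the number of separated points of
    modulus at most r; a family of maximal cardinality is near every such point. *)
Lemma maximal_family (r : R) : r < 1 -> exists m (a : 'I_m -> Vec), sepfam a /\
  forall b, enorm b <= r -> exists k, bnear 384 b (a k).
Proof.
move=> r1; have [K K0 hK] := packing hV n_gt0.
pose P m := `[< exists a : 'I_m -> Vec, sepfam a /\ forall k, enorm (a k) <= r >].
have P0 : exists m, P m.
  exists 0%N; apply/asboolP; exists (fun=> 0); split; first by split=> -[].
  by case.
have d0 : 0 < (1 - r) ^+ n.+1 by rewrite exprn_gt0// subr_gt0.
have Pub m : P m -> (m <= Num.bound (K * 2 ^+ n.+1 / (1 - r) ^+ n.+1))%N.
  move=> /asboolP[a [sa ar]].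
  have B0 : Ball (0 : Vec) by rewrite BallE enorm0.
  have h := hK m a sa 0 2 B0 ltac:(by []).
  have h2 : m%:R * (1 - r) ^+ n.+1 <= K * 2 ^+ n.+1.
    apply: le_trans h; rewrite -[m in m%:R]card_ord mulr_natl -sumr_const; apply: ler_sum => k _.
    rewrite /kd cinner0l subr0 cabs1 ler1n mulr1; apply: lerXn2r; rewrite ?nnegrE.
      by rewrite subr_ge0 ltW.
      by apply/ltW; apply: bdef_gt0; exact: sa.1.
    exact: bdef_ge.
  rewrite -(ler_nat R); apply: le_trans (_ : K * 2 ^+ n.+1 / (1 - r) ^+ n.+1 <= _).
    by rewrite ler_pdivlMr.
  by apply: ltW; apply: archi_boundP; rewrite divr_ge0 ?(ltW d0)// mulr_ge0 ?(ltW K0)// exprn_ge0.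
case: (ex_maxnP P0 Pub) => m /asboolP[a [[aB sa] ar]] mmax.
exists m, a; split=> // b br; apply: contrapT => /forallNP nb.
have Bb : Ball b by rewrite BallE (le_lt_trans br).
pose a' (i : 'I_m.+1) := if unlift ord_max i is Some j then a j else b.
suff /asboolP/mmax : exists a : 'I_m.+1 -> Vec, sepfam a /\ forall k, enorm (a k) <= r by rewrite ltnn.
exists a'; split; last by move=> k; rewrite /a'; case: unliftP.
split=> [k|k l kl]; first by rewrite /a'; case: unliftP.
rewrite /a'; move: kl; case: unliftP => [k' ->|->]; case: unliftP => [l' ->|->].
- by rewrite (inj_eq lift_inj); exact: sa.
- by move=> _ /bnearC; exact: nb.
- by move=> _; exact: nb.
- by rewrite eqxx.
Qed.

End MaximalFamilies.

(** * Norms of kernel sums and sampling *)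

Section KernelSums.
Variables (R : realType) (n : nat).
Local Notation C := R[i].
Local Notation Vec := 'rV[C]_n.
Local Notation Cn := (Cn R n).
Variables (V : {measure set Cn -> \bar R}) (hV : normalized_volume V) (n_gt0 : (0 < n)%N).
Variable w : R -> R.
Hypotheses (hw : radial_weight w) (hwD : Dclass w).

Lemma bdef_ge_sub (z : Vec) : Ball z -> 1 - enorm z <= bdef z.
Proof. by move=> Bz; apply: bdef_ge (lexx _) Bz. Qed.

Lemma bdef_le_sub (z : Vec) : Ball z -> bdef z <= 2 * (1 - enorm z).
Proof.
rewrite BallE => z1; rewrite bdef_enorm; have z0 := enorm_ge0 z.
by rewrite mulrC ler_wpM2r//; lra.
Qed.

(* With u_j = (x_j / kd z a_j)^b, factor c_j u_j^2 = (c_j u_j x_j^t) (u_j x_j^-t) and bound the first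
   factor by its l^p norm: this handles p <= 1 and p > 1 alike. *)
Lemma kernel_sum (p : R) : 0 < p -> exists b : nat, exists2 k : R, 0 < k &
  forall m (a : 'I_m -> Vec) (c : 'I_m -> R) (F : Vec -> C), sepfam a -> (forall j, 0 <= c j) ->
  holomorphic_on (@Ball R n) F ->
  (forall z, Ball z -> cabs (F z) <= \sum_j c j * (bdef (a j) / kd z (a j)) ^+ (2 * b)) ->
  (\int[V]_z (bmod F z `^ p * wext w (enorm (z : Vec)))%:E <=
    (k * \sum_j (c j `^ p * (bdef (a j) ^+ n * Hw w (bdef (a j)))))%:E)%E.
Proof.
move=> p0; have [e e0 /(_ _ p0)[b0 hb0]] := kernel_tail hV n_gt0 hw hwD.
have [t [t0 tE]] : exists t, 0 < t /\ t * p = e by exists (e / p); rewrite divr_gt0// divfK ?gt_eqF.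
pose b := (b0 + Num.bound (n.+1%:R + t))%N.
have bt : n.+1%:R + t <= b%:R :> R.
  rewrite natrD; apply: le_trans (_ : (Num.bound (n.+1%:R + t))%:R <= _); last by rewrite lerDr.
  by apply/ltW/archi_boundP; rewrite addr_ge0 ?ler0n// ltW.
have [k k0 hk] := hb0 b (leq_addr _ _); have [K K0 hK] := schur_sum hV n_gt0 t0 bt.
exists b, (K `^ p * k); first by rewrite mulr_gt0 ?powR_gt0.
move=> m a c F sa c0 hF FE; have [aB _] := sa.
pose u j (z : Vec) := (bdef (a j) / kd z (a j)) ^+ b.
have u0 j z : 0 <= u j z.
  by rewrite exprn_ge0// divr_ge0 ?kd_ge0// ltW ?bdef_gt0.
have x0 j := bdef_gt0 (aB j).
pose s (z : Vec) := \sum_j (c j `^ p * bdef (a j) `^ e) * u j z `^ p.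
have s0 z : 0 <= s z by apply: sumr_ge0 => j _; rewrite !mulr_ge0 ?powR_ge0.
have cs j z : c j * u j z * bdef (a j) `^ t <= s z `^ p^-1.
  have y0 : 0 <= c j * u j z * bdef (a j) `^ t by rewrite !mulr_ge0 ?powR_ge0.
  rewrite -[X in X <= _](@powRK R p^-1) ?invr_gt0// invrK; apply: powR_le; rewrite ?powR_ge0 ?invr_ge0 ?(ltW p0)//.
  rewrite !powRM ?mulr_ge0 ?powR_ge0// -powRrM tE /s (bigD1 j)//= mulrAC lerDl.
  by apply: sumr_ge0 => i _; rewrite !mulr_ge0 ?powR_ge0.
have Fs z : Ball z -> cabs (F z) `^ p <= K `^ p * bdef z `^ (- e) * s z.
  move=> Bz; have z0 := bdef_gt0 Bz.
  have h : cabs (F z) <= s z `^ p^-1 * (K * bdef z `^ (- t)).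
    apply: le_trans (FE z Bz) _; apply: le_trans (ler_wpM2l (powR_ge0 _ _) (hK m a sa z Bz)).
    rewrite mulr_sumr; apply: ler_sum => j _.
    rewrite mul2n -addnn exprD -/(u j z).
    have -> : c j * (u j z * u j z) = (c j * u j z * bdef (a j) `^ t) * (u j z * bdef (a j) `^ (- t)).
      have -> : c j * u j z * bdef (a j) `^ t * (u j z * bdef (a j) `^ (- t)) =
        c j * (u j z * u j z) * (bdef (a j) `^ t * bdef (a j) `^ (- t)) by ring.
      by rewrite -powRD0// subrr powRr0 mulr1.
    by rewrite ler_wpM2r// mulr_ge0 ?powR_ge0.
  apply: le_trans (powR_le (ltW p0) (cabs_ge0 _) h) _.
  rewrite !powRM ?mulr_ge0 ?powR_ge0 ?(ltW K0)// -!powRrM mulNr tE mulVf ?gt_eqF// powRr1//.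
  by rewrite mulrC.
have mwe : measurable_fun [set: Cn] (fun z : Cn => wext w (enorm (z : Vec))).
  by apply: measurableT_comp (measurable_wext hw) _; exact: measurable_enorm.
have mvw : measurable_fun [set: Cn] (fun z : Cn => vw w e (enorm (z : Vec))).
  by apply: measurableT_comp (measurable_vw hw e) _; exact: measurable_enorm.
have mu j : measurable_fun [set: Cn] (fun z : Cn => u j (z : Vec) `^ p).
  apply: measurableT_comp (measurable_powR p) _; apply: measurable_funX.
  apply: measurable_funM => //.
  rewrite (_ : (fun z : Cn => _) = (fun z : Cn => kd (z : Vec) (a j) `^ (-1))); last first.
    by apply/funext => z; rewrite powR_inv1 ?kd_ge0.
  exact: measurableT_comp (measurable_powR _) (@measurable_kd R n (a j)).
pose g j (z : Cn) := u j (z : Vec) `^ p * vw w e (enorm (z : Vec)).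
have g0 j z : 0 <= g j z by apply: mulr_ge0; [exact: powR_ge0|exact: vw_ge0].
have mg j : measurable_fun setT (g j) by exact: measurable_funM.
pose d j := K `^ p * (c j `^ p * bdef (a j) `^ e).
have d0 j : 0 <= d j by rewrite /d; apply: mulr_ge0; [exact: powR_ge0|apply: mulr_ge0; exact: powR_ge0].
apply: (@le_trans _ _ (\int[V]_z (\sum_j d j * g j z)%:E)%E).
  apply: ge0_le_integral => //.
  - by move=> z _; rewrite lee_fin mulr_ge0 ?powR_ge0 ?(wext_ge0 hw).
  - by apply/measurable_EFinP; apply: measurable_funM => //; exact: measurable_bmod_powR.
  - by apply/measurable_EFinP; apply: measurable_sum => j; apply: measurable_funM => //; exact: measurable_cst.
  - move=> z _; rewrite lee_fin; have [z1|z1] := ltP (enorm (z : Vec)) 1; last first.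
      rewrite wext_out ?mulr0; first by apply: sumr_ge0 => j _; rewrite mulr_ge0.
      by rewrite negb_and -!leNgt z1 orbT.
    have Bz : Ball (z : Vec) by [].
    rewrite bmodE//; apply: le_trans (ler_wpM2r (wext_ge0 hw _) (Fs _ Bz)) _.
    have -> : \sum_j d j * g j z = K `^ p * s z * vw w e (enorm (z : Vec)).
      rewrite /s mulr_sumr mulr_suml; apply: eq_bigr => j _; rewrite /d /g; ring.
    rewrite [K `^ p * _ * s z]mulrAC -[leLHS]mulrA ler_wpM2l ?mulr_ge0 ?powR_ge0//.
    rewrite /vw ler_wpM2r ?(wext_ge0 hw)//; apply: powRN_le; rewrite ?(ltW e0)// ?subr_gt0//.
    exact: bdef_ge_sub.
under eq_integral do rewrite -sumEFin.
rewrite ge0_integral_sum//; last 2 first.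
- by move=> j; apply/measurable_EFinP; apply: measurable_funM => //; exact: measurable_cst.
- by move=> j z _; rewrite lee_fin mulr_ge0.
rewrite mulr_sumr -sumEFin; apply: lee_sum => j _.
under eq_integral do rewrite EFinM.
rewrite ge0_integralZl//; last 2 first.
- by move=> z _; rewrite lee_fin.
- by rewrite lee_fin.
2: by apply/measurable_EFinP.
apply: le_trans (lee_wpmul2l _ (hk _ (aB j))) _; first by rewrite lee_fin.
rewrite -EFinM lee_fin /d; have := powRD0 e (- e) (x0 j); rewrite subrr powRr0 => h.
move: (bdef (a j) `^ e) (bdef (a j) `^ (- e)) h => y1 y2 h.
rewrite [leRHS](_ : _ = K `^ p * k * (c j `^ p * (bdef (a j) ^+ n * Hw w (bdef (a j)))) * 1); last by rewrite mulr1.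
by rewrite h le_eqVlt; apply/orP; left; apply/eqP; move: (_ `^ _) (_ `^ _) (_ ^+ _) (Hw _ _) => *; ring.
Qed.

Lemma Hw_doubling_le (N : R) : exists2 k : R, 0 < k & forall d, 0 < d -> Hw w (N * d) <= k * Hw w d.
Proof.
have [K K1 hK] := Hw_doubling_pow hw hwD.
have [j Nj] : exists j, N <= 2 ^+ j.
  exists (Num.bound `|N|); apply: le_trans (ler_norm _) _.
  apply: le_trans (ltW (archi_boundP (normr_ge0 N))) _.
  by rewrite -natrX ler_nat ltnW// ltn_expl.
exists (K ^+ j) => [|d d0]; first by rewrite exprn_gt0// (lt_le_trans ltr01).
by apply: le_trans (hK j d d0); apply: Hw_mono => //; rewrite ler_pM2r.
Qed.

(** [packing] at scale M bdef z: the centres near z all have bdef at least bdef z / (2 M), so the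
    bound on the sum of the powers bounds their number. *)
Lemma overlap (M : R) : 0 < M -> exists2 k : R, 0 < k & forall m (a : 'I_m -> Vec), sepfam a ->
  forall z, Ball z -> \sum_j bR (`[< bnear M z (a j) >]) <= k.
Proof.
move=> M0; have [K K0 hK] := packing hV n_gt0.
exists (K * M ^+ n.+1 * (2 * M) ^+ n.+1); first by rewrite !mulr_gt0 ?exprn_gt0 ?mulr_gt0.
move=> m a sa z Bz; have [aB _] := sa; have x0 := bdef_gt0 Bz.
have := hK m a sa z (M * bdef z) Bz; rewrite mulr_gt0// => /(_ isT) h.
have p0 : 0 < (bdef z / (2 * M)) ^+ n.+1 by rewrite exprn_gt0// divr_gt0// mulr_gt0.
rewrite -(ler_pM2l p0) mulr_sumr; apply: le_trans (le_trans _ h) _; last first.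
  rewrite !exprMn exprVn; have : (2 * M) ^+ n.+1 != 0 by rewrite expf_neq0// mulf_neq0// gt_eqF.
  rewrite exprMn; move: (2 ^+ n.+1) (M ^+ n.+1) (bdef z ^+ n.+1) => y1 y2 y3 y0.
  move: (y1 * y2) y0 => y4 y0.
  by rewrite le_eqVlt; apply/orP; left; apply/eqP; field.
apply: ler_sum => j _; case: asboolP => [nj|_]; last first.
  by rewrite mulr0 mulr_ge0 ?bR_ge0// exprn_ge0// ltW// bdef_gt0.
rewrite nj.1 !mulr1 lerXn2r// ?nnegrE ?(ltW (bdef_gt0 (aB j)))//.
  by rewrite divr_ge0 ?(ltW x0)// mulr_ge0// ltW.
rewrite ler_pdivrMr ?mulr_gt0// mulrC; exact: (bnear_bdef (aB j) Bz (bnearC nj)).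
Qed.

(** Mean values over the sets b_j + [Qset (b j)] are added up. The b_j may coincide or cluster, but
    a point z of such a set is N-near a_j, so [overlap] for the separated family bounds the
    multiplicity. Doubling makes Hw(bdef a_j) / bdef a_j at most a multiple of [tailw] at z. *)
Lemma sampling (M : R) : 1 <= M -> exists2 k : R, 0 < k &
  forall p m (a b : 'I_m -> Vec) f, 0 < p -> sepfam a -> (forall j, Ball (b j)) ->
  (forall j, bnear M (b j) (a j)) -> holomorphic_on (@Ball R n) f ->
  ((\sum_j (cabs (f (b j)) `^ p * (bdef (a j) ^+ n * Hw w (bdef (a j)))))%:E <=
    k%:E * \int[V]_z (bmod f z `^ p * tailw w z)%:E)%E.
Proof.
move=> M1; have M0 : 0 < M by exact: lt_le_trans M1.
have [k1 k10 hk1] := vol_Qset hV n_gt0.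
have [N [N0 NE]] : exists N : R, 0 < N /\ N = 6 * (4 + M) ^+ 2.
  by exists (6 * (4 + M) ^+ 2); rewrite mulr_gt0// exprn_gt0// addr_gt0.
have [k2 k20 hk2] := overlap N0.
have [k3 k30 hk3] := Hw_doubling_le (4 * N).
exists ((2 * M) ^+ n.+1 / k1 * (k3 * (2 * N) * k2)).
  by apply: mulr_gt0; [rewrite divr_gt0// exprn_gt0// mulr_gt0|rewrite !mulr_gt0].
move=> p m a b f p0 sa bB nb hf; have [aB _] := sa.
have x0 j := bdef_gt0 (aB j).
pose h j := Hw w (bdef (a j)) / bdef (a j).
have h0 j : 0 <= h j by rewrite divr_ge0 ?(Hw_ge0 hw)// ltW.
pose I j (z : Cn) : R := \1_(Qset (b j)) (z - b j : Cn).
have I0 j z : 0 <= I j z by [].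
have mI j : measurable_fun setT (I j) by exact: measurable_Qset_shift.
have mP : measurable_fun setT (fun z : Cn => bmod f z `^ p) by exact: measurable_bmod_powR.
have P0 z : 0 <= bmod f z `^ p by exact: powR_ge0.
have hIP0 j z : 0 <= h j * I j z * bmod f z `^ p.
  by apply: mulr_ge0 => //; apply: mulr_ge0.
have mtw := @measurable_tailw R n w hw.
have step1 j : ((cabs (f (b j)) `^ p * (bdef (a j) ^+ n * Hw w (bdef (a j))))%:E <=
    ((2 * M) ^+ n.+1 / k1)%:E * \int[V]_z (h j * I j z * bmod f z `^ p)%:E)%E.
  have vQ := hk1 _ (bB j); have pm := pointwise_mean hV hf (bB j) p0.
  have nE := bnear_bdef (bB j) (aB j) (nb j).
  under eq_integral do rewrite -mulrA EFinM.
  rewrite ge0_integralZl//; last 2 first.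
  - by move=> z _; rewrite lee_fin mulr_ge0.
  - by rewrite lee_fin.
  2: by apply/measurable_EFinP; exact: measurable_funM.
  apply: le_trans (lee_wpmul2l _ (lee_wpmul2l _ pm)); last 2 first.
  - by rewrite lee_fin divr_ge0 ?(ltW k10)// exprn_ge0// mulr_ge0// ltW.
  - by rewrite lee_fin.
  apply: le_trans (lee_wpmul2l _ (lee_wpmul2l _ (lee_wpmul2l _ vQ))); last 3 first.
  - by rewrite lee_fin divr_ge0 ?(ltW k10)// exprn_ge0// mulr_ge0// ltW.
  - by rewrite lee_fin.
  - by rewrite lee_fin powR_ge0.
  rewrite -!EFinM lee_fin /h.
  have e1 : bdef (a j) ^+ n.+1 <= (2 * M) ^+ n.+1 * bdef (b j) ^+ n.+1.
    have bj := bdef_gt0 (bB j); rewrite -exprMn lerXn2r ?nnegrE ?(ltW (x0 j))//.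
    by rewrite mulr_ge0 ?(ltW bj)// mulr_ge0// ltW.
  have -> : (2 * M) ^+ n.+1 / k1 * (Hw w (bdef (a j)) / bdef (a j) * (cabs (f (b j)) `^ p * (k1 * bdef (b j) ^+ n.+1))) =
    (cabs (f (b j)) `^ p * (Hw w (bdef (a j)) / bdef (a j))) * ((2 * M) ^+ n.+1 * bdef (b j) ^+ n.+1).
    move: (_ `^ _) ((2 * M) ^+ _) (Hw _ _) (bdef (b j) ^+ _) => *; field.
    by rewrite !gt_eqF.
  apply: le_trans (ler_wpM2l _ e1); last first.
    by rewrite mulr_ge0 ?powR_ge0//; exact: h0.
  rewrite exprS le_eqVlt; apply/orP; left; apply/eqP.
  move: (_ `^ _) (Hw _ _) (bdef (a j) ^+ _) => *; field.
  by rewrite gt_eqF.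
rewrite -sumEFin; apply: le_trans (lee_sum _ (fun j _ => step1 j)) _.
rewrite -ge0_sume_distrr; last first.
  by move=> j _; apply: integral_ge0 => z _; rewrite lee_fin.
rewrite [(_ * (k3 * _ * _))%:E]EFinM -[leRHS]muleA; apply: lee_wpmul2l.
  by rewrite lee_fin divr_ge0 ?(ltW k10)// exprn_ge0// mulr_ge0// ltW.
rewrite -ge0_integral_sum//; last 2 first.
- by move=> j; apply/measurable_EFinP; apply: measurable_funM => //; apply: measurable_funM => //; exact: measurable_cst.
- by move=> j z _; rewrite lee_fin.
rewrite -ge0_integralZl//; last 3 first.
- by apply/measurable_EFinP; exact: measurable_funM.
- by move=> z _; rewrite lee_fin mulr_ge0 ?(tailw_ge0 hw).
- by rewrite lee_fin !mulr_ge0// ltW.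
under eq_integral do rewrite sumEFin.
apply: ge0_le_integral => //.
- by move=> z _; rewrite lee_fin sumr_ge0.
- apply/measurable_EFinP; apply: measurable_sum => j; apply: measurable_funM => //; apply: measurable_funM => //; exact: measurable_cst.
- by apply/measurable_EFinP; apply: measurable_funM; [exact: measurable_cst|exact: measurable_funM].
move=> z _; rewrite -EFinM lee_fin -mulr_suml mulrC mulrCA ler_wpM2l//.
have tw0 := tailw_ge0 hw z.
have kN0 : 0 <= k3 * (2 * N) by rewrite !mulr_ge0// ltW.
have kNk0 : 0 <= k3 * (2 * N) * k2 by rewrite mulr_ge0// ltW.
have [z1|z1] := pselect (Ball (z : Vec)); last first.
  rewrite big1 => [|j _]; first by exact: mulr_ge0.
  rewrite /I indicE; have [/set_mem Qz|_] := boolP (_ \in _); last by rewrite mulr0.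
  by case: z1; have [] := Qset_bnear (bB j) Qz; rewrite addrC subrK.
have d0 : 0 < 1 - enorm (z : Vec) by rewrite subr_gt0.
apply: (@le_trans _ _ (\sum_j k3 * (2 * N) * tailw w z * bR `[< bnear N (z : Vec) (a j) >])); last first.
  rewrite -mulr_sumr [leRHS]mulrAC; apply: ler_wpM2l; [exact: mulr_ge0|exact: hk2].
apply: ler_sum => j _; rewrite /I indicE; have [/set_mem Qz|_] := boolP (_ \in _); last first.
  by rewrite mulr0; apply: mulr_ge0; [exact: mulr_ge0|exact: bR_ge0].
have [_] := Qset_bnear (bB j) Qz; rewrite addrC subrK => nz.
have nN : bnear N (z : Vec) (a j) by rewrite NE; apply: (bnear_trans _ _ z1 (bB j)) => //; exact: ltW.
have -> : `[< bnear N (z : Vec) (a j) >] by apply/asboolP.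
rewrite mulr1 /bR mulr1 /tailw /h powR_inv1 ?(ltW d0)//.
have h1 := bnear_bdef z1 (aB j) nN; have h2 := bnear_bdef (aB j) z1 (bnearC nN).
have h3 := bdef_ge_sub z1; have h4 := bdef_le_sub z1.
have e1 : Hw w (bdef (a j)) <= k3 * Hw w (1 - enorm (z : Vec)).
  apply: le_trans (hk3 _ d0); apply: Hw_mono => //; apply: le_trans h1 _.
  have -> : 4 * N * (1 - enorm (z : Vec)) = 2 * N * (2 * (1 - enorm (z : Vec))) by ring.
  by rewrite ler_wpM2l// mulr_ge0// ltW.
have e2 : (bdef (a j))^-1 <= 2 * N * (1 - enorm (z : Vec))^-1.
  rewrite -[X in X <= _]mul1r ler_pdivrMr// mulrAC ler_pdivlMr// mul1r.
  exact: le_trans h3 h2.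
apply: le_trans (ler_pM _ _ e1 e2) _; rewrite ?(Hw_ge0 hw)// ?invr_ge0 ?(ltW (x0 j))//.
by rewrite le_eqVlt; apply/orP; left; apply/eqP; move: (Hw _ _) (_^-1) => *; ring.
Qed.

End KernelSums.

(** * Domination of oscillations by random kernel sums *)

Section Oscillation.
Variables (R : realType) (n : nat).
Local Notation C := R[i].
Local Notation Vec := 'rV[C]_n.
Local Notation Cn := (Cn R n).
Variables (V : {measure set Cn -> \bar R}) (hV : normalized_volume V) (n_gt0 : (0 < n)%N).
Variable w : R -> R.
Hypotheses (hw : radial_weight w) (hwD : Dclass w).

(* The F i are sums of kernels with all choices of signs. *)
Lemma oscillation (p q r : R) : 0 < p -> 0 < q -> 0 < r -> r < 1 -> exists2 k : R, 0 < k &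
  forall f, holomorphic_on (@Ball R n) f -> forall r0, r0 < 1 ->
  exists (I : finType) (F : I -> Vec -> C), [/\ (0 < #|I|)%N,
    forall i, holomorphic_on (@Ball R n) (F i),
    forall i, (\int[V]_z (bmod (F i) z `^ p * wext w (enorm (z : Vec)))%:E <=
      k%:E * \int[V]_z (bmod f z `^ p * wext w (enorm (z : Vec)))%:E)%E &
    forall a b, Ball b -> enorm a <= r0 -> pseudohyp a b < r ->
      #|I|%:R * cabs (f b - f a) `^ q <= k * pseudohyp a b `^ q * \sum_i cabs (F i a) `^ q].
Proof.
move=> p0 q0 r_gt0 r1; have M4 := lipM_ge4 r_gt0 r1.
have [M [M0 M1]] : exists M : R, 0 < M /\ M = lipM r by exists (lipM r); split=> //; lra.
rewrite -M1 in M4.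
(* By [bnear_trans], whatever is M-near a point that is 384-near a_j is N-near a_j; the maximum of
   |f| near x is thus covered by the one near a_j. *)
have [N [N1 NE]] : exists N : R, 1 <= N /\ N = 6 * (M + 384) ^+ 2.
  by exists (6 * (M + 384) ^+ 2); split=> //; nra.
have [b [k1 k10 hk1]] := kernel_sum hV n_gt0 hw hwD p0.
have [k2 k20 hk2] := sampling hV n_gt0 hw hwD N1.
have [k3 k30 hk3] := tailw_le hV n_gt0 hw hwD.
have [T [T1 TE]] : exists T : R, 1 <= T /\ T = 384 by exists 384; split=> //; rewrite ler1n.
have T0 : 0 < T by lra.
have [L [L0 LE]] : exists L : R, 0 < L /\ L = 160 * lipM r.
  by exists (160 * lipM r); split=> //; apply: mulr_gt0; [rewrite ltr0n|rewrite -M1].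
have [A [A0 AE]] : exists A, 0 < A /\ A = L * T ^+ (2 * b).
  by exists (L * T ^+ (2 * b)); rewrite mulr_gt0 ?exprn_gt0.
pose k := k1 * (2 `^ p * (k2 * k3)) + A `^ q * 2.
have k0 : 0 < k by rewrite addr_gt0 ?mulr_gt0 ?powR_gt0.
exists k => // f hf r0 r01.
(* Only this finite family depends on r0; all the constants have been fixed before. *)
have [m [a [sa acov]]] := maximal_family hV n_gt0 r01; have [aB _] := sa.
have /choice[z hz] : forall j, exists z, [/\ Ball z, bnear N z (a j) &
  forall x, Ball x -> bnear N x (a j) -> cabs (f x) <= 2 * cabs (f z)].
  by move=> j; exact: near_max.
pose c j := 2 * cabs (f (z j)).
have c0 j : 0 <= c j by rewrite mulr_ge0 ?cabs_ge0.
pose K j (x : Vec) : C := (((bdef (a j))%:C)%C / (1 - cinner x (a j))) ^+ (2 * b).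
pose F (e : {ffun 'I_m -> bool}) (x : Vec) := \sum_j (-1) ^+ e j * (((c j)%:C)%C * K j x).
have KE j x : cabs (((c j)%:C)%C * K j x) = c j * (bdef (a j) / kd x (a j)) ^+ (2 * b).
  rewrite cabsM cabsR ger0_norm// /K cabsX cabsM cabsV cabsR ger0_norm//.
  by apply/ltW/bdef_gt0.
have hF e : holomorphic_on (@Ball R n) (F e).
  apply: holomorphic_sum => j; apply: holomorphicZ; apply: holomorphicZ; exact: holomorphic_kernel.
exists {ffun 'I_m -> bool}, F; split=> //.
- by apply/card_gt0P; exists [ffun=> true].
- move=> e; apply: le_trans (hk1 m a c (F e) sa c0 (hF e) _) _.
    move=> x Bx; apply: le_trans (cabs_sum _ _ _) _; apply: ler_sum => j _.
    by rewrite cabsM cabsX cabsN cabs1 expr1n mul1r KE.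
  have -> : \sum_j c j `^ p * (bdef (a j) ^+ n * Hw w (bdef (a j))) =
     2 `^ p * \sum_j (cabs (f (z j)) `^ p * (bdef (a j) ^+ n * Hw w (bdef (a j)))).
    by rewrite mulr_sumr; apply: eq_bigr => j _; rewrite /c powRM ?cabs_ge0// -mulrA.
  have s2 := hk2 p m a z f p0 sa (fun j => let: And3 h _ _ := hz j in h) (fun j => let: And3 _ h _ := hz j in h) hf.
  have I0 : (0 <= \int[V]_z (bmod f z `^ p * wext w (enorm (z : Vec)))%:E)%E.
    by apply: integral_ge0 => x _; rewrite lee_fin mulr_ge0 ?powR_ge0 ?(wext_ge0 hw).
  rewrite mulrA EFinM; apply: le_trans (lee_wpmul2l _ s2) _.
    by rewrite lee_fin mulr_ge0 ?powR_ge0 ?(ltW k10).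
  apply: le_trans (lee_wpmul2l _ (lee_wpmul2l _ (hk3 f p hf p0))) _.
  - by rewrite lee_fin mulr_ge0 ?powR_ge0 ?(ltW k10).
  - by rewrite lee_fin ltW.
  rewrite !muleA -!EFinM; apply: lee_wpmul2r => //.
  by rewrite lee_fin /k -!mulrA lerDl mulr_ge0 ?powR_ge0.
- move=> x y By xr hxy.
  have Bx : Ball x by rewrite BallE (le_lt_trans xr).
  have [j nj] := acov x xr; rewrite -TE in nj; have [Bz nz hzj] := hz j.
  have hS u : Ball u -> bnear (lipM r) u x -> cabs (f u) <= c j.
    move=> Bu nu; apply: hzj => //; rewrite NE -TE.
    by rewrite -M1 in nu; apply: (bnear_trans (ltW M0) (ltW T0) Bu Bx (aB j) nu nj).
  have l1 := pseudohyp_lipschitz hf r_gt0 r1 Bx By hxy hS.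
  have r0' := pseudohyp_ge0 x y.
  (* At x the modulus of the j-th kernel is at least 384^(-2 b), because [kd x (a j)] is at most 384
     times [bdef (a j)]. *)
  have l2 : c j <= T ^+ (2 * b) * cabs (((c j)%:C)%C * K j x).
    rewrite KE mulrCA -exprMn ler_peMr// exprn_ege1//.
    by rewrite mulrA ler_pdivlMr ?kd_gt0// mul1r; exact: nj.2.
  have l3 : cabs (f y - f x) <= A * (pseudohyp x y * cabs (((c j)%:C)%C * K j x)).
    apply: le_trans l1 _; rewrite -LE AE.
    have -> : L * T ^+ (2 * b) * (pseudohyp x y * cabs (((c j)%:C)%C * K j x)) =
      L * pseudohyp x y * (T ^+ (2 * b) * cabs (((c j)%:C)%C * K j x)).
      by move: (T ^+ _) (pseudohyp x y) (cabs _) => *; ring.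
    by rewrite ler_wpM2l// mulr_ge0// ltW.
  have l4 : cabs (f y - f x) `^ q <= A `^ q * (pseudohyp x y `^ q * cabs (((c j)%:C)%C * K j x) `^ q).
    by rewrite -!powRM ?mulr_ge0 ?cabs_ge0// ?(ltW A0)//; apply: powR_le; rewrite ?(ltW q0) ?cabs_ge0.
  have l5 := sign_average (fun j => ((c j)%:C)%C * K j x) j q0.
  apply: le_trans (ler_wpM2l (ler0n _ _) l4) _.
  rewrite [leLHS](_ : _ = A `^ q * pseudohyp x y `^ q * (#|{ffun 'I_m -> bool}|%:R * cabs (((c j)%:C)%C * K j x) `^ q)); last first.
    by move: (_ `^ _) (_ `^ _) (_ `^ _) (_%:R) => *; ring.
  apply: le_trans (ler_wpM2l _ l5) _; first by rewrite mulr_ge0 ?powR_ge0.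
  have S0 : 0 <= \sum_e cabs (F e x) `^ q by apply: sumr_ge0 => e _; exact: powR_ge0.
  rewrite [leLHS](_ : _ = A `^ q * 2 * pseudohyp x y `^ q * \sum_e cabs (F e x) `^ q); last first.
    by rewrite /F; move: (_ `^ _) (_ `^ _) (\sum_e _) => *; ring.
  by rewrite ler_wpM2r// ler_wpM2r ?powR_ge0// /k lerDr !mulr_ge0 ?powR_ge0 ?(ltW k10) ?(ltW k20) ?(ltW k30).
Qed.

End Oscillation.

(** * Normal families *)

Section ComplexLimits.
Variable R : realType.
Local Notation C := R[i].
Implicit Types (v : nat -> C) (L : C).

Lemma ccvg_le v L (K : R) : ccvg v L -> (forall k, cabs (v k) <= K) -> cabs L <= K.
Proof.
move=> hv hK; apply/ler_addgt0Pr => e e0; have [N hN] := hv e e0.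
have := hN N (leqnn N); have := hK N; have := cabs_lerB L (v N); rewrite cabs_distC; lra.
Qed.

Lemma ccvgD v v' L L' : ccvg v L -> ccvg v' L' -> ccvg (fun k => v k + v' k) (L + L').
Proof.
move=> hv hv' e e0; have e20 : 0 < e / 2 by rewrite divr_gt0.
have [N hN] := hv _ e20; have [N' hN'] := hv' _ e20.
exists (maxn N N') => k; rewrite geq_max => /andP[/hN h /hN' h'].
have := cabsD (v k - L) (v' k - L').
have -> : v k - L + (v' k - L') = v k + v' k - (L + L') by ring.
lra.
Qed.

Lemma ccvgZ (c : C) v L : ccvg v L -> ccvg (fun k => c * v k) (c * L).
Proof.
move=> hv e e0; have c0 := cabs_ge0 c.
have [N hN] := hv (e / (1 + cabs c)) ltac:(by rewrite divr_gt0// ltr_pwDl).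
exists N => k /hN h; rewrite -mulrBr cabsM.
have h1 : cabs c * cabs (v k - L) <= cabs c * (e / (1 + cabs c)) by rewrite ler_wpM2l// ltW.
apply: le_lt_trans h1 _.
by rewrite mulrA ltr_pdivrMr ?ltr_pwDl// mulrC ltr_pM2l// ltrDr.
Qed.

Lemma ccvgB v v' L L' : ccvg v L -> ccvg v' L' -> ccvg (fun k => v k - v' k) (L - L').
Proof.
move=> hv hv'; have := ccvgD hv (ccvgZ (-1) hv'); rewrite mulN1r.
by congr ccvg; apply/funext => k; rewrite mulN1r.
Qed.

Lemma ccvg_cst L : ccvg (fun=> L) L.
Proof. by move=> e e0; exists 0%N => k _; rewrite subrr cabs0. Qed.

Lemma ccvg_sub v L s : sincr s -> ccvg v L -> ccvg (fun k => v (s k)) L.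
Proof.
move=> hs hv e /hv[N hN]; exists N => k Nk; apply: hN; exact: leq_trans Nk (sincr_ge hs k).
Qed.

Lemma ccauchy_ccvg v : (forall e : R, 0 < e -> exists N, forall k l, (N <= k)%N -> (N <= l)%N ->
  cabs (v k - v l) < e) -> exists L, ccvg v L.
Proof.
move=> hv; have [N hN] := hv 1 ltr01.
have [k j|s [hs [L hL]]] := @diagonal_cextraction R (fun k _ => v (N + k)%N) (fun=> cabs (v N) + 1).
  have := hN (N + k)%N N (leq_addr _ _) (leqnn N); have := cabs_lerB (v (N + k)%N) (v N); lra.
exists (L 0%N) => e e0; have e20 : 0 < e / 2 by rewrite divr_gt0.
have [K hK] := hL 0%N _ e20; have [N' hN'] := hv _ e20.
exists N' => k Nk; pose i := maxn K N'.
have h1 := hK i (leq_maxl _ _).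
have h2 := hN' k (N + s i)%N Nk (leq_trans (leq_trans (leq_maxr K N') (sincr_ge hs i)) (leq_addl _ _)).
have := cabsD (v k - v (N + s i)%N) (v (N + s i)%N - L 0%N).
have -> : v k - v (N + s i)%N + (v (N + s i)%N - L 0%N) = v k - L 0%N by ring.
lra.
Qed.

End ComplexLimits.

(** * Montel's theorem *)

Section NormalFamilies.
Variables (R : realType) (n : nat).
Local Notation C := R[i].
Local Notation Vec := 'rV[C]_n.
Implicit Types (f g : Vec -> C).

Lemma hol_segment f z y (r : R) : holomorphic_on (@Ball R n) f -> r < 1 -> enorm z <= r ->
  enorm y <= (1 - r) / 4 ->
  hol2 (fun s => f (z + s *: y)) /\
  forall s, cabs s <= 9 / 5 -> enorm (z + s *: y) <= (1 + r) / 2.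
Proof.
move=> hf r1 zr yr.
have h s : cabs s <= 9 / 5 -> enorm (z + s *: y) <= (1 + r) / 2.
  move=> hs; apply: le_trans (enormD _ _) _; rewrite enormZ.
  have := ler_pM (cabs_ge0 s) (enorm_ge0 y) hs yr; lra.
have r2 : (1 + r) / 2 < 1 by lra.
by split=> //; have [] := hol_line hf r2 h.
Qed.

(** Schwarz's estimate along the complex line through z and x, with a unit step of length (1 - r) /
    4; 40 is 10 times 4. *)
Lemma hol_lipschitz f z x (r M : R) : holomorphic_on (@Ball R n) f -> r < 1 -> enorm z <= r ->
  enorm (x - z) <= (1 - r) / 4 -> (forall y, enorm y <= (1 + r) / 2 -> cabs (f y) <= M) ->
  cabs (f x - f z) <= 40 * M / (1 - r) * enorm (x - z).
Proof.
move=> hf r1 zr xr hM.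
have d0 : 0 < (1 - r) / 4 by rewrite divr_gt0// subr_gt0.
have [->|/eqP xz] := pselect (x = z); first by rewrite !subrr enorm0 cabs0 mulr0.
have h0 : 0 < enorm (x - z).
  rewrite lt_neqAle enorm_ge0 andbT eq_sym; apply: contra_neq xz => h.
  by apply/eqP; rewrite -subr_eq0; apply/eqP/sqnorm0_eq; rewrite -enorm_sqr h expr0n.
pose t := enorm (x - z) / ((1 - r) / 4).
have t0 : 0 < t by rewrite divr_gt0.
have tC : (t%:C)%C != 0 :> C by rewrite -cabs_gt0 cabsR normr_gt0 gt_eqF.
pose y := (t%:C)%C^-1 *: (x - z).
have yr : enorm y <= (1 - r) / 4.
  rewrite enormZ cabsV cabsR (ger0_norm (ltW t0)) /t invf_div divfK ?gt_eqF//.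
have [g2 hr] := hol_segment hf r1 zr yr.
have := schwarz1 g2 (fun s hs => hM _ (hr s hs)) (z := (t%:C)%C).
rewrite cabsR (ger0_norm (ltW t0)) ler_pdivrMr// mul1r => /(_ xr).
rewrite scale0r addr0 /y scalerA divff// scale1r addrCA subrr addr0 => h.
apply: le_trans h _; rewrite /t le_eqVlt; apply/orP; left; apply/eqP.
by move: (enorm _) => u; field; rewrite gt_eqF// subr_gt0.
Qed.

(** Continuity passes to the limit through the common Lipschitz bound. For the partial derivatives,
    the bound of [schwarz2] on the quadratic remainder is uniform in k and passes to the limit along
    a subsequence on which the linear coefficients converge. *)
Lemma normal_limit (f : nat -> Vec -> C) (M : R -> R) g :
  (forall k, holomorphic_on (@Ball R n) (f k)) ->
  (forall r, r < 1 -> forall k z, enorm z <= r -> cabs (f k z) <= M r) ->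
  (forall z, Ball z -> ccvg (fun k => f k z) (g z)) -> holomorphic_on (@Ball R n) g.
Proof.
move=> hf hM hg; apply/holomorphic_onP; split=> z Bz => [e e0|j].
  have z1 : enorm z < 1 := Bz; pose r := enorm z.
  have r1 : (1 + r) / 2 < 1 by rewrite /r; lra.
  have d0 : 0 < (1 - r) / 4 by rewrite divr_gt0// subr_gt0.
  pose K := 40 * M ((1 + r) / 2) / (1 - r).
  have K0 : 0 <= K.
    rewrite divr_ge0 ?subr_ge0 ?(ltW z1)// mulr_ge0//; apply: le_trans (hM _ r1 0%N z _); first exact: cabs_ge0.
    by rewrite -/r; lra.
  have K10 : 0 < 1 + K by rewrite ltr_pwDl.
  exists (Num.min ((1 - r) / 4) (e / (1 + K))) => [|x]; rewrite lt_min; first by rewrite d0 divr_gt0.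
  move=> /andP[/ltW h1]; rewrite ltr_pdivlMr// => h2.
  have Bx : Ball x.
    rewrite BallE -(subrK z x); apply: le_lt_trans (enormD _ _) _; rewrite -/r.
    have : r < 1 by []. lra.
  apply: (@le_lt_trans _ _ (K * enorm (x - z))); last first.
    by have := enorm_ge0 (x - z); rewrite mulrC; nra.
  apply: (ccvg_le (ccvgB (hg x Bx) (hg z Bz))) => k.
  by apply: hol_lipschitz => // y hy; exact: hM.
have z1 : enorm z < 1 := Bz; pose r := enorm z.
have r1 : (1 + r) / 2 < 1 by rewrite /r; lra.
have [d [d0 dE]] : exists d : R, 0 < d /\ d = (1 - r) / 4.
  by exists ((1 - r) / 4); split=> //; rewrite divr_gt0// subr_gt0.
pose y : Vec := (d%:C)%C *: delta_mx 0 j.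
have yr : enorm y <= (1 - r) / 4 by rewrite enormZ enorm_delta mulr1 cabsR dE ger0_norm// -dE ltW.
have S k := hol_segment (hf k) z1 (lexx _) yr.
pose N := M ((1 + r) / 2).
have N0 : 0 <= N.
  by apply: le_trans (hM _ r1 0%N z _); [exact: cabs_ge0|rewrite -/r; lra].
have fN k s : cabs s <= 9 / 5 -> cabs (f k (z + s *: y)) <= N.
  by move=> hs; apply: hM => //; have [_] := S k; apply.
have /choice[l hl] : forall k, exists l, forall s, cabs s <= 1 ->
    cabs (f k (z + s *: y) - f k z - l * s) <= 8 * N * cabs s ^+ 2.
  move=> k; have [l hl] := schwarz2 (S k).1 (fun s hs => fN k s hs); exists l => s hs.
  by have := hl s hs; rewrite scale0r addr0.
have lb k : cabs (l k) <= 10 * N.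
  have := hl k 1; rewrite cabs1 expr1n !mulr1 lexx => /(_ isT) h.
  have h1 := fN k 1; rewrite cabs1 in h1; have {}h1 := h1 ltac:(lra).
  have h2 := fN k 0; rewrite cabs0 scale0r addr0 in h2; have {}h2 := h2 ltac:(lra).
  have := cabs_lerB (l k) (f k (z + 1 *: y) - f k z); rewrite [cabs (l k - _)]cabs_distC => h3.
  have := cabsB (f k (z + 1 *: y)) (f k z); lra.
have [s [hs [L hL]]] := @diagonal_cextraction R (fun k _ => l k) (fun=> 10 * N) (fun k _ => lb k).
have Bs t : cabs t <= 1 -> Ball (z + t *: y).
  move=> t1; rewrite BallE; have [_ h] := S 0%N; apply: le_lt_trans (h t _) r1; lra.
have H t : cabs t <= 1 -> cabs (g (z + t *: y) - g z - L 0%N * t) <= 8 * N * cabs t ^+ 2.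
  move=> t1; have c1 := ccvgB (ccvg_sub hs (hg _ (Bs t t1))) (ccvg_sub hs (hg z Bz)).
  have := ccvgB c1 (ccvgZ t (hL 0%N)); rewrite [t * _]mulrC => /ccvg_le; apply => k.
  by rewrite [t * _]mulrC; exact: hl.
have dC : (d%:C)%C != 0 :> C by rewrite -cabs_gt0 cabsR normr_gt0 gt_eqF.
exists (L 0%N / (d%:C)%C) => e e0.
have d2 : 0 < e * d ^+ 2 / (1 + 8 * N) by rewrite divr_gt0 ?mulr_gt0 ?exprn_gt0// ltr_pwDl// mulr_ge0.
exists (Num.min d (e * d ^+ 2 / (1 + 8 * N))) => [|t]; rewrite lt_min; first by rewrite d0 d2.
move=> /andP[td]; rewrite ltr_pdivlMr ?ltr_pwDl ?mulr_ge0// => t2.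
have := H (t / (d%:C)%C); rewrite cabsM cabsV cabsR (ger0_norm (ltW d0)) ler_pdivrMr// mul1r => /(_ (ltW td)).
rewrite /y scalerA divfK// add0r scale0r addr0 => h.
rewrite mulrAC; apply: le_trans (le_trans _ h) _; first by rewrite mulrA.
rewrite exprMn exprVn mulrA ler_pdivrMr ?exprn_gt0//.
have := cabs_ge0 t; move: (cabs t) t2 => u t2 u0.
have -> : e * u * d ^+ 2 = (e * d ^+ 2) * u by ring.
have -> : 8 * N * u ^+ 2 = u * (8 * N) * u by ring.
by apply: ler_wpM2r => //; lra.
Qed.

Definition rat_pt (q : {ffun 'I_n -> rat * rat}) : Vec :=
  \row_j (ratr (q j).1 +i* ratr (q j).2)%C.

Lemma rat_pt_dense (z : Vec) (d : R) : 0 < d -> exists q, enorm (rat_pt q - z) < d.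
Proof.
move=> d0; pose e := d / (2 * n%:R + 1).
have e0 : 0 < e by rewrite divr_gt0// ltr_wpDl// mulr_ge0.
have ex (x : R) : exists a : rat, `|ratr a - x| <= e.
  have [a] := @rat_in_itvoo R (x - e) (x + e) ltac:(lra); rewrite in_itv /= => /andP[a1 a2].
  by exists a; rewrite ler_norml; apply/andP; split; lra.
have /choice[F hF] := ex.
exists [ffun j : 'I_n => (F (complex.Re (z 0 j)), F (complex.Im (z 0 j)))].
apply: (@le_lt_trans _ _ (2 * e * n%:R)).
  apply: enorm_coord => j; apply: le_trans (cabs_le_ReIm _) _.
  rewrite !mxE !ffunE cReD cImD cReN cImN /=.
  have := hF (complex.Re (z 0 j)); have := hF (complex.Im (z 0 j)); lra.
have he : e * (2 * n%:R + 1) = d by rewrite /e divfK// gt_eqF// ltr_wpDl// mulr_ge0.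
have -> : 2 * e * n%:R = d - e by rewrite -[in RHS]he; ring.
by rewrite gtrBl.
Qed.

(** Diagonal extraction on the rational points of the ball; the common local Lipschitz bound turns
    convergence there into a Cauchy property at every point. *)
Lemma montel (f : nat -> Vec -> C) (M : R -> R) :
  (forall k, holomorphic_on (@Ball R n) (f k)) ->
  (forall r, r < 1 -> forall k z, enorm z <= r -> cabs (f k z) <= M r) ->
  exists s g, [/\ sincr s, holomorphic_on (@Ball R n) g &
    forall z, Ball z -> ccvg (fun k => f (s k) z) (g z)].
Proof.
move=> hf hM.
(* Rational points outside the ball, and integers that code no point, are replaced by 0. *)
pose pt j : Vec := if unpickle j is Some q then (if `[< Ball (rat_pt q) >] then rat_pt q else 0) else 0.
have Bpt j : Ball (pt j).
  by rewrite /pt; case: unpickle => [q|]; [case: asboolP => // _|]; rewrite BallE enorm0.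
have [k j|s [hs [L hL]]] := @diagonal_cextraction R (fun k j => f k (pt j)) (fun j => M (enorm (pt j))).
  by apply: hM => //; exact: Bpt.
have /choice[g hg] : forall z, exists l, Ball z -> ccvg (fun k => f (s k) z) l.
  move=> z; have [Bz|] := pselect (Ball z); last by exists 0.
  suff [l hl] : exists l, ccvg (fun k => f (s k) z) l by exists l.
  apply: ccauchy_ccvg => e e0.
  have z1 : enorm z < 1 := Bz; pose r := enorm z.
  have r1 : (1 + r) / 2 < 1 by rewrite /r; lra.
  pose K := 40 * M ((1 + r) / 2) / (1 - r).
  have K0 : 0 <= K.
    rewrite divr_ge0 ?subr_ge0 ?(ltW z1)// mulr_ge0//; apply: le_trans (hM _ r1 0%N z _); first exact: cabs_ge0.
    by rewrite -/r; lra.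
  have K10 : 0 < 1 + K by rewrite ltr_pwDl.
  have d0 : 0 < Num.min ((1 - r) / 4) (e / 4 / (1 + K)).
    by rewrite lt_min !divr_gt0// subr_gt0.
  have [q] := rat_pt_dense z d0; rewrite lt_min => /andP[q1]; rewrite ltr_pdivlMr// => q2.
  have Bq : Ball (rat_pt q).
    rewrite BallE -(subrK z (rat_pt q)); apply: le_lt_trans (enormD _ _) _; rewrite -/r.
    have : r < 1 by []. lra.
  have lip k : cabs (f (s k) (rat_pt q) - f (s k) z) < e / 4.
    apply: (@le_lt_trans _ _ (K * enorm (rat_pt q - z))).
      by apply: (hol_lipschitz _ _ _ (ltW q1)) => // y hy; exact: hM.
    by have := enorm_ge0 (rat_pt q - z); nra.
  have [N hN] := hL (pickle q) (e / 4) ltac:(by rewrite divr_gt0).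
  have ptq : pt (pickle q) = rat_pt q by rewrite /pt pickleK; case: asboolP.
  rewrite ptq in hN; exists N => k l /hN h1 /hN h2; have h3 := lip k; have h4 := lip l.
  move: (L _) h1 h2 => c h1 h2.
  have -> : f (s k) z - f (s l) z = - (f (s k) (rat_pt q) - f (s k) z) + (f (s k) (rat_pt q) - c)
     + ((f (s l) (rat_pt q) - f (s l) z) - (f (s l) (rat_pt q) - c)) by ring.
  apply: le_lt_trans (cabsD _ _) _; apply: le_lt_trans (lerD (cabsD _ _) (cabsB _ _)) _.
  rewrite cabsN; lra.
exists s, g; split=> //.
by apply: (@normal_limit (fun k => f (s k)) M) => // r r1 k z; exact: hM.
Qed.

End NormalFamilies.

(** * Point evaluations on the weighted space *)

Section PointEvaluation.
Variables (R : realType) (n : nat).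
Local Notation C := R[i].
Local Notation Vec := 'rV[C]_n.
Local Notation Cn := (Cn R n).
Variables (V : {measure set Cn -> \bar R}) (hV : normalized_volume V) (n_gt0 : (0 < n)%N).
Variable w : R -> R.
Hypotheses (hw : radial_weight w) (hwD : Dclass w).

Lemma point_evaluation (p r : R) : 0 < p -> r < 1 -> exists2 k : R, 0 < k &
  forall f a, holomorphic_on (@Ball R n) f -> enorm a <= r ->
  ((cabs (f a) `^ p)%:E <= k%:E * \int[V]_z (bmod f z `^ p * wext w (enorm (z : Vec)))%:E)%E.
Proof.
move=> p0 r1; have [k1 k10 hk1] := vol_Qset hV n_gt0.
have [k3 k30 hk3] := tailw_le hV n_gt0 hw hwD.
(* For z in a + [Qset a] one has 1 - r <= bdef a <= 16 (1 - |z|), so d bounds 1 - |z| from below on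
   the whole neighbourhood. *)
have [d [d0 dE]] : exists d : R, 0 < d /\ d = (1 - r) / 16.
  by exists ((1 - r) / 16); split=> //; rewrite divr_gt0// subr_gt0.
have H0 := Hw_gt0 hw d0; pose A := k1 * (1 - r) ^+ n.+1.
have A0 : 0 < A by rewrite mulr_gt0// exprn_gt0// subr_gt0.
exists (A^-1 * ((Hw w d)^-1 * k3)); first by rewrite !mulr_gt0 ?invr_gt0.
move=> f a hf ar; have Ba : Ball a by rewrite BallE (le_lt_trans ar).
have I0 (g : Cn -> R) : (forall z, 0 <= g z) -> (0 <= \int[V]_z (g z)%:E)%E.
  by move=> g0; apply: integral_ge0 => z _; rewrite lee_fin.
have mP : measurable_fun setT (fun z : Cn => bmod f z `^ p) by exact: measurable_bmod_powR.
have P0 (z : Cn) : 0 <= bmod f z `^ p by exact: powR_ge0.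
have T0 z := @tailw_ge0 R n w hw z; have mT := @measurable_tailw R n w hw.
have s1 : ((cabs (f a) `^ p)%:E * A%:E <= \int[V]_z (\1_(Qset a) (z - a : Cn) * bmod f z `^ p)%:E)%E.
  apply: le_trans (pointwise_mean hV hf Ba p0); apply: lee_wpmul2l; first by rewrite lee_fin powR_ge0.
  apply: le_trans (hk1 a Ba); rewrite lee_fin /A ler_wpM2l ?(ltW k10)//.
  apply: lerXn2r; rewrite ?nnegrE; [by rewrite subr_ge0 ltW|exact: ltW (bdef_gt0 Ba)|exact: bdef_ge].
have s2 : (\int[V]_z (\1_(Qset a) (z - a : Cn) * bmod f z `^ p)%:E <=
    (Hw w d)^-1%:E * \int[V]_z (bmod f z `^ p * tailw w z)%:E)%E.
  rewrite -ge0_integralZl//; last 3 first.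
  - by apply/measurable_EFinP; exact: measurable_funM.
  - by move=> z _; rewrite lee_fin mulr_ge0.
  - by rewrite lee_fin invr_ge0 ltW.
  apply: ge0_le_integral => //.
  - by move=> z _; rewrite lee_fin mulr_ge0.
  - by apply/measurable_EFinP; apply: measurable_funM => //; exact: measurable_Qset_shift.
  - apply/measurable_EFinP; apply: measurable_funM; [exact: measurable_cst|exact: measurable_funM].
  move=> z _; rewrite -EFinM lee_fin indicE; have [/set_mem Qz|_] := boolP (_ \in _); last first.
    by rewrite mul0r mulr_ge0 ?invr_ge0 ?(ltW H0)// mulr_ge0.
  have [Bz nz] := Qset_bnear Ba Qz; rewrite addrC subrK in Bz; rewrite addrC subrK in nz.
  have z1 : 0 < 1 - enorm (z : Vec) by rewrite subr_gt0.
  have h1 := bnear_bdef Bz Ba nz; have h2 := bdef_le_sub Bz; have h3 := bdef_ge ar r1.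
  have h4 : d <= 1 - enorm (z : Vec) by rewrite dE ler_pdivrMr//; lra.
  rewrite mul1r mulrCA ler_peMr// mulrC ler_pdivlMr// mul1r /tailw.
  rewrite -[leLHS]mulr1; apply: ler_pM => //; [exact: ltW|exact: Hw_mono|].
  by rewrite powR_inv1 ?(ltW z1)// invf_ge1// lerBlDr lerDl enorm_ge0.
rewrite EFinM -muleA lee_pdivlMl// muleC; apply: le_trans s1 (le_trans s2 _).
rewrite EFinM -muleA; apply: lee_wpmul2l; last exact: hk3.
by rewrite lee_fin invr_ge0 ltW.
Qed.

Lemma Ap_montel (p B : R) (f : nat -> Vec -> C) : 0 < p ->
  (forall k, holomorphic_on (@Ball R n) (f k)) ->
  (forall k, (\int[V]_z (bmod (f k) z `^ p * wext w (enorm (z : Vec)))%:E <= B%:E)%E) ->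
  exists s g, [/\ sincr s, holomorphic_on (@Ball R n) g &
    forall z, Ball z -> ccvg (fun k => f (s k) z) (g z)].
Proof.
move=> p0 hf hB.
have /choice[K hK] : forall r : R, exists k, r < 1 -> 0 < k /\ forall f a, holomorphic_on (@Ball R n) f -> enorm a <= r ->
  ((cabs (f a) `^ p)%:E <= k%:E * \int[V]_z (bmod f z `^ p * wext w (enorm (z : Vec)))%:E)%E.
  move=> r; have [r1|] := ltP r 1; last by exists 0.
  by have [k k0 hk] := point_evaluation p0 r1; exists k.
apply: (@montel R n f (fun r => (K r * B) `^ p^-1)) => // r r1 k z zr.
have [k0 hk] := hK r r1.
have h : cabs (f k z) `^ p <= K r * B.
  rewrite -lee_fin EFinM; apply: le_trans (hk _ _ (hf k) zr) _.
  by apply: lee_wpmul2l => //; rewrite lee_fin ltW.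
rewrite -[leLHS](@powRK R p^-1) ?cabs_ge0 ?invr_gt0// invrK.
by apply: powR_le; rewrite ?powR_ge0 ?invr_ge0 ?(ltW p0).
Qed.

End PointEvaluation.

(** * Brezis-Lieb and gliding hump *)

Section BrezisLieb.
Variables (d : measure_display) (X : measurableType d) (R : realType) (m : {measure set X -> \bar R}).
Local Notation C := R[i].

Lemma dominated_to0 (W : nat -> X -> R) (G : X -> R) :
  (forall k, measurable_fun setT (W k)) -> measurable_fun setT G ->
  (forall k x, 0 <= W k x) -> (forall k x, W k x <= G x) -> (\int[m]_x (G x)%:E < +oo)%E ->
  (forall x e, 0 < e -> exists N, forall k, (N <= k)%N -> W k x < e) ->
  forall e, 0 < e -> exists N, forall k, (N <= k)%N -> (\int[m]_x (W k x)%:E < e%:E)%E.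
Proof.
move=> mW mG W0 WG Gf W_cvg e e0.
have G0 x : 0 <= G x by apply: le_trans (W0 0%N x) (WG 0%N x).
have iG : m.-integrable setT (EFin \o G).
  apply/integrableP; split; first exact/measurable_EFinP.
  by under eq_integral => x _ do rewrite /= ger0_norm//.
have := @dominated_cvg _ _ _ m setT measurableT (fun k x => (W k x)%:E) (fun=> 0%E) (fun x => (G x)%:E).
move=> /(_ (fun k => ltac:(exact/measurable_EFinP))) h.
have := h _ _ iG _ [set y | (y < e%:E)%E]; rewrite integral0 => /(_ _ _ _ _)[].
- move=> x _; apply: cvg_EFin; first by near=> k.
  apply/cvgrPdist_lt => e' e'0; have [N hN] := W_cvg x _ e'0.
  by exists N => // k Nk /=; rewrite sub0r normrN ger0_norm//; exact: hN.
- by [].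
- by move=> k x _; rewrite gee0_abs ?lee_fin.
- exact: (@open_ereal_lt' R 0%E e%:E).
by move=> N _ hN; exists N => k Nk; exact: hN.
Unshelve. all: by end_near.
Qed.

Variables (rho : X -> R) (p : R).
Hypotheses (mrho : measurable_fun setT rho) (rho0 : forall x, 0 <= rho x) (p0 : 0 < p).

Definition pint (g : X -> C) : \bar R := (\int[m]_x (cabs (g x) `^ p * rho x)%:E)%E.

Definition mcabs (g : X -> C) := measurable_fun setT (fun x => cabs (g x)).

Lemma measurable_pint g : mcabs g -> measurable_fun setT (fun x => cabs (g x) `^ p * rho x).
Proof. by move=> mg; apply: measurable_funM => //; exact: measurableT_comp (measurable_powR p) mg. Qed.

(** The two inequalities on s are the triangle inequalities for s = |g + h|, a = |g| and b = |h|.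
    [powR_split] is applied in both directions, which covers p < 1. *)
Lemma powR_brezis_lieb (e : R) : 0 < e -> exists2 K : R, 0 <= K & forall a b s : R,
  0 <= a -> 0 <= b -> 0 <= s -> s <= a + b -> b <= a + s ->
  `|s `^ p - b `^ p - a `^ p| <= e * b `^ p + K * a `^ p.
Proof.
move=> e0; pose e' := Num.min 1 (e / 2).
have e'0 : 0 < e' by rewrite lt_min ltr01 divr_gt0.
have e'1 : e' <= 1 by rewrite ge_min lexx.
have e'2 : e' <= e / 2 by rewrite ge_min lexx orbT.
have [K K0 hK] := powR_split p0 e'0; exists (2 * K + 1) => [|a b s a0 b0 s0 sab bas].
  by rewrite addr_ge0// mulr_ge0.
have h1 := le_trans (powR_le (ltW p0) s0 sab) (hK a b a0 b0).
have h2 := le_trans (powR_le (ltW p0) b0 bas) (hK a s a0 s0).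
have := powR_ge0 a p; have := powR_ge0 b p; have := powR_ge0 s p.
move: (a `^ p) (b `^ p) (s `^ p) h1 h2 => A B S h1 h2 S0 B0 A0.
have KA : 0 <= K * A by rewrite mulr_ge0.
have eB : e' * B <= e / 2 * B by rewrite ler_wpM2r.
have eS : e' * S <= e' * ((1 + e') * B + K * A) by rewrite ler_wpM2l// ltW.
have eKA : e' * (K * A) <= 1 * (K * A) by rewrite ler_wpM2r.
have eeB : e' * (e' * B) <= 1 * (e' * B) by rewrite ler_wpM2r// mulr_ge0// ltW.
by rewrite ler_norml; apply/andP; split; lra.
Qed.

(** The part of the defect that exceeds t |h_k|^p is dominated by K |g|^p and tends to 0 pointwise,
    so its integral tends to 0; the rest is at most t B <= e / 2. Two inequalities with an added
    error take the place of a difference of integrals, which might be infinite. *)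
Lemma brezis_lieb (g : X -> C) (h : nat -> X -> C) (B : R) :
  mcabs g -> (forall k, mcabs (h k)) -> (forall k, mcabs (fun x => g x + h k x)) ->
  (pint g < +oo)%E -> (forall k, pint (h k) <= B%:E)%E -> (forall x, ccvg (fun k => h k x) 0) ->
  forall e : R, 0 < e -> exists N, forall k, (N <= k)%N ->
    (pint (fun x => g x + h k x)%R <= pint g + pint (h k) + e%:E)%E /\
    (pint g + pint (h k) <= pint (fun x => g x + h k x)%R + e%:E)%E.
Proof.
move=> mg mh mgh gf hB h_cvg e e0.
have B0 : 0 <= B.
  rewrite -lee_fin; apply: le_trans (hB 0%N); apply: integral_ge0 => x _.
  by rewrite lee_fin mulr_ge0 ?powR_ge0.
have [t [t0 tB]] : exists t : R, 0 < t /\ t * B <= e / 2.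
  exists (e / 2 / (1 + B)); split; first by rewrite !divr_gt0// ltr_pwDl.
  by rewrite mulrAC ler_pdivrMr ?ltr_pwDl// ler_wpM2l ?divr_ge0 ?(ltW e0)// lerDr.
have [K K0 hK] := powR_brezis_lieb t0.
pose a x := cabs (g x); pose b k x := cabs (h k x); pose s k x := cabs (g x + h k x).
have sab k x : s k x <= a x + b k x by exact: cabsD.
have bas k x : b k x <= a x + s k x.
  by have := cabsB (g x + h k x) (g x); rewrite addrAC subrr add0r addrC.
have asb k x : a x <= s k x + b k x.
  by have := cabsB (g x + h k x) (h k x); rewrite addrK.
have a0 x : 0 <= a x by exact: cabs_ge0.
have b0 k x : 0 <= b k x by exact: cabs_ge0.
have s0 k x : 0 <= s k x by exact: cabs_ge0.
have ma : measurable_fun setT (fun x => a x `^ p * rho x) by exact: measurable_pint.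
have mb k : measurable_fun setT (fun x => b k x `^ p * rho x) by exact: measurable_pint.
have ms k : measurable_fun setT (fun x => s k x `^ p * rho x) by exact: measurable_pint (mgh k).
pose D k x := `|s k x `^ p - b k x `^ p - a x `^ p| - t * b k x `^ p.
pose W k x := Num.max 0 (D k x) * rho x.
have W0 k x : 0 <= W k x by rewrite mulr_ge0// le_max lexx.
have mW k : measurable_fun setT (W k).
  apply: measurable_funM => //; apply: measurable_maxr; first exact: measurable_cst.
  have mpow (f : X -> C) : mcabs f -> measurable_fun setT (fun x => cabs (f x) `^ p).
    by move=> mf; exact: measurableT_comp (measurable_powR p) mf.
  apply: measurable_funB; last by apply: measurable_funM; [exact: measurable_cst|exact: mpow].
  apply: measurableT_comp => //; apply: measurable_funB; last exact: mpow.
  by apply: measurable_funB; exact: mpow.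
have WG k x : W k x <= K * (a x `^ p * rho x).
  rewrite mulrA ler_wpM2r// ge_max mulr_ge0 ?powR_ge0//= /D lerBlDl.
  exact: hK.
have [N hN] : exists N, forall k, (N <= k)%N -> (\int[m]_x (W k x)%:E < (e / 2)%:E)%E.
  apply: (@dominated_to0 W (fun x => K * (a x `^ p * rho x))) => //; last by rewrite divr_gt0.
  - by apply: measurable_funM => //; exact: measurable_cst.
  - under eq_integral do rewrite EFinM.
    rewrite ge0_integralZl//; last 2 first.
    + exact/measurable_EFinP.
    + by move=> x _; rewrite lee_fin mulr_ge0 ?powR_ge0.
    by rewrite lte_mul_pinfty.
  move=> x e' e'0; pose c := e' / (2 * (1 + rho x)).
  have c0 : 0 < c by rewrite divr_gt0// mulr_gt0// ltr_pwDl.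
  have [dl dl0 hdl] := @powR_modulus R p (a x + 1) c p0 c0.
  have [N hN] := h_cvg x (Num.min 1 dl) ltac:(by rewrite lt_min ltr01).
  exists N => k /hN; rewrite subr0 lt_min -/(b k x) => /andP[b1 bd].
  have h1 : s k x `^ p <= a x `^ p + c by apply: hdl => //; have := sab k x; lra.
  have h2 : a x `^ p <= s k x `^ p + c by apply: hdl => //; have := asb k x; have := sab k x; lra.
  have h3 : b k x `^ p <= c.
    by have := @hdl (b k x) 0 (b0 k x) (lexx _); rewrite powR0 ?gt_eqF// add0r add0r; apply; have := a0 x; lra.
  have h4 : Num.max 0 (D k x) <= 2 * c.
    rewrite ge_max mulr_ge0 ?(ltW c0)//= /D.
    have := powR_ge0 (b k x) p; move: (s k x `^ p) (a x `^ p) (b k x `^ p) h1 h2 h3 => u v y h1 h2 h3 y0.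
    have ty : 0 <= t * y by rewrite mulr_ge0// ltW.
    have : `|u - y - v| <= 2 * c by rewrite ler_norml; apply/andP; split; lra.
    lra.
  apply: le_lt_trans (ler_wpM2r (rho0 x) h4) _.
  have r1 : 0 < 1 + rho x by rewrite ltr_pwDl.
  have -> : 2 * c * rho x = e' * rho x / (1 + rho x) by rewrite /c; field; rewrite gt_eqF.
  by rewrite ltr_pdivrMr// ltr_pM2l// ltrDr.
have mtb k : measurable_fun setT (fun x => t * (b k x `^ p * rho x)).
  by apply: measurable_funM => //; exact: mb.
have tail k : (N <= k)%N -> (\int[m]_x (t * (b k x `^ p * rho x) + W k x)%:E <= e%:E)%E.
  move=> Nk; under eq_integral do rewrite EFinD.
  rewrite ge0_integralD//; last 4 first.
  - by move=> x _; rewrite lee_fin mulr_ge0 ?(ltW t0)// mulr_ge0 ?powR_ge0.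
  - by apply/measurable_EFinP.
  - by move=> x _; rewrite lee_fin.
  - by apply/measurable_EFinP.
  under eq_integral do rewrite EFinM.
  rewrite ge0_integralZl//; last 3 first.
  - exact/measurable_EFinP.
  - by move=> x _; rewrite lee_fin mulr_ge0 ?powR_ge0.
  - by rewrite lee_fin ltW.
  rewrite [e](_ : _ = e / 2 + e / 2); last by field.
  rewrite EFinD; apply: leeD; last exact/ltW/hN.
  apply: le_trans (lee_wpmul2l _ (hB k)) _; first by rewrite lee_fin ltW.
  by rewrite -EFinM lee_fin.
have int2 (u v : X -> R) : (forall x, 0 <= u x) -> (forall x, 0 <= v x) ->
    measurable_fun setT u -> measurable_fun setT v ->
    (\int[m]_x (u x + v x)%:E = \int[m]_x (u x)%:E + \int[m]_x (v x)%:E)%E.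
  move=> u0 v0 mu mv; under eq_integral do rewrite EFinD.
  apply: ge0_integralD => //.
  - by move=> x _; rewrite lee_fin.
  - exact/measurable_EFinP.
  - by move=> x _; rewrite lee_fin.
  - exact/measurable_EFinP.
have A0 x : 0 <= a x `^ p * rho x by rewrite mulr_ge0 ?powR_ge0.
have Bk0 k x : 0 <= b k x `^ p * rho x by rewrite mulr_ge0 ?powR_ge0.
have S0 k x : 0 <= s k x `^ p * rho x by rewrite mulr_ge0 ?powR_ge0.
have tW0 k x : 0 <= t * (b k x `^ p * rho x) + W k x.
  by rewrite addr_ge0// mulr_ge0// ltW.
have mtW k : measurable_fun setT (fun x => t * (b k x `^ p * rho x) + W k x) by exact: measurable_funD.
have key k x : `|s k x `^ p * rho x - b k x `^ p * rho x - a x `^ p * rho x| <= t * (b k x `^ p * rho x) + W k x.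
  rewrite -!mulrBl normrM (ger0_norm (rho0 x)) mulrA /W -mulrDl ler_wpM2r//.
  by rewrite -lerBlDl le_max lexx orbT.
exists N => k Nk; have {Nk}tk := tail k Nk; split.
- apply: le_trans (_ : _ <= \int[m]_x ((a x `^ p * rho x + b k x `^ p * rho x) + (t * (b k x `^ p * rho x) + W k x))%:E)%E _.
    apply: ge0_le_integral => //.
    + by move=> x _; rewrite lee_fin; exact: S0.
    + by apply/measurable_EFinP; exact: ms.
    + by apply/measurable_EFinP; apply: measurable_funD => //; exact: measurable_funD.
    + move=> x _; rewrite lee_fin; have := key k x; rewrite ler_norml => /andP[_].
      by rewrite -/(s k x); lra.
  rewrite int2//; last 2 first.
  + by move=> x; rewrite addr_ge0.
  + exact: measurable_funD.
  by rewrite int2//; apply: leeD.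
- have E : (pint g + pint (h k) <= \int[m]_x (a x `^ p * rho x + b k x `^ p * rho x)%:E)%E.
    by rewrite (int2 _ _ A0 (Bk0 k) ma (mb k)).
  apply: (le_trans E).
  apply: le_trans (_ : _ <= \int[m]_x (s k x `^ p * rho x + (t * (b k x `^ p * rho x) + W k x))%:E)%E _.
    apply: ge0_le_integral => //.
    + by move=> x _; rewrite lee_fin addr_ge0.
    + by apply/measurable_EFinP; exact: measurable_funD.
    + by apply/measurable_EFinP; exact: measurable_funD.
    + move=> x _; rewrite lee_fin; have := key k x; rewrite ler_norml => /andP[+ _].
      lra.
  rewrite int2//.
  by apply: leeD.
Qed.

End BrezisLieb.

(** * The gliding hump argument for q < p *)

Section GlidingHump.
Variable R : realType.
Local Notation C := R[i].

Lemma sublinear_unbounded (c t : R) : 0 <= c -> t < 1 -> exists N : nat, c * N%:R `^ t < N%:R.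
Proof.
move=> c0 t1; have s0 : 0 < 1 - t by rewrite subr_gt0.
pose N := (Num.bound (c `^ (1 - t)^-1)).+1; exists N.
have hN : c `^ (1 - t)^-1 < N%:R.
  apply: lt_trans (archi_boundP (powR_ge0 _ _)) _; by rewrite ltr_nat.
have N0 : 0 < N%:R :> R by rewrite ltr0n.
have NE : N%:R = N%:R `^ (1 - t) * N%:R `^ t :> R by rewrite -powRD0// subrK powRr1// ltW.
rewrite [ltRHS]NE ltr_pM2r ?powR_gt0// -(@powRK R (1 - t) c)//.
by apply: powR_lt => //; exact: powR_ge0.
Qed.

Variables (d1 d2 : measure_display) (X : measurableType d1) (Y : measurableType d2).
Variables (m1 : {measure set X -> \bar R}) (m2 : {measure set Y -> \bar R}).
Variables (rho1 : X -> R) (rho2 : Y -> R) (p q : R).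
Hypotheses (mrho1 : measurable_fun setT rho1) (mrho2 : measurable_fun setT rho2).
Hypotheses (rho10 : forall x, 0 <= rho1 x) (rho20 : forall y, 0 <= rho2 y).
Hypotheses (q0 : 0 < q) (qp : q < p).
(** An additive structure detached from the ball: in the application [J] and [S] send f to f and to
    T f, both extended by 0. *)
Variables (A : Type) (add : A -> A -> A) (zero : A) (H : A -> Prop) (J : A -> X -> C) (S : A -> Y -> C).
Hypotheses (H0 : H zero) (HD : forall f g, H f -> H g -> H (add f g)).
Hypotheses (J0 : forall x, J zero x = 0) (JD : forall f g x, J (add f g) x = J f x + J g x).
Hypotheses (SD : forall f g y, S (add f g) y = S f y + S g y).
Hypotheses (mJ : forall f, H f -> mcabs (J f)) (mS : forall f, H f -> mcabs (S f)).
Variables (K : R) (K0 : 0 <= K).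
Hypothesis hK : forall f, H f -> forall B, 0 <= B -> (pint m1 rho1 p (J f) <= B%:E)%E ->
  (pint m2 rho2 q (S f) <= (K * B `^ (q / p))%:E)%E.

(* A sum of N almost disjointly supported terms of size 1 has p-norm N^(1/p), while its image would
   have q-norm of order N^(1/q), which is impossible since q < p. *)
Lemma gliding_hump (h : nat -> A) (B : R) : (forall k, H (h k)) ->
  (forall k, pint m1 rho1 p (J (h k)) <= B%:E)%E ->
  (forall x, ccvg (fun k => J (h k) x) 0) -> (forall y, ccvg (fun k => S (h k) y) 0) ->
  forall e : R, 0 < e -> exists N, forall k, (N <= k)%N -> (pint m2 rho2 q (S (h k)) < e%:E)%E.
Proof.
move=> Hh hB cJ cS e e0; apply: contrapT => hN.
have p0 : 0 < p by exact: lt_trans qp.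
have big N : exists k, (N <= k)%N /\ (e%:E <= pint m2 rho2 q (S (h k)))%E.
  apply: contrapT => hk; apply: hN; exists N => k Nk; rewrite ltNge; apply/negP => h1.
  by apply: hk; exists k.
have B0 : 0 <= B.
  rewrite -lee_fin; apply: le_trans (hB 0%N); apply: integral_ge0 => x _.
  by rewrite lee_fin mulr_ge0 ?powR_ge0.
(* Each new term costs at most B + 1 in the p-integral and brings at least e / 2 in the q-integral,
   the errors 1 and e / 2 of [brezis_lieb] included. *)
have sums N : exists F, [/\ H F, (pint m1 rho1 p (J F) <= (N%:R * (B + 1))%:E)%E &
    ((N%:R * (e / 2))%:E <= pint m2 rho2 q (S F))%E].
  elim: N => [|N [F [HF F1 F2]]].
    exists zero; rewrite !mul0r; split=> //.
      rewrite /pint (eq_integral (fun=> 0%E)) ?integral0// => x _.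
      by rewrite J0 cabs0 powR0 ?mul0r// gt_eqF.
    by apply: integral_ge0 => y _; rewrite lee_fin mulr_ge0 ?powR_ge0.
  have B1 : 0 <= N%:R * (B + 1) by rewrite mulr_ge0 ?ler0n// addr_ge0.
  have SF := hK HF B1 F1.
  have Sh k := hK (Hh k) B0 (hB k).
  have JFh k : (fun x => J F x + J (h k) x) = J (add F (h k)) by apply/funext => x; rewrite JD.
  have SFh k : (fun x => S F x + S (h k) x) = S (add F (h k)) by apply/funext => x; rewrite SD.
  have [N1 hN1] := @brezis_lieb _ X R m1 rho1 p mrho1 rho10 p0 (J F) (fun k => J (h k)) B
    (mJ HF) (fun k => mJ (Hh k)) (fun k => ltac:(rewrite JFh; exact: mJ (HD HF (Hh k))))
    (le_lt_trans F1 (ltry _)) hB cJ 1 ltr01.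
  have e20 : 0 < e / 2 by rewrite divr_gt0.
  have [N2 hN2] := @brezis_lieb _ Y R m2 rho2 q mrho2 rho20 q0 (S F) (fun k => S (h k)) _
    (mS HF) (fun k => mS (Hh k)) (fun k => ltac:(rewrite SFh; exact: mS (HD HF (Hh k))))
    (le_lt_trans SF (ltry _)) Sh cS _ e20.
  have [k []] := big (maxn N1 N2); rewrite geq_max => /andP[/hN1[k1 _] /hN2[_ k2]] k3.
  rewrite JFh in k1; rewrite SFh in k2; exists (add F (h k)); split; first exact: HD.
    apply: le_trans k1 _; apply: le_trans (leeD (leeD F1 (hB k)) (lexx _)) _.
    by rewrite -!EFinD lee_fin -natr1; lra.
  rewrite -(@leeD2rE _ (e / 2)%:E)//; apply: le_trans k2; apply: le_trans (leeD F2 k3).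
  by rewrite -!EFinD lee_fin -natr1; lra.
have t1 : q / p < 1 by rewrite ltr_pdivrMr// mul1r.
(* N e / 2 <= K (N (B + 1))^(q/p) amounts to N <= c N^(q/p), against [sublinear_unbounded]. *)
pose c := K * (B + 1) `^ (q / p) * (e / 2)^-1.
have c0 : 0 <= c by rewrite !mulr_ge0 ?powR_ge0// invr_ge0 ltW// divr_gt0.
have [N hc] := sublinear_unbounded c0 t1.
have [F [HF F1 F2]] := sums N.
have B1 : 0 <= N%:R * (B + 1) by rewrite mulr_ge0 ?ler0n// addr_ge0.
have := le_trans F2 (hK HF B1 F1); rewrite lee_fin powRM ?ler0n ?addr_ge0// -ler_pdivlMr ?divr_gt0//.
apply/negP; rewrite -ltNge; apply: le_lt_trans hc.
by rewrite /c le_eqVlt; apply/orP; left; apply/eqP; rewrite -!mulrA; congr (_ * _); rewrite mulrC -mulrA.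
Qed.

End GlidingHump.

(** * Differences of weighted composition operators *)

Section WeightedPushforward.
Variables (d1 d2 : measure_display) (Y : measurableType d1) (X : measurableType d2) (R : realType).

Variables (m : {measure set Y -> \bar R}) (nu : {measure set X -> \bar R}).
Variables (Phi : Y -> X) (D : Y -> R).
Hypotheses (mPhi : measurable_fun setT Phi) (mD : measurable_fun setT D) (D0 : forall y, 0 <= D y).
Import HBNNSimple.

(** Simple functions from below and Fatou's lemma. An inequality on sets is the suitable hypothesis,
    since each of the three densities is compared separately with the one measure that dominates
    their sum. *)
Lemma weighted_push_le : (forall E, measurable E -> (\int[m]_y (\1_E (Phi y) * D y)%:E <= nu E)%E) ->
  forall g : X -> R, measurable_fun setT g -> (forall x, 0 <= g x) ->
  (\int[m]_y (g (Phi y) * D y)%:E <= \int[nu]_x (g x)%:E)%E.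
Proof.
move=> hE g mg g0.
have mgE : measurable_fun setT (EFin \o g) by exact/measurable_EFinP.
pose h := nnsfun_approx measurableT mgE.
have hc x : EFin \o h^~ x @ \oo --> (g x)%:E.
  by apply: (@cvg_nnsfun_approx _ _ _ _ measurableT _ mgE) => // y _; rewrite lee_fin.
have hg k x : h k x <= g x.
  by rewrite -lee_fin /h nnsfun_approxE; apply: le_approx => // y _; rewrite lee_fin.
have h0 k x : 0 <= h k x by exact: fun_ge0.
have mh k : measurable_fun setT (h k) by exact/measurable_funP.
have mhP k : measurable_fun setT (fun y => h k (Phi y) * D y).
  by apply: measurable_funM => //; exact: measurableT_comp.
apply: (@fatou_le R _ _ m (fun k y => h k (Phi y) * D y)) => //.
- by move=> k y; rewrite mulr_ge0.
- by apply: measurable_funM => //; exact: measurableT_comp.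
- by move=> y; rewrite mulr_ge0.
- move=> y e e0; have Dy : 0 < 1 + D y by rewrite ltr_pwDl.
  have /fine_cvgP[_ /cvgrPdist_lt/(_ _ (divr_gt0 e0 Dy))[N _ hN]] := hc (Phi y).
  exists N => k /hN /=; rewrite ger0_norm ?subr_ge0// ltr_pdivlMr// => h1.
  have := D0 y; have : 0 <= g (Phi y) - h k (Phi y) by rewrite subr_ge0.
  move: (g _) (h _ _) (D _) h1 => u v t h1 uv t0; nra.
move=> k; apply: (@le_trans _ _ (\int[nu]_x (h k x)%:E)%E); last first.
  apply: ge0_le_integral => //.
  - by move=> x _; rewrite lee_fin.
  - exact/measurable_EFinP.
  - by move=> x _; rewrite lee_fin.
pose s : seq R := finmap.enum_fset (fset_set (h k @` setT)).
have sE x : h k x = \sum_(i < size s) (s`_i * \1_(h k @^-1` [set s`_i]) x) by exact: fimfunEord.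
have s0 (i : 'I_(size s)) : 0 <= s`_i.
  have : s`_i \in h k @` setT by rewrite -(in_fset_set (fimfunP (h k))); exact: mem_nth.
  by move=> /set_mem[x _ <-].
have ms (i : 'I_(size s)) : measurable (h k @^-1` [set s`_i]).
  by rewrite -[X in measurable X]setTI; apply: mh.
rewrite (eq_integral (fun y => (\sum_(i < size s) (s`_i * (\1_(h k @^-1` [set s`_i]) (Phi y) * D y))%:E)%E)); last first.
  by move=> y _; rewrite sumEFin sE mulr_suml; congr (_%:E); apply: eq_bigr => i _; rewrite mulrA.
rewrite [leRHS](eq_integral (fun x => (\sum_(i < size s) (s`_i * \1_(h k @^-1` [set s`_i]) x)%:E)%E)); last first.
  by move=> y _; rewrite sumEFin sE.
have mI (i : 'I_(size s)) : measurable_fun setT (\1_(h k @^-1` [set s`_i]) : X -> R) by exact: measurable_indic.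
have mIP (i : 'I_(size s)) : measurable_fun setT (fun y => \1_(h k @^-1` [set s`_i]) (Phi y) * D y : R).
  by apply: measurable_funM => //; exact: measurableT_comp (mI i) mPhi.
rewrite !ge0_integral_sum//; last 4 first.
- by move=> i; apply/measurable_EFinP; apply: measurable_funM => //; exact: measurable_cst.
- by move=> i x _; rewrite lee_fin mulr_ge0.
- by move=> i; apply/measurable_EFinP; apply: measurable_funM => //; exact: measurable_cst.
- by move=> i x _; rewrite lee_fin mulr_ge0// mulr_ge0.
apply: lee_sum => i _.
under eq_integral do rewrite EFinM.
under [leRHS]eq_integral do rewrite EFinM.
have mIE : measurable_fun setT (fun x => (\1_(h k @^-1` [set s`_i]) x : R)%:E) by exact/measurable_EFinP.
have mIPE : measurable_fun setT (fun y => (\1_(h k @^-1` [set s`_i]) (Phi y) * D y : R)%:E).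
  exact/measurable_EFinP.
rewrite !ge0_integralZl ?lee_fin//; last by move=> x _; rewrite lee_fin mulr_ge0.
apply: lee_wpmul2l; first by rewrite lee_fin.
by rewrite integral_indic ?setIT//; exact: hE.
Qed.

End WeightedPushforward.

(** * Measurability of the symbols and of the densities *)

Section Symbols.
Variables (R : realType) (n : nat).
Local Notation C := R[i].
Local Notation Vec := 'rV[C]_n.
Local Notation Cn := (Cn R n).
Implicit Types (f g u v : Vec -> C) (phi psi : Vec -> Vec).

(* The hypotheses say nothing outside the ball, so functions and symbols are extended by 0. *)
Definition rst f z : C := if z \in @Ball R n then f z else 0.

Lemma cabs_rst f z : cabs (rst f z) = bmod f z.
Proof. by rewrite /rst /bmod; case: ifP => // _; rewrite cabs0. Qed.

Lemma measurable_patch_Ball (g : Vec -> R) : measurable_fun (@Ball R n : set Cn) (g : Cn -> R) ->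
  measurable_fun [set: Cn] (fun z : Cn => if (z : Vec) \in @Ball R n then g z else 0).
Proof. by move=> mg; apply: ((measurable_restrictT _ (@measurable_Ball R n)).1 mg). Qed.

Lemma cmeasurable_cabs g : cmeasurable g ->
  measurable_fun (@Ball R n : set Cn) (fun z : Cn => cabs (g z)).
Proof.
move=> [mRe mIm].
rewrite (_ : (fun z => cabs (g z)) = (fun z => (complex.Re (g z) ^+ 2 + complex.Im (g z) ^+ 2) `^ 2^-1)).
  apply: measurableT_comp (measurable_powR _) _.
  by apply: measurable_funD; apply: measurable_funX.
by apply/funext => z; rewrite -cabs_sqr -powR_mulrn ?cabs_ge0// -powRrM divff// powRr1// cabs_ge0.
Qed.

Lemma cmeasurable_bmod g : cmeasurable g -> measurable_fun [set: Cn] (fun z : Cn => bmod g z).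
Proof. by move=> /cmeasurable_cabs/measurable_patch_Ball. Qed.

Lemma cmeasurableB u v : cmeasurable u -> cmeasurable v -> cmeasurable (fun z => u z - v z).
Proof.
move=> [u1 u2] [v1 v2]; split.
  by under eq_fun do rewrite cReD cReN; exact: measurable_funB.
by under eq_fun do rewrite cImD cImN; exact: measurable_funB.
Qed.

Lemma selfmap_ceps phi z (e : R) : holo_selfmap phi -> Ball z -> 0 < e -> exists2 d : R, 0 < d &
  forall x, enorm (x - z) < d -> enorm (phi x - phi z) < e.
Proof.
move=> [hphi _] Bz e0.
have n0 : 0 < 1 + n%:R :> R by rewrite ltr_pwDl.
have /choice[d hd] : forall j : 'I_n, exists d : R, 0 < d /\
    forall x : Vec, enorm (x - z) < d -> cabs (phi x 0 j - phi z 0 j) < e / (1 + n%:R).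
  move=> j; have [d d0 hd] := hol_ceps (hphi j) Bz (divr_gt0 e0 n0).
  by exists d.
exists (\big[Num.min/1]_j d j).
  by elim/big_ind: _ => // [x y x0 y0|j _]; [rewrite lt_min x0|exact: (hd j).1].
move=> x hx; apply: (@le_lt_trans _ _ (e / (1 + n%:R) * n%:R)).
  apply: enorm_coord => j; rewrite !mxE; apply/ltW/(hd j).2; apply: lt_le_trans hx _.
  exact: bigmin_le_cond.
by rewrite mulrAC ltr_pdivrMr// ltr_pM2l// ltrDr.
Qed.

Lemma ceps_comp f phi z : holomorphic_on (@Ball R n) f -> holo_selfmap phi -> Ball z -> ceps (f \o phi) z.
Proof.
move=> hf hphi Bz e e0; have [d d0 hd] := hol_ceps hf (hphi.2 z Bz) e0.
by have [d' d'0 hd'] := selfmap_ceps hphi Bz d0; exists d' => // x /hd' /hd.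
Qed.

Lemma cmeasurable_wcomp_diff f u v phi psi : holomorphic_on (@Ball R n) f -> holo_selfmap phi ->
  holo_selfmap psi -> cmeasurable u -> cmeasurable v -> cmeasurable (wcomp_diff u v phi psi f).
Proof.
move=> hf hphi hpsi [u1 u2] [v1 v2].
have [a1 a2] := ceps_measurable_ReIm (@eopen_Ball R n) (fun z Bz => ceps_comp hf hphi Bz).
have [b1 b2] := ceps_measurable_ReIm (@eopen_Ball R n) (fun z Bz => ceps_comp hf hpsi Bz).
rewrite /wcomp_diff; split.
  rewrite (_ : (fun z : Cn => _) = (fun z : Cn => (complex.Re (u z) * complex.Re ((f \o phi) z) - complex.Im (u z) * complex.Im ((f \o phi) z))
    - (complex.Re (v z) * complex.Re ((f \o psi) z) - complex.Im (v z) * complex.Im ((f \o psi) z)))); last first.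
    by apply/funext => z; rewrite cReD cReN !cReM.
  by apply: measurable_funB; apply: measurable_funB; exact: measurable_funM.
rewrite (_ : (fun z : Cn => _) = (fun z : Cn => (complex.Re (u z) * complex.Im ((f \o phi) z) + complex.Im (u z) * complex.Re ((f \o phi) z))
    - (complex.Re (v z) * complex.Im ((f \o psi) z) + complex.Im (v z) * complex.Re ((f \o psi) z)))); last first.
  by apply/funext => z; rewrite cImD cImN !cImM.
by apply: measurable_funB; apply: measurable_funD; exact: measurable_funM.
Qed.

Definition phi0 phi (z : Vec) : Vec := if z \in @Ball R n then phi z else 0.

Lemma measurable_phi0 phi : holo_selfmap phi -> measurable_fun [set: Cn] (phi0 phi : Cn -> Cn).
Proof.
move=> [hphi _]; apply: measurable_Cn_fun => j.
  have [h _] := ceps_measurable_ReIm (@eopen_Ball R n) (fun z Bz => hol_ceps (hphi j) Bz).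
  rewrite (_ : (fun z : Cn => _) = (fun z : Cn => if (z : Vec) \in @Ball R n then complex.Re (phi z 0 j) else 0)); last first.
    by apply/funext => z; rewrite /phi0; case: ifP => // _; rewrite mxE.
  exact: measurable_patch_Ball.
have [_ h] := ceps_measurable_ReIm (@eopen_Ball R n) (fun z Bz => hol_ceps (hphi j) Bz).
rewrite (_ : (fun z : Cn => _) = (fun z : Cn => if (z : Vec) \in @Ball R n then complex.Im (phi z 0 j) else 0)); last first.
  by apply/funext => z; rewrite /phi0; case: ifP => // _; rewrite mxE.
exact: measurable_patch_Ball.
Qed.

Lemma measurable_kd_comp phi psi : holo_selfmap phi -> holo_selfmap psi ->
  measurable_fun (@Ball R n : set Cn) (fun z : Cn => kd (psi z) (phi z)).
Proof.
move=> hphi hpsi; apply: (@ceps_measurable R n _ (fun z => kd (psi z) (phi z)) (@eopen_Ball R n)) => z Bz e e0.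
have e20 : 0 < e / 2 by rewrite divr_gt0.
have [d1 d10 h1] := selfmap_ceps hphi Bz e20; have [d2 d20 h2] := selfmap_ceps hpsi Bz e20.
have [d3 d30 h3] := @eopen_Ball R n z Bz.
exists (Num.min d1 (Num.min d2 d3)) => [|x]; rewrite !lt_min; first by rewrite d10 d20.
move=> /andP[/h1 {}h1 /andP[/h2 {}h2 /h3 Bx]].
have B1 : enorm (phi x) < 1 := hphi.2 x Bx; have B2 : enorm (psi z) < 1 := hpsi.2 z Bz.
have k1 : cabs (cinner (psi x - psi z) (phi x)) < e / 2.
  apply: le_lt_trans (cabs_cinner _ _) _; apply: le_lt_trans h2; rewrite ler_piMr ?enorm_ge0//; exact: ltW.
have k2 : cabs (cinner (psi z) (phi x - phi z)) < e / 2.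
  apply: le_lt_trans (cabs_cinner _ _) _; apply: le_lt_trans h1; rewrite ler_piMl ?enorm_ge0//; exact: ltW.
have E : 1 - cinner (psi z) (phi z) - (1 - cinner (psi x) (phi x)) =
    cinner (psi x - psi z) (phi x) + cinner (psi z) (phi x - phi z).
  by rewrite cinnerDl cinnerNl cinnerDr cinnerNr; ring.
have h4 : cabs (1 - cinner (psi z) (phi z) - (1 - cinner (psi x) (phi x))) < e.
  by rewrite E; apply: le_lt_trans (cabsD _ _) _; lra.
rewrite ltr_norml; apply/andP; split; rewrite /kd.
  have := cabs_lerB (1 - cinner (psi z) (phi z)) (1 - cinner (psi x) (phi x)); lra.
have := cabs_lerB (1 - cinner (psi x) (phi x)) (1 - cinner (psi z) (phi z)).
rewrite cabs_distC; lra.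
Qed.

(** By [pseudohyp_kd] the distance is the square root of 1 minus the product of the two values of
    bdef divided by kd^2, an expression whose factors are measurable. *)
Lemma measurable_rho2 phi psi : holo_selfmap phi -> holo_selfmap psi ->
  measurable_fun (@Ball R n : set Cn) (fun z : Cn => rho2 phi psi z).
Proof.
move=> hphi hpsi.
pose g (z : Cn) := (1 - (1 - enorm (phi0 phi z) ^+ 2) * (1 - enorm (phi0 psi z) ^+ 2) * (kd (psi z) (phi z) `^ (-1)) ^+ 2) `^ 2^-1.
apply: (@eq_measurable_fun _ _ _ _ _ g) => [z /set_mem Bz|].
  have B1 := hphi.2 z Bz; have B2 := hpsi.2 z Bz.
  have k0 := kd_gt0 B2 B1; have := pseudohyp_kd B1 B2; rewrite -/(rho2 phi psi z).
  have p0 : 0 <= rho2 phi psi z by exact: pseudohyp_ge0.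
  rewrite /g /phi0 mem_set// powR_inv1 ?kd_ge0// [enorm (phi z) ^+ 2]enorm_sqr [enorm (psi z) ^+ 2]enorm_sqr.
  rewrite -/(bdef (phi z)) -/(bdef (psi z)) exprVn => <-.
  by rewrite mulfK ?expf_neq0 ?gt_eqF// subKr -powR_mulrn// -powRrM divff// powRr1.
apply: measurableT_comp (measurable_powR _) _; apply: measurable_funB; first exact: measurable_cst.
have men chi : holo_selfmap chi -> measurable_fun (@Ball R n : set Cn) (fun z : Cn => 1 - enorm (phi0 chi z) ^+ 2).
  move=> hchi; apply: measurable_funB; first exact: measurable_cst.
  apply: measurable_funX; apply: measurable_funTS.
  exact: measurableT_comp (@measurable_enorm R n) (measurable_phi0 hchi).
apply: measurable_funM; first by apply: measurable_funM; exact: men.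
apply: measurable_funX; apply: measurableT_comp (measurable_powR _) _; exact: measurable_kd_comp.
Qed.

Definition rho_dens q phi psi u (z : Cn) : R :=
  if (z : Vec) \in @Ball R n then (rho2 phi psi z * cabs (u z)) `^ q else 0.

(** [1 - bR (r <= rho2 phi psi z)] is the indicator of [Gr], which is defined by a strict
    inequality. *)
Definition near_dens q r phi psi u v (z : Cn) : R :=
  if (z : Vec) \in @Ball R n then (1 - bR (r <= rho2 phi psi z)) * cabs (u z - v z) `^ q else 0.

Lemma rho_dens_ge0 q phi psi u z : 0 <= rho_dens q phi psi u z.
Proof. by rewrite /rho_dens; case: ifP => // _; exact: powR_ge0. Qed.

Lemma near_dens_ge0 q r phi psi u v z : 0 <= near_dens q r phi psi u v z.
Proof.
by rewrite /near_dens; case: ifP => // _; rewrite mulr_ge0 ?powR_ge0// subr_ge0 bR_le1.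
Qed.

Lemma measurable_rho_dens q phi psi u : holo_selfmap phi -> holo_selfmap psi -> cmeasurable u ->
  measurable_fun setT (rho_dens q phi psi u).
Proof.
move=> hphi hpsi hu; apply: measurable_patch_Ball; apply: measurableT_comp (measurable_powR _) _.
by apply: measurable_funM; [exact: measurable_rho2|exact: cmeasurable_cabs].
Qed.

Lemma measurable_near_dens q r phi psi u v : holo_selfmap phi -> holo_selfmap psi ->
  cmeasurable u -> cmeasurable v -> measurable_fun setT (near_dens q r phi psi u v).
Proof.
move=> hphi hpsi hu hv.
rewrite (_ : near_dens q r phi psi u v = (fun z => (1 - bR (r <= if (z : Vec) \in @Ball R n then rho2 phi psi z else 0)) *
    (if (z : Vec) \in @Ball R n then cabs (u z - v z) `^ q else 0))); last first.
  by apply/funext => z; rewrite /near_dens; case: ifP => // _; rewrite mulr0.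
apply: measurable_funM.
  apply: measurable_funB; first exact: measurable_cst.
  by apply: measurable_bR; [exact: measurable_cst|apply: measurable_patch_Ball; exact: measurable_rho2].
apply: measurable_patch_Ball; apply: measurableT_comp (measurable_powR _) _.
exact: cmeasurable_cabs (cmeasurableB hu hv).
Qed.

End Symbols.

(** * Boundedness from A^p to L^q *)

Section Boundedness.
Variables (R : realType) (n : nat).
Local Notation C := R[i].
Local Notation Vec := 'rV[C]_n.
Local Notation Cn := (Cn R n).
Variables (V : {measure set Cn -> \bar R}) (hV : normalized_volume V) (n_gt0 : (0 < n)%N).
Variable w : R -> R.
Hypotheses (hw : radial_weight w) (hwD : Dclass w).
Variables (p q r : R) (q0 : 0 < q) (qp : q < p) (r0 : 0 < r) (r1 : r < 1).
Variables (mu nu : {measure set Cn -> \bar R}).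
Implicit Types (f u v : Vec -> C) (phi psi : Vec -> Vec).

Let p0 : 0 < p. Proof. exact: lt_trans qp. Qed.

Definition Ap f : \bar R := (\int[V]_z (bmod f z `^ p * wext w (enorm (z : Vec)))%:E)%E.

Definition Lq (m : {measure set Cn -> \bar R}) f : \bar R := (\int[m]_z (bmod f z `^ q)%:E)%E.

(** The norm inequality raised to the power q and stated for every upper bound B of the p-integral,
    which avoids roots and finite parts of integrals. *)
Definition Ap_bounded (m : {measure set Cn -> \bar R}) (H : (Vec -> C) -> Vec -> C) (K : R) :=
  forall f, holomorphic_on (@Ball R n) f -> forall B, 0 <= B -> (Ap f <= B%:E)%E ->
  (Lq m (H f) <= (K * B `^ (q / p))%:E)%E.

Definition push_le (chi : Cn -> Cn) (D : Cn -> R) := forall g : Cn -> R,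
  measurable_fun setT g -> (forall x, 0 <= g x) ->
  (\int[mu]_z (g (chi z) * D z)%:E <= \int[nu]_x (g x)%:E)%E.

Lemma powRD_le2 (x y : R) : 0 <= x -> 0 <= y -> (x + y) `^ q <= 2 `^ q * (x `^ q + y `^ q).
Proof.
move=> x0 y0; have [xy|yx] := leP x y.
  apply: (@le_trans _ _ ((2 * y) `^ q)).
    by apply: powR_le; [exact: ltW|exact: addr_ge0|lra].
  by rewrite powRM// ler_wpM2l ?powR_ge0// lerDr powR_ge0.
apply: (@le_trans _ _ ((2 * x) `^ q)).
  by apply: powR_le; [exact: ltW|exact: addr_ge0|lra].
by rewrite powRM// ler_wpM2l ?powR_ge0// lerDl powR_ge0.
Qed.

(** Here a, b, c are the q-th powers of |u|, |v|, |u - v|, then s and t those of |f(phi)| and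
    |f(psi)|, P that of rho, and g the majorant at phi. The factors 1 - 1 here and 1 - 0 in
    [near_combine] are the two values of the indicator of [Gr]. *)
Lemma far_combine (A a b s t P g c : R) : 1 <= A * P -> 0 <= a -> 0 <= b -> 0 <= t -> 0 <= g -> s <= g ->
  a * s + b * t <= A * (g * (P * a) + (t * (P * b) + t * ((1 - 1) * c))).
Proof.
move=> AP a0 b0 t0 g0 sg.
have e1 : a * s <= a * g by rewrite ler_wpM2l.
have e2 : 1 * (a * g) <= A * P * (a * g) by rewrite ler_wpM2r ?mulr_ge0.
have e3 : 1 * (b * t) <= A * P * (b * t) by rewrite ler_wpM2r ?mulr_ge0.
have -> : A * (g * (P * a) + (t * (P * b) + t * ((1 - 1) * c))) = A * P * (a * g) + A * P * (b * t) by ring.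
lra.
Qed.

Lemma near_combine (k A a b c o t P g : R) : 0 < A -> k <= A -> 1 <= A -> 0 <= a -> 0 <= b -> 0 <= c ->
  0 <= t -> 0 <= P -> 0 <= g -> o <= k * P * g ->
  a * o + c * t <= A * (g * (P * a) + (t * (P * b) + t * ((1 - 0) * c))).
Proof.
move=> A0 kA A1 a0 b0 c0 t0 P0 g0 ok.
have e1 : a * o <= a * (k * P * g) by rewrite ler_wpM2l.
have e2 : k * (a * P * g) <= A * (a * P * g) by rewrite ler_wpM2r ?mulr_ge0.
have e3 : 1 * (c * t) <= A * (c * t) by rewrite ler_wpM2r ?mulr_ge0.
have e4 : 0 <= A * (t * (P * b)) by rewrite mulr_ge0 ?(ltW A0)// mulr_ge0// mulr_ge0.
have -> : A * (g * (P * a) + (t * (P * b) + t * ((1 - 0) * c))) =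
  A * (a * P * g) + A * (t * (P * b)) + A * (c * t) by ring.
have e5 : a * (k * P * g) = k * (a * P * g) by ring.
lra.
Qed.

(** |T f|^q is bounded pointwise by three products of a function at phi(z) or psi(z) with one of the
    densities, and each product is transferred to nu. The Carleson bound is applied to f and to all
    the F i. *)
Lemma wcomp_diff_bounded phi psi u v (K : R) : holo_selfmap phi -> holo_selfmap psi ->
  cmeasurable u -> cmeasurable v -> 0 <= K -> Ap_bounded nu id K ->
  push_le (phi0 phi) (rho_dens q phi psi u) -> push_le (phi0 psi) (rho_dens q phi psi v) ->
  push_le (phi0 psi) (near_dens q r phi psi u v) ->
  exists2 K', 0 <= K' & Ap_bounded mu (wcomp_diff u v phi psi) K'.
Proof.
move=> hphi hpsi hu hv K0 hK H1 H2 H3.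
have [k k0 hk] := oscillation hV n_gt0 hw hwD p0 q0 r0 r1.
(* r^-q compensates the factor rho^q where rho >= r, k serves the oscillation where rho < r, and 1
   the term with u - v. *)
have [A [A0 [A1 [A2 A3]]]] : exists A : R, 0 < A /\ r `^ (- q) <= A /\ k <= A /\ 1 <= A.
  have rq : 0 < r `^ (- q) by exact: powR_gt0.
  by exists (r `^ (- q) + k + 1); split; [|split; [|split]]; lra.
exists (2 `^ q * A * (K + K * k `^ (q / p) + K + K)).
  rewrite mulr_ge0//; first by rewrite mulr_ge0 ?powR_ge0// ltW.
  by rewrite !addr_ge0// mulr_ge0// powR_ge0.
move=> f hf B B0 fB; set T := wcomp_diff u v phi psi f.
(* [oscillation] provides its functions for |a| <= r0 with r0 < 1; the cut-off |phi(z)| <= rr j is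
   removed by [fatou_le], as the constants do not depend on j. *)
pose rr j : R := 1 - j.+1%:R^-1.
have rr1 j : rr j < 1 by rewrite gtrBl invr_gt0 ltr0n.
have mT : measurable_fun setT (fun z : Cn => bmod T z `^ q).
  apply: measurableT_comp (measurable_powR q) _; apply: cmeasurable_bmod.
  exact: cmeasurable_wcomp_diff.
have mD1 := measurable_rho_dens q hphi hpsi hu.
have mD2 := measurable_rho_dens q hphi hpsi hv.
have mD3 := measurable_near_dens q r hphi hpsi hu hv.
have mphi := measurable_phi0 hphi; have mpsi := measurable_phi0 hpsi.
have mb g : holomorphic_on (@Ball R n) g -> measurable_fun setT (fun z : Cn => bmod g z `^ q).
  by move=> hg; exact: measurable_bmod_powR.
have mbR j : measurable_fun setT (fun z : Cn => bR (enorm (phi0 phi z) <= rr j) : R).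
  apply: measurable_bR; last exact: measurable_cst.
  exact: measurableT_comp (@measurable_enorm R n) mphi.
apply: (@fatou_le R _ _ mu (fun j z => bmod T z `^ q * bR (enorm (phi0 phi z) <= rr j))) => //.
- by move=> j; exact: measurable_funM.
- by move=> j z; rewrite mulr_ge0 ?powR_ge0 ?bR_ge0.
- by move=> z; exact: powR_ge0.
- move=> z e e0; have [Bz|Bz] := pselect (Ball (z : Vec)); last first.
    by exists 0%N => j _; rewrite bmod0// powR0 ?gt_eqF// mul0r add0r ltW.
  have h : 0 < 1 - enorm (phi z) by rewrite subr_gt0; exact: hphi.2.
  exists (Num.bound (1 - enorm (phi z))^-1) => j hj.
  suff -> : enorm (phi0 phi z) <= rr j by rewrite mulr1 lerDl ltW.
  rewrite /phi0 mem_set// /rr lerBrDl -lerBrDr -[leRHS]invrK lef_pV2 ?posrE ?invr_gt0 ?ltr0n//.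
  apply: le_trans (ltW (archi_boundP _)) _; first by rewrite invr_ge0 ltW.
  by rewrite ler_nat; exact: leq_trans hj (leqnSn _).
move=> j.
have [I [F [I0 hF FB Fosc]]] := hk f hf (rr j) (rr1 j).
have iI0 : 0 < #|I|%:R :> R by rewrite ltr0n.
(* The first term serves where rho >= r and the average over i where rho < r. Both are taken at
   phi(z), so a single pushforward along phi handles them. *)
pose G (x : Cn) := bmod f x `^ q + #|I|%:R^-1 * \sum_i bmod (F i) x `^ q.
have G0 x : 0 <= G x.
  rewrite addr_ge0 ?powR_ge0// mulr_ge0 ?invr_ge0 ?(ltW iI0)//.
  by apply: sumr_ge0 => i _; exact: powR_ge0.
have mS : measurable_fun setT (fun x : Cn => \sum_i bmod (F i) x `^ q).
  by apply: measurable_sum => i; exact: mb.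
have mG : measurable_fun setT G.
  apply: measurable_funD; first exact: mb.
  by apply: measurable_funM => //; exact: measurable_cst.
have fE := hK f hf B B0 fB; rewrite /= in fE.
have GE : (\int[nu]_x (G x)%:E <= ((K + K * k `^ (q / p)) * B `^ (q / p))%:E)%E.
  rewrite /G; under eq_integral do rewrite EFinD.
  rewrite ge0_integralD//; last 4 first.
  - by move=> x _; rewrite lee_fin powR_ge0.
  - by apply/measurable_EFinP; exact: mb.
  - move=> x _; rewrite lee_fin mulr_ge0 ?invr_ge0 ?(ltW iI0)//.
    by apply: sumr_ge0 => i _; exact: powR_ge0.
  - by apply/measurable_EFinP; apply: measurable_funM => //; exact: measurable_cst.
  rewrite mulrDl EFinD; apply: leeD; first exact: fE.
  under eq_integral do rewrite EFinM.
  rewrite ge0_integralZl//; last 2 first.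
  - by apply/measurable_EFinP.
  - by move=> x _; rewrite lee_fin; apply: sumr_ge0 => i _; exact: powR_ge0.
  rewrite lee_pdivrMl//.
  under eq_integral do rewrite -sumEFin.
  rewrite ge0_integral_sum//; last 2 first.
  - by move=> i; apply/measurable_EFinP; exact: mb.
  - by move=> i x _; rewrite lee_fin powR_ge0.
  have Fi i : (Lq nu (F i) <= (K * k `^ (q / p) * B `^ (q / p))%:E)%E.
    rewrite -mulrA -powRM ?(ltW k0)//; apply: (hK (F i) (hF i)).
      by rewrite mulr_ge0// ltW.
    apply: le_trans (FB i) _; rewrite EFinM; apply: lee_wpmul2l => //.
    by rewrite lee_fin ltW.
  apply: le_trans (lee_sum _ (fun i _ => Fi i)) _.
  by rewrite sumEFin lee_fin sumr_const mulr_natl.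
have mGphi : measurable_fun setT (fun z : Cn => G (phi0 phi z) * rho_dens q phi psi u z).
  by apply: measurable_funM => //; exact: measurableT_comp mG mphi.
have mfpsi (D : Cn -> R) : measurable_fun setT D ->
    measurable_fun setT (fun z : Cn => bmod f (phi0 psi z) `^ q * D z).
  by move=> mD; apply: measurable_funM => //; exact: measurableT_comp (mb f hf) mpsi.
pose W (z : Cn) := G (phi0 phi z) * rho_dens q phi psi u z +
   (bmod f (phi0 psi z) `^ q * rho_dens q phi psi v z + bmod f (phi0 psi z) `^ q * near_dens q r phi psi u v z).
have ptw z : bmod T z `^ q * bR (enorm (phi0 phi z) <= rr j) <= 2 `^ q * A * W z.
  have [W1 [W2 W3]] : 0 <= G (phi0 phi z) * rho_dens q phi psi u z /\
     (0 <= bmod f (phi0 psi z) `^ q * rho_dens q phi psi v z /\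
      0 <= bmod f (phi0 psi z) `^ q * near_dens q r phi psi u v z).
    by split; [|split]; rewrite mulr_ge0 ?powR_ge0 ?rho_dens_ge0 ?near_dens_ge0.
  have W0 : 0 <= W z by rewrite /W addr_ge0// addr_ge0.
  have RHS0 : 0 <= 2 `^ q * A * W z by rewrite mulr_ge0// mulr_ge0 ?powR_ge0// ltW.
  have [Bz|Bz] := pselect (Ball (z : Vec)); last by rewrite bmod0// powR0 ?gt_eqF// mul0r.
  have [phir|_] := leP (enorm (phi0 phi z)) (rr j); last by rewrite mulr0.
  rewrite mulr1 bmodE// -mulrA.
  have pz : phi0 phi z = phi z by rewrite /phi0 mem_set.
  have sz : phi0 psi z = psi z by rewrite /phi0 mem_set.
  have Bphi := hphi.2 z Bz; have Bpsi := hpsi.2 z Bz.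
  move: W1 W2 W3; rewrite /W /rho_dens /near_dens mem_set// pz sz in phir *.
  rewrite !bmodE//.
  set rho := rho2 phi psi z; have rho0 : 0 <= rho by exact: pseudohyp_ge0.
  rewrite !powRM ?cabs_ge0//.
  have Gf : cabs (f (phi z)) `^ q <= G (phi z).
    rewrite /G bmodE// lerDl mulr_ge0 ?invr_ge0 ?(ltW iI0)//.
    by apply: sumr_ge0 => i _; exact: powR_ge0.
  have AP : r <= rho -> 1 <= A * rho `^ q.
    move=> rrho; have <- : r `^ (- q) * r `^ q = 1 by rewrite -powRD0// addrC subrr powRr0.
    by apply: ler_pM; rewrite ?powR_ge0//; apply: powR_le => //; exact: ltW.
  have a0 := powR_ge0 (cabs (u z)) q; have b0 := powR_ge0 (cabs (v z)) q.
  have c0 := powR_ge0 (cabs (u z - v z)) q; have t0 := powR_ge0 (cabs (f (psi z))) q.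
  have s0 := powR_ge0 (cabs (f (phi z))) q; have P0 := powR_ge0 rho q.
  have T1 : cabs (T z) <= cabs (u z) * cabs (f (phi z)) + cabs (v z) * cabs (f (psi z)).
    by rewrite -!cabsM; exact: cabsB.
  (* With this grouping the coefficient u - v meets f(psi(z)), which is why the near density is
     pushed forward along psi. *)
  have T2 : cabs (T z) <= cabs (u z) * cabs (f (psi z) - f (phi z)) + cabs (u z - v z) * cabs (f (psi z)).
    rewrite [cabs (f (psi z) - _)]cabs_distC -!cabsM.
    have -> : T z = u z * (f (phi z) - f (psi z)) + (u z - v z) * f (psi z) by rewrite /T /wcomp_diff; ring.
    exact: cabsD.
  have {}T1 := le_trans (powR_le (ltW q0) (cabs_ge0 _) T1) (powRD_le2 (mulr_ge0 (cabs_ge0 _) (cabs_ge0 _)) (mulr_ge0 (cabs_ge0 _) (cabs_ge0 _))).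
  have {}T2 := le_trans (powR_le (ltW q0) (cabs_ge0 _) T2) (powRD_le2 (mulr_ge0 (cabs_ge0 _) (cabs_ge0 _)) (mulr_ge0 (cabs_ge0 _) (cabs_ge0 _))).
  rewrite !powRM ?cabs_ge0// in T1 T2.
  have osc : rho < r -> cabs (f (psi z) - f (phi z)) `^ q <= k * rho `^ q * G (phi z).
    move=> rhor; have := Fosc (phi z) (psi z) Bpsi phir rhor.
    rewrite -/rho mulrC -ler_pdivlMr// => h; apply: le_trans h _.
    rewrite -[leLHS]mulrA; apply: ler_wpM2l; first by rewrite mulr_ge0// ltW.
    rewrite /G mulrC; apply: le_trans (_ : _ <= #|I|%:R^-1 * \sum_i bmod (F i) (phi z) `^ q) _.
      rewrite ler_wpM2l ?invr_ge0 ?(ltW iI0)//; apply: ler_sum => i _; by rewrite bmodE.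
    by rewrite lerDr powR_ge0.
  have g0 := G0 (phi z).
  move: T1 T2 AP osc a0 b0 c0 t0 s0 P0 Gf g0.
  move: (cabs (T z) `^ q) (cabs (f (psi z) - f (phi z)) `^ q) (cabs (u z) `^ q) (cabs (v z) `^ q)
    (cabs (u z - v z) `^ q) (cabs (f (phi z)) `^ q) (cabs (f (psi z)) `^ q) (rho `^ q) (G (phi z)).
  move=> TT o a b c s t P g T1 T2 AP osc a0 b0 c0 t0 s0 P0 Gf g0.
  have [rrho|rhor] := leP r rho; rewrite /bR => _ _ _.
    apply: le_trans T1 _; rewrite ler_wpM2l ?powR_ge0//.
    by apply: far_combine => //; exact: AP.
  apply: le_trans T2 _; rewrite ler_wpM2l ?powR_ge0//.
  by apply: (@near_combine k) => //; exact: osc.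
have mW : measurable_fun setT W.
  by apply: measurable_funD => //; apply: measurable_funD; exact: mfpsi.
have W1 z : 0 <= G (phi0 phi z) * rho_dens q phi psi u z by rewrite mulr_ge0 ?rho_dens_ge0.
have W2 z : 0 <= bmod f (phi0 psi z) `^ q * rho_dens q phi psi v z.
  by rewrite mulr_ge0 ?powR_ge0 ?rho_dens_ge0.
have W3 z : 0 <= bmod f (phi0 psi z) `^ q * near_dens q r phi psi u v z.
  by rewrite mulr_ge0 ?powR_ge0 ?near_dens_ge0.
have W0 z : 0 <= W z by rewrite /W addr_ge0// addr_ge0.
have A20 : 0 <= 2 `^ q * A by rewrite mulr_ge0 ?powR_ge0// ltW.
apply: (@le_trans _ _ (\int[mu]_z (2 `^ q * A * W z)%:E)%E).
  apply: ge0_le_integral => //.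
  - by move=> z _; rewrite lee_fin mulr_ge0 ?powR_ge0 ?bR_ge0.
  - by apply/measurable_EFinP; exact: measurable_funM.
  - by apply/measurable_EFinP; apply: measurable_funM => //; exact: measurable_cst.
  - by move=> z _; rewrite lee_fin.
under eq_integral do rewrite EFinM.
rewrite ge0_integralZl//; last 2 first.
- by apply/measurable_EFinP.
- by move=> z _; rewrite lee_fin.
suff SW : (\int[mu]_x (W x)%:E <= ((K + K * k `^ (q / p) + K + K) * B `^ (q / p))%:E)%E.
  apply: le_trans (lee_wpmul2l _ SW) _; first by rewrite lee_fin.
  by rewrite -EFinM lee_fin mulrA.
have m2 : measurable_fun setT (fun z : Cn => bmod f (phi0 psi z) `^ q * rho_dens q phi psi v z) by exact: mfpsi.
have m3 : measurable_fun setT (fun z : Cn => bmod f (phi0 psi z) `^ q * near_dens q r phi psi u v z) by exact: mfpsi.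
rewrite /W; under eq_integral do rewrite !EFinD.
rewrite ge0_integralD//; last 4 first.
- by move=> z _; rewrite lee_fin.
- by apply/measurable_EFinP.
- by move=> z _; rewrite -EFinD lee_fin addr_ge0.
- by under eq_fun do rewrite -EFinD; apply/measurable_EFinP; exact: measurable_funD.
rewrite ge0_integralD//; last 4 first.
- by move=> z _; rewrite lee_fin.
- by apply/measurable_EFinP.
- by move=> z _; rewrite lee_fin.
- by apply/measurable_EFinP.
have h1 := le_trans (H1 G mG G0) GE.
have fq0 (x : Cn) : 0 <= bmod f x `^ q by exact: powR_ge0.
have h2 := le_trans (H2 _ (mb f hf) fq0) fE; have h3 := le_trans (H3 _ (mb f hf) fq0) fE.
apply: le_trans (leeD h1 (leeD h2 h3)) _.
by rewrite -!EFinD lee_fin -!mulrDl addrA.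
Qed.

End Boundedness.

(** * From the Carleson hypothesis to compactness *)

Section Assembly.
Variables (R : realType) (n : nat).
Local Notation C := R[i].
Local Notation Vec := 'rV[C]_n.
Local Notation Cn := (Cn R n).
Variables (V : {measure set Cn -> \bar R}) (hV : normalized_volume V) (n_gt0 : (0 < n)%N).
Variable w : R -> R.
Hypotheses (hw : radial_weight w) (hwD : Dclass w).
Variables (p q r : R) (q0 : 0 < q) (qp : q < p) (r0 : 0 < r) (r1 : r < 1).
Implicit Types (f u v : Vec -> C) (phi psi chi : Vec -> Vec) (mu nu : {measure set Cn -> \bar R}).

Let p0 : 0 < p. Proof. exact: lt_trans qp. Qed.

Lemma Ap_intE f : Ap_int V p w f = Ap V w p f.
Proof.
rewrite /Ap_int integral_mkcond; apply: eq_integral => z _; rewrite /patch /bmod.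
case: ifPn => [/set_mem Bz|_]; last by rewrite powR0 ?gt_eqF// mul0r.
have z1 : enorm (z : Vec) < 1 by [].
by rewrite /wext enorm_ge0 z1.
Qed.

Lemma Lq_intE mu f : Lq_int mu q f = Lq q mu f.
Proof.
rewrite /Lq_int integral_mkcond; apply: eq_integral => z _; rewrite /patch /bmod.
by case: ifPn => // _; rewrite powR0 ?gt_eqF.
Qed.

Lemma Ap_ge0 f : (0 <= Ap V w p f)%E.
Proof. by apply: integral_ge0 => z _; rewrite lee_fin mulr_ge0 ?powR_ge0 ?(wext_ge0 hw). Qed.

Lemma Lq_ge0 mu f : (0 <= Lq q mu f)%E.
Proof. by apply: integral_ge0 => z _; rewrite lee_fin powR_ge0. Qed.

Lemma in_Ap_fin f : in_Ap V p w f -> Ap V w p f = (fine (Ap V w p f))%:E /\ 0 <= fine (Ap V w p f).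
Proof.
move=> [_]; rewrite Ap_intE => fin; have := Ap_ge0 f.
have -> : Ap V w p f = (fine (Ap V w p f))%:E by rewrite fineK// ge0_fin_numE// Ap_ge0.
by rewrite lee_fin.
Qed.

Lemma carleson_bounded nu : carleson V p w q nu -> exists2 K, 0 <= K & Ap_bounded V w p q nu id K.
Proof.
move=> [K [K0 hK]]; exists (K `^ q); first exact: powR_ge0.
move=> f hf B B0 fB; have fAp : in_Ap V p w f by split=> //; rewrite Ap_intE (le_lt_trans fB) ?ltry.
have [fE f0] := in_Ap_fin fAp.
have := hK f fAp; rewrite Lq_intE => h; apply: le_trans h _; rewrite lee_fin /Ap_norm Ap_intE.
rewrite powRM ?powR_ge0// ler_wpM2l ?powR_ge0// -powRrM [p^-1 * q]mulrC.
by apply: powR_le => //; [rewrite divr_ge0// ltW|rewrite -lee_fin -fE].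
Qed.

Lemma rho2C phi psi z : holo_selfmap phi -> holo_selfmap psi -> Ball z -> rho2 psi phi z = rho2 phi psi z.
Proof. by move=> hphi hpsi Bz; apply: pseudohypC; [exact: hpsi.2|exact: hphi.2]. Qed.

Lemma rho_densC phi psi u : holo_selfmap phi -> holo_selfmap psi ->
  rho_dens q psi phi u = rho_dens q phi psi u.
Proof.
move=> hphi hpsi; apply/funext => z; rewrite /rho_dens.
have [Bz|_] := boolP ((z : Vec) \in @Ball R n); last by [].
by rewrite (rho2C hphi hpsi (set_mem Bz)).
Qed.

Lemma near_densC phi psi u v : holo_selfmap phi -> holo_selfmap psi ->
  near_dens q r psi phi v u = near_dens q r phi psi u v.
Proof.
move=> hphi hpsi; apply/funext => z; rewrite /near_dens.
have [Bz|_] := boolP ((z : Vec) \in @Ball R n); last by [].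
by rewrite (rho2C hphi hpsi (set_mem Bz)) cabs_distC.
Qed.

Lemma Lq_wcomp_diffC mu phi psi u v f :
  Lq q mu (wcomp_diff v u psi phi f) = Lq q mu (wcomp_diff u v phi psi f).
Proof.
apply: eq_integral => z _; rewrite (_ : bmod _ z = bmod (wcomp_diff u v phi psi f) z)//.
by rewrite /bmod /wcomp_diff cabs_distC.
Qed.

Section Pushforwards.
Variables (mu nu : {measure set Cn -> \bar R}) (phi psi chi : Vec -> Vec) (u v : Vec -> C).
Hypotheses (hphi : holo_selfmap phi) (hpsi : holo_selfmap psi) (hchi : holo_selfmap chi).
Hypotheses (hu : cmeasurable u) (hv : cmeasurable v).
Hypothesis nuE : forall E, measurable E -> nu E = (eta_m mu q u v phi psi E + sigma_m mu q u v phi psi r chi E)%E.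

Let eta0 (chi' : Vec -> Vec) (x : Vec -> C) E :
  (0 <= \int[mu]_(z in (@Ball R n `&` chi' @^-1` E : set Cn)) ((rho2 phi psi z * cabs (x z)) `^ q)%:E)%E.
Proof. by apply: integral_ge0 => z _; rewrite lee_fin powR_ge0. Qed.

Let sigma0 E : (0 <= sigma_m mu q u v phi psi r chi E)%E.
Proof. by apply: integral_ge0 => z _; rewrite lee_fin powR_ge0. Qed.

Lemma int_rho_dens (chi' : Vec -> Vec) (x : Vec -> C) (E : set Cn) :
  (\int[mu]_z (\1_E (phi0 chi' z : Cn) * rho_dens q phi psi x z)%:E =
   \int[mu]_(z in (@Ball R n `&` chi' @^-1` E : set Cn)) ((rho2 phi psi z * cabs (x z)) `^ q)%:E)%E.
Proof.
rewrite [RHS]integral_mkcond; apply: eq_integral => z _; rewrite /patch in_setI /rho_dens /phi0.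
have [Bz|_] := boolP (_ \in @Ball R n); last by rewrite mulr0.
rewrite indicE /=; have [h|h] := boolP (_ \in E).
  by rewrite ifT ?mul1r//; apply/mem_set; exact: set_mem h.
by rewrite ifF ?mul0r//; apply/negP => /set_mem /= h'; rewrite mem_set in h.
Qed.

Lemma int_near_dens (E : set Cn) :
  (\int[mu]_z (\1_E (phi0 chi z : Cn) * near_dens q r phi psi u v z)%:E = sigma_m mu q u v phi psi r chi E)%E.
Proof.
rewrite [RHS]integral_mkcond; apply: eq_integral => z _; rewrite /patch !in_setI /near_dens /phi0.
have [Bz|_] := boolP (_ \in @Ball R n); last by rewrite mulr0.
have [h|h] := leP r (rho2 phi psi z).
  rewrite subrr mul0r mulr0 ifF//; apply/negP => /andP[/set_mem /=].
  by rewrite /Gr /= ltNge h.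
rewrite subr0 mul1r mem_set//= indicE /=; have [h1|h1] := boolP (_ \in E).
  by rewrite ifT ?mul1r//; apply/mem_set; exact: set_mem h1.
by rewrite ifF ?mul0r//; apply/negP => /set_mem /= h'; rewrite mem_set in h1.
Qed.

Lemma push_phi : push_le mu nu (phi0 phi) (rho_dens q phi psi u).
Proof.
apply: weighted_push_le; [exact: measurable_phi0|exact: measurable_rho_dens|exact: rho_dens_ge0|].
move=> E mE; rewrite nuE// int_rho_dens /eta_m -addeA; apply: leeDl.
by rewrite adde_ge0.
Qed.

Lemma push_psi : push_le mu nu (phi0 psi) (rho_dens q phi psi v).
Proof.
apply: weighted_push_le; [exact: measurable_phi0|exact: measurable_rho_dens|exact: rho_dens_ge0|].
move=> E mE; rewrite nuE// int_rho_dens /eta_m addeAC; apply: leeDr.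
by rewrite adde_ge0.
Qed.

Lemma push_chi : push_le mu nu (phi0 chi) (near_dens q r phi psi u v).
Proof.
apply: weighted_push_le; [exact: measurable_phi0|exact: measurable_near_dens|exact: near_dens_ge0|].
move=> E mE; rewrite nuE// int_near_dens; apply: leeDr.
by rewrite /eta_m adde_ge0.
Qed.

End Pushforwards.

(** With sigma along phi, the pairs (phi, u) and (psi, v) exchange their roles: the densities are
    symmetric because rho is, and the operator only changes its sign. *)
Lemma wcomp_diff_Ap_bounded mu phi psi u v : holo_selfmap phi -> holo_selfmap psi ->
  cmeasurable u -> cmeasurable v ->
  carleson_setfun V p w q (fun E => (eta_m mu q u v phi psi E + sigma_m mu q u v phi psi r phi E)%E) \/
  carleson_setfun V p w q (fun E => (eta_m mu q u v phi psi E + sigma_m mu q u v phi psi r psi E)%E) ->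
  exists2 K, 0 <= K & Ap_bounded V w p q mu (wcomp_diff u v phi psi) K.
Proof.
move=> hphi hpsi hu hv [] [nu [nuE /carleson_bounded[K K0 hK]]].
  have [K' K'0 hK'] : exists2 K, 0 <= K & Ap_bounded V w p q mu (wcomp_diff v u psi phi) K.
    apply: (wcomp_diff_bounded hV n_gt0 hw hwD q0 qp r0 r1 hpsi hphi hv hu K0 hK).
    - by rewrite rho_densC//; exact: push_psi nuE.
    - by rewrite rho_densC//; exact: push_phi nuE.
    - by rewrite near_densC//; exact: push_chi nuE.
  exists K'; first exact: K'0.
  move=> f hf B B0 fB.
  apply: le_trans (hK' f hf B B0 fB).
  rewrite Lq_wcomp_diffC.
  exact: lexx.
apply: (wcomp_diff_bounded hV n_gt0 hw hwD q0 qp r0 r1 hphi hpsi hu hv K0 hK).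
- exact: push_phi nuE.
- exact: push_psi nuE.
- exact: push_chi nuE.
Qed.

Lemma Ap_le_limit (f : nat -> Vec -> C) g (B : R) :
  (forall k, holomorphic_on (@Ball R n) (f k)) -> holomorphic_on (@Ball R n) g ->
  (forall z, Ball z -> ccvg (fun k => f k z) (g z)) ->
  (forall k, (Ap V w p (f k) <= B%:E)%E) -> (Ap V w p g <= B%:E)%E.
Proof.
move=> hf hg fg fB.
have mwe : measurable_fun [set: Cn] (fun z : Cn => wext w (enorm (z : Vec))).
  by apply: measurableT_comp (measurable_wext hw) _; exact: measurable_enorm.
have m0 h : holomorphic_on (@Ball R n) h ->
    measurable_fun [set: Cn] (fun z : Cn => bmod h z `^ p * wext w (enorm (z : Vec))).
  by move=> hh; apply: measurable_funM => //; exact: measurable_bmod_powR.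
apply: (@fatou_le R _ _ V (fun k z => bmod (f k) z `^ p * wext w (enorm (z : Vec)))) => //.
- by move=> k; exact: m0.
- by move=> k z; rewrite mulr_ge0 ?powR_ge0 ?(wext_ge0 hw).
- exact: m0.
- by move=> z; rewrite mulr_ge0 ?powR_ge0 ?(wext_ge0 hw).
move=> z e e0; have [Bz|Bz] := pselect (Ball (z : Vec)); last first.
  by exists 0%N => k _; rewrite !bmod0// powR0 ?gt_eqF// mul0r add0r ltW.
have W0 := wext_ge0 hw (enorm (z : Vec)); set W := wext w _ in W0 *.
have W1 : 0 < 1 + W by rewrite ltr_pwDl.
have [d d0 hd] := @powR_modulus R p (cabs (g z) + 1) (e / (1 + W)) p0 ltac:(by rewrite divr_gt0).
have [N hN] := fg z Bz (Num.min 1 d) ltac:(by rewrite lt_min ltr01).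
exists N => k /hN; rewrite lt_min => /andP[h1 h2]; rewrite !bmodE//.
have h3 := cabs_lerB (f k z) (g z); have h4 := cabs_lerB (g z) (f k z); rewrite cabs_distC in h4.
have h5 : cabs (g z) `^ p <= cabs (f k z) `^ p + e / (1 + W).
  by apply: hd; rewrite ?cabs_ge0//; lra.
apply: le_trans (ler_wpM2r W0 h5) _; rewrite mulrDl lerD2l mulrAC ler_pdivrMr//.
by rewrite ler_wpM2l ?(ltW e0)// lerDr.
Qed.

Lemma ApD f g (B B' : R) : holomorphic_on (@Ball R n) f -> holomorphic_on (@Ball R n) g ->
  (Ap V w p f <= B%:E)%E -> (Ap V w p g <= B'%:E)%E ->
  (Ap V w p (fun z => f z - g z)%R <= (2 `^ p * (B + B'))%:E)%E.
Proof.
move=> hf hg fB gB.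
have mwe : measurable_fun [set: Cn] (fun z : Cn => wext w (enorm (z : Vec))).
  by apply: measurableT_comp (measurable_wext hw) _; exact: measurable_enorm.
have m0 h : holomorphic_on (@Ball R n) h ->
    measurable_fun [set: Cn] (fun z : Cn => bmod h z `^ p * wext w (enorm (z : Vec))).
  by move=> hh; apply: measurable_funM => //; exact: measurable_bmod_powR.
have n0 h (z : Cn) : 0 <= bmod h z `^ p * wext w (enorm (z : Vec)).
  by rewrite mulr_ge0 ?powR_ge0 ?(wext_ge0 hw).
have hfg : holomorphic_on (@Ball R n) (fun z => f z - g z).
  have := holomorphicD hf (holomorphicZ (-1) hg); congr holomorphic_on.
  by apply/funext => z; rewrite mulN1r.
apply: (@le_trans _ _ (\int[V]_z (2 `^ p * (bmod f z `^ p * wext w (enorm (z : Vec)) + bmod g z `^ p * wext w (enorm (z : Vec))))%:E)%E).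
  apply: ge0_le_integral => //.
  - by move=> z _; rewrite lee_fin.
  - by apply/measurable_EFinP; exact: m0.
  - apply/measurable_EFinP; apply: measurable_funM; first exact: measurable_cst.
    by apply: measurable_funD; exact: m0.
  - move=> z _; rewrite lee_fin -mulrDl mulrA ler_wpM2r ?(wext_ge0 hw)//.
    have [Bz|Bz] := pselect (Ball (z : Vec)); last by rewrite !bmod0// powR0 ?gt_eqF// addr0 mulr0.
    rewrite !bmodE//; apply: le_trans (powRD_le2 p0 (cabs_ge0 _) (cabs_ge0 _)).
    by apply: powR_le; rewrite ?(ltW p0) ?cabs_ge0 ?cabsB.
under eq_integral do rewrite EFinM.
rewrite ge0_integralZl//; last 2 first.
- by apply/measurable_EFinP; apply: measurable_funD; exact: m0.
- by move=> z _; rewrite lee_fin addr_ge0.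
rewrite EFinM; apply: lee_wpmul2l; first by rewrite lee_fin powR_ge0.
under eq_integral do rewrite EFinD.
rewrite ge0_integralD//; last 4 first.
- by move=> z _; rewrite lee_fin.
- by apply/measurable_EFinP; exact: m0.
- by move=> z _; rewrite lee_fin.
- by apply/measurable_EFinP; exact: m0.
by rewrite EFinD; apply: leeD.
Qed.

(** The limit g stays in A^p by Fatou's lemma, so T g is a legitimate limit and the differences h_k
    are bounded in A^p. Their images tend to 0 pointwise because phi and psi map the ball into
    itself. *)
Lemma wcomp_diff_compact mu phi psi u v (K : R) : holo_selfmap phi -> holo_selfmap psi ->
  cmeasurable u -> cmeasurable v -> 0 <= K -> Ap_bounded V w p q mu (wcomp_diff u v phi psi) K ->
  compact_op V p w mu q (wcomp_diff u v phi psi).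
Proof.
move=> hphi hpsi hu hv K0 hK; set T := wcomp_diff u v phi psi.
have TLq f B : holomorphic_on (@Ball R n) f -> (Ap V w p f <= B%:E)%E -> in_Lq mu q (T f).
  move=> hf fB; split; first exact: cmeasurable_wcomp_diff.
  have B0 : 0 <= B by rewrite -lee_fin; exact: le_trans (Ap_ge0 f) fB.
  by rewrite Lq_intE; apply: le_lt_trans (hK f hf B B0 fB) _; rewrite ltry.
split=> [f fAp|fs fsAp [M hM]].
  by have [fE _] := in_Ap_fin fAp; apply: (TLq f _ fAp.1); rewrite fE.
have hfs k : holomorphic_on (@Ball R n) (fs k) by exact: (fsAp k).1.
have fsM k : (Ap V w p (fs k) <= M%:E)%E by rewrite -Ap_intE.
have [s [g [hs hg fg]]] := Ap_montel hV n_gt0 hw hwD p0 hfs fsM.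
have gM : (Ap V w p g <= M%:E)%E by apply: (Ap_le_limit (fun k => hfs (s k)) hg fg) => k.
exists s, (T g); split; first exact: sincr_homo.
split; first exact: TLq gM.
pose h k z := fs (s k) z - g z.
have hh k : holomorphic_on (@Ball R n) (h k).
  have := holomorphicD (hfs (s k)) (holomorphicZ (-1) hg); congr holomorphic_on.
  by apply/funext => z; rewrite mulN1r.
have hB k := ApD (hfs (s k)) hg (fsM (s k)) gM.
have h0 z : Ball z -> ccvg (fun k => h k z) 0.
  by move=> Bz; have := ccvgB (fg z Bz) (ccvg_cst (g z)); rewrite subrr.
have Th k : (fun z => T (fs (s k)) z - T g z) = T (h k).
  by apply/funext => z; rewrite /T /wcomp_diff /h; ring.
have mwe : measurable_fun [set: Cn] (fun z : Cn => wext w (enorm (z : Vec))).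
  by apply: measurableT_comp (measurable_wext hw) _; exact: measurable_enorm.
have pintV f : pint V (fun z => wext w (enorm (z : Vec))) p (rst f) = Ap V w p f.
  by apply: eq_integral => z _; rewrite cabs_rst.
have pintmu f : pint mu (fun=> 1) q (rst f) = Lq q mu f.
  by apply: eq_integral => z _; rewrite cabs_rst mulr1.
have small : forall e : R, 0 < e -> exists N, forall k, (N <= k)%N -> (Lq q mu (T (h k)) < e%:E)%E.
  move=> e e0.
  have := @gliding_hump R _ _ Cn Cn V mu (fun z => wext w (enorm (z : Vec))) (fun=> 1) p q
    mwe (measurable_cst _) (fun z => wext_ge0 hw _) (fun=> ler01) q0 qp (Vec -> C)
    (fun f f' z => f z + f' z) (fun=> 0) (fun f => holomorphic_on (@Ball R n) f) (fun f => rst f) (fun f => rst (T f)).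
  move=> /(_ (holomorphic_cst n 0) (fun f f' => @holomorphicD R n f f')) hump.
  have [] := hump _ _ _ _ _ K K0 _ h (2 `^ p * (M + M)) hh _ _ _ e e0.
  - by move=> x; rewrite /rst if_same.
  - by move=> f f' x; rewrite /rst; case: ifP => // _; rewrite addr0.
  - by move=> f f' x; rewrite /rst; case: ifP => // _; rewrite ?addr0// /T /wcomp_diff; ring.
  - move=> f hf; rewrite /mcabs (_ : (fun z => _) = (fun z : Cn => bmod f z)); first exact: measurable_bmod.
    by apply/funext => z; rewrite cabs_rst.
  - move=> f hf; rewrite /mcabs (_ : (fun z => _) = (fun z : Cn => bmod (T f) z)).
      by apply: cmeasurable_bmod; exact: cmeasurable_wcomp_diff.
    by apply/funext => z; rewrite cabs_rst.
  - by move=> f hf B B0; rewrite pintV pintmu; exact: hK.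
  - by move=> k; rewrite pintV; exact: hB.
  - move=> x; rewrite /rst; have [Bx|_] := boolP ((x : Vec) \in @Ball R n); last exact: ccvg_cst.
    exact: h0 (set_mem Bx).
  - move=> x; rewrite /rst; have [/set_mem Bx|_] := boolP ((x : Vec) \in @Ball R n); last exact: ccvg_cst.
    have := ccvgB (ccvgZ (u x) (h0 _ (hphi.2 x Bx))) (ccvgZ (v x) (h0 _ (hpsi.2 x Bx))).
    by rewrite !mulr0 subrr.
  by move=> N hN; exists N => k /hN; rewrite pintmu.
rewrite (_ : (fun k => _) = (fun k => Lq q mu (T (h k)))); last first.
  by apply/funext => k; rewrite Th Lq_intE.
apply/fine_cvgP; split.
  have [N hN] := small 1 ltr01; exists N => // k Nk.
  by rewrite /= ge0_fin_numE ?Lq_ge0//; apply: lt_trans (hN k Nk) _; rewrite ltry.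
apply/cvgrPdist_lt => e e0; have [N hN] := small e e0; exists N => // k Nk /=.
have := hN k Nk; have := Lq_ge0 mu (T (h k)); rewrite sub0r normrN.
by case: (Lq q mu (T (h k))) => [y||]//=; rewrite lee_fin lte_fin => y0; rewrite ger0_norm.
Qed.

End Assembly.

Theorem theorem4p5 (R : realType) (n : nat) (n_gt0 : (0 < n)%N)
  (V : {measure set (Cn R n) -> \bar R}) (hV : normalized_volume V)
  (p q r : R) (hq : 0 < q) (hqp : q < p) (hr0 : 0 < r) (hr1 : r < 1)
  (w : R -> R) (hw : radial_weight w) (hwD : Dclass w)
  (phi psi : 'rV[R[i]]_n -> 'rV[R[i]]_n)
  (hphi : holo_selfmap phi) (hpsi : holo_selfmap psi)
  (u v : 'rV[R[i]]_n -> R[i]) (hu : cmeasurable u) (hv : cmeasurable v)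
  (mu : {measure set (Cn R n) -> \bar R}) :
  carleson_setfun V p w q
    (fun E => (eta_m mu q u v phi psi E + sigma_m mu q u v phi psi r phi E)%E) \/
  carleson_setfun V p w q
    (fun E => (eta_m mu q u v phi psi E + sigma_m mu q u v phi psi r psi E)%E) ->
  compact_op V p w mu q (wcomp_diff u v phi psi).
Proof.
move=> hc.
have [K K0 hK] := wcomp_diff_Ap_bounded hV n_gt0 hw hwD hq hqp hr0 hr1 hphi hpsi hu hv hc.
exact: (wcomp_diff_compact hV n_gt0 hw hwD hq hqp hphi hpsi hu hv K0 hK).
Qed.
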